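(* Let $\mathcal{G}$ be a Hamiltonian-Hermitian group acting with equivariant moment map $\mu$ on a Domic-Toledo space $(\mathfrak{X},\Omega,\mathcal{K})$. For $x\in\mathfrak{X}$ and $\widetilde g\in\widetilde{\mathcal{G}}$ represented by a path $\{g_t\}_{t\in[0,1]}$ in $\mathcal{G}$ with $g_0=\mathrm{Id}$, $g_1=g$, set $$\nu_x(\widetilde g)=\int_D\Omega-\int_0^1\mu(X_t)(g_t\cdot x)\,dt,$$ where $D$ is any disk in $\mathfrak{X}$ with boundary the loop $\{g_t\cdot x\}_{t\in[0,1]}\,\#\,[g\cdot x,x]$ and $X_t=\frac{d}{d\tau}\big|_{\tau=t}g_\tau\, g_t^{-1}\in \mathrm{Lie}(\mathcal{G})$. Then for each $x\in\mathfrak{X}$ this gives a well-defined (independent of the representing path and of $D$) function $\nu_x:\widetilde{\mathcal{G}}\to\mathbb{R}$, which is a quasimorphism. Moreover, the homogenization $\nu(\widetilde g)=\lim_{k\to\infty}\frac1k\nu_x(\widetilde g^{\,k})$ does not depend on the basepoint $x$, and the restriction of $\nu$ to $\pi_1(\mathcal{G})\subset\widetilde{\mathcal{G}}$ equals the Action homomorphism $\mathcal{A}_\mu:\pi_1(\mathcal{G})\to\mathbb{R}$.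
   Context: All Lie groups and manifolds may be infinite-dimensional (e.g. regular Fréchet). $\widetilde{\mathcal G}$ is the group of homotopy classes, with fixed endpoints, of smooth paths in $\mathcal G$ starting at $\mathrm{Id}$. Quasimorphism: a function $\nu:\Gamma\to\mathbb{R}$ on a group with $\sup_{a,b}|\nu(ab)-\nu(a)-\nu(b)|<\infty$. Equivariant moment map: for an action of a Lie group $\mathcal{G}$ on a symplectic manifold $(\mathfrak{X},\Omega)$ preserving $\Omega$, a map $\mu:\mathrm{Lie}(\mathcal{G})\times\mathfrak{X}\to\mathbb{R}$, written $\mu(X)(x)$, linear in $X$, with $\iota_{\Xi}\Omega=-d\mu(X)$ for the vector field $\Xi$ on $\mathfrak{X}$ generated by $X$ (i.e. $\Xi_x=\frac{d}{dt}|_{t=0}g_t\cdot x$ for a path $g_t$ with $g_0=\mathrm{Id}$, $\dot g_0=X$), and with $\mu(\mathrm{Ad}_\phi X)(\phi\cdot x)=\mu(X)(x)$ for all $\phi\in\mathcal{G}$, $X\in\mathrm{Lie}(\mathcal G)$, $x\in\mathfrak X$. Domic-Toledo space: a triple $(\mathfrak{X},\Omega,\mathcal{K})$ where $(\mathfrak{X},\Omega)$ is a connected symplectic manifold with $\pi_1(\mathfrak{X})=0$ and $\pi_2(\mathfrak{X})=0$, and $\mathcal{K}$ is a system of paths $[x,y]$ from $x$ to $y$, one for every $x,y\in\mathfrak{X}$, such that there is a constant $C_{\mathfrak X}$ with $|\int_{\Delta(x,y,z)}\Omega|<C_{\mathfrak X}$ for all $x,y,z\in\mathfrak X$, where $\Delta(x,y,z)$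 is any disk with boundary $[x,y]\cup[y,z]\cup[z,x]$. Hamiltonian-Hermitian group: a Lie group $\mathcal{G}$ acting on a Domic-Toledo space $(\mathfrak{X},\Omega,\mathcal{K})$, preserving $\Omega$ and $\mathcal{K}$ (i.e. $g\cdot[x,y]=[g\cdot x,g\cdot y]$), with an equivariant moment map $\mu$. Action homomorphism: for a class $a\in\pi_1(\mathcal{G},\mathrm{Id})$ represented by a loop $\{\phi_t\}$ with $X_t=\dot\phi_t\phi_t^{-1}$, $\mathcal{A}_\mu(a)=\int_D\Omega-\int_0^1\mu(X_t)(\phi_t\cdot x)\,dt$, where $x\in\mathfrak X$ is any point and $D:\{|z|\le1\}\to\mathfrak X$ is any smooth disk with $D(e^{2\pi it})=\phi_t\cdot x$ (it is a well-defined homomorphism to $\mathbb R$ since $\pi_2(\mathfrak X)=0$).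
   Formalization: The moment map is additionally assumed to be jointly continuous on Lie(G) × X, which is automatic for finite-dimensional G; without it the integral of μ(X_t)(g_t·x) can be undefined when Lie(G) is infinite-dimensional. *)

(* Defs.v *)
From HB Require Import structures.
From mathcomp Require Import all_boot all_order all_algebra.
From mathcomp Require Import generic_quotient.
From mathcomp Require Import all_classical all_reals all_analysis.
From mathcomp Require Import lra.

Set Implicit Arguments.
Unset Strict Implicit.
Unset Printing Implicit Defensive.

Import Order.TTheory GRing.Theory Num.Theory.
Import numFieldNormedType.Exports.

Local Open Scope classical_set_scope.
Local Open Scope ring_scope.

Section calculus.
Context {R : realType}.

Definition dquot {E F : tvsType R} (f : E -> F) (u v : E) : R^o -> F :=
  fun t => t^-1 *: (f (u + t *: v) - f u).

Definition gateaux {E F : tvsType R} (f : E -> F) (u v : E) : F :=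
  xget 0 [set l | dquot f u v t @[t --> 0^'] --> l].

(* Michal-Bastiani calculus in locally convex spaces.  Only meant for U open;
   gateaux f u v is 0 when the limit does not exist, so that its convergence
   is required separately. *)
Fixpoint Ck (k : nat) {E F : tvsType R} (U : set E) (f : E -> F) : Prop :=
  match k with
  | 0 => forall u, U u -> {for u, continuous f}
  | k'.+1 => [/\ forall u, U u -> {for u, continuous f},
      forall u v, U u -> dquot f u v t @[t --> 0^'] --> gateaux f u v
      & Ck k' (U `*` [set: E]) (fun p : E * E => gateaux f p.1 p.2)]
  end.

Definition Csmooth {E F : tvsType R} (U : set E) (f : E -> F) : Prop :=
  forall k, Ck k U f.

End calculus.

(* chart_fun and chart_inv are total; their values outside chart_dom and
   chart_img are irrelevant. *)
Record chart (E M : topologicalType) := Chart {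
  chart_dom : set M;
  chart_img : set E;
  chart_fun :> M -> E;
  chart_inv : E -> M;
  open_chart_dom : open chart_dom;
  open_chart_img : open chart_img;
  chart_funS : forall x, chart_dom x -> chart_img (chart_fun x);
  chart_invS : forall u, chart_img u -> chart_dom (chart_inv u);
  chart_funK : forall x, chart_dom x -> chart_inv (chart_fun x) = x;
  chart_invK : forall u, chart_img u -> chart_fun (chart_inv u) = u;
  chart_fun_continuous : forall x, chart_dom x -> {for x, continuous chart_fun};
  chart_inv_continuous : forall u, chart_img u -> {for u, continuous chart_inv}
}.

(* The tangent space of M at x is identified with the model space E through
   the preferred chart chart_at x. *)
HB.mixin Record isManifold (R : realType) (E : tvsType R) M & Topological M := {
  model_hausdorff : hausdorff_space E;
  manifold_hausdorff : hausdorff_space M;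
  atlas : set (chart E M);
  chart_at : M -> chart E M;
  chart_at_atlas : forall x, atlas (chart_at x);
  chart_at_dom : forall x, chart_dom (chart_at x) x;
  atlas_smooth : forall c c', atlas c -> atlas c' ->
    Csmooth (chart_img c `&` chart_inv c @^-1` chart_dom c')
            (c' \o chart_inv c)
}.

#[short(type="manifoldType")]
HB.structure Definition Manifold (R : realType) (E : tvsType R) :=
  { M of isManifold R E M & Topological M }.

Section smooth_maps.
Context {R : realType}.

(* Only meant for U open. *)
Definition smooth_into {A E : tvsType R} {M : manifoldType E}
    (U : set A) (f : A -> M) : Prop :=
  (forall a, U a -> {for a, continuous f}) /\
  forall c : chart E M, atlas c -> Csmooth (U `&` f @^-1` chart_dom c) (c \o f).

Definition smooth_map {E E' : tvsType R} {M : manifoldType E}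
    {N : manifoldType E'} (f : M -> N) : Prop :=
  forall c : chart E M, atlas c -> smooth_into (chart_img c) (f \o chart_inv c).

Definition smooth_fun {E : tvsType R} {M : manifoldType E} (f : M -> R^o) : Prop :=
  forall c : chart E M, atlas c -> Csmooth (chart_img c) (f \o chart_inv c).

Definition smooth_map2 {E E' E'' : tvsType R} {M : manifoldType E}
    {N : manifoldType E'} {P : manifoldType E''} (f : M -> N -> P) : Prop :=
  forall (c : chart E M) (c' : chart E' N), atlas c -> atlas c' ->
  smooth_into (chart_img c `*` chart_img c')
    (fun p : E * E' => f (chart_inv c p.1) (chart_inv c' p.2)).

(* Smoothness on a set that need not be open, such as [0, 1] or the closed
   disk: f is smooth on some open neighborhood, its values elsewhere being
   irrelevant. *)
Definition smooth_near {A E : tvsType R} {M : manifoldType E}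
    (B : set A) (f : A -> M) : Prop :=
  exists U : set A, [/\ open U, B `<=` U & smooth_into U f].

(* The tangent vector with coordinates v in the chart c, read in the
   preferred chart. *)
Definition tangent_of {E : tvsType R} {M : manifoldType E} (c : chart E M)
    (u v : E) : E :=
  gateaux ((chart_at (chart_inv c u) : chart E M) \o chart_inv c) u v.

Definition partial {A E : tvsType R} {M : manifoldType E} (f : A -> M) (a v : A) : E :=
  gateaux ((chart_at (f a) : chart E M) \o f) a v.

Definition velocity {E : tvsType R} {M : manifoldType E} (f : R^o -> M) (t : R^o) : E :=
  partial f t 1.

Definition tangent_map {E E' : tvsType R} {M : manifoldType E}
    {N : manifoldType E'} (f : M -> N) (x : M) (v : E) : E' :=
  partial (f \o chart_inv (chart_at x : chart E M)) ((chart_at x : chart E M) x) v.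

Definition dfun {E : tvsType R} {M : manifoldType E} (f : M -> R^o) (x : M) (v : E) : R^o :=
  gateaux (f \o chart_inv (chart_at x : chart E M)) ((chart_at x : chart E M) x) v.

End smooth_maps.

HB.mixin Record isLieGroup (R : realType) (E : tvsType R) G
    & Manifold R E G & Group G := {
  smooth_mulg : smooth_map2 (fun x y : G => (x * y)%g);
  smooth_invg : smooth_map (fun x : G => x^-1%g)
}.

#[short(type="lieGroupType")]
HB.structure Definition LieGroup (R : realType) (E : tvsType R) :=
  { G of isLieGroup R E G & Manifold R E G & Group G }.

Section symplectic.
Context {R : realType} {E : tvsType R} {M : manifoldType E}.
Implicit Types (Omega : M -> E -> E -> R^o).

Definition form_in Omega (c : chart E M) (u v w : E) : R^o :=
  Omega (chart_inv c u) (tangent_of c u v) (tangent_of c u w).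

Definition two_form Omega : Prop :=
  [/\ forall x (a : R) v v' w,
        Omega x (a *: v + v') w = a *: Omega x v w + Omega x v' w,
      forall x v w, Omega x v w = - Omega x w v
    & forall c : chart E M, atlas c ->
        Csmooth (chart_img c `*` [set: E * E])
          (fun p : E * (E * E) => form_in Omega c p.1 p.2.1 p.2.2)].

Definition closed_form Omega : Prop :=
  forall c : chart E M, atlas c -> forall u, chart_img c u -> forall v1 v2 v3,
    gateaux (fun u => form_in Omega c u v2 v3) u v1
    - gateaux (fun u => form_in Omega c u v1 v3) u v2
    + gateaux (fun u => form_in Omega c u v1 v2) u v3 = 0.

(* Weak nondegeneracy, the usual notion for infinite-dimensional models. *)
Definition nondegenerate Omega : Prop :=
  forall x v, (forall w, Omega x v w = 0) -> v = 0.

Definition symplectic Omega : Prop :=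
  [/\ two_form Omega, closed_form Omega & nondegenerate Omega].

Definition unit_disk : set (R^o * R^o) := [set p | p.1 ^+ 2 + p.2 ^+ 2 <= 1].

Definition circle (t : R) : R^o * R^o := (cos (2 * pi * t), sin (2 * pi * t)).

Definition smooth_disk (D : R^o * R^o -> M) : Prop := smooth_near unit_disk D.

(* The integral of the pullback of Omega, the disk being oriented
   counterclockwise. *)
Definition disk_integral Omega (D : R^o * R^o -> M) : R :=
  \int[(@lebesgue_measure R \x @lebesgue_measure R)%E]_(p in unit_disk)
    Omega (D p) (partial D p (1, 0)) (partial D p (0, 1)).

Definition smooth_path (g : R^o -> M) : Prop := smooth_near (`[0, 1] : set R^o) g.

Definition path_concat (g h : R -> M) (t : R) : M :=
  if t <= 2^-1 then g (2 * t) else h (2 * t - 1).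

(* D restricted to the unit circle traverses the loop g once, up to an
   orientation-preserving reparametrization theta; theta slows down at the
   corners of g, so that a smooth disk may bound a piecewise smooth loop. *)
Definition disk_boundary (D : R^o * R^o -> M) (g : R -> M) : Prop :=
  exists theta : R^o -> R^o,
    [/\ exists2 U : set R^o, open U /\ `[0, 1] `<=` U & Csmooth U theta,
        {in `[0, 1] &, {homo theta : s t / s <= t}},
        theta 0 = 0 /\ theta 1 = 1
      & forall t, 0 <= t <= 1 -> D (circle t) = g (theta t)].

End symplectic.

Section homotopy.
Context {R : realType}.

Definition cube (n : nat) : set 'rV[R]_n :=
  [set p | forall i, 0 <= p ord0 i <= 1].

Definition cube_boundary (n : nat) : set 'rV[R]_n :=
  [set p | cube p /\ exists i, p ord0 i = 0 \/ p ord0 i = 1].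

(* pi_n(M, x0) = 0 for every base point x0. *)
Definition trivial_pi (n : nat) (M : topologicalType) : Prop :=
  forall (x0 : M) (f : 'rV[R]_n -> M),
    {within @cube n, continuous f} ->
    (forall p, cube_boundary p -> f p = x0) ->
    exists H : R^o * 'rV[R]_n -> M,
      [/\ {within `[0, 1] `*` @cube n, continuous H},
          forall p, cube p -> H (0, p) = f p /\ H (1, p) = x0
        & forall s p, 0 <= s <= 1 -> cube_boundary p -> H (s, p) = x0].

(* Homotopy with fixed endpoints of paths parametrized by [0, 1]. *)
Definition homotopic (M : topologicalType) (g h : R^o -> M) : Prop :=
  exists H : R^o * R^o -> M,
    [/\ {within `[0, 1] `*` `[0, 1], continuous H},
        forall t, 0 <= t <= 1 -> H (0, t) = g t /\ H (1, t) = h t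
      & forall s, 0 <= s <= 1 -> H (s, 0) = g 0 /\ H (s, 1) = g 1].

End homotopy.


Section calculus_theory.
Context {R : realType}.
Implicit Types (E F : tvsType R).

Lemma cvg_addT {T : Type} (H : set_system T) {FH : Filter H} F (f g : T -> F) a b :
  f @ H --> a -> g @ H --> b -> (f t + g t) @[t --> H] --> a + b.
Proof.
move=> fa gb; apply: (@continuous2_cvg _ _ _ _ _ _ f g (fun x y => x + y) a b) => //.
exact: (@add_continuous F (a, b)).
Qed.

Lemma cvg_scaleT {T : Type} (H : set_system T) {FH : Filter H} F (f : T -> R^o)
  (g : T -> F) (a : R^o) b :
  f @ H --> a -> g @ H --> b -> (f t *: g t) @[t --> H] --> a *: b.
Proof.
move=> fa gb.
apply: (@continuous2_cvg _ _ _ _ _ _ f g (fun (x : R^o) y => x *: y) a b) => //.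
exact: (@scale_continuous R F (a, b)).
Qed.

Lemma prod_hausdorff (S T : topologicalType) :
  hausdorff_space S -> hausdorff_space T -> hausdorff_space (S * T)%type.
Proof.
move=> hS hT [x1 x2] [y1 y2] /= cl; congr pair.
- apply: hS => A B A1 B1.
  have [||[z1 z2] [[/= ? _] [/= ? _]]] := cl (A `*` setT) (B `*` setT).
  + by exists (A, setT) => //; split => //; exact: filterT.
  + by exists (B, setT) => //; split => //; exact: filterT.
  + by exists z1.
- apply: hT => A B A1 B1.
  have [||[z1 z2] [[/= _ ?] [/= _ ?]]] := cl (setT `*` A) (setT `*` B).
  + by exists (setT, A) => //; split => //; exact: filterT.
  + by exists (setT, B) => //; split => //; exact: filterT.
  + by exists z2.
Qed.

Lemma dir_unique E F (hF : hausdorff_space F) (f : E -> F) u v l :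
  dquot f u v t @[t --> 0^'] --> l -> gateaux f u v = l.
Proof.
move=> fl; have dl : dquot f u v t @[t --> 0^'] --> gateaux f u v 
  by apply: (@xgetPex _ 0 [set l | dquot f u v t @[t --> 0^'] --> l]); exists l.
exact: (cvg_unique hF dl fl).
Qed.

Lemma near_line E (U : set E) u v : open U -> U u -> 
  \forall t \near (0 : R^o), U (u + t *: v).
Proof.
move=> oU Uu.
have : (u + t *: v) @[t --> (0:R^o)] --> u + 0 *: v.
  by apply: cvg_addT; [exact: cvg_cst|apply: cvg_scaleT; [exact: cvg_id|exact: cvg_cst]].
rewrite scale0r addr0 => /(_ U); apply; exact: open_nbhs_nbhs.
Qed.

Lemma convexP F (C : set F) : convex_set (C : set (convex_lmodType F)) ->
  forall (a b : R) (x y : F), 0 <= a -> 0 <= b -> a + b = 1 -> C x -> C y -> C (a *: x + b *: y).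
Proof.
move=> cC a b x y a0 b0 ab Cx Cy.
have a1 : a <= 1 by rewrite -ab lerDl.
have h : Itv.spec (Itv.num_sem (R:=R)) (Itv.Real `[0%Z, 1%Z]) a.
  by rewrite /= /Itv.num_sem/= num_real /= in_itv/= a0 a1.
have /set_mem := cC x y (Itv.mk h) (mem_set Cx) (mem_set Cy).
have -> : b = 1 - a by rewrite -ab addrAC subrr add0r.
by [].
Qed.

Lemma mvt F (h : R^o -> F) (h' : R^o -> F) (C : set F) :
  open C -> convex_set (C : set (convex_lmodType F)) ->
  (forall s, 0 <= s <= 1 -> dquot h s 1 t @[t --> 0^'] --> h' s) ->
  (forall s, 0 <= s <= 1 -> C (h' s)) -> C (h 1 - h 0).
Proof.
move=> oC cC dh Ch'.
pose sl a b : F := (b - a : R)^-1 *: (h b - h a).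
have slC a b c : a < b -> b < c -> C (sl a b) -> C (sl b c) -> C (sl a c).
  move=> ab bc Cab Cbc.
  have -> : sl a c = ((b - a) / (c - a)) *: sl a b + ((c - b) / (c - a)) *: sl b c.
    have ba : b - a != 0 by rewrite subr_eq0 gt_eqF.
    have cb : c - b != 0 by rewrite subr_eq0 gt_eqF.
    rewrite /sl !scalerA mulrAC divff// mul1r (mulrAC (c - b)) divff// mul1r.
    by rewrite -scalerDr; congr (_ *: _); rewrite [RHS]addrC addrA subrK.
  apply: convexP => //; try by apply: divr_ge0; rewrite subr_ge0 ltW// (lt_trans ab).
  rewrite -mulrDl (_ : b - a + (c - b) = c - a) ?divff// ?subr_eq0 ?gt_eqF//; last by lra.
  exact: lt_trans bc.
have loc s : 0 <= s <= 1 -> exists2 e : R, 0 < e & forall u, `|u - s| < e -> u != s ->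
     C (sl s u) /\ C (sl u s).
  move=> s01; have := dh _ s01 C (open_nbhs_nbhs (conj oC (Ch' _ s01))).
  rewrite /= /dnbhs /= => -[e /= e0 He]; exists e => // u us uns.
  have := He (u - s); rewrite /= sub0r normrN => /(_ us).
  rewrite subr_eq0 => /(_ uns).
  rewrite /dquot => H.
  have E1 : s + (u - s)%R *: (1:R^o) = u by rewrite /GRing.scale/= mulr1 addrC subrK.
  rewrite E1 in H; split; first exact: H.
  by rewrite /sl -opprB invrN scaleNr -scalerN opprB.
pose S := [set s : R | 0 < s <= 1 /\ C (sl 0 s)].
have [e0 e0p He0] := loc 0 ltac:(by rewrite lexx ler01).
have Sne : S !=set0.
  exists (Num.min (e0/2) 1); split.
    by rewrite lt_min ge_min lexx orbT ltr01 divr_gt0.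
  have [] // := He0 (Num.min (e0/2) 1).
    rewrite subr0 ger0_norm; last by rewrite le_min ler01 divr_ge0// ltW.
    by rewrite gt_min ltr_pdivrMr// ltr_pMr// ltr1n.
  by rewrite gt_eqF// lt_min ltr01 divr_gt0.
have hS : has_sup S by split => //; exists 1 => s [/andP[]].
set m := sup S.
have m1 : m <= 1 by apply: ge_sup => // s [/andP[]].
have m0 : 0 < m.
  have [s Ss] := Sne; have [/andP[s0 _] _] := Ss.
  by apply: (lt_le_trans s0); apply: ub_le_sup => //; case: hS.
have [e ep He] := loc m ltac:(by rewrite (ltW m0) m1).
have Sm : S m.
  have [s Ss es] := sup_adherent ep hS.
  have sm : s <= m by apply: ub_le_sup => //; case: hS.
  have [/andP[s0 s1] Cs] := Ss.
  move: sm; rewrite le_eqVlt => /orP[/eqP <- //|sm].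
  split; first by rewrite m0.
  apply: (slC _ s) => //.
  have [] // := He s; last by rewrite lt_eqF.
  by rewrite distrC ger0_norm ?subr_ge0 ?ltW// ltrBlDr -ltrBlDl.
move: m1; rewrite le_eqVlt => /orP[/eqP mE|m1].
  by case: Sm => _; rewrite mE /sl subr0 invr1 scale1r.
pose u := Num.min (m + e/2) 1.
have mu : m < u by rewrite lt_min m1 ltrDl divr_gt0.
suff /(ub_le_sup (proj2 hS)) : S u by rewrite leNgt mu.
split; first by rewrite (lt_trans m0 mu)/= ge_min lexx orbT.
apply: (slC _ m) => //; first by case: Sm.
have [] // := He u; last by rewrite gt_eqF.
rewrite ger0_norm ?subr_ge0 ?ltW// ltrBlDl.
by rewrite gt_min ltrD2l ltr_pdivrMr// ltr_pMr// ltr1n.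
Qed.

Lemma cvg_eqnear {T : Type} (H : set_system T) {FH : Filter H} (F : topologicalType)
    (f g : T -> F) (l : F) :
  f t @[t --> H] --> l -> (\forall t \near H, f t = g t) -> g t @[t --> H] --> l.
Proof.
move=> fl fg A nA; have fA := fl A nA.
change (H (g @^-1` A)); change (H (f @^-1` A)) in fA.
by apply: filterS2 fg fA => t /= ->.
Qed.

Lemma cvg_eqnear0 F (f g : R^o -> F) (l : F) :
  f t @[t --> 0^'] --> l -> (\forall t \near 0^', f t = g t) -> g t @[t --> 0^'] --> l.
Proof. by move=> fl fg; exact: (@cvg_eqnear _ _ _ _ _ _ _ fl fg). Qed.

Lemma dnbhs0_filter : Filter ((0 : R^o)^').
Proof. exact: _. Qed.

Lemma cvg_cst0 F (c : F) : (fun _ : R^o => c) t @[t --> 0^'] --> c.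
Proof. by move=> A nA; apply: nbhs_dnbhs; near=> t; exact: nbhs_singleton nA.
Unshelve. all: by end_near. Qed.

Lemma cvg_mul_dnbhs0 (r : R) : r != 0 -> (t * r : R^o) @[t --> (0 : R^o)^'] --> (0 : R^o)^'.
Proof.
move=> r0 A [e /= e0 He]; have r0' : 0 < `|r| by rewrite normr_gt0.
exists (e / `|r|) => /=; first exact: divr_gt0.
move=> t /=; rewrite sub0r normrN ltr_pdivlMr// => te tn0.
by apply: He; rewrite /= ?mulf_neq0// sub0r normrN normrM.
Qed.

Lemma hadamard {I : Type} (H : set_system I) {FH : Filter H} E F (f : E -> F)
    (V : set E) (y w : E) (r : I -> R^o) (w_ : I -> E) :
  open V -> V y -> (forall u v, V u -> dquot f u v t @[t --> 0^'] --> gateaux f u v) ->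
  {for (y, w), continuous (fun p : E * E => gateaux f p.1 p.2)} ->
  r @ H --> (0 : R^o) -> (\forall i \near H, r i != 0) -> w_ @ H --> w ->
  ((r i)^-1 *: (f (y + r i *: w_ i) - f y)) @[i --> H] --> gateaux f y w.
Proof.
move=> oV Vy df cf r0 rn0 ww A nA.
have [B cB [oB bB]] := @locally_convex R F.
have [C [BC Cd] CA] := bB (gateaux f y w) A nA.
have oC := oB _ BC; have cC := cB _ (mem_set BC).
have := cf C (open_nbhs_nbhs (conj oC Cd)).
move=> [[A1 A2] /= [nA1 nA2] A12].
have c0 : (fun p : R^o * E => y + p.1 *: p.2) p @[p --> (0 : R^o, w)] --> y + (0:R^o) *: w.
  by apply: cvg_addT; [exact: cvg_cst|apply: cvg_scaleT; [exact: cvg_fst|exact: cvg_snd]].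
rewrite scale0r addr0 in c0.
have nA1V : nbhs y (A1 `&` V) by apply: filterI => //; exact: open_nbhs_nbhs.
have [[B1 B2] /= [[e /= e0 He] nB2] B12] := c0 _ nA1V.
change (\forall i \near H, A ((r i)^-1 *: (f (y + r i *: w_ i) - f y))).
near=> i; apply: CA => /=.
have re : `|r i| < e.
  near: i; have : nbhs (0:R^o) (fun x => `|x| < e).
    by exists e => //= x; rewrite /= sub0r normrN.
  by move=> /r0.
have ri : r i != 0 by near: i.
have wA2 : A2 (w_ i) by near: i; exact: ww.
have wB2 : B2 (w_ i) by near: i; exact: ww.
have pt s : 0 <= s <= 1 -> (A1 `&` V) (y + (s * r i) *: w_ i).
  move=> /andP[s0 s1]; apply: (B12 (s * r i, w_ i)); split => //=.
  apply: He; rewrite /= sub0r normrN normrM (ger0_norm s0).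
  by rewrite (le_lt_trans _ re)// ler_piMl.
pose h (s : R^o) := (r i)^-1 *: f (y + (s * r i) *: w_ i).
have := @mvt F h (fun s => gateaux f (y + (s * r i) *: w_ i) (w_ i)) C oC cC.
rewrite /h mul1r mul0r scale0r addr0 -scalerBr; apply.
- move=> s s01; have [_ Vs] := pt s s01.
  have L := cvg_comp _ _ (cvg_mul_dnbhs0 ri) (df _ (w_ i) Vs).
  apply: (cvg_eqnear0 L); near=> t.
  rewrite /= /dquot -scalerBr scalerA -invfM; congr (_ *: (f _ - _)).
  by rewrite -addrA -scalerDl /GRing.scale/= mulr1 mulrDl.
- by move=> s s01; have [A1s _] := pt s s01; exact: (A12 (_, _)).
Unshelve. all: by end_near. Qed.

Lemma dnbhs0_neq : \forall t \near (0 : R^o)^', t != 0.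
Proof. by exists 1 => //= t _. Qed.


Lemma chain (E F H : tvsType R) (hH : hausdorff_space H) (f : E -> F) (g : F -> H) (V : set F) u v :
  open V -> V (f u) -> (forall a b, V a -> dquot g a b t @[t --> 0^'] --> gateaux g a b) ->
  (forall b, {for (f u, b), continuous (fun p : F * F => gateaux g p.1 p.2)}) ->
  dquot f u v t @[t --> 0^'] --> gateaux f u v ->
  dquot (g \o f) u v t @[t --> 0^'] --> gateaux g (f u) (gateaux f u v) /\
  gateaux (g \o f) u v = gateaux g (f u) (gateaux f u v).
Proof.
move=> oV Vf dg cg df.
suff L : dquot (g \o f) u v t @[t --> 0^'] --> gateaux g (f u) (gateaux f u v).
  by split => //; exact: (dir_unique hH L).
have id0 : (fun t : R^o => t) @ (0 : R^o)^' --> (0 : R^o).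
  by move=> A /= nA; apply: nbhs_dnbhs.
have L := hadamard oV Vf dg (cg _) id0 dnbhs0_neq df.
apply: cvg_eqnear0 (L dnbhs0_filter) _.
near=> t.
have t0 : t != 0 by near: t; exact: dnbhs0_neq.
rewrite /dquot /= scalerA divff// scale1r (addrC (f u)) subrK //.
Unshelve. all: by end_near. Qed.

Lemma dquot_near_eq E F (U : set E) (f g : E -> F) u v : open U -> U u ->
  (forall x, U x -> f x = g x) ->
  \forall t \near (0 : R^o)^', dquot f u v t = dquot g u v t.
Proof.
move=> oU Uu fg; apply: nbhs_dnbhs.
near=> t; rewrite /dquot !fg//; near: t; exact: near_line.
Unshelve. all: by end_near. Qed.

Lemma dir_eq E F (U : set E) (f g : E -> F) u v : open U -> U u ->
  (forall x, U x -> f x = g x) -> gateaux f u v = gateaux g u v.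
Proof.
move=> oU Uu fg; congr xget; apply/seteqP; split => l /= L; apply: (cvg_eqnear0 L).
  exact: (dquot_near_eq v oU Uu).
by apply: (dquot_near_eq v oU Uu) => x /fg.
Qed.

Lemma open_setX (S T : topologicalType) (A : set S) (B : set T) :
  open A -> open B -> open (A `*` B).
Proof.
move=> oA oB; rewrite openE => -[x y] [/= Ax By]; exists (A, B) => //=.
by split; apply: open_nbhs_nbhs.
Qed.

Lemma openXT E F (U : set E) : open U -> open (U `*` [set: F]).
Proof. by move=> oU; exact: open_setX oU openT. Qed.

Lemma Ck_eq k E F (U : set E) (f g : E -> F) : open U ->
  (forall x, U x -> f x = g x) -> Ck k U f -> Ck k U g.
Proof.
have ceq E' F' (V : set E') (a b : E' -> F') : open V -> (forall x, V x -> a x = b x) ->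
    (forall u, V u -> {for u, continuous a}) -> forall u, V u -> {for u, continuous b}.
  move=> oV ab ca u Vu; have L := ca u Vu; rewrite /prop_for /continuous_at ab// in L *.
  apply: (@cvg_eqnear _ _ _ _ _ _ _ L).
  by apply: filterS (open_nbhs_nbhs (conj oV Vu)) => x /ab.
elim: k E F U f g => [|k IH] E F U f g oU fg /=; first exact: ceq.
move=> [cf df kf]; split; first exact: (ceq _ _ U f).
  move=> u v Uu; rewrite -(dir_eq v oU Uu fg); apply: (cvg_eqnear0 (df u v Uu)).
  exact: (dquot_near_eq v oU Uu).
apply: IH kf; first exact: openXT.
by move=> [u v] [/= Uu _]; exact: (dir_eq v oU Uu fg).
Qed.

Lemma Ck_sub k E F (U V : set E) (f : E -> F) : V `<=` U -> Ck k U f -> Ck k V f.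
Proof.
elim: k E F U V f => [|k IH] E F U V f VU /=; first by move=> cf u /VU; exact: cf.
move=> [cf df kf]; split; first by move=> u /VU; exact: cf.
  by move=> u v /VU; exact: df.
by apply: IH kf => -[u v] [/= /VU].
Qed.

Lemma Ck_local k E F (U : set E) (f : E -> F) :
  (forall u, U u -> exists V, [/\ open V, V u & Ck k V f]) -> Ck k U f.
Proof.
elim: k E F U f => [|k IH] E F U f loc /=.
  by move=> u /loc[V [_ Vu]]; exact.
split.
- by move=> u /loc[V [_ Vu [cf _ _]]]; exact: cf.
- by move=> u v /loc[V [_ Vu [_ df _]]]; exact: df.
- apply: IH => -[u v] [/= /loc[V [oV Vu [_ _ kf]]] _].
  by exists (V `*` setT); split => //; exact: openXT.
Qed.

Lemma CkS k E F (U : set E) (f : E -> F) : Ck k.+1 U f -> Ck k U f.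
Proof.
elim: k E F U f => [|k IH] E F U f /=; first by case.
by move=> [cf df [c1 c2 c3]]; split => //; exact: IH.
Qed.

Lemma Ck_cont k E F (U : set E) (f : E -> F) : Ck k U f ->
  forall u, U u -> {for u, continuous f}.
Proof. by case: k => [//|k []]. Qed.

Lemma Ck_linear k E F (hF : hausdorff_space F) (U : set E) (L : E -> F) :
  (forall (a : R) x y, L (a *: x + y) = a *: L x + L y) -> continuous L -> Ck k U L.
Proof.
elim: k E F hF U L => [|k IH] E F hF U L lin cL /=; first by move=> u _; exact: cL.
have dL u v : dquot L u v t @[t --> 0^'] --> L v.
  apply: (cvg_eqnear0 (@cvg_cst0 _ (L v))).
  near=> t.
  have t0 : t != 0 by near: t; exact: dnbhs0_neq.
  by rewrite /dquot [u + _]addrC lin addrK scalerA mulVf// scale1r.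
have dirL u v : gateaux L u v = L v by exact: (dir_unique hF (dL u v)).
split; first by move=> u _; exact: cL.
  by move=> u v _; rewrite dirL.
have -> : (fun p : E * E => gateaux L p.1 p.2) = L \o snd by apply/funext => -[u v] /=.
apply: IH => //; first by move=> a [x1 x2] [y1 y2] /=; exact: lin.
move=> p; apply: continuous_comp; [exact: cvg_snd|exact: cL].
Unshelve. all: by end_near. Qed.

Lemma Ck_cst k E F (hF : hausdorff_space F) (U : set E) (c : F) : Ck k U (fun=> c).
Proof.
elim: k E F hF U c => [|k IH] E F hF U c /=; first by move=> u _; exact: cvg_cst.
have dc u v : dquot (fun _ : E => c) u v t @[t --> 0^'] --> (0 : F).
  rewrite (_ : dquot _ _ _ = fun=> 0); first exact: cvg_cst0.
  by apply/funext => t; rewrite /dquot subrr scaler0.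
have dirc u v : gateaux (fun _ : E => c) u v = 0 by exact: (dir_unique hF (dc u v)).
split; first by move=> u _; exact: cvg_cst.
  by move=> u v _; rewrite dirc.
have -> : (fun p : E * E => gateaux (fun _ : E => c) p.1 p.2) = fun=> 0.
  by apply/funext => -[u v] /=.
exact: IH.
Qed.

Lemma Ck_pair k (E F H : tvsType R) (hF : hausdorff_space F) (hH : hausdorff_space H)
    (U : set E) (f : E -> F) (g : E -> H) : open U ->
  Ck k U f -> Ck k U g -> Ck k U (fun x => (f x, g x)).
Proof.
have cp (E' F' H' : tvsType R) (a : E' -> F') (b : E' -> H') u :
    {for u, continuous a} -> {for u, continuous b} ->
    {for u, continuous (fun x => (a x, b x))} by move=> ca cb; exact: cvg_pair.
elim: k E F H hF hH U f g => [|k IH] E F H hF hH U f g oU /=.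
  by move=> cf cg u Uu; apply: cp; [exact: cf|exact: cg].
move=> [cf df kf] [cg dg kg].
have dfg u v : U u -> dquot (fun x => (f x, g x)) u v t @[t --> 0^'] -->
    (gateaux f u v, gateaux g u v).
  by move=> Uu; exact: cvg_pair (df u v Uu) (dg u v Uu).
have hFH := prod_hausdorff hF hH.
have dirfg u v : U u -> gateaux (fun x => (f x, g x)) u v = (gateaux f u v, gateaux g u v).
  by move=> Uu; exact: (dir_unique hFH (dfg u v Uu)).
split; first by move=> u Uu; apply: cp; [exact: cf|exact: cg].
  by move=> u v Uu; rewrite dirfg//; exact: dfg.
have := IH _ _ _ hF hH (U `*` setT) _ _ (openXT oU) kf kg.
apply: Ck_eq; first exact: openXT.
by move=> [u v] [/= Uu _]; rewrite dirfg.
Qed.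

Lemma Ck_comp k (E F H : tvsType R) (hE : hausdorff_space E) (hF : hausdorff_space F)
    (hH : hausdorff_space H) (U : set E) (V : set F) (f : E -> F) (g : F -> H) :
  open U -> open V -> (forall x, U x -> V (f x)) ->
  Ck k U f -> Ck k V g -> Ck k U (g \o f).
Proof.
elim: k E F H hE hF hH U V f g => [|k IH] E F H hE hF hH U V f g oU oV UV.
  by move=> cf cg u Uu; apply: continuous_comp; [exact: cf|apply: cg; exact: UV].
move=> kf1 kg1; have kf := CkS kf1; case: kf1 kg1 => [cf df kdf] [cg dg kdg].
have ch u v (Uu : U u) := @chain E F H hH f g V u v oV (UV u Uu) dg
  (fun b => @Ck_cont k _ _ (V `*` [set: F]) _ kdg (f u, b) (conj (UV u Uu) I)) (df u v Uu).
split.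
- by move=> u Uu; apply: continuous_comp; [exact: cf|apply: cg; exact: UV].
- by move=> u v Uu; have [L ->] := ch u v Uu.
- apply: (@Ck_eq _ _ _ _ ((fun q : F * F => gateaux g q.1 q.2) \o
      (fun p : E * E => (f p.1, gateaux f p.1 p.2)))); first exact: openXT.
    by move=> [u v] [/= Uu _]; have [_ ->] := ch u v Uu.
  apply: (IH _ _ _ _ _ _ _ (V `*` setT)) => //.
  + exact: prod_hausdorff.
  + exact: prod_hausdorff.
  + exact: openXT.
  + exact: openXT.
  + by move=> [u v] [/= Uu _]; split => //; exact: UV.
  + apply: Ck_pair => //; first exact: openXT.
    apply: (IH _ _ _ _ _ _ _ U) => //; first exact: prod_hausdorff.
    * exact: openXT.
    * by move=> [u v] [].
    * by apply: Ck_linear => //; move=> p; exact: cvg_fst.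
Qed.

Lemma open_pre (S T : topologicalType) (U : set S) (f : S -> T) (D : set T) :
  open U -> open D -> (forall a, U a -> {for a, continuous f}) ->
  open (U `&` f @^-1` D).
Proof.
move=> oU oD cf; rewrite openE => a [Ua Da]; apply: filterI.
  exact: open_nbhs_nbhs.
by apply: (cf a Ua); exact: open_nbhs_nbhs.
Qed.

Lemma smooth_into_comp {A B E : tvsType R} (hA : hausdorff_space A)
    (hB : hausdorff_space B) {N : manifoldType E}
    (V : set B) (h : B -> N) (W : set A) (phi : A -> B) :
  open V -> open W -> (forall a, W a -> V (phi a)) -> Csmooth W phi ->
  smooth_into V h -> smooth_into W (h \o phi).
Proof.
move=> oV oW WV sphi [ch sh]; split.
  move=> a Wa; apply: continuous_comp; first exact: (Ck_cont (sphi 0) Wa).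
  by apply: ch; exact: WV.
move=> c ac k; have hE := @model_hausdorff R E N.
have cphi a : W a -> {for a, continuous phi} by move=> Wa; exact: (Ck_cont (sphi 0) Wa).
have hphi a : W a -> {for a, continuous (h \o phi)}.
  by move=> Wa; apply: continuous_comp; [exact: cphi|apply: ch; exact: WV].
have oc := open_chart_dom c.
apply: (@Ck_comp k A B E hA hB hE _ (V `&` h @^-1` chart_dom c) phi (c \o h)) => //.
- exact: open_pre.
- exact: open_pre.
- by move=> a [Wa ca]; split => //; exact: WV.
- by apply: Ck_sub (sphi k) => a [].
- exact: sh.
Qed.

Lemma smooth_into_local {A E : tvsType R} {N : manifoldType E} (U : set A) (f : A -> N) :
  (forall a, U a -> exists W, [/\ open W, W a & smooth_into W f]) -> smooth_into U f.
Proof.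
move=> loc; split; first by move=> a /loc[W [_ Wa [cf _]]]; exact: cf.
move=> c ac k; apply: Ck_local => a [/loc[W [oW Wa [cf sf]]] ca].
exists (W `&` f @^-1` chart_dom c); split => //; last exact: sf.
by apply: open_pre => //; exact: open_chart_dom.
Qed.

Lemma smooth_into_eq {A E : tvsType R} {N : manifoldType E} (U : set A) (f g : A -> N) :
  open U -> (forall a, U a -> f a = g a) -> smooth_into U f -> smooth_into U g.
Proof.
move=> oU fg [cf sf]; split.
  move=> a Ua; have L := cf a Ua; rewrite /prop_for /continuous_at fg// in L *.
  apply: (@cvg_eqnear _ _ _ _ _ _ _ L).
  by apply: filterS (open_nbhs_nbhs (conj oU Ua)) => x /fg.
move=> c ac k; have UE : U `&` f @^-1` chart_dom c = U `&` g @^-1` chart_dom c.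
  by apply/seteqP; split => a /= [Ua]; rewrite fg.
rewrite -UE; apply: Ck_eq (sf c ac k).
  by apply: open_pre => //; exact: open_chart_dom.
by move=> a [Ua _] /=; rewrite fg.
Qed.

Lemma smooth_into_sub {A E : tvsType R} {N : manifoldType E} (U V : set A) (f : A -> N) :
  V `<=` U -> smooth_into U f -> smooth_into V f.
Proof.
move=> VU [cf sf]; split; first by move=> a /VU; exact: cf.
by move=> c ac k; apply: Ck_sub (sf c ac k) => a [/VU].
Qed.

Lemma smooth_into_cst {A E : tvsType R} {N : manifoldType E} (U : set A) (x : N) :
  smooth_into U (fun=> x).
Proof.
split; first by move=> a _; exact: cvg_cst.
by move=> c _ k; apply: Ck_cst; exact: (@model_hausdorff R E N).
Qed.

Lemma smooth_into_map {A E E' : tvsType R} (hA : hausdorff_space A)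
    {M : manifoldType E} {N : manifoldType E'} (U : set A) (f : M -> N) (g : A -> M) :
  open U -> smooth_map f -> smooth_into U g -> smooth_into U (f \o g).
Proof.
move=> oU sf [cg sg]; apply: smooth_into_local => a Ua.
pose c : chart E M := chart_at (g a).
have ac : atlas c by exact: chart_at_atlas.
have oW : open (U `&` g @^-1` chart_dom c).
  by apply: open_pre => //; exact: open_chart_dom.
exists (U `&` g @^-1` chart_dom c); split => //.
  by split => //; exact: chart_at_dom.
apply: (@smooth_into_eq _ _ _ _ ((f \o chart_inv c) \o (c \o g))) => //.
  by move=> b [_ cb] /=; rewrite chart_funK.
apply: (@smooth_into_comp _ _ _ hA (@model_hausdorff R E M) _ (chart_img c)) => //.
- exact: open_chart_img.
- by move=> b [_ cb]; exact: chart_funS.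
- exact: sg.
- exact: sf.
Qed.

Lemma smooth_into_map2 {A E E' E'' : tvsType R} (hA : hausdorff_space A)
    {M : manifoldType E} {M' : manifoldType E'} {N : manifoldType E''}
    (U : set A) (f : M -> M' -> N) (g : A -> M) (g' : A -> M') :
  open U -> smooth_map2 f -> smooth_into U g -> smooth_into U g' ->
  smooth_into U (fun a => f (g a) (g' a)).
Proof.
move=> oU sf [cg sg] [cg' sg']; apply: smooth_into_local => a Ua.
pose c : chart E M := chart_at (g a).
pose c' : chart E' M' := chart_at (g' a).
have ac : atlas c by exact: chart_at_atlas.
have ac' : atlas c' by exact: chart_at_atlas.
have o1 : open (U `&` g @^-1` chart_dom c).
  by apply: open_pre => //; exact: open_chart_dom.
have o2 : open (U `&` g' @^-1` chart_dom c').
  by apply: open_pre => //; exact: open_chart_dom.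
pose W := (U `&` g @^-1` chart_dom c) `&` (U `&` g' @^-1` chart_dom c').
have oW : open W by exact: openI.
exists W; split => //.
  by split; split => //; exact: chart_at_dom.
apply: (@smooth_into_eq _ _ _ _
  ((fun p : E * E' => f (chart_inv c p.1) (chart_inv c' p.2)) \o
   (fun b => (c (g b), c' (g' b))))) => //.
  by move=> b [[_ cb] [_ cb']] /=; rewrite !chart_funK.
have hE := @model_hausdorff R E M; have hE' := @model_hausdorff R E' M'.
apply: (@smooth_into_comp _ _ _ hA (prod_hausdorff hE hE') _
  (chart_img c `*` chart_img c')) => //.
- by apply: open_setX; exact: open_chart_img.
- by move=> b [[_ cb] [_ cb']]; split; exact: chart_funS.
- move=> k; apply: Ck_pair => //.
  + by apply: Ck_sub (sg c ac k) => b [].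
  + by apply: Ck_sub (sg' c' ac' k) => b [].
- exact: sf.
Qed.

End calculus_theory.

Section paths.
Context {R : realType} {E : tvsType R} {G : lieGroupType E}.
Implicit Types g h : R^o -> G.

Lemma scalar_hausdorff : hausdorff_space (R^o : tvsType R).
Proof. exact: norm_hausdorff. Qed.

Lemma smooth_path_cst : smooth_path (fun=> 1%g : G).
Proof. by exists setT; split => //; [exact: openT|exact: smooth_into_cst]. Qed.

Lemma smooth_path_mul g h : smooth_path g -> smooth_path h ->
  smooth_path (fun t => g t * h t)%g.
Proof.
move=> [U [oU IU sg]] [V [oV IV sh]]; exists (U `&` V); split.
- exact: openI.
- by move=> t It; split; [exact: IU|exact: IV].
- apply: (@smooth_into_map2 _ _ _ _ _ scalar_hausdorff _ _ _ _ (fun x y : G => x * y)%g).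
  + exact: openI.
  + exact: smooth_mulg.
  + by apply: smooth_into_sub sg => t [].
  + by apply: smooth_into_sub sh => t [].
Qed.

Lemma smooth_path_inv g : smooth_path g -> smooth_path (fun t => (g t)^-1)%g.
Proof.
move=> [U [oU IU sg]]; exists U; split => //.
apply: (@smooth_into_map _ _ _ _ scalar_hausdorff _ _ _ (fun x : G => x^-1)%g) => //.
exact: smooth_invg.
Qed.

Lemma mulg_cont_comp (T : topologicalType) (f f' : T -> G) (H : set_system T) {FH : Filter H} x y :
  f @ H --> x -> f' @ H --> y -> (fun t => f t * f' t)%g @ H --> (x * y)%g.
Proof.
move=> fx fy.
pose c : chart E G := chart_at x; pose c' : chart E G := chart_at y.
have [cm _] := smooth_mulg c c' (chart_at_atlas x) (chart_at_atlas y) : smooth_into (chart_img c `*` chart_img c') _.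
have dx := chart_at_dom x : chart_dom c x; have dy := chart_at_dom y : chart_dom c' y.
have L : (fun t => (c (f t), c' (f' t))) @ H --> (c x, c' y).
  apply: cvg_pair.
    by apply: cvg_comp fx _; exact: (chart_fun_continuous dx).
  by apply: cvg_comp fy _; exact: (chart_fun_continuous dy).
have Lm := cm (c x, c' y) (conj (chart_funS dx) (chart_funS dy)).
rewrite /prop_for /continuous_at /= !chart_funK// in Lm.
apply: (@cvg_eqnear _ _ FH _ _ _ _ (cvg_comp _ _ L Lm)).
have n1 : \forall t \near H, chart_dom c (f t).
  by apply: fx; apply: open_nbhs_nbhs; split => //; exact: open_chart_dom.
have n2 : \forall t \near H, chart_dom c' (f' t).
  by apply: fy; apply: open_nbhs_nbhs; split => //; exact: open_chart_dom.
by apply: filterS2 n1 n2 => t d1 d2 /=; rewrite !chart_funK.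
Qed.

Lemma invg_cont_comp (T : topologicalType) (f : T -> G) (H : set_system T) {FH : Filter H} x :
  f @ H --> x -> (fun t => (f t)^-1)%g @ H --> (x^-1)%g.
Proof.
move=> fx; pose c : chart E G := chart_at x.
have [cm _] := smooth_invg c (chart_at_atlas x) : smooth_into (chart_img c) _.
have dx := chart_at_dom x : chart_dom c x.
have L : (fun t => c (f t)) @ H --> c x.
  by apply: cvg_comp fx _; exact: (chart_fun_continuous dx).
have Lm := cm (c x) (chart_funS dx).
rewrite /prop_for /continuous_at /= !chart_funK// in Lm.
apply: (@cvg_eqnear _ _ FH _ _ _ _ (cvg_comp _ _ L Lm)).
have n1 : \forall t \near H, chart_dom c (f t).
  by apply: fx; apply: open_nbhs_nbhs; split => //; exact: open_chart_dom.
by apply: filterS n1 => t d1 /=; rewrite !chart_funK.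
Qed.

End paths.

Section idpaths.
Context {R : realType} {E : tvsType R}.

(* Smooth paths starting at the identity; only the restriction to [0, 1] matters. *)
Record idpath (G : lieGroupType E) := IdPath {
  idpath_fun :> R^o -> G;
  idpath_smooth : smooth_path idpath_fun;
  idpath0 : idpath_fun 0 = 1%g
}.

HB.instance Definition _ (G : lieGroupType E) := gen_eqMixin (idpath G).
HB.instance Definition _ (G : lieGroupType E) := gen_choiceMixin (idpath G).

Section operations.
Context {G : lieGroupType E}.
Implicit Types p q r : idpath G.

Definition idpath_one : idpath G :=
  IdPath (@smooth_path_cst R E G) erefl.

Fact idpath_mul_subproof p q : (p 0 * q 0)%g = 1%g :> G.
Proof. by rewrite !idpath0 mulg1. Qed.

Definition idpath_mul p q : idpath G :=
  IdPath (smooth_path_mul (idpath_smooth p) (idpath_smooth q))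
    (idpath_mul_subproof p q).

Fact idpath_inv_subproof p : (p 0)^-1%g = 1%g :> G.
Proof. by rewrite idpath0 invg1. Qed.

Definition idpath_inv p : idpath G :=
  IdPath (smooth_path_inv (idpath_smooth p)) (idpath_inv_subproof p).

Local Notation I2 := ((`[0, 1] : set R^o) `*` (`[0, 1] : set R^o)).

Lemma within_comp (S T U : topologicalType) (A : set S) (B : set T)
    (phi : S -> T) (H : T -> U) :
  (forall x, A x -> {for x, continuous phi}) -> (forall x, A x -> B (phi x)) ->
  {within B, continuous H} -> {within A, continuous (H \o phi)}.
Proof.
move=> cphi AB /subspace_continuousP cH; apply/subspace_continuousP => x Ax.
apply: (cvg_comp _ _ _ (cH _ (AB _ Ax))) => D /= nD.
have nD' : nbhs x (phi @^-1` [set y | B y -> D y]) by exact: cphi x Ax _ nD.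
change (nbhs x [set y | A y -> D (phi y)]).
by apply: filterS nD' => y /= yD Ay; apply: yD; exact: AB.
Qed.

Lemma homotopic_refl p : homotopic p p.
Proof.
exists (fun x => p x.2); split => //.
have [U [oU IU [cU _]]] := idpath_smooth p.
apply: (@within_comp _ _ _ _ (`[0, 1] : set R^o) (@snd R^o R^o) p).
- by move=> x _; exact: cvg_snd.
- by move=> x [].
- by apply/subspace_continuousP => x Ix; apply: cvg_within_filter; apply: cU; exact: IU.
Qed.

Lemma affine_continuous (a b : R) (x : R^o * R^o) :
  {for x, continuous (fun x : R^o * R^o => (a * x.1 + b, x.2) : R^o * R^o)}.
Proof.
have c1 : {for x, continuous (fun y : R^o * R^o => a *: y.1 + b : R^o)}.
  by apply: cvg_addT; [apply: cvg_scaleT; [exact: cvg_cst|exact: cvg_fst]|exact: cvg_cst].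
have c2 : {for x, continuous (fun y : R^o * R^o => y.2)} by exact: cvg_snd.
exact: (cvg_pair c1 c2).
Qed.

Lemma homotopic_sym p q : homotopic p q -> homotopic q p.
Proof.
move=> [H [cH H01 He]]; exists (fun x => H (-1 * x.1 + 1, x.2)); split.
- apply: (@within_comp _ _ _ _ I2 (fun x : R^o * R^o => (-1 * x.1 + 1, x.2) : R^o * R^o)) => //.
    by move=> x _; exact: affine_continuous.
  move=> [s t] [/= /itvP Is It]; split => //=; rewrite in_itv/=.
  have s0 : 0 <= s by rewrite Is.
  have s1 : s <= 1 by rewrite Is.
  by apply/andP; split; lra.
- move=> t It; rewrite /= mulr0 add0r mulr1 addrC subrr.
  by have [-> ->] := H01 t It.
- move=> s /andP[s0 s1]; have : 0 <= -1 * s + 1 <= 1 by apply/andP; split; lra.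
  move=> /He [/= -> ->]; have I0 : 0 <= (0:R) <= 1 by rewrite lexx ler01.
  have I1 : 0 <= (1:R) <= 1 by rewrite lexx ler01.
  by have [_ <-] := H01 0 I0; have [_ <-] := H01 1 I1; have [-> ->] := He 1 I1.
Qed.

Lemma homotopic_trans p q r : homotopic p q -> homotopic q r -> homotopic p r.
Proof.
move=> [H [cH H01 He]] [K [cK K01 Ke]].
have h0 : (0 : R) < 2^-1 by rewrite invr_gt0.
pose L (x : R^o * R^o) : G :=
  if x.1 <= 2^-1 then H (2 * x.1 + 0, x.2) else K (2 * x.1 - 1, x.2).
exists L; rewrite /L; split.
- rewrite -/L; pose A1 := (`[0, 2^-1] : set R^o) `*` (`[0, 1] : set R^o).
  pose A2 := (`[2^-1, 1] : set R^o) `*` (`[0, 1] : set R^o).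
  have -> : I2 = A1 `|` A2.
    apply/seteqP; split => -[s t] /=.
      move=> [/= Is It]; case: (leP s 2^-1) => sh; [left|right]; split => //=.
        by rewrite in_itv/= sh andbT (itvP Is).
      by rewrite in_itv/= (ltW sh) (itvP Is).
    move=> [] [/= Is It]; split => //=; rewrite in_itv/=.
      by rewrite (itvP Is)/= (@le_trans _ _ 2^-1) ?(itvP Is)//; lra.
    by rewrite (itvP Is) andbT (@le_trans _ _ 2^-1) ?(itvP Is)// ltW.
  have cl (a b : R^o) : closed ((`[a, b] : set R^o) `*` (`[0, 1] : set R^o)).
    rewrite (_ : _ `*` _ = fst @^-1` (`[a, b] : set R^o) `&` snd @^-1` (`[0, 1] : set R^o)) //.
    by apply: closedI; apply: preimage_closed; try exact: itv_closed;
      move=> x _; [exact: cvg_fst|exact: cvg_snd].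
  apply: withinU_continuous; [exact: cl|exact: cl| |].
  + apply: (@subspace_eq_continuous _ _ _ (H \o (fun x : R^o * R^o => (2 * x.1 + 0, x.2)))).
      move=> [s t] /set_mem[/= Is It]; have s1 : s <= 2^-1 by rewrite (itvP Is).
      by rewrite /L /from_subspace /= s1.
    apply: (@within_comp _ _ _ _ I2) => //; first by move=> x _; exact: affine_continuous.
    move=> [s t] [/= /itvP Is It]; split => //=; rewrite in_itv/=.
    have := Is; have s0 : 0 <= s by rewrite Is.
    have s1 : s <= 2^-1 by rewrite Is.
    by move=> _; apply/andP; split; lra.
  + apply: (@subspace_eq_continuous _ _ _ (K \o (fun x : R^o * R^o => (2 * x.1 - 1, x.2)))).
      move=> [s t] /set_mem[/= Is It]; rewrite /L /from_subspace /=; case: ifPn => // sh.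
      have s1 : 2^-1 <= s by rewrite (itvP Is).
      have -> : s = 2^-1 by apply/eqP; rewrite eq_le sh s1.
      have It' : 0 <= t <= 1 by rewrite !(itvP It).
      rewrite divff// subrr addr0; have [-> _] := K01 t It'.
      by have [_ ->] := H01 t It'.
    apply: (@within_comp _ _ _ _ I2) => //; first by move=> x _; exact: affine_continuous.
    move=> [s t] [/= /itvP Is It]; split => //=; rewrite in_itv/=.
    have s0 : 2^-1 <= s by rewrite Is.
    have s1 : s <= 1 by rewrite Is.
    by apply/andP; split; lra.
- move=> t It /=; rewrite mulr0 addr0 (ltW h0); have [-> _] := H01 t It; split => //.
  rewrite ifF; last by apply/negbTE; rewrite -ltNge; lra.
  by rewrite mulr1 (_ : 2 - 1 = 1); [have [_ ->] := K01 t It|lra].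
- move=> s /andP[s0 s1] /=; case: ifPn => sh.
    by apply: He; apply/andP; split; lra.
  rewrite -ltNge in sh.
  have Is : 0 <= 2 * s - 1 <= 1 by apply/andP; split; lra.
  have [-> ->] := Ke _ Is.
  have I0 : 0 <= (0:R) <= 1 by rewrite lexx ler01.
  have I1 : 0 <= (1:R) <= 1 by rewrite lexx ler01.
  by have [_ <-] := H01 0 I0; have [_ <-] := H01 1 I1; have [-> ->] := He 1 I1.
Qed.

Lemma homotopic_mul p p' q q' : homotopic p p' -> homotopic q q' ->
  homotopic (idpath_mul p q) (idpath_mul p' q').
Proof.
move=> [H [/subspace_continuousP cH H01 He]] [K [/subspace_continuousP cK K01 Ke]].
exists (fun x => H x * K x)%g; split.
- apply/subspace_continuousP => x Ix.
  by apply: mulg_cont_comp; [exact: cH|exact: cK].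
- by move=> t It /=; have [-> ->] := H01 t It; have [-> ->] := K01 t It.
- by move=> s Is /=; have [-> ->] := He s Is; have [-> ->] := Ke s Is.
Qed.

Lemma homotopic_inv p p' : homotopic p p' -> homotopic (idpath_inv p) (idpath_inv p').
Proof.
move=> [H [/subspace_continuousP cH H01 He]]; exists (fun x => (H x)^-1)%g; split.
- by apply/subspace_continuousP => x Ix; apply: invg_cont_comp; exact: cH.
- by move=> t It /=; have [-> ->] := H01 t It.
- by move=> s Is /=; have [-> ->] := He s Is.
Qed.

Lemma idpath_eq p q : p =1 q -> p = q.
Proof.
case: p q => [p sp p0] [q sq q0] /= /funext pq; subst q.
by rewrite (Prop_irrelevance sp sq) (Prop_irrelevance p0 q0).
Qed.

Definition homotopicb p q : bool := `[< homotopic p q >].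

Lemma homotopicb_refl : reflexive homotopicb.
Proof. by move=> p; apply/asboolP; exact: homotopic_refl. Qed.

Lemma homotopicb_sym : symmetric homotopicb.
Proof. by move=> p q; apply/asboolP/asboolP; exact: homotopic_sym. Qed.

Lemma homotopicb_trans : transitive homotopicb.
Proof.
move=> q p r /asboolP pq /asboolP qr; apply/asboolP.
exact: homotopic_trans pq qr.
Qed.

Canonical homotopicb_equiv :=
  EquivRel homotopicb homotopicb_refl homotopicb_sym homotopicb_trans.

End operations.
End idpaths.

Section universal_group.
Context {R : realType} {E : tvsType R} {G : lieGroupType E}.
Local Open Scope quotient_scope.

(* The group of homotopy classes with fixed endpoints of smooth paths starting
   at the identity, with the pointwise product. *)
Definition ucover := {eq_quot @homotopicb R E G}.
HB.instance Definition _ : EqQuotient _ (@homotopicb R E G) ucover :=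
  EqQuotient.on ucover.
HB.instance Definition _ := Choice.on ucover.

Definition ucover_class (p : idpath G) : ucover := \pi_ucover p.

Lemma ucover_classP p q : ucover_class p = ucover_class q <-> homotopic p q.
Proof.
split; first by move=> /eqquotP /asboolP.
by move=> pq; apply/eqquotP/asboolP.
Qed.

Lemma ucover_repr (a : ucover) : ucover_class (repr a) = a.
Proof. exact: reprK. Qed.

Definition ucover_one : ucover := ucover_class idpath_one.
Definition ucover_mul (a b : ucover) : ucover := ucover_class (idpath_mul (repr a) (repr b)).
Definition ucover_inv (a : ucover) : ucover := ucover_class (idpath_inv (repr a)).

Lemma ucover_classM p q :
  ucover_mul (ucover_class p) (ucover_class q) = ucover_class (idpath_mul p q).
Proof.
by apply/ucover_classP; apply: homotopic_mul; apply/ucover_classP; rewrite ucover_repr.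
Qed.

Lemma ucover_classV p : ucover_inv (ucover_class p) = ucover_class (idpath_inv p).
Proof.
by apply/ucover_classP; apply: homotopic_inv; apply/ucover_classP; rewrite ucover_repr.
Qed.

Fact ucover_mulA : associative ucover_mul.
Proof.
move=> a b c; rewrite -(ucover_repr a) -(ucover_repr b) -(ucover_repr c) !ucover_classM.
by congr ucover_class; apply: idpath_eq => t /=; rewrite mulgA.
Qed.

Fact ucover_mul1 : left_id ucover_one ucover_mul.
Proof.
move=> a; rewrite -(ucover_repr a) /ucover_one ucover_classM.
by congr ucover_class; apply: idpath_eq => t /=; rewrite mul1g.
Qed.

Fact ucover_1mul : right_id ucover_one ucover_mul.
Proof.
move=> a; rewrite -(ucover_repr a) /ucover_one ucover_classM.
by congr ucover_class; apply: idpath_eq => t /=; rewrite mulg1.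
Qed.

Fact ucover_mulV : left_inverse ucover_one ucover_inv ucover_mul.
Proof.
move=> a; rewrite -(ucover_repr a) ucover_classV ucover_classM.
by congr ucover_class; apply: idpath_eq => t /=; rewrite mulVg.
Qed.

Fact ucover_Vmul : right_inverse ucover_one ucover_inv ucover_mul.
Proof.
move=> a; rewrite -(ucover_repr a) ucover_classV ucover_classM.
by congr ucover_class; apply: idpath_eq => t /=; rewrite mulgV.
Qed.

HB.instance Definition _ := isGroup.Build ucover
  ucover_mulA ucover_mul1 ucover_1mul ucover_mulV ucover_Vmul.

Definition ucover_end (a : ucover) : G := repr a 1.

End universal_group.

Arguments ucover {R E} G.

Definition pi1 {R : realType} {E : tvsType R} {G : lieGroupType E} : set (ucover G) :=
  [set a | exists2 p : idpath G, ucover_class p = a & p 1 = 1%g].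

Definition quasimorphism {R : realType} {Gamma : groupType} (nu : Gamma -> R) : Prop :=
  exists C : R, forall a b, `|nu (a * b)%g - nu a - nu b| <= C.

Section hamiltonian.
Context {R : realType} {E F : tvsType R} {G : lieGroupType E} {X : manifoldType F}.
Implicit Types (Omega : X -> F -> F -> R^o) (K : X -> X -> R^o -> X).
Implicit Types (act : G -> X -> X) (mu : E -> X -> R^o).

Definition domic_toledo Omega K : Prop :=
  [/\ symplectic Omega,
      [/\ connected [set: X], @trivial_pi R 1 X & @trivial_pi R 2 X],
      forall x y, [/\ smooth_path (K x y), K x y 0 = x & K x y 1 = y]
    & exists C : R, forall x y z (D : R^o * R^o -> X), smooth_disk D ->
        disk_boundary D (path_concat (K x y) (path_concat (K y z) (K z x))) ->
        `|disk_integral Omega D| < C].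

Definition smooth_action act : Prop :=
  [/\ smooth_map2 act, forall x, act 1%g x = x
    & forall g h x, act (g * h)%g x = act g (act h x)].

(* phi * 1 * phi^-1 = 1, so that both the argument and the value are in the
   tangent space at 1, which is identified with E through chart_at 1. *)
Definition Ad (phi : G) (v : E) : E :=
  tangent_map (fun g : G => phi * g * phi^-1)%g 1%g v.

(* The continuity of mu on the product of Lie(G) and X makes the integrals of
   mu along paths well-behaved when Lie(G) is infinite-dimensional. *)
Definition moment_map act Omega mu : Prop :=
  [/\ forall (a : R) v w x, mu (a *: v + w) x = a *: mu v x + mu w x,
      forall v, smooth_fun (mu v),
      continuous (fun p : E * X => mu p.1 p.2),
      forall (v : E) (g : R^o -> G), smooth_path g -> g 0 = 1%g ->
        velocity g 0 = v -> forall x w,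
        Omega x (velocity (fun t => act (g t) x) 0) w = - dfun (mu v) x w
    & forall phi v x, mu (Ad phi v) (act phi x) = mu v x].

Definition hamiltonian_hermitian act Omega K mu : Prop :=
  [/\ domic_toledo Omega K, smooth_action act,
      forall g x v w, Omega (act g x) (tangent_map (act g) x v)
                        (tangent_map (act g) x w) = Omega x v w,
      forall g x y t, 0 <= t <= 1 -> act g (K x y t) = K (act g x) (act g y) t
    & moment_map act Omega mu].

(* The derivative at t of g g_t^-1, which is in the tangent space at 1. *)
Definition log_velocity (g : R^o -> G) (t : R^o) : E :=
  velocity (fun s => g s * (g t)^-1)%g t.

Definition action_integral act Omega mu (x : X) (g : R^o -> G)
    (D : R^o * R^o -> X) : R :=
  disk_integral Omega D - \int[@lebesgue_measure R]_(t in `[0, 1])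
                   mu (log_velocity g t) (act (g t) x).

(* All the values of the defining formula of nu_x for a given path, when the
   disk varies. *)
Definition nu_values act Omega K mu (x : X) (p : idpath G) : set R :=
  [set r | exists D, [/\ smooth_disk D,
      disk_boundary D (path_concat (fun t => act (p t) x) (K (act (p 1) x) x))
    & r = action_integral act Omega mu x p D]].

(* All the values of the defining formula of the action homomorphism at the
   class a, when the loop representing a and the disk vary. *)
Definition action_values act Omega mu (x : X) (a : ucover G) : set R :=
  [set r | exists (p : idpath G) (D : R^o * R^o -> X),
    [/\ ucover_class p = a /\ p 1 = 1%g, smooth_disk D,
        forall t, 0 <= t <= 1 -> D (circle t) = act (p t) x
      & r = action_integral act Omega mu x p D]].

End hamiltonian.

(* Main.v *)
(** Integrals of Omega over disks are traded for values of a functional on paths.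
    Coning a path off from a base point x0 with the paths [x0, y], and integrating
    Omega over the cone, gives [prim]; since Omega is closed and pi_1 and pi_2
    vanish, the integral of Omega over any smooth square is the signed sum of
    [prim] over its four sides (Stokes on a cube that contracts the closed-up
    square, made smooth by a smoothing theorem for continuous maps).  Hence a disk
    bounding a piecewise smooth loop has area the sum of [prim] over its pieces.

    For a square H in G, the area of H x is computed by the equivariant moment map:
    with a_t = mu(d_t H H^-1)(H x), one has d_s a_t - d_t a_s = Omega(d_s Hx, d_t Hx).
    So [path_action] W(g) = prim(g x) - int mu is also additive around squares of G;
    it is homotopy invariant, W(pq) = W(p) + W(p(1) q), and invariance of Omega and
    [mu] compares W(p(1) q) with W(q).  Writing P(y,z) = prim [y,z], one gets
    nu_x(p) = W(p) + P(gx,x), whose defect -P(ghx,gx) + P(ghx,x) - P(gx,x) is a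
    bounded combination of areas of triangles, as is nu_x - nu_y.  On a loop p at
    the identity W(p^k) = k W(p), so that the homogenization is W(p), the action. *)

Require Import Defs.
From HB Require Import structures.
From mathcomp Require Import all_boot all_order all_algebra.
From mathcomp Require Import all_classical all_reals all_analysis.
From mathcomp Require Import lra ring.

Set Implicit Arguments.
Unset Strict Implicit.
Unset Printing Implicit Defensive.

Import Order.TTheory GRing.Theory Num.Theory.
Import numFieldNormedType.Exports.

Local Open Scope classical_set_scope.
Local Open Scope ring_scope.

#[local] Hint Resolve scalar_hausdorff prod_hausdorff model_hausdorff : core.

(** The hypotheses speak of continuous null-homotopies, of disks smooth up to the boundary and of
    boundary loops with corners, in models where partitions of unity may not exist. Smoothing
    therefore uses bump functions on the source only, which is [R^2] or [R^3], and convex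
    combinations inside one chart at a time, for which local convexity of the model is enough. Every
    gluing is preceded by [step], constant near both ends, so that the pieces agree on an overlap.
    Disks are never cut or glued: a disk is used only through its boundary, by [prim], whose values
    add along paths.

    Nothing relates [K x y] to [K y x], [K x x] may be a nonconstant loop, and [K x0 y] need not
    depend continuously on [y]. So [prim] is not the integral of a one-form but rests on a choice of
    cone for each path, and its additivity comes from areas of squares alone. The missing symmetry
    of [K] also makes degenerate triangles enter the bound of the defect.

    The triangle bound says something only about disks that exist, so disks with prescribed boundary
    have to be built, for it as well as for [nu_values] and [action_values]. *)

Lemma subrACA (V : zmodType) (a b c d : V) : (a - b) - (c - d) = (a - c) - (b - d).
Proof. by rewrite !opprB addrACA [RHS]addrACA [- b - c]addrC. Qed.

(** * Michal-Bastiani calculus *)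

Section smooth_calculus.
Context {R : realType}.
Implicit Types (A E F H : tvsType R).

Lemma lin_continuous_smooth E F (hF : hausdorff_space F) (U : set E) (L : E -> F) :
  (forall (a : R) x y, L (a *: x + y) = a *: L x + L y) -> continuous L -> Csmooth U L.
Proof. by move=> lL cL k; exact: Ck_linear. Qed.

Lemma smooth_cst E F (hF : hausdorff_space F) (U : set E) (c : F) : Csmooth U (fun=> c).
Proof. by move=> k; exact: Ck_cst. Qed.

Lemma smooth_id E (hE : hausdorff_space E) (U : set E) : Csmooth U (fun x : E => x).
Proof. by apply: lin_continuous_smooth => // x; exact: cvg_id. Qed.

Lemma smooth_pair A E F (hE : hausdorff_space E) (hF : hausdorff_space F) (U : set A)
    (f : A -> E) (g : A -> F) : open U ->
  Csmooth U f -> Csmooth U g -> Csmooth U (fun x => (f x, g x)).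
Proof. by move=> oU sf sg k; exact: Ck_pair. Qed.

Lemma smooth_comp A E F (hA : hausdorff_space A) (hE : hausdorff_space E)
    (hF : hausdorff_space F) (V : set E) (U : set A) (f : A -> E) (g : E -> F) :
  open U -> open V -> (forall x, U x -> V (f x)) ->
  Csmooth U f -> Csmooth V g -> Csmooth U (fun x => g (f x)).
Proof. by move=> oU oV UV sf sg k; exact: (@Ck_comp R k A E F hA hE hF U V f g). Qed.

Lemma smooth_fst E F (hE : hausdorff_space E) (U : set (E * F)) :
  Csmooth U (fun x : E * F => x.1).
Proof. by apply: lin_continuous_smooth => // x; exact: cvg_fst. Qed.

Lemma smooth_snd E F (hF : hausdorff_space F) (U : set (E * F)) :
  Csmooth U (fun x : E * F => x.2).
Proof. by apply: lin_continuous_smooth => // x; exact: cvg_snd. Qed.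

Lemma smooth_sub A E (U V : set A) (f : A -> E) : V `<=` U -> Csmooth U f -> Csmooth V f.
Proof. by move=> VU sf k; exact: Ck_sub (sf k). Qed.

Lemma smooth_eq A E (U : set A) (f g : A -> E) : open U ->
  (forall x, U x -> f x = g x) -> Csmooth U f -> Csmooth U g.
Proof. by move=> oU fg sf k; exact: Ck_eq (sf k). Qed.

Lemma smooth_local A E (U : set A) (f : A -> E) :
  (forall u, U u -> exists V, [/\ open V, V u & Csmooth V f]) -> Csmooth U f.
Proof.
move=> loc k; apply: Ck_local => u /loc[V [oV Vu sV]]; exists V; split => //; exact: sV.
Qed.

Lemma smooth_cont A E (U : set A) (f : A -> E) : Csmooth U f ->
  forall u, U u -> {for u, continuous f}.
Proof. by move=> sf; exact: (sf 0). Qed.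

Lemma smooth_add A E (hA : hausdorff_space A) (hE : hausdorff_space E) (U : set A)
    (f g : A -> E) : open U ->
  Csmooth U f -> Csmooth U g -> Csmooth U (fun x => f x + g x).
Proof.
move=> oU sf sg.
apply: (@smooth_comp A (E * E)%type E hA _ hE setT U (fun x => (f x, g x))
  (fun p : E * E => p.1 + p.2)) => //; [exact: prod_hausdorff|exact: openT|exact: smooth_pair|].
apply: lin_continuous_smooth => //.
  by move=> a x y /=; rewrite scalerDr addrACA.
by move=> x; exact: (@add_continuous E x).
Qed.

(** The derivative at [p] in the direction [q] is [B p.1 q.2 + B q.1 p.2], a sum of compositions of
    [B] with continuous linear maps. Hence the induction on the order of differentiability closes on
    [B] itself, once the domain is enlarged to the whole space. *)
Lemma bilinear_smooth E F H (hE : hausdorff_space E) (hF : hausdorff_space F)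
    (hH : hausdorff_space H) (U : set (E * F)) (B : E -> F -> H) :
  (forall (a : R) x x' y, B (a *: x + x') y = a *: B x y + B x' y) ->
  (forall (a : R) x y y', B x (a *: y + y') = a *: B x y + B x y') ->
  continuous (fun p : E * F => B p.1 p.2) -> Csmooth U (fun p : E * F => B p.1 p.2).
Proof.
move=> Bl Br cB k; apply: (@Ck_sub _ _ _ _ setT) => //.
have self0 (V : zmodType) (v : V) : v = v + v -> v = 0.
  by move=> e; apply: (@addrI _ v); rewrite addr0 -e.
have B0l y : B 0 y = 0.
  by apply: self0; rewrite -{1}(addr0 0) -{1}(scale1r 0) Bl scale1r.
have B0r x : B x 0 = 0.
  by apply: self0; rewrite -{1}(addr0 0) -{1}(scale1r 0) Br scale1r.
have BDl x x' y : B (x + x') y = B x y + B x' y by rewrite -{1}(scale1r x) Bl scale1r.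
have BDr x y y' : B x (y + y') = B x y + B x y' by rewrite -{1}(scale1r y) Br scale1r.
have BZl a x y : B (a *: x) y = a *: B x y by rewrite -{1}(addr0 (a *: x)) Bl B0l addr0.
have BZr a x y : B x (a *: y) = a *: B x y by rewrite -{1}(addr0 (a *: y)) Br B0r addr0.
pose dB (p q : E * F) := B p.1 q.2 + B q.1 p.2.
have dqB p q : dquot (fun p : E * F => B p.1 p.2) p q t @[t --> 0^'] --> dB p q.
  apply: (@cvg_eqnear0 _ _ (fun t : R^o => dB p q + t *: B q.1 q.2)).
    rewrite -[X in _ --> X]addr0 -(scale0r (B q.1 q.2)).
    apply: cvg_addT; first exact: cvg_cst0.
    apply: cvg_scaleT; last exact: cvg_cst0.
    by move=> S nS; exact: nbhs_dnbhs.
  near=> t; have t0 : t != 0 by near: t; exact: dnbhs0_neq.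
  rewrite /dquot /= BDl !BDr -(addrA (B p.1 p.2)) [B p.1 p.2 + _]addrC addrK !BZl !BZr.
  by rewrite !scalerDr !scalerA mulVf// mulKf// !scale1r /dB addrA.
have gB p q : gateaux (fun p : E * F => B p.1 p.2) p q = dB p q.
  exact: (dir_unique hH (dqB p q)).
have hEF := prod_hausdorff hE hF.
elim: k => [|k IH]; first by move=> u _; exact: cB.
split; first by move=> u _; exact: cB.
  by move=> u v _; rewrite gB.
have -> : (fun p => gateaux (fun p : E * F => B p.1 p.2) p.1 p.2) =
    (fun p : (E * F) * (E * F) => dB p.1 p.2) by apply/funext => p; rewrite gB.
have linC (f : (E * F) * (E * F) -> E * F) :
    (forall (a : R) x y, f (a *: x + y) = a *: f x + f y) -> continuous f ->
    Ck k setT (fun p => B (f p).1 (f p).2).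
  move=> lf cf; have hD := prod_hausdorff hEF hEF.
  apply: (@Ck_comp R k _ _ H hD hEF hH setT setT f (fun p : E * F => B p.1 p.2)) => //.
  - exact: openT.
  - exact: openT.
  - exact: Ck_linear.
have hHH := prod_hausdorff hH hH; have hD := prod_hausdorff hEF hEF.
rewrite (_ : _ `*` _ = setT); last by apply/seteqP.
apply: (@Ck_comp R k _ _ H hD hHH hH setT setT
   (fun p : (E * F) * (E * F) => (B p.1.1 p.2.2, B p.2.1 p.1.2)) (fun p : H * H => p.1 + p.2)) => //;
  try exact: openT.
- apply: Ck_pair => //; first exact: openT.
  + apply: (linC (fun p => (p.1.1, p.2.2))) => // x.
    apply: cvg_pair.
      by apply: (@continuous_comp _ _ _ (@fst (E * F)%type (E * F)%type) fst); [exact: cvg_fst|exact: cvg_fst].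
    by apply: (@continuous_comp _ _ _ (@snd (E * F)%type (E * F)%type) snd); [exact: cvg_snd|exact: cvg_snd].
  + apply: (linC (fun p => (p.2.1, p.1.2))) => // x.
    apply: cvg_pair.
      by apply: (@continuous_comp _ _ _ (@snd (E * F)%type (E * F)%type) fst); [exact: cvg_snd|exact: cvg_fst].
    by apply: (@continuous_comp _ _ _ (@fst (E * F)%type (E * F)%type) snd); [exact: cvg_fst|exact: cvg_snd].
- apply: Ck_linear => //.
    by move=> a x y /=; rewrite scalerDr addrACA.
  by move=> x; exact: (@add_continuous H x).
Unshelve. all: by end_near. Qed.

Lemma smooth_scale A F (hA : hausdorff_space A) (hF : hausdorff_space F) (U : set A)
    (f : A -> R^o) (g : A -> F) : open U ->
  Csmooth U f -> Csmooth U g -> Csmooth U (fun x => (f x : R) *: g x).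
Proof.
move=> oU sf sg.
apply: (@smooth_comp A (R^o * F)%type F hA _ hF setT U (fun x => (f x, g x))
  (fun p : R^o * F => (p.1 : R) *: p.2)) => //; [exact: prod_hausdorff|exact: openT|exact: smooth_pair|].
apply: (@bilinear_smooth R^o F F scalar_hausdorff hF hF setT (fun (a : R^o) (x : F) => (a : R) *: x)).
- by move=> a x x' y; rewrite scalerDl scalerA.
- by move=> a x y y'; rewrite scalerDr !scalerA [a * x]mulrC.
- by move=> x; exact: (@scale_continuous R F x).
Qed.

Lemma smooth_opp A F (hA : hausdorff_space A) (hF : hausdorff_space F) (U : set A)
    (g : A -> F) : open U -> Csmooth U g -> Csmooth U (fun x => - g x).
Proof.
move=> oU sg; apply: (@smooth_eq _ _ _ (fun x => (-1 : R) *: g x)) => //.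
  by move=> x _; rewrite scaleN1r.
by apply: (@smooth_scale _ _ _ _ _ (fun=> -1)) => //; exact: smooth_cst.
Qed.

Lemma smooth_sub_fun A F (hA : hausdorff_space A) (hF : hausdorff_space F) (U : set A)
    (f g : A -> F) : open U -> Csmooth U f -> Csmooth U g -> Csmooth U (fun x => f x - g x).
Proof. by move=> oU sf sg; apply: smooth_add => //; exact: smooth_opp. Qed.

Lemma smooth_mul A (hA : hausdorff_space A) (U : set A) (f g : A -> R^o) : open U ->
  Csmooth U f -> Csmooth U g -> Csmooth U (fun x => f x * g x : R^o).
Proof. exact: smooth_scale. Qed.

Lemma smooth_gateaux A E (U : set A) (f : A -> E) : Csmooth U f ->
  Csmooth (U `*` [set: A]) (fun p : A * A => gateaux f p.1 p.2).
Proof. by move=> sf k; case: (sf k.+1). Qed.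

Lemma smooth_dquot A E (U : set A) (f : A -> E) u v : Csmooth U f -> U u ->
  dquot f u v t @[t --> 0^'] --> gateaux f u v.
Proof. by move=> sf Uu; have [_ + _] := sf 1%N; exact. Qed.

Lemma smooth_gateaux_at A E (hA : hausdorff_space A) (hE : hausdorff_space E)
  (U : set A) (f : A -> E) v : open U -> Csmooth U f -> Csmooth U (fun u => gateaux f u v).
Proof.
move=> oU sf; have hAA := prod_hausdorff hA hA.
apply: (@smooth_comp A (A * A)%type E hA hAA hE (U `*` setT) U (fun u => (u, v)) (fun p => gateaux f p.1 p.2)) => //.
- exact: openXT.
- by apply: smooth_pair => //; [exact: smooth_id|exact: smooth_cst].
- exact: smooth_gateaux.
Qed.

Lemma gateaux0 A E (hE : hausdorff_space E) (f : A -> E) u : gateaux f u 0 = 0.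
Proof.
apply: (dir_unique hE); apply: (cvg_eqnear0 (@cvg_cst0 _ _ (0 : E))).
by near=> t; rewrite /dquot scaler0 addr0 subrr scaler0.
Unshelve. all: by end_near. Qed.

Lemma gateauxZ A E (hE : hausdorff_space E) (U : set A) (f : A -> E) u v (r : R) :
  Csmooth U f -> U u -> gateaux f u (r *: v) = r *: gateaux f u v.
Proof.
move=> sf Uu; have [->|r0] := eqVneq r 0; first by rewrite !scale0r gateaux0.
apply: (dir_unique hE).
have L : (fun t : R^o => r *: dquot f u v (t * r)) t @[t --> 0^'] --> r *: gateaux f u v.
  apply: cvg_scaleT; first exact: cvg_cst0.
  exact: cvg_comp (cvg_mul_dnbhs0 r0) (smooth_dquot sf Uu).
apply: (cvg_eqnear0 L); near=> t.
have t0 : t != 0 by near: t; exact: dnbhs0_neq.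
by rewrite /dquot invfM !scalerA mulrCA divff// mulr1.
Unshelve. all: by end_near. Qed.

Lemma cont_shift A (u v w : A) :
  (fun p : R^o * R^o => u + (p.1 : R) *: v + (p.2 : R) *: w) p @[p --> ((0, 0) : R^o * R^o)] --> u.
Proof.
rewrite -[X in _ --> X]addr0 -[X in _ --> X + _]addr0.
apply: cvg_addT; first apply: cvg_addT; first exact: cvg_cst.
  by rewrite -(scale0r v); apply: cvg_scaleT; [exact: cvg_fst|exact: cvg_cst].
by rewrite -(scale0r w); apply: cvg_scaleT; [exact: cvg_snd|exact: cvg_cst].
Qed.

Lemma near_box (P : set (R^o * R^o)) : nbhs ((0, 0) : R^o * R^o) P ->
  exists2 e : R, 0 < e & forall x y : R, `|x| < e -> `|y| < e -> P (x, y).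
Proof.
move=> [[P1 P2] /= [[e1 /= e10 H1] [e2 /= e20 H2]] H].
exists (Num.min e1 e2); first by rewrite lt_min e10.
move=> x y; rewrite !lt_min => /andP[x1 _] /andP[_ y2]; apply: (H (x, y)); split => /=.
  by apply: H1; rewrite /= sub0r normrN.
by apply: H2; rewrite /= sub0r normrN.
Qed.

Lemma near0_abs (e : R) : 0 < e -> \forall t \near (0 : R^o), `|t| < e.
Proof. by move=> e0; exists e => //= t /=; rewrite sub0r normrN. Qed.

Lemma conv_nbhs E (x : E) (N : set E) : nbhs x N ->
  exists C, [/\ open C, C x, convex_set (C : set (convex_lmodType E)) & C `<=` N].
Proof.
move=> nA; have [B cB [oB bB]] := @locally_convex R E.
by have [C [BC Cd] CA] := bB x N nA; exists C; split => //; [exact: oB|exact: (cB _ (mem_set BC))].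
Qed.

Lemma affine_dquot A E (U : set A) (f : A -> E) u v (s c : R) : Csmooth U f ->
  U (u + s *: v) -> dquot (fun s : R^o => c *: f (u + s *: v)) s 1 t @[t --> 0^'] -->
    c *: gateaux f (u + s *: v) v.
Proof.
move=> sf Us.
have L : (fun t : R^o => c *: dquot f (u + s *: v) v t) t @[t --> 0^'] --> c *: gateaux f (u + s *: v) v.
  by apply: cvg_scaleT; [exact: cvg_cst0|exact: smooth_dquot sf Us].
apply: (cvg_eqnear0 L); near=> t.
rewrite /dquot scalerA mulrC -scalerA scalerBr; congr (_ *: (_ *: f _ - _)).
by rewrite -addrA -scalerDl /GRing.scale/= mulr1.
Unshelve. all: by end_near. Qed.

(** Directional derivatives need not be additive in the direction; continuity of the derivative in
    the point and the direction makes them so. The quotient along [v + w] is the quotient along [v]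
    at [u] plus a quotient along [w] at [u + t v], and [mvt] confines the latter to a convex
    neighborhood of [gateaux f u w]. *)
Lemma gateauxD A E (hE : hausdorff_space E) (U : set A) (f : A -> E) u v w :
  open U -> Csmooth U f -> U u -> gateaux f u (v + w) = gateaux f u v + gateaux f u w.
Proof.
move=> oU sf Uu; apply: (dir_unique hE).
suff L : (t^-1 *: (f (u + t *: v + t *: w) - f (u + t *: v))) @[t --> 0^'] --> gateaux f u w.
  have L2 : (fun t : R^o => dquot f u v t + t^-1 *: (f (u + t *: v + t *: w) - f (u + t *: v))) t
    @[t --> 0^'] --> gateaux f u v + gateaux f u w.
    by apply: cvg_addT => //; exact: smooth_dquot sf Uu.
  apply: (cvg_eqnear0 L2); near=> t; rewrite /dquot -scalerDr; congr (_ *: _).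
  by rewrite (scalerDr t v w) [u + (_ + _)]addrA [LHS]addrC addrA subrK.
move=> N nN; have [C [oC Cx cC CN]] := conv_nbhs nN.
have nC : nbhs (u, w) [set p : A * A | C (gateaux f p.1 p.2) /\ U p.1].
  apply: filterI.
    apply: (smooth_cont (smooth_gateaux sf)); first by split.
    exact: open_nbhs_nbhs.
  have := @cvg_fst A A (nbhs u) (nbhs w) _ U; apply; exact: open_nbhs_nbhs.
have nC' : \forall y \near u, C (gateaux f y w) /\ U y.
  have c : (fun y : A => (y, w)) y @[y --> u] --> (u, w).
    by apply: cvg_pair; [exact: cvg_id|exact: cvg_cst].
  exact: c _ nC.
have [e e0 He] := near_box (@cont_shift A u v w _ nC').
change (\forall t \near 0^', N (t^-1 *: (f (u + t *: v + t *: w) - f (u + t *: v)))).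
near=> t; apply: CN.
have te : `|t| < e by near: t; apply: nbhs_dnbhs; exact: near0_abs.
have t0 : t != 0 by near: t; exact: dnbhs0_neq.
have He' s : 0 <= s <= 1 -> C (gateaux f (u + t *: v + s *: (t *: w)) w) /\ U (u + t *: v + s *: (t *: w)).
  move=> /andP[s0 s1]; rewrite scalerA; apply: (He t (s * t)) => //.
  by rewrite normrM (ger0_norm s0) (le_lt_trans _ te)// ler_piMl.
have := @mvt R E (fun s : R^o => t^-1 *: f (u + t *: v + s *: (t *: w)))
  (fun s => t^-1 *: gateaux f (u + t *: v + s *: (t *: w)) (t *: w)) C oC cC.
rewrite scale1r scale0r addr0 -scalerBr; apply.
  by move=> s /He'[_ Us]; exact: affine_dquot sf Us.
move=> s /He'[Cs Us]; rewrite (gateauxZ hE _ _ sf Us) scalerA mulVf// scale1r //.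
Unshelve. all: by end_near. Qed.

(** Both mixed derivatives are limits of the same second difference, divided by [t * t]: two uses of
    [mvt] put it into any convex neighborhood of either of them. *)
Lemma gateaux_sym A E (hE : hausdorff_space E) (hA : hausdorff_space A) (U : set A)
    (f : A -> E) u v w : open U -> Csmooth U f -> U u ->
  gateaux (fun x => gateaux f x v) u w = gateaux (fun x => gateaux f x w) u v.
Proof.
move=> oU sf Uu.
have key v' w' N : nbhs (gateaux (fun x => gateaux f x v') u w') N -> exists2 e : R, 0 < e &
    forall t, t != 0 -> `|t| < e ->
    N ((t * t)^-1 *: (f (u + t *: v' + t *: w') - f (u + t *: w') - f (u + t *: v') + f u)).
  move=> nN; have [C [oC Cx cC CN]] := conv_nbhs nN.
  have sg := @smooth_gateaux_at _ _ hA hE _ _ v' oU sf.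
  have sgg := @smooth_gateaux_at _ _ hA hE _ _ w' oU sg.
  have nC : nbhs u [set y | C (gateaux (fun x => gateaux f x v') y w') /\ U y].
    apply: filterI; last exact: open_nbhs_nbhs.
    by apply: (smooth_cont sgg Uu); exact: open_nbhs_nbhs.
  have [e e0 He] := near_box (@cont_shift A u v' w' _ nC).
  exists e => // t t0 te; apply: CN.
  have small s : 0 <= s <= 1 -> `|s * t| < e.
    by move=> /andP[s0 s1]; rewrite normrM (ger0_norm s0) (le_lt_trans _ te)// ler_piMl.
  have box a b : 0 <= a <= 1 -> 0 <= b <= 1 ->
      C (gateaux (fun x => gateaux f x v') (u + (a * t) *: v' + (b * t) *: w') w') /\
      U (u + (a * t) *: v' + (b * t) *: w').
    by move=> /small Ha /small Hb; exact: (He _ _ Ha Hb).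
  have I0 : 0 <= (0 : R) <= 1 by rewrite lexx ler01.
  have I1 : 0 <= (1 : R) <= 1 by rewrite lexx ler01.
  pose h (a : R^o) := (t * t)^-1 *: f (u + t *: w' + a *: (t *: v')) - (t * t)^-1 *: f (u + a *: (t *: v')).
  have -> : (t * t)^-1 *: (f (u + t *: v' + t *: w') - f (u + t *: w') - f (u + t *: v') + f u) = h 1 - h 0.
    rewrite /h !scale1r !scale0r !addr0 -!scalerBr; congr (_ *: _).
    by rewrite [u + _ + _]addrAC opprB [f u - _]addrC addrA; congr (_ + _); exact: addrAC.
  apply: (@mvt R E h (fun a => (t * t)^-1 *: (gateaux f (u + t *: w' + a *: (t *: v')) (t *: v') -
      gateaux f (u + a *: (t *: v')) (t *: v'))) C oC cC).
    move=> a aI.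
    have [_ U1] := box a 1 aI I1; have [_ U2] := box a 0 aI I0.
    rewrite mul1r addrAC -scalerA in U1; rewrite mul0r scale0r addr0 -scalerA in U2.
    have L1 := @affine_dquot A E U f (u + t *: w') (t *: v') a (t * t)^-1 sf U1.
    have L2 := @affine_dquot A E U f u (t *: v') a (t * t)^-1 sf U2.
    have L3 : (fun s : R^o => dquot (fun s : R^o => (t * t)^-1 *: f (u + t *: w' + s *: (t *: v'))) a 1 s
       - dquot (fun s : R^o => (t * t)^-1 *: f (u + s *: (t *: v'))) a 1 s) s @[s --> 0^'] -->
       (t * t)^-1 *: gateaux f (u + t *: w' + a *: (t *: v')) (t *: v') -
       (t * t)^-1 *: gateaux f (u + a *: (t *: v')) (t *: v').
      by apply: cvg_addT => //; rewrite -scaleN1r; apply: (@cvg_eqnear0 _ _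
        (fun s : R^o => (-1 : R) *: dquot (fun s : R^o => (t * t)^-1 *: f (u + s *: (t *: v'))) a 1 s));
        [apply: cvg_scaleT; [exact: cvg_cst0|exact: L2]|near=> s; rewrite scaleN1r].
    rewrite scalerBr; apply: (cvg_eqnear0 L3).
    near=> s; rewrite /dquot -scalerBr; congr (_ *: _).
    by rewrite /h subrACA.
  move=> a aI.
  have [_ U1] := box a 1 aI I1; have [_ U2] := box a 0 aI I0.
  rewrite (gateauxZ hE _ _ sf); last by move: U1; rewrite mul1r addrAC scalerA.
  rewrite (gateauxZ hE _ _ sf); last by move: U2; rewrite mul0r scale0r addr0 scalerA.
  rewrite -scalerBr scalerA invfM mulrAC mulVf// mul1r.
  pose k (b : R^o) := t^-1 *: gateaux f (u + a *: (t *: v') + b *: (t *: w')) v'.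
  have -> : t^-1 *: (gateaux f (u + t *: w' + a *: (t *: v')) v' - gateaux f (u + a *: (t *: v')) v') = k 1 - k 0.
    by rewrite /k scale1r scale0r addr0 -scalerBr (addrAC u).
  apply: (@mvt R E k (fun b => t^-1 *: gateaux (fun x => gateaux f x v') (u + a *: (t *: v') + b *: (t *: w')) (t *: w')) C oC cC).
    move=> b bI; have [_ Uab] := box a b aI bI; rewrite -!scalerA in Uab.
    exact: affine_dquot sg Uab.
  move=> b bI; have [Cab Uab] := box a b aI bI; rewrite -!scalerA in Uab Cab.
  by rewrite (gateauxZ hE _ _ sg)// scalerA mulVf// scale1r.
(* The second difference is symmetric in [v] and [w], so a single small [t] gives a point common to
   the two neighborhoods. *)
apply: hE => N1 N2 /key[e1 e10 H1] /key[e2 e20 H2].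
pose t := Num.min e1 e2 / 2.
have m0 : 0 < Num.min e1 e2 by rewrite lt_min e10.
have t0 : 0 < t by rewrite divr_gt0.
have tm : t < Num.min e1 e2 by rewrite ltr_pdivrMr// ltr_pMr// ltr1n.
move: tm; rewrite lt_min => /andP[te1 te2].
exists ((t * t)^-1 *: (f (u + t *: v + t *: w) - f (u + t *: w) - f (u + t *: v) + f u)).
split; first by apply: H1; rewrite ?gt_eqF// ger0_norm// ltW.
have := H2 t; rewrite gt_eqF// ger0_norm ?(ltW t0)// => /(_ isT te2); congr (N2 _).
by rewrite [u + _ + _]addrAC; congr (_ *: (_ + _)); exact: addrAC.
Unshelve. all: by end_near. Qed.

End smooth_calculus.
Arguments smooth_gateaux_at {R A E} hA hE {U f} v.
Arguments gateauxD {R A E} hE {U f u} v w.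
Arguments gateauxZ {R A E} hE {U f u} v r.
Arguments gateaux_sym {R A E} hE hA {U f u} v w.

(** * A smooth step function *)

Section scalar_functions.
Context {R : realType}.
Implicit Types (A E F H : tvsType R).

Lemma is_derive_dquot (f : R -> R) (x l : R) : is_derive x 1 f l ->
  dquot (f : R^o -> R^o) x 1 t @[t --> 0^'] --> (l : R^o).
Proof.
move=> df; have := @ex_derive _ _ _ _ _ _ _ df.
rewrite /derivable -(derive_val (is_derive := df)) => L.
apply: (@cvg_eqnear0 _ _ (fun h => h^-1 *: ((f \o shift x) (h *: 1) - f x))) => //.
by near=> t; rewrite /dquot /= [x + _]addrC.
Unshelve. all: by end_near. Qed.

Lemma dquot_is_derive (f : R -> R) (x l : R) :
  dquot (f : R^o -> R^o) x 1 t @[t --> 0^'] --> (l : R^o) -> is_derive x 1 f l.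
Proof.
move=> L; have L' : (fun h => h^-1 *: ((f \o shift x) (h *: 1) - f x)) t @[t --> 0^'] --> l.
  by apply: (cvg_eqnear0 L); near=> t; rewrite /dquot /= [x + _]addrC.
by apply: DeriveDef; [apply/cvg_ex; exists l|exact: cvg_lim L'].
Unshelve. all: by end_near. Qed.

(** The bridge from one-variable derivatives to [Ck]: here [gateaux f u v] is [v *: f' u], a product
    of smooth data with [f']. *)
Lemma CkS_derive k (U : set R^o) (f f' : R^o -> R^o) : open U ->
  (forall x : R, U x -> is_derive x 1 (f : R -> R) (f' x : R)) ->
  Ck k U f' -> Ck k.+1 U f.
Proof.
move=> oU df kf'.
have gf (u v : R^o) : U u -> dquot f u v t @[t --> 0^'] --> (v *: f' u : R^o).
  move=> Uu; have [->|v0] := eqVneq v 0.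
    rewrite scale0r; apply: (cvg_eqnear0 (@cvg_cst0 _ _ (0 : R^o))).
    by near=> t; rewrite /dquot scaler0 addr0 subrr scaler0.
  have L : (fun t : R^o => (v : R) *: dquot f u 1 (t * v)) t @[t --> 0^'] --> (v *: f' u : R^o).
    apply: cvg_scaleT; first exact: cvg_cst0.
    exact: cvg_comp (cvg_mul_dnbhs0 v0) (is_derive_dquot (df u Uu)).
  apply: (cvg_eqnear0 L); near=> t.
  have t0 : t != 0 by near: t; exact: dnbhs0_neq.
  rewrite /dquot scalerA invfM mulrCA divff// mulr1; congr (_ *: (f (_ + _) - _)).
  by rewrite /GRing.scale/= mulr1.
have gE (u v : R^o) : U u -> gateaux f u v = v *: f' u.
  by move=> Uu; exact: (dir_unique scalar_hausdorff (gf u v Uu)).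
split.
- move=> u Uu; have [du _] := df u Uu.
  by have /derivable1_diffP/differentiable_continuous := du.
- by move=> u v Uu; rewrite gE//; exact: gf.
- apply: (@Ck_eq _ k _ _ _ (fun p : R^o * R^o => (p.2 : R) *: f' p.1)); first exact: openXT.
    by move=> [u v] [/= Uu _]; rewrite gE.
  apply: (@Ck_comp _ k _ (R^o * R^o)%type _ _ _ _ (U `*` setT) setT (fun p => (p.2, f' p.1)) (fun q : R^o * R^o => (q.1 : R) *: q.2)) => //; auto.
  + exact: openXT.
  + exact: openT.
  + apply: Ck_pair => //; auto; first exact: openXT.
      by apply: (@smooth_snd R R^o R^o).
    apply: (@Ck_comp _ k _ _ _ _ _ _ (U `*` setT) U fst f') => //; auto.
    - exact: openXT.
    - by move=> [a b] [].
    - by apply: (@smooth_fst R R^o R^o).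
  + apply: (@smooth_scale _ (R^o * R^o)%type R^o); auto; first exact: openT.
      by apply: (@smooth_fst R R^o R^o).
    by apply: (@smooth_snd R R^o R^o).
Unshelve. all: by end_near. Qed.

Lemma cos_sin_smooth (U : set R^o) : Csmooth U (cos : R^o -> R^o) /\ Csmooth U (sin : R^o -> R^o).
Proof.
suff H k : Ck k setT (cos : R^o -> R^o) /\ Ck k setT (sin : R^o -> R^o).
  by split=> k; apply: (@Ck_sub _ _ _ _ setT) => //; case: (H k).
elim: k => [|k [IHc IHs]]; first by split=> u _; [exact: continuous_cos|exact: continuous_sin].
split; apply: CkS_derive; try exact: openT.
- apply: (@Ck_comp _ k _ _ R^o _ _ _ setT setT sin (fun x : R^o => - x)) => //; try exact: openT.
  exact: (@smooth_opp R R^o R^o scalar_hausdorff scalar_hausdorff setT id openT (@smooth_id R R^o scalar_hausdorff setT) k).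
- exact: IHc.
Qed.

Lemma inv_smooth : Csmooth (fun x : R^o => 0 < x) (fun x : R^o => x^-1 : R^o).
Proof.
have oU : open (fun x : R^o => 0 < x) by exact: open_gt.
elim=> [|k IH].
  by move=> u /= u0; apply: inv_continuous; rewrite gt_eqF.
apply: (@CkS_derive _ _ _ (fun x => - (x^-1 * x^-1))) => //.
- move=> x x0; have xn0 : (id x) != 0 :> R by rewrite gt_eqF.
  have := @is_deriveV R id x 1 1 xn0 (is_derive_id _ _).
  by rewrite /GRing.scale/= mulr1 expr2 invfM.
- apply: (@Ck_comp _ k _ (R^o * R^o)%type R^o _ _ _ (fun x : R^o => 0 < x) setT (fun x => (x^-1, x^-1)) (fun p : R^o * R^o => - (p.1 * p.2))) => //; auto; try exact: openT.
  + exact: Ck_pair.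
  + apply: smooth_opp; auto; first exact: openT.
    apply: smooth_mul; auto; first exact: openT.
      exact: smooth_fst.
    exact: smooth_snd.
Qed.

(* The functions x^-n exp(-1/x), extended by 0 to x <= 0, are stable under
   derivation up to linear combinations. *)
Definition flat (n : nat) (x : R^o) : R^o :=
  if 0 < x then (x^-1) ^+ n * expR (- x^-1) else 0.

(** The exponential of [x^-1] dominates the term of degree [n + 1] of its series. A bound linear in
    [x] is what makes the difference quotients at 0 tend to 0. *)
Lemma flat_le n x : 0 < x -> flat n x <= n.+1`!%:R * x.
Proof.
move=> x0; rewrite /flat x0 expRN.
have xi0 : 0 <= x^-1 by rewrite invr_ge0 ltW.
have := expR_ge1Dxn n xi0; set e := expR _ => He.
have e0 : 0 < e by exact: expR_gt0.
rewrite ler_pdivrMr//.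
have f0 : 0 < n.+1`!%:R :> R by rewrite ltr0n fact_gt0.
have H : x^-1 ^+ n.+1 <= n.+1`!%:R * e.
  by rewrite -ler_pdivrMl// mulrC (le_trans _ He)// lerDr.
rewrite mulrAC -ler_pdivrMr//; apply: le_trans H.
by rewrite exprS mulrC.
Qed.

Lemma flat_ge0 n x : 0 <= flat n x.
Proof.
rewrite /flat; case: ifPn => // x0.
by rewrite mulr_ge0 ?expR_ge0// exprn_ge0// invr_ge0 ltW.
Qed.

Lemma flat_derive n (x : R) : is_derive x 1 (flat n : R -> R) (flat n.+2 x - n%:R * flat n.+1 x).
Proof.
apply: dquot_is_derive.
have [x0|x0|->] := ltgtP x 0.
- have E y : y < 0 -> flat n y = 0 by move=> y0; rewrite /flat ltNge (ltW y0).
  have [-> ->] : flat n.+2 x = 0 /\ flat n.+1 x = 0 by rewrite /flat !ltNge (ltW x0).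
  rewrite mulr0 subr0; apply: (cvg_eqnear0 (@cvg_cst0 _ R^o 0)).
  have oU : open (fun x : R^o => x < 0) by exact: open_lt.
  have := @dquot_near_eq _ _ _ _ (fun=> 0) (flat n) x 1 oU x0 (fun y y0 => esym (E y y0)).
  by apply: filterS => t <-; rewrite /dquot subrr scaler0.
- have xn0 : (id x) != 0 :> R by rewrite gt_eqF.
  have D1 := @is_deriveV R id x 1 1 xn0 (is_derive_id _ _).
  have D2 : is_derive x 1 (fun y : R => expR (- y^-1)) (expR (- x^-1) * (x^-1 * x^-1)).
    have DN : is_derive x 1 (fun y : R => - y^-1) (x^-1 * x^-1).
      apply: (is_derive_eq (is_deriveN D1)).
      by rewrite /GRing.scale/= mulr1 expr2 invfM opprK.
    exact: is_derive1_comp.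
  have D3 : is_derive x 1 (fun y : R => (y^-1) ^+ n) (- n%:R * x^-1 ^+ n.+1).
    have := @is_deriveX _ _ (fun y : R => y^-1) n x 1 _ D1; rewrite exprfctE => D3.
    apply: (is_derive_eq D3); rewrite /GRing.scale/= mulr1 expr2 invfM.
    by case: (n) => [|m]; rewrite ?mulr0n ?oppr0 ?mul0r//= !exprS; ring.
  have D := is_deriveM D3 D2.
  have := is_derive_dquot D.
  rewrite {2 3}/flat x0.
  have oU : open (fun x : R^o => 0 < x) by exact: open_gt.
  have E y : 0 < y -> ((fun y : R => (y^-1) ^+ n) * (fun y : R => expR (- y^-1))) y = flat n y.
    by move=> y0; rewrite /flat y0.
  rewrite (_ : _ *: _ + _ *: _ = x^-1 ^+ n.+2 * expR (- x^-1) - n%:R * (x^-1 ^+ n.+1 * expR (- x^-1))); last first.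
    by rewrite /GRing.scale/= !exprS; ring.
  move=> /cvg_eqnear0; apply; exact: dquot_near_eq oU x0 E.
(* At 0 the difference quotient of [flat n] at [t] is [flat n.+1 t], which tends to 0 by the linear
   bound. *)
- have -> : flat n.+2 0 - n%:R * flat n.+1 0 = 0 by rewrite /flat ltxx mulr0 subr0.
  have B (t : R) : `|flat n.+1 t| <= n.+2`!%:R * `|t|.
    rewrite ger0_norm ?flat_ge0//; case: (ltP 0 t) => t0.
      by rewrite (gtr0_norm t0); exact: flat_le.
    by rewrite /flat ltNge t0 /= mulr_ge0.
  have L : flat n.+1 t @[t --> 0^'] --> (0 : R^o).
    apply/cvgr0Pnorm_lt => e e0; near=> t.
    apply: le_lt_trans (B t) _; rewrite mulrC -ltr_pdivlMr ?ltr0n ?fact_gt0//.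
    near: t; apply: nbhs_dnbhs; apply: near0_abs; rewrite divr_gt0// ltr0n fact_gt0//.
  apply: (cvg_eqnear0 L); near=> t.
  rewrite /dquot add0r /GRing.scale/= mulr1 /flat ltxx subr0; case: ifPn => _; last by rewrite mulr0.
  by rewrite exprS mulrA.
Unshelve. all: by end_near. Qed.

Lemma flat_smooth n : Csmooth setT (flat n).
Proof.
move=> k; elim: k n => [|k IH] n.
  by move=> u _; have [/derivable1_diffP/differentiable_continuous] := flat_derive n u.
apply: CkS_derive; first exact: openT.
  by move=> x _; exact: flat_derive.
apply: (@Ck_comp _ k _ (R^o * R^o)%type R^o _ _ _ setT setT (fun x => (flat n.+2 x, flat n.+1 x)) (fun p : R^o * R^o => p.1 - n%:R * p.2)) => //; auto; try exact: openT.
  by apply: Ck_pair => //; exact: openT.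
apply: smooth_sub_fun; auto; first exact: openT.
  exact: smooth_fst.
apply: smooth_mul; auto; first exact: openT.
  exact: smooth_cst.
exact: smooth_snd.
Qed.

Lemma flat0_homo : {homo flat 0 : x y / x <= y}.
Proof.
move=> x y xy; rewrite /flat !expr0 !mul1r.
case: ifPn => x0; last by case: ifPn => // _; exact: expR_ge0.
have y0 : 0 < y by exact: lt_le_trans xy.
by rewrite y0 ler_expR lerN2 lef_pV2.
Qed.

Lemma flat0_gt0 x : (0 < flat 0 x) = (0 < x).
Proof. by rewrite /flat; case: ifPn => [_|_]; rewrite ?ltxx// expr0 mul1r expR_gt0. Qed.

Lemma flat0_0 x : x <= 0 -> flat 0 x = 0.
Proof. by rewrite /flat ltNge => ->. Qed.

(** The argument [2 * x - 2^-1] is nonpositive up to [x = 1/4] and at least 1 from [x = 3/4] on.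
    Being constant near both ends, and with values in [[0, 1]] for every real argument, it makes
    glued maps smooth and turns paths given on [[0, 1]] into maps of the line. *)
Definition step (x : R) : R :=
  let y := 2 * x - 2^-1 in flat 0 y / (flat 0 y + flat 0 (1 - y)).

Lemma step_den (y : R) : 0 < flat 0 y + flat 0 (1 - y).
Proof.
case: (ltP 0 y) => y0; first by rewrite ltr_wpDr ?flat_ge0// flat0_gt0.
by rewrite ltr_wpDl ?flat_ge0// flat0_gt0; lra.
Qed.

Lemma step0 x : x <= 4^-1 -> step x = 0.
Proof. by move=> x4; rewrite /step flat0_0 ?mul0r//; lra. Qed.

Lemma step1 x : 3 / 4 <= x -> step x = 1.
Proof.
move=> x4; rewrite /step (@flat0_0 (1 - _)) ?addr0 ?divff//; last by lra.
by rewrite gt_eqF// flat0_gt0; lra.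
Qed.

Lemma step_ge0 x : 0 <= step x.
Proof. by rewrite /step divr_ge0 ?addr_ge0// ?flat_ge0. Qed.

Lemma step_le1 x : step x <= 1.
Proof. by rewrite /step ler_pdivrMr ?step_den// mul1r lerDl flat_ge0. Qed.

Lemma step_homo : {homo step : x y / x <= y}.
Proof.
move=> x y xy; rewrite /step ler_pdivrMr ?step_den// mulrAC ler_pdivlMr ?step_den//.
rewrite !mulrDr mulrC lerD2l.
by apply: ler_pM; rewrite ?flat_ge0//; apply: flat0_homo; lra.
Qed.

Lemma step_smooth : Csmooth setT (step : R^o -> R^o).
Proof.
have oT := @openT R^o; have hR := @scalar_hausdorff R.
have saff : Csmooth setT (fun x : R^o => 2 * x - 2^-1 : R^o).
  apply: smooth_add => //; last exact: smooth_cst.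
  by apply: smooth_mul => //; [exact: smooth_cst|exact: smooth_id].
have sf1 : Csmooth setT (fun x : R^o => flat 0 (2 * x - 2^-1)).
  exact: (@smooth_comp _ _ _ _ hR hR hR setT setT _ _ oT oT _ saff (@flat_smooth 0)).
have sf2 : Csmooth setT (fun x : R^o => flat 0 (1 - (2 * x - 2^-1))).
  apply: (@smooth_comp _ _ _ _ hR hR hR setT setT _ _ oT oT _ _ (@flat_smooth 0)) => //.
  by apply: smooth_sub_fun => //; exact: smooth_cst.
apply: (@smooth_mul _ _ _ setT (fun x : R^o => flat 0 (2 * x - 2^-1))
  (fun x => (flat 0 (2 * x - 2^-1) + flat 0 (1 - (2 * x - 2^-1)))^-1)) => //.
apply: (@smooth_comp _ _ _ _ hR hR hR (fun x : R^o => 0 < x) setT _ _ oT _ _ _ inv_smooth).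
- exact: open_gt.
- by move=> x _; exact: step_den.
- exact: smooth_add.
Qed.

End scalar_functions.

(** * Smoothing of continuous maps into manifolds *)

Section smoothing.
Context {R : realType}.
Implicit Types (A E F H : tvsType R).

(** A requirement on the source of the maps to be smoothed, not on the model of the manifold, which
    may have no smooth bump functions. *)
Definition bumpy A := forall (z : A) (U : set A), open U -> U z ->
  exists (chi : A -> R^o) (P C : set A),
    [/\ Csmooth setT chi, forall x, 0 <= chi x <= 1,
        open P /\ P z, forall x, P x -> chi x = 1
      & [/\ closed C, compact C, C `<=` U & forall x, ~ C x -> chi x = 0]].

Lemma bumpy_scalar : bumpy R^o.
Proof.
move=> z U oU Uz.
have [r /= r0 Hr] : nbhs z U by exact: open_nbhs_nbhs.
have hR := @scalar_hausdorff R; have oT := @openT R^o.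
pose y (x : R^o) : R^o := (x - z) / r.
have sy : Csmooth setT y.
  apply: smooth_mul => //; last exact: smooth_cst.
  by apply: smooth_sub_fun => //; [exact: smooth_id|exact: smooth_cst].
(* With [y = (x - z) / r], both factors are 1 for [|y| <= 1/4], and one of them is 0 for
   [|y| >= 3/4]. *)
exists (fun x => step (y x + 1) * step (1 - y x)), (`](z - r / 4), (z + r / 4)[%classic : set R^o),
  (`[(z - 3 / 4 * r), (z + 3 / 4 * r)]%classic : set R^o); split.
- apply: smooth_mul => //.
    apply: (@smooth_comp _ _ _ _ hR hR hR setT setT _ _ oT oT _ _ step_smooth) => //.
    by apply: smooth_add => //; exact: smooth_cst.
  apply: (@smooth_comp _ _ _ _ hR hR hR setT setT _ _ oT oT _ _ step_smooth) => //.
  by apply: smooth_sub_fun => //; exact: smooth_cst.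
- move=> x; rewrite mulr_ge0 ?step_ge0//= -[1](mulr1 1) ler_pM ?step_ge0// ?step_le1//.
- split; first exact: itv_open.
  by rewrite /= in_itv/=; apply/andP; split; have := r0; lra.
- move=> x; rewrite /= in_itv/= => /andP[x1 x2].
  rewrite !step1 ?mulr1// /y.
    suff : (x - z) / r <= 1 / 4 by lra.
    by rewrite ler_pdivrMr//; lra.
  suff : - (1 / 4) <= (x - z) / r by lra.
  by rewrite ler_pdivlMr//; lra.
- split.
  + exact: itv_closed.
  + exact: segment_compact.
  + move=> x; rewrite /= in_itv/= => /andP[x1 x2]; apply: Hr => /=.
    by rewrite ltr_norml; apply/andP; split; have := r0; lra.
  + move=> x; rewrite /= in_itv/= => /negP; rewrite negb_and -!ltNge => /orP[h|h].
      rewrite step0 ?mul0r// /y; suff : (x - z) / r <= - (3 / 4) by lra.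
      by rewrite ler_pdivrMr//; lra.
    rewrite (@step0 _ (1 - _)) ?mulr0// /y; suff : 3 / 4 <= (x - z) / r by lra.
    by rewrite ler_pdivlMr//; lra.
Qed.

Lemma bumpy_prod E F : hausdorff_space E -> hausdorff_space F ->
  bumpy E -> bumpy F -> bumpy (E * F)%type.
Proof.
move=> hE hF bE bF [x y] U oU Uz.
have [[U1 U2] /= [n1 n2] U12] : nbhs (x, y) U by exact: open_nbhs_nbhs.
have U1x : U1^° x by []; have U2y : U2^° y by [].
have [c1 [P1 [C1 [s1 b1 [oP1 P1x] e1 [cC1 kC1 CU1 z1]]]]] := bE x _ (@open_interior _ U1) U1x.
have [c2 [P2 [C2 [s2 b2 [oP2 P2y] e2 [cC2 kC2 CU2 z2]]]]] := bF y _ (@open_interior _ U2) U2y.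
have hEF := prod_hausdorff hE hF.
exists (fun p => c1 p.1 * c2 p.2), (P1 `*` P2), (C1 `*` C2); split.
- apply: smooth_mul => //; first exact: openT.
    by apply: (@smooth_comp _ _ _ _ hEF hE _ setT setT (fun p : E * F => p.1) c1) => //;
      try exact: openT; exact: smooth_fst.
  by apply: (@smooth_comp _ _ _ _ hEF hF _ setT setT (fun p : E * F => p.2) c2) => //;
      try exact: openT; exact: smooth_snd.
- move=> p; have /andP[a0 a1] := b1 p.1; have /andP[d0 d1] := b2 p.2.
  by rewrite mulr_ge0//= -[1](mulr1 1) ler_pM.
- by split => //; exact: open_setX.
- by move=> p [/= /e1 -> /e2 ->]; rewrite mulr1.
- split.
  + rewrite (_ : _ `*` _ = fst @^-1` C1 `&` snd @^-1` C2) //.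
    by apply: closedI; apply: preimage_closed => // p _; [exact: cvg_fst|exact: cvg_snd].
  + exact: compact_setX.
  + move=> [a b] [/= /CU1/interior_subset Ua /CU2/interior_subset Ub]; exact: (U12 (a, b)).
  + move=> [a b] /= ab; have [/z2 ->|nb] := pselect (~ C2 b); first by rewrite mulr0.
    by rewrite z1 ?mul0r// => Ca; apply: ab; split => //; exact: contrapT.
Qed.

Lemma compact_seq_cover (T : choiceType) (X : topologicalType) (K : set X) (pt : T -> X)
    (P : T -> set X) : compact K -> (forall i, K (pt i) -> open (P i)) ->
  (forall x, K x -> exists2 i, K (pt i) & P i x) ->
  exists s : seq T, (forall i, i \in s -> K (pt i)) /\
    (forall x, K x -> exists2 i, i \in s & P i x).
Proof.
move=> cK oP Kx.
(* Finite sequences directed by inclusion: the near-covering form of compactness then yields one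
   sequence that serves all points of [K]. *)
pose F := filter_from [set: seq T] (fun s0 => [set s : seq T | {subset s0 <= s}]).
have FF : Filter F.
  apply: filter_from_filter; first by exists [::].
  move=> s1 s2 _ _; exists (s1 ++ s2) => // s /= Hs.
  by split=> i si; apply: Hs; rewrite mem_cat si ?orbT.
have [s0 _ Hs0] : F [set s : seq T | K `<=` [set x : X | exists i : T, [/\ i \in s, K (pt i) & P i x]]].
  have := (compact_near_coveringP _).1 cK _ F (fun (s : seq T) (x : X) => exists i : T, [/\ i \in s, K (pt i) & P i x]) FF.
  apply=> x /Kx[i Ki Pi].
  exists (P i, [set s : seq T | i \in s]) => /=.
    split; first by apply: open_nbhs_nbhs; split => //; exact: oP.
    by exists [:: i] => //= s; apply; exact: mem_head.
  by move=> [y s] /= [Py si]; exists i.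
have {}Hs0 := Hs0 s0 (fun _ => id).
exists [seq i <- s0 | `[<K (pt i)>]]; split.
  by move=> i; rewrite mem_filter => /andP[/asboolP].
move=> x /Hs0[i [si Ki Pi]]; exists i => //.
by rewrite mem_filter si andbT; exact/asboolP.
Qed.

Lemma cvg_subT {T : Type} (H : set_system T) {FH : Filter H} F (f g : T -> F) a b :
  f @ H --> a -> g @ H --> b -> (f t - g t) @[t --> H] --> a - b.
Proof.
move=> fa gb; apply: cvg_addT => //.
by apply: cvg_comp gb _; exact: (@opp_continuous F b).
Qed.

(** Each [w] of the list replaces [psi] by [(1 - chi w) psi + chi w * phi w]. The result is constant
    where [chi w] is 1, keeps the smoothness already gained, and is unchanged off [C w]. The error
    stays in the convex set [V], because [phi w - phi z] lies in [V] on [C w]. *)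
Lemma blend A E (hA : hausdorff_space A) (hE : hausdorff_space E)
    (B W0 : set A) (V : set E) (phi : A -> E) (chi : A -> A -> R^o) (P C : A -> set A) (s : seq A) :
  open B -> open W0 -> W0 `<=` B -> convex_set (V : set (convex_lmodType E)) -> V 0 ->
  (forall z, B z -> {for z, continuous phi}) -> Csmooth W0 phi ->
  (forall w, w \in s -> [/\ Csmooth setT (chi w), forall x, 0 <= chi w x <= 1, open (P w),
      forall x, P w x -> chi w x = 1 & forall x, ~ C w x -> chi w x = 0]) ->
  (forall w z, w \in s -> C w z -> V (phi w - phi z)) ->
  exists psi : A -> E, [/\ forall z, B z -> {for z, continuous psi},
     Csmooth (W0 `|` (B `&` [set z | exists2 w, w \in s & P w z])) psi,
     forall z, V (psi z - phi z) & forall z, (forall w, w \in s -> ~ C w z) -> psi z = phi z].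
Proof.
move=> oB oW WB cV V0 cphi sphi.
elim: s => [|w s IH] Hs HV.
  exists phi; split => //; last by move=> z; rewrite subrr.
  by apply: smooth_sub sphi => z [//|[_ []]].
have [||psi [cpsi spsi Vpsi epsi]] := IH.
- by move=> v vs; apply: Hs; rewrite inE vs orbT.
- by move=> v z vs; apply: HV; rewrite inE vs orbT.
have [schi chi01 oP P1 C0] := Hs w (mem_head _ _).
have oPs : open (B `&` [set z | exists2 v, v \in s & P v z]).
  apply: openI => //; rewrite openE => z [v vs Pv].
  have [_ _ oPv _ _] : [/\ Csmooth setT (chi v), forall x, 0 <= chi v x <= 1, open (P v),
      forall x, P v x -> chi v x = 1 & forall x, ~ C v x -> chi v x = 0].
    by apply: Hs; rewrite inE vs orbT.
  have n : nbhs z (P v) by exact: open_nbhs_nbhs.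
  by apply: filterS n => y Py; exists v.
have oW1 : open (W0 `|` (B `&` [set z | exists2 v, v \in s & P v z])) by exact: openU.
exists (fun z => (1 - chi w z : R) *: psi z + (chi w z : R) *: phi w); split.
- move=> z Bz; have cc := smooth_cont schi (I : setT z).
  apply: cvg_addT; apply: cvg_scaleT => //; first by apply: cvgB => //; exact: cvg_cst.
    exact: cpsi.
  exact: cvg_cst.
- apply: smooth_local => z Wz.
  have [Wz1|/not_orP[nW nB]] := pselect ((W0 `|` (B `&` [set z | exists2 v, v \in s & P v z])) z).
    eexists; split; [exact: oW1|exact: Wz1|].
    have sc : Csmooth (W0 `|` (B `&` [set z | exists2 v, v \in s & P v z])) (chi w).
      exact: (smooth_sub (@subsetT _ _) schi).
    apply: smooth_add => //; apply: smooth_scale => //; auto.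
      by apply: smooth_sub_fun; auto; exact: smooth_cst.
    exact: smooth_cst.
  have Pwz : P w z.
    case: Wz => [//|[Bz [v]]]; rewrite inE => /orP[/eqP -> //|vs Pv].
    by case: nB; split => //; exists v.
  exists (P w); split => //.
  apply: (@smooth_eq _ _ _ _ (fun=> phi w)) => //; last exact: smooth_cst.
  by move=> y /P1 ->; rewrite subrr scale0r add0r scale1r.
- move=> z; have [Cz|/C0 ->] := pselect (C w z); last by rewrite subr0 scale1r scale0r addr0.
  have /andP[c0 c1] := chi01 z.
  have -> : (1 - chi w z : R) *: psi z + (chi w z : R) *: phi w - phi z =
     (1 - chi w z : R) *: (psi z - phi z) + (chi w z : R) *: (phi w - phi z).
    rewrite !scalerBr addrACA -opprD; congr (_ - _).
    by rewrite -scalerDl subrK scale1r.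
  apply: convexP => //; rewrite ?subr_ge0 ?subrK//.
  exact: HV (mem_head _ _) Cz.
- move=> z Hz; rewrite C0 ?subr0 ?scale1r ?scale0r ?addr0; last exact: Hz (mem_head _ _).
  by apply: epsi => v vs; apply: Hz; rewrite inE vs orbT.
Qed.

Lemma bumpy_choice A (bA : bumpy A) (K : set A) (O : A -> set A) :
  (forall w, K w -> open (O w) /\ O w w) ->
  exists (chi : A -> A -> R^o) (P C : A -> set A), forall w, K w ->
    [/\ Csmooth setT (chi w), forall x, 0 <= chi w x <= 1,
        open (P w) /\ P w w, forall x, P w x -> chi w x = 1
      & [/\ closed (C w), compact (C w), C w `<=` O w & forall x, ~ C w x -> chi w x = 0]].
Proof.
move=> HO.
have HH w : exists p : (A -> R^o) * (set A * set A), K w ->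
    [/\ Csmooth setT p.1, forall x, 0 <= p.1 x <= 1,
        open p.2.1 /\ p.2.1 w, forall x, p.2.1 x -> p.1 x = 1
      & [/\ closed p.2.2, compact p.2.2, p.2.2 `<=` O w & forall x, ~ p.2.2 x -> p.1 x = 0]].
  have [Kw|nK] := pselect (K w); last by exists (cst 0, (set0, set0)) => /nK.
  have [oO Ow] := HO w Kw; have [chi [P [C H]]] := bA w _ oO Ow.
  by exists (chi, (P, C)).
pose g w := sval (cid (HH w)).
have Hg w := svalP (cid (HH w)).
by exists (fun w => (g w).1), (fun w => (g w).2.1), (fun w => (g w).2.2).
Qed.

Lemma closed_bigU_seq (T : eqType) (X : topologicalType) (C : T -> set X) (s : seq T) :
  (forall i, i \in s -> closed (C i)) -> closed [set x | exists2 i, i \in s & C i x].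
Proof.
elim: s => [|i s IH] Hs.
  rewrite (_ : [set _ | _] = set0); first exact: closed0.
  by apply/seteqP; split => x //= [].
rewrite (_ : [set _ | _] = C i `|` [set x | exists2 i, i \in s & C i x]).
  apply: closedU; first by apply: Hs; exact: mem_head.
  by apply: IH => j js; apply: Hs; rewrite inE js orbT.
apply/seteqP; split => x /=.
  by move=> [j]; rewrite inE => /orP[/eqP ->|js] Cj; [left|right; exists j].
move=> [Ci|[j js Cj]]; first by exists i => //; exact: mem_head.
by exists j => //; rewrite inE js orbT.
Qed.

Lemma compact_bigU_seq (T : eqType) (X : topologicalType) (C : T -> set X) (s : seq T) :
  (forall i, i \in s -> compact (C i)) -> compact [set x | exists2 i, i \in s & C i x].
Proof.
elim: s => [|i s IH] Hs.
  rewrite (_ : [set _ | _] = set0); first exact: compact0.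
  by apply/seteqP; split => x //= [].
rewrite (_ : [set _ | _] = C i `|` [set x | exists2 i, i \in s & C i x]).
  apply: compactU; first by apply: Hs; exact: mem_head.
  by apply: IH => j js; apply: Hs; rewrite inE js orbT.
apply/seteqP; split => x /=.
  by move=> [j]; rewrite inE => /orP[/eqP ->|js] Cj; [left|right; exists j].
move=> [Ci|[j js Cj]]; first by exists i => //; exact: mem_head.
by exists j => //; rewrite inE js orbT.
Qed.

Lemma open_bigU_seq (T : eqType) (X : topologicalType) (C : T -> set X) (s : seq T) :
  (forall i, i \in s -> open (C i)) -> open [set x | exists2 i, i \in s & C i x].
Proof.
move=> Hs; rewrite openE => x [i si Ci].
have n : nbhs x (C i) by apply: open_nbhs_nbhs; split => //; exact: Hs.
by apply: filterS n => y Cy; exists i.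
Qed.

Lemma chart_inv_smooth E {M : manifoldType E} (c : chart E M) : atlas c ->
  smooth_into (chart_img c) (chart_inv c).
Proof.
by move=> ac; split; [exact: chart_inv_continuous|move=> c' ac'; exact: atlas_smooth].
Qed.

Lemma continuous_near_eq (S T : topologicalType) (f g : S -> T) (z : S) :
  {for z, continuous f} -> (\forall x \near z, f x = g x) -> {for z, continuous g}.
Proof.
move=> cf fg; have e := nbhs_singleton fg.
rewrite /prop_for /continuous_at -e => N /cf nN.
change (nbhs z (g @^-1` N)); change (nbhs z (f @^-1` N)) in nN.
by apply: filterS2 fg nN => x /= ->.
Qed.

(** One stage of the smoothing, inside one chart. The open set [G] around the graph of [f] carries
    the conditions that later stages still need; the domain of smoothness only grows. *)
Lemma chart_smoothing A E (hA : hausdorff_space A) (bA : bumpy A) {M : manifoldType E}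
    (c : chart E M) (f : A -> M) (W C N : set A) (G : set (A * M)) :
  atlas c -> continuous f -> open W -> smooth_into W f -> compact C -> open N -> C `<=` N ->
  (forall z, C z -> chart_dom c (f z)) -> open G -> (forall z, G (z, f z)) ->
  exists f' W', [/\ continuous f', [/\ open W', W `<=` W' & C `<=` W'], smooth_into W' f',
     forall z, ~ N z -> f' z = f z & forall z, G (z, f' z)].
Proof.
move=> ac cf oW sf kC oN CN Cc oG Gf.
have hE := @model_hausdorff R E M.
pose B := N `&` f @^-1` chart_dom c.
have oB : open B.
  by apply: open_pre => //; [exact: open_chart_dom|move=> a _; exact: cf].
have CB : C `<=` B by move=> z Cz; split; [exact: CN|exact: Cc].
pose phi := c \o f.
have cphi z : B z -> {for z, continuous phi}.
  by move=> [_ dz]; apply: continuous_comp; [exact: cf|exact: chart_fun_continuous].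
(* This first family only provides a compact neighborhood [D] of [C] inside [B], on which the
   admissible error can be chosen uniformly. A second, finer family supported in [Q] does the
   blending. *)
have [chi0 [P0 [C0 H0]]] := bumpy_choice bA (fun w Cw => conj oB (CB w Cw)).
have [|x Cx|s0 [s0C Cs0]] := @compact_seq_cover A A C id P0 kC.
- by move=> w Cw; case: (H0 w Cw) => _ _ [].
- by exists x => //; case: (H0 x Cx) => _ _ [].
pose Q := [set z | exists2 w, w \in s0 & P0 w z].
pose D := [set z | exists2 w, w \in s0 & C0 w z].
have oQ : open Q by apply: open_bigU_seq => w /s0C Cw; case: (H0 w Cw) => _ _ [].
have kD : compact D.
  by apply: compact_bigU_seq => w /s0C Cw; case: (H0 w Cw) => _ _ _ _ [].
have DB : D `<=` B.
  by move=> z [w /s0C Cw wz]; case: (H0 w Cw) => _ _ _ _ [_ _ + _]; apply.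
have QD : Q `<=` D.
  move=> z [w ws Pz]; exists w => //; have Cw := s0C w ws; apply: contrapT => nCz.
  have [_ _ _ /(_ z Pz) e1 [_ _ _ /(_ z nCz) e0]] := H0 w Cw.
  by move: e1; rewrite e0 => /esym/eqP; rewrite oner_eq0.
pose Good z u := chart_img c u /\ G (z, chart_inv c u).
(* Compactness of [D] gives one neighborhood of 0 of displacements that keep the values inside the
   chart and the graph inside [G]. *)
have tube : \forall v \near (0 : E), D `<=` (fun z => Good z (phi z + v)).
  have := (compact_near_coveringP _).1 kD _ (nbhs (0 : E)) (fun v z => Good z (phi z + v)) _.
  apply=> z Dz; have [_ dz] := DB z Dz.
  have Ls : (fun p : A * E => phi p.1 + p.2) p @[p --> (z, 0)] --> phi z.
    rewrite -[X in _ --> X]addr0; apply: cvg_addT; last exact: cvg_snd.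
    by apply: cvg_comp; [exact: cvg_fst|exact: cphi (DB z Dz)].
  have Pz : chart_img c (phi z) by exact: chart_funS.
  have n1 : \forall p \near ((z, 0) : A * E), chart_img c (phi p.1 + p.2).
    by apply: Ls; apply: open_nbhs_nbhs; split => //; exact: open_chart_img.
  have n2 : \forall p \near ((z, 0) : A * E), G (p.1, chart_inv c (phi p.1 + p.2)).
    have L2 : (fun p : A * E => (p.1, chart_inv c (phi p.1 + p.2))) p @[p --> (z, 0)] --> (z, f z).
      apply: cvg_pair; first exact: cvg_fst.
      have -> : f z = chart_inv c (phi z) by rewrite /phi /= chart_funK.
      by apply: cvg_comp Ls _; exact: chart_inv_continuous.
    by apply: L2; apply: open_nbhs_nbhs.
  have n3 : \forall p \near ((z, 0) : A * E), Good p.1 (phi p.1 + p.2).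
    by apply: filterS2 n1 n2 => p.
  exact: n3.
have [V [oV V0 cV VN]] := conv_nbhs tube.
pose O w := Q `&` (B `&` (fun z => phi w - phi z) @^-1` V).
have HO w : C w -> open (O w) /\ O w w.
  move=> Cw; split; last first.
    by split; [exact: Cs0|split; [exact: CB|rewrite /= subrr]].
  apply: openI => //; apply: open_pre => // a Ba.
  by apply: cvg_subT; [exact: cvg_cst|exact: cphi].
have [chi [P [C1 H1]]] := bumpy_choice bA HO.
have [|x Cx|s [sC Cs]] := @compact_seq_cover A A C id P kC.
- by move=> w Cw; case: (H1 w Cw) => _ _ [].
- by exists x => //; case: (H1 x Cx) => _ _ [].
have oWB : open (W `&` B) by exact: openI.
have sphi : Csmooth (W `&` B) phi.
  by apply: (smooth_sub _ (sf.2 c ac)) => z [Wz [_ dz]].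
have [|||psi [cpsi spsi Vpsi epsi]] := @blend A E hA hE B (W `&` B) V phi chi P C1 s oB oWB _ cV V0 cphi sphi.
- by move=> z [].
- by move=> w /sC Cw; have [? ? [? _] ? [_ _ _ ?]] := H1 w Cw.
- move=> w z /sC Cw Cz; have [_ _ _ _ [_ _ CO _]] := H1 w Cw.
  by have [_ []] := CO z Cz.
pose D1 := [set z | exists2 w, w \in s & C1 w z].
have cD1 : closed D1.
  by apply: closed_bigU_seq => w /sC Cw; have [_ _ _ _ []] := H1 w Cw.
have D1D : D1 `<=` D.
  move=> z [w /sC Cw Cz]; have [_ _ _ _ [_ _ CO _]] := H1 w Cw.
  by apply: QD; have [] := CO z Cz.
have psiE z : ~ D1 z -> psi z = phi z.
  by move=> nD; apply: epsi => w ws Cz; apply: nD; exists w.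
have Gpsi z : B z -> Good z (psi z).
  move=> Bz; have [Dz|nD] := pselect (D z).
    have -> : psi z = phi z + (psi z - phi z) by rewrite addrC subrK.
    by apply: (VN _ (Vpsi z)).
  rewrite psiE; last by move=> /D1D.
  split; first by apply: chart_funS; case: Bz.
  by rewrite /phi /= chart_funK; [exact: Gf|case: Bz].
(* [psi] differs from [phi] only on the closed set [D1], which lies inside [B]. So [f'] is [f] off
   [D1], and the two branches agree near the frontier of [B]. *)
pose f' z := if `[<B z>] then chart_inv c (psi z) else f z.
have f'B z : B z -> f' z = chart_inv c (psi z) by move=> Bz; rewrite /f' asboolT.
have f'D1 z : ~ D1 z -> f' z = f z.
  move=> nD; rewrite /f'; case: asboolP => // Bz.
  by rewrite psiE// /phi /= chart_funK//; case: Bz.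
have oPs : open [set z | exists2 w, w \in s & P w z].
  by apply: open_bigU_seq => w /sC Cw; case: (H1 w Cw) => _ _ [].
have oD1 : open (~` D1) by exact: closed_openC.
exists f', (W `|` (B `&` [set z | exists2 w, w \in s & P w z])); split.
- move=> z; have [Bz|nB] := pselect (B z).
    apply: (@continuous_near_eq _ _ (chart_inv c \o psi)).
      by apply: continuous_comp; [exact: cpsi|apply: chart_inv_continuous; case: (Gpsi z Bz)].
    by apply: filterS (open_nbhs_nbhs (conj oB Bz)) => x Bx; rewrite f'B.
  have nD : (~` D1) z by move=> /D1D /DB.
  apply: (@continuous_near_eq _ _ f); first exact: cf.
  by apply: filterS (open_nbhs_nbhs (conj oD1 nD)) => x Dx; rewrite f'D1.
- split; first by apply: openU => //; exact: openI.
    by move=> z; left.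
  by move=> z Cz; right; split; [exact: CB|exact: Cs].
- have sB (W1 : set A) : open W1 -> W1 `<=` B -> Csmooth W1 psi -> smooth_into W1 f'.
    move=> oW1 WB sW1; apply: (@smooth_into_eq _ _ _ _ _ (chart_inv c \o psi)) => //.
      by move=> z /WB/f'B.
    apply: (@smooth_into_comp _ _ _ _ hA hE _ (chart_img c)) => //.
    + exact: open_chart_img.
    + by move=> z /WB/Gpsi[].
    + exact: chart_inv_smooth.
  apply: smooth_into_local => z [Wz|[Bz Pz]].
    have [Bz|nB] := pselect (B z).
      exists (W `&` B); split => //; apply: (sB _ oWB); first by move=> y [].
      by apply: smooth_sub spsi => y; left.
    exists (W `&` ~` D1); split; first exact: openI.
      by split => //; move=> /D1D /DB.
    apply: (@smooth_into_eq _ _ _ _ _ f) => //.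
    + exact: openI.
    + by move=> y [_ Dy]; rewrite f'D1.
    + by apply: smooth_into_sub sf => y [].
  exists (B `&` [set z | exists2 w, w \in s & P w z]); split => //; first exact: openI.
  apply: sB; first exact: openI.
    by move=> y [].
  by apply: smooth_sub spsi => y; right.
- by move=> z nN; rewrite f'D1// => /D1D /DB [].
- move=> z; rewrite /f'; case: asboolP => [/Gpsi[]//|_]; exact: Gf.
Qed.

Lemma patch_smoothing A E (hA : hausdorff_space A) (bA : bumpy A) {M : manifoldType E}
    (N : set A) (c : A -> chart E M) (C : A -> set A) (s : seq A) (f : A -> M) (W : set A) :
  (forall w, atlas (c w)) -> continuous f -> open W -> smooth_into W f -> open N ->
  (forall w, w \in s -> [/\ closed (C w), compact (C w), C w `<=` N &
     forall z, C w z -> chart_dom (c w) (f z)]) ->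
  exists f' W', [/\ continuous f', [/\ open W', W `<=` W' & forall w, w \in s -> C w `<=` W'],
     smooth_into W' f' & forall z, ~ N z -> f' z = f z].
Proof.
move=> ac + + + oN; elim: s f W => [|w s IH] f W cf oW sf Hs; first by exists f, W; split => //; split.
(* The patches still to be treated must be sent into their charts by the modified map too. Each
   [C v] is closed and each chart domain open, so this is an open condition on the graph. *)
pose G := [set p : A * M | forall v, v \in s -> C v p.1 -> chart_dom (c v) p.2].
have oG : open G.
  have -> : G = ~` [set p | exists2 v, v \in s & (fst @^-1` C v `&` snd @^-1` (~` chart_dom (c v))) p].
    apply/seteqP; split => p /=.
      by move=> Gp [v vs [Cv nd]]; apply: nd; exact: Gp.
    by move=> nG v vs Cv; apply: contrapT => nd; apply: nG; exists v.
  apply: closed_openC; apply: closed_bigU_seq => v vs.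
  have [|cC _ _ _] := Hs v; first by rewrite inE vs orbT.
  apply: closedI; apply: preimage_closed => //.
  - by move=> p _; exact: cvg_fst.
  - by move=> p _; exact: cvg_snd.
  - by apply: open_closedC; exact: open_chart_dom.
have Gf z : G (z, f z).
  by move=> v vs /= Cv; have [|_ _ _] := Hs v; [rewrite inE vs orbT|apply].
have [cCw kCw CwN Cwf] := Hs w (mem_head _ _).
have [f1 [W1 [cf1 [oW1 WW1 CW1] sf1 e1 G1]]] :=
  chart_smoothing hA bA (ac w) cf oW sf kCw oN CwN Cwf oG Gf.
have [|f2 [W2 [cf2 [oW2 WW2 CW2] sf2 e2]]] := IH f1 W1 cf1 oW1 sf1.
  move=> v vs; have [|cCv kCv CvN _] := Hs v; first by rewrite inE vs orbT.
  by split => // z; exact: (G1 z v vs).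
exists f2, W2; split => //; last by move=> z nN; rewrite e2// e1.
split => //; first by move=> z /WW1/WW2.
by move=> v; rewrite inE => /orP[/eqP ->|/CW2//] z /CW1/WW2.
Qed.

(** Only the compact set [K] needs patches, since [f] is already smooth on [W]. Finitely many
    suffice, each sent by [f] into one chart and contained in [N], which leaves [f] untouched
    outside [N]. *)
Theorem smoothing A E (hA : hausdorff_space A) (bA : bumpy A) {M : manifoldType E}
    (f : A -> M) (W K N : set A) :
  continuous f -> open W -> smooth_into W f -> compact K -> open N -> K `<=` N ->
  W `|` K = setT ->
  exists2 f' : A -> M, smooth_into setT f' & forall z, ~ N z -> f' z = f z.
Proof.
move=> cf oW sf kK oN KN WK.
pose O w := N `&` f @^-1` chart_dom (chart_at (f w) : chart E M).
have HO w : K w -> open (O w) /\ O w w.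
  move=> Kw; split; last by split; [exact: KN|exact: chart_at_dom].
  by apply: open_pre => //; [exact: open_chart_dom|move=> a _; exact: cf].
have [chi [P [C H]]] := bumpy_choice bA HO.
have [|x Kx|s [sK Ks]] := @compact_seq_cover A A K id P kK.
- by move=> w Kw; case: (H w Kw) => _ _ [].
- by exists x => //; case: (H x Kx) => _ _ [].
have [||f' [W' [cf' [oW' WW' CW'] sf' e']]] :=
  @patch_smoothing A E hA bA M N (fun w => chart_at (f w)) C s f W _ cf oW sf oN.
- by move=> w; exact: chart_at_atlas.
- move=> w /sK Kw; have [_ _ _ _ [cC kC CO _]] := H w Kw; split => //.
    by move=> z /CO[].
  by move=> z /CO[].
exists f' => //; apply: smooth_into_sub sf' => z _.
have : (W `|` K) z by rewrite WK.
move=> [/WW'//|/Ks[w ws Pz]]; apply: (CW' w ws).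
have [_ _ _ /(_ z Pz) e1 [_ _ _ e0]] := H w (sK w ws).
apply: contrapT => /e0; rewrite e1 => /eqP; rewrite oner_eq0 //.
Qed.

End smoothing.

(** * Pullbacks of two-forms *)

Section chart_calculus.
Context {R : realType}.
Implicit Types (A B E F H : tvsType R).

Lemma gateaux_comp A E F (hA : hausdorff_space A) (hE : hausdorff_space E)
    (hF : hausdorff_space F) (U : set A) (V : set E) (f : A -> E) (g : E -> F) u v :
  open U -> open V -> Csmooth U f -> Csmooth V g -> U u -> V (f u) ->
  gateaux (fun x => g (f x)) u v = gateaux g (f u) (gateaux f u v).
Proof.
move=> oU oV sf sg Uu Vf.
have [|b||_ //] := @chain R A E F hF f g V u v oV Vf.
- by move=> a b Va; exact: smooth_dquot sg Va.
- by apply: (smooth_cont (smooth_gateaux sg)); split.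
- exact: smooth_dquot sf Uu.
Qed.

Lemma gateaux_pair A E F (hE : hausdorff_space E) (hF : hausdorff_space F) (U : set A)
    (f : A -> E) (g : A -> F) u v : Csmooth U f -> Csmooth U g -> U u ->
  gateaux (fun x => (f x, g x)) u v = (gateaux f u v, gateaux g u v).
Proof.
move=> sf sg Uu.
have L : dquot (fun x => (f x, g x)) u v t @[t --> 0^'] --> (gateaux f u v, gateaux g u v).
  exact: cvg_pair (smooth_dquot sf Uu) (smooth_dquot sg Uu).
exact: (dir_unique (prod_hausdorff hE hF) L).
Qed.

Lemma gateaux_lin A E (hE : hausdorff_space E) (L : A -> E) u v :
  (forall (a : R) x y, L (a *: x + y) = a *: L x + L y) -> gateaux L u v = L v.
Proof.
move=> lL; apply: (dir_unique hE); apply: (cvg_eqnear0 (@cvg_cst0 _ E (L v))).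
near=> t; have t0 : t != 0 by near: t; exact: dnbhs0_neq.
by rewrite /dquot [u + _]addrC lL addrK scalerA mulVf// scale1r.
Unshelve. all: by end_near. Qed.

Context {E : tvsType R} {M : manifoldType E}.
Let hE : hausdorff_space E := @model_hausdorff R E M.

Lemma partial_chart A (hA : hausdorff_space A) (U : set A) (S : A -> M) (c : chart E M) a v :
  open U -> smooth_into U S -> U a -> atlas c -> chart_dom c (S a) ->
  partial S a v = tangent_of c (c (S a)) (gateaux (c \o S) a v).
Proof.
move=> oU [cS sS] Ua ac Sa.
pose c' : chart E M := chart_at (S a); have ac' : atlas c' := chart_at_atlas _.
have Sa' : chart_dom c' (S a) by exact: chart_at_dom.
rewrite /tangent_of chart_funK// /partial -/c'.
pose V := chart_img c `&` chart_inv c @^-1` chart_dom c'.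
have oV : open V.
  by apply: open_pre; [exact: open_chart_img|exact: open_chart_dom|exact: chart_inv_continuous].
have oW : open (U `&` S @^-1` chart_dom c) by apply: open_pre => //; exact: open_chart_dom.
have VS : V ((c \o S) a) by split; rewrite /= ?chart_funK//; exact: chart_funS.
have -> : gateaux (c' \o S) a v = gateaux (fun x => (c' \o chart_inv c) ((c \o S) x)) a v.
  apply: (dir_eq v oW) => // x [Ux Sx] /=; by rewrite chart_funK.
apply: (@gateaux_comp A E E hA hE hE _ V (c \o S) (c' \o chart_inv c) a v oW oV) => //.
- exact: sS.
- exact: atlas_smooth.
Qed.

Context {Omega : M -> E -> E -> R^o} (tO : two_form Omega).

Definition pullback A (S : A -> M) (v w : A) (a : A) : R^o :=
  Omega (S a) (partial S a v) (partial S a w).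

Lemma pullback_chart A (hA : hausdorff_space A) (U : set A) (S : A -> M) (c : chart E M) a v w :
  open U -> smooth_into U S -> U a -> atlas c -> chart_dom c (S a) ->
  pullback S v w a = form_in Omega c (c (S a)) (gateaux (c \o S) a v) (gateaux (c \o S) a w).
Proof.
move=> oU sS Ua ac Sa; rewrite /pullback /form_in chart_funK//.
by rewrite !(partial_chart hA _ oU sS Ua ac Sa).
Qed.

Lemma pullback_smooth A (hA : hausdorff_space A) (U : set A) (S : A -> M) v w :
  open U -> smooth_into U S -> Csmooth U (pullback S v w).
Proof.
move=> oU sS; apply: smooth_local => a Ua.
pose c : chart E M := chart_at (S a); have ac : atlas c := chart_at_atlas _.
have oW : open (U `&` S @^-1` chart_dom c).
  by apply: open_pre => //; [exact: open_chart_dom|case: sS].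
exists (U `&` S @^-1` chart_dom c); split => //; first by split => //; exact: chart_at_dom.
have sc : Csmooth (U `&` S @^-1` chart_dom c) (c \o S) by exact: sS.2.
have hEE := prod_hausdorff hE hE; have hEEE := prod_hausdorff hE hEE.
apply: (@smooth_eq _ _ _ _ (fun x => (fun p : E * (E * E) => form_in Omega c p.1 p.2.1 p.2.2)
   ((c \o S) x, (gateaux (c \o S) x v, gateaux (c \o S) x w)))) => //.
  by move=> x [Ux Sx] /=; rewrite (pullback_chart hA v w oU sS Ux ac Sx).
have [_ _ sO] := tO.
apply: (@smooth_comp _ A _ R^o hA hEEE _ _ _ _ _ oW _ _ _ (sO c ac)) => //.
- by apply: open_setX; [exact: open_chart_img|exact: openT].
- by move=> x [_ Sx]; split => //; exact: chart_funS.
- apply: smooth_pair => //; apply: smooth_pair => //.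
    exact: (smooth_gateaux_at hA hE v oW sc).
  exact: (smooth_gateaux_at hA hE w oW sc).
Qed.

Lemma two_formD x v v' w : Omega x (v + v') w = Omega x v w + Omega x v' w.
Proof. by have [Ol _ _] := tO; rewrite -{1}(scale1r v) Ol scale1r. Qed.

Lemma two_formC x v w : Omega x v w = - Omega x w v.
Proof. by have [_ Oa _] := tO. Qed.

Lemma two_form0 x w : Omega x 0 w = 0.
Proof. by apply: (@addrI _ (Omega x 0 w)); rewrite -two_formD !addr0. Qed.

Lemma two_formZ x (a : R) v w : Omega x (a *: v) w = a *: Omega x v w.
Proof. by have [Ol _ _] := tO; rewrite -{1}(addr0 (a *: v)) Ol two_form0 addr0. Qed.

Lemma two_form_alt x v : Omega x v v = 0.
Proof. by have := two_formC x v v; lra. Qed.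

Lemma tangent_of_lin (c : chart E M) u (a : R) v w : atlas c -> chart_img c u ->
  tangent_of c u (a *: v + w) = a *: tangent_of c u v + tangent_of c u w.
Proof.
move=> ac cu; rewrite /tangent_of; set c' : chart E M := chart_at _.
have ac' : atlas c' := chart_at_atlas _.
have Sa' : chart_dom c' (chart_inv c u) by exact: chart_at_dom.
pose V := chart_img c `&` chart_inv c @^-1` chart_dom c'.
have oV : open V.
  by apply: open_pre; [exact: open_chart_img|exact: open_chart_dom|exact: chart_inv_continuous].
have Vu : V u by split.
have sc := atlas_smooth _ _ ac ac'.
by rewrite (gateauxD hE _ _ oV sc Vu) (gateauxZ hE _ _ sc Vu).
Qed.

Lemma form_in_linl (c : chart E M) u (a : R) v v' w : atlas c -> chart_img c u ->
  form_in Omega c u (a *: v + v') w = a *: form_in Omega c u v w + form_in Omega c u v' w.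
Proof. by move=> ac cu; rewrite /form_in tangent_of_lin// two_formD two_formZ. Qed.

Lemma form_inC (c : chart E M) u v w : form_in Omega c u v w = - form_in Omega c u w v.
Proof. exact: two_formC. Qed.

Lemma form_in_linr (c : chart E M) u (a : R) v w w' : atlas c -> chart_img c u ->
  form_in Omega c u v (a *: w + w') = a *: form_in Omega c u v w + form_in Omega c u v w'.
Proof.
by move=> ac cu; rewrite form_inC form_in_linl// opprD -scalerN -!form_inC.
Qed.

(** Linearity in the last two slots makes the difference quotients in these directions constant,
    equal to the form itself. *)
Lemma gateaux_form_in (c : chart E M) u v w u' v' w' : atlas c -> chart_img c u ->
  gateaux (fun p : E * (E * E) => form_in Omega c p.1 p.2.1 p.2.2) (u, (v, w)) (u', (v', w')) =
  gateaux (fun u => form_in Omega c u v w) u u' + form_in Omega c u v' w + form_in Omega c u v w'.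
Proof.
move=> ac cu; have [_ _ sO] := tO; have {}sO := sO c ac.
set Phi := (fun p : E * (E * E) => _) in sO *.
have oV : open (chart_img c `*` [set: E * E]).
  by apply: open_setX; [exact: open_chart_img|exact: openT].
have Vp : (chart_img c `*` [set: E * E]) (u, (v, w)) by [].
have -> : (u', (v', w')) = (u', (0, 0)) + (0, (v', 0)) + (0, (0, w')) :> E * (E * E).
  by congr (_, (_, _)); rewrite /= ?addr0 ?add0r.
have hR := @scalar_hausdorff R.
have D1 := gateauxD hR ((u', (0, 0)) + (0, (v', 0)) : E * (E * E)) (0, (0, w')) oV sO Vp.
have D2 := gateauxD hR ((u', (0, 0)) : E * (E * E)) (0, (v', 0)) oV sO Vp.
apply: (etrans D1); apply: f_equal2; first (apply: (etrans D2); apply: f_equal2).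
- have e : dquot Phi (u, (v, w)) (u', (0, 0)) = dquot (fun u => form_in Omega c u v w : R^o) u u'.
    by apply/funext => t; rewrite /dquot /Phi /= !scaler0 !addr0.
  by rewrite /gateaux e.
- apply: (dir_unique hR); apply: (cvg_eqnear0 (@cvg_cst0 _ R^o _)); near=> t.
  have t0 : t != 0 by near: t; exact: dnbhs0_neq.
  rewrite /dquot /Phi /= !scaler0 !addr0 [v + _]addrC form_in_linl// addrK scalerA mulVf// scale1r //.
- apply: (dir_unique hR); apply: (cvg_eqnear0 (@cvg_cst0 _ R^o _)); near=> t.
  have t0 : t != 0 by near: t; exact: dnbhs0_neq.
  rewrite /dquot /Phi /= !scaler0 !addr0 [w + _]addrC form_in_linr// addrK scalerA mulVf// scale1r //.
Unshelve. all: by end_near. Qed.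

(** The chain rule in a chart: one term moves the base point of the form, the other two move its
    vectors and involve second derivatives of [f]. *)
Lemma gateaux_pullback A (hA : hausdorff_space A) (U : set A) (S : A -> M) (c : chart E M) a v w z :
  open U -> smooth_into U S -> U a -> atlas c -> chart_dom c (S a) ->
  gateaux (pullback S v w) a z = 
    let f := c \o S in
    gateaux (fun u => form_in Omega c u (gateaux f a v) (gateaux f a w)) (f a) (gateaux f a z)
    + form_in Omega c (f a) (gateaux (fun x => gateaux f x v) a z) (gateaux f a w)
    + form_in Omega c (f a) (gateaux f a v) (gateaux (fun x => gateaux f x w) a z).
Proof.
move=> oU sS Ua ac Sa /=; set f := c \o S.
have oW : open (U `&` S @^-1` chart_dom c).
  by apply: open_pre => //; [exact: open_chart_dom|case: sS].
have sf : Csmooth (U `&` S @^-1` chart_dom c) f by exact: sS.2.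
have Wa : (U `&` S @^-1` chart_dom c) a by [].
have sfv := smooth_gateaux_at hA hE v oW sf.
have sfw := smooth_gateaux_at hA hE w oW sf.
have hEE := prod_hausdorff hE hE; have hEEE := prod_hausdorff hE hEE.
have [_ _ sO] := tO.
have sg : Csmooth (U `&` S @^-1` chart_dom c) (fun x => (f x, (gateaux f x v, gateaux f x w))).
  by apply: smooth_pair => //; exact: smooth_pair.
rewrite -gateaux_form_in//; last exact: chart_funS.
transitivity (gateaux (fun x => (fun p : E * (E * E) => form_in Omega c p.1 p.2.1 p.2.2)
    (f x, (gateaux f x v, gateaux f x w))) a z).
  apply: (dir_eq z oW) => // x [Ux Sx] /=.
  by rewrite (pullback_chart hA v w oU sS Ux ac Sx).
rewrite (@gateaux_comp A _ R^o hA hEEE (@scalar_hausdorff R) _ _ _ _ a z oW _ sg (sO c ac)) //.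
- rewrite (gateaux_pair hE hEE z sf _ Wa); last exact: smooth_pair.
  by rewrite (gateaux_pair hE hE z sfv sfw Wa).
- by apply: open_setX; [exact: open_chart_img|exact: openT].
- by split => //; exact: chart_funS.
Qed.

(** Exterior derivatives commute with pullbacks. The base point terms sum to zero by closedness, and
    the second derivative terms cancel in pairs by [gateaux_sym] and skew-symmetry. *)
Lemma pullback_closed A (hA : hausdorff_space A) (U : set A) (S : A -> M) a e1 e2 e3 :
  closed_form Omega -> open U -> smooth_into U S -> U a ->
  gateaux (pullback S e2 e3) a e1 - gateaux (pullback S e1 e3) a e2
    + gateaux (pullback S e1 e2) a e3 = 0.
Proof.
move=> cO oU sS Ua.
pose c : chart E M := chart_at (S a); have ac : atlas c := chart_at_atlas _.
have Sa : chart_dom c (S a) := chart_at_dom _.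
rewrite !(gateaux_pullback hA _ _ _ oU sS Ua ac Sa) /=.
set f := c \o S.
have oW : open (U `&` S @^-1` chart_dom c).
  by apply: open_pre => //; [exact: open_chart_dom|case: sS].
have sf : Csmooth (U `&` S @^-1` chart_dom c) f by exact: sS.2.
have Wa : (U `&` S @^-1` chart_dom c) a by [].
rewrite (gateaux_sym hE hA e1 e2 oW sf Wa) (gateaux_sym hE hA e1 e3 oW sf Wa)
  (gateaux_sym hE hA e2 e3 oW sf Wa).
have := cO c ac (c (S a)) (chart_funS Sa) (gateaux f a e1) (gateaux f a e2) (gateaux f a e3).
set x12 := gateaux (fun x => gateaux f x e2) a e1.
set x13 := gateaux (fun x => gateaux f x e3) a e1.
set x23 := gateaux (fun x => gateaux f x e3) a e2.
rewrite (form_inC _ _ (gateaux f a e2) x13).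
set t1 := gateaux _ _ (gateaux f a e1); set t2 := gateaux _ _ (gateaux f a e2).
set t3 := gateaux _ _ (gateaux f a e3).
set o1 := form_in _ _ _ x12 _; set o2 := form_in _ _ _ x13 _; set o3 := form_in _ _ _ _ x23.
move=> H; rewrite -[RHS]H; ring.
Qed.

End chart_calculus.

Lemma continuous_pair (S T U : topologicalType) (f : S -> T) (g : S -> U) (x : S) :
  {for x, continuous f} -> {for x, continuous g} -> {for x, continuous (fun x => (f x, g x))}.
Proof. by move=> cf cg; exact: cvg_pair. Qed.

(** * Iterated integrals *)

Section integrals.
Context {R : realType}.
Notation mu := (@lebesgue_measure R).

Definition itg (a b : R) (f : R -> R) : R := \int[mu]_(t in `[a, b]) f t.

Lemma itg_integrable (f : R^o -> R^o) (a b : R) : continuous f ->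
  mu.-integrable `[a, b] (EFin \o f).
Proof.
move=> cf; apply: continuous_compact_integrable; first exact: segment_compact.
exact: continuous_subspaceT.
Qed.

Lemma itg_eq (f g : R -> R) (a b : R) : (forall t, a <= t <= b -> f t = g t) ->
  itg a b f = itg a b g.
Proof.
by move=> fg; apply: eq_Rintegral => t; rewrite inE/= in_itv/= => /fg.
Qed.

Lemma itgD (f g : R^o -> R^o) (a b : R) : continuous f -> continuous g ->
  itg a b (fun t => f t + g t) = itg a b f + itg a b g.
Proof. by move=> cf cg; apply: RintegralD => //; exact: itg_integrable. Qed.

Lemma itgB (f g : R^o -> R^o) (a b : R) : continuous f -> continuous g ->
  itg a b (fun t => f t - g t) = itg a b f - itg a b g.
Proof. by move=> cf cg; apply: RintegralB => //; exact: itg_integrable. Qed.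

Lemma itgZ (f : R^o -> R^o) (a b c : R) : continuous f ->
  itg a b (fun t => c * f t) = c * itg a b f.
Proof. by move=> cf; apply: RintegralZl => //; exact: itg_integrable. Qed.

Lemma itg0 (a b : R) : itg a b (fun=> 0) = 0.
Proof. by rewrite /itg Rintegral_cst//= mul0r. Qed.

Lemma itg_FTC2 (f F : R^o -> R^o) (a b : R) : a <= b -> continuous f ->
  (forall x : R, a <= x <= b -> is_derive x 1 (F : R -> R) (f x)) ->
  itg a b f = F b - F a.
Proof.
rewrite le_eqVlt => /predU1P[<- _ _|ab cf dF].
  by rewrite /itg set_itv1 Rintegral_set1 subrr.
have cF x : a <= x <= b -> {for x, continuous F}.
  by move=> /dF[/derivable1_diffP/differentiable_continuous].
rewrite /itg /Rintegral (@continuous_FTC2 _ f F)//.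
- exact: continuous_subspaceT.
- split.
  + by move=> x; rewrite in_itv/= => /andP[/ltW ax /ltW xb]; case: (dF x); rewrite ?ax.
  + by apply: cvg_at_right_filter; apply: cF; rewrite lexx ltW.
  + by apply: cvg_at_left_filter; apply: cF; rewrite lexx ltW.
- move=> x; rewrite in_itv/= => /andP[/ltW ax /ltW xb].
  by rewrite derive1E; case: (dF x); rewrite ?ax.
Qed.

Lemma antiderivative (f : R^o -> R^o) (a b : R) : continuous f ->
  exists F : R -> R, forall x, a < x < b -> is_derive x 1 F (f x).
Proof.
move=> cf; exists (fun x => itg a x f) => x /andP[ax xb].
have [d e] := @continuous_FTC1_closed R f a x b xb (@itg_integrable f a b cf) ax (cf x).
apply: DeriveDef; first exact: d.
by rewrite -derive1E; exact: e.
Qed.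

(** The proof composes [th] with an antiderivative of [f] on []A, B[], an interval that contains the
    range of [th]. Thus [th] may leave the interval between its end values and need not be
    monotone. *)
Lemma itg_subst (f th dth : R^o -> R^o) (a b A B : R) : a <= b -> th a <= th b ->
  continuous f -> continuous dth -> (forall x : R, is_derive x 1 (th : R -> R) (dth x)) ->
  (forall t, a <= t <= b -> A < th t < B) ->
  itg a b (fun t => f (th t) * dth t) = itg (th a) (th b) f.
Proof.
move=> ab thab cf cdth dt thAB.
have cth : continuous th.
  by move=> x; have [/derivable1_diffP/differentiable_continuous] := dt x.
have [F dF] := antiderivative A B cf.
have Aa : A < th a by have /andP[] := thAB a ltac:(by rewrite lexx).
have bB : th b < B by have /andP[] := thAB b ltac:(by rewrite ab lexx).
have e1 : itg (th a) (th b) f = F (th b) - F (th a).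
  apply: itg_FTC2 => // x /andP[ax xb].
  by apply: dF; rewrite (lt_le_trans Aa ax) (le_lt_trans xb bB).
rewrite e1; apply: (@itg_FTC2 _ (F \o th) a b ab).
- by move=> x; apply: cvgM; [apply: continuous_comp; [exact: cth|exact: cf]|exact: cdth].
- by move=> x xab; apply: is_derive1_comp; exact: dF (thAB x xab).
Qed.

Lemma itg_split (f : R^o -> R^o) (a b c : R) : a <= b -> b <= c -> continuous f ->
  itg a c f = itg a b f + itg b c f.
Proof.
move=> ab bc cf; have ac := le_trans ab bc.
have [F dF] := antiderivative (a - 1) (c + 1) cf.
have H x y : a <= x -> x <= y -> y <= c -> itg x y f = F y - F x.
  move=> ax xy yc; apply: itg_FTC2 => // z /andP[xz zy]; apply: dF.
  by apply/andP; split; lra.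
rewrite (H a c) ?lexx// (H a b) ?lexx// (H b c) ?lexx//; ring.
Qed.

Lemma itg_norm_le (f : R^o -> R^o) (a b M : R) : a <= b -> continuous f ->
  (forall t, a <= t <= b -> `|f t| <= M) -> `|itg a b f| <= M * (b - a).
Proof.
move=> ab cf fM; apply: (@le_trans _ _ (\int[mu]_(t in `[a, b]) `|f t|)).
  by apply: le_normr_Rintegral => //; exact: itg_integrable.
have -> : M * (b - a) = \int[mu]_(t in `[a, b]) M.
  by rewrite Rintegral_cst//= lebesgue_measure_itv/= lte_fin; case: ltgtP ab => // <- _; rewrite subrr.
apply: le_Rintegral => //.
- apply: (@itg_integrable (fun t => `|f t|)) => x.
  by apply: continuous_comp; [exact: cf|exact: norm_continuous].
- by apply: (@itg_integrable (fun=> M)) => x; exact: cvg_cst.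
Qed.

Lemma itg_continuous (P : topologicalType) (f : P -> R^o -> R^o) (a b : R) : a <= b ->
  continuous (fun q : P * R^o => f q.1 q.2) -> continuous (fun p => itg a b (f p) : R^o).
Proof.
move=> ab cf p.
have cfp q : continuous (f q).
  move=> t; have c : {for t, continuous (fun t : R^o => (q, t))}.
    by apply: continuous_pair; [exact: cvg_cst|move=> ?; exact: cvg_id].
  exact: (@continuous_comp _ _ _ (fun t : R^o => (q, t)) (fun q : P * R^o => f q.1 q.2) t c (cf (q, t))).
apply/cvgrPdist_lt => e e0.
(* The summand 1 keeps the denominator positive when [a = b]. *)
pose d := e / (2 * (b - a + 1)).
have ba : 0 < b - a + 1 by lra.
have d0 : 0 < d by rewrite divr_gt0// mulr_gt0.
have Hn : \forall q \near p, `[a, b] `<=` (fun t : R^o => `|f p t - f q t| < d).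
  apply: ((compact_near_coveringP _).1 (@segment_compact R a b) _ (nbhs p)
    (fun (q : P) (t : R^o) => `|f p t - f q t| < d)) => t _.
  have /cvgrPdist_lt/(_ (d / 2) ltac:(by rewrite divr_gt0)) c1 := cf (p, t).
  have /cvgrPdist_lt/(_ (d / 2) ltac:(by rewrite divr_gt0)) c2 := cfp p t.
  have c2' : \forall q \near (t, p), `|f p t - f p q.1| < d / 2.
    by have := @cvg_fst _ _ (nbhs t) (nbhs p) _ _ c2; exact.
  have sw : {for (t, p), continuous (fun q : R^o * P => (q.2, q.1))}.
    by apply: continuous_pair; [exact: cvg_snd|exact: cvg_fst].
  have c1' : \forall q \near (t, p), `|f p t - f q.2 q.1| < d / 2 := sw _ c1.
  have c3 : \forall q \near (t, p), `|f p q.1 - f q.2 q.1| < d.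
    apply: filterS2 c1' c2' => q h1 h2; rewrite (splitr d).
    by apply: le_lt_trans (ler_distD (f p t) _ _) _; rewrite ltrD// distrC.
  exact: c3.
change (\forall q \near p, `|itg a b (f p) - itg a b (f q)| < e).
near=> q.
rewrite -itgB//; apply: (@le_lt_trans _ _ (d * (b - a))).
  apply: itg_norm_le => // [t|t tab].
    by apply: cvgB; exact: cfp.
  apply: ltW; have Hq : `[a, b] `<=` (fun t => `|f p t - f q t| < d) by near: q.
  by apply: Hq; rewrite /= in_itv.
by rewrite /d mulrAC ltr_pdivrMr ?mulr_gt0// ltr_pM2l//; lra.
Unshelve. all: by end_near. Qed.

(** An open set of the plane is the union of the rational boxes it contains, and these are countable
    in number. This links the product topology to the product sigma-algebra. *)
Lemma open_measurable_prod (U : set (R^o * R^o)) : open U ->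
  measurable (U : set (measurableTypeR R * measurableTypeR R)).
Proof.
move=> oU.
pose box (q : (rat * rat) * (rat * rat)) : set (R * R) :=
  `](ratr q.1.1), (ratr q.1.2)[%classic `*` `](ratr q.2.1), (ratr q.2.2)[%classic.
pose S n : set (R * R) := match unpickle n with
  | Some q => if `[<box q `<=` U>] then box q else set0 | None => set0 end.
have -> : U = \bigcup_n S n.
  apply/seteqP; split => [[x y] Uxy|p [n _]]; last first.
    by rewrite /S; case: unpickle => [q|//]; case: asboolP => // h /h.
  have [[U1 U2] /= [[e1 /= e10 H1] [e2 /= e20 H2]] U12] : nbhs (x, y) U by exact: open_nbhs_nbhs.
  have [|a1 a1x] := @rat_in_itvoo R (x - e1) (x); first by rewrite ltrBlDr ltrDl.
  have [|b1 b1x] := @rat_in_itvoo R (x) (x + e1); first by rewrite ltrDl.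
  have [|a2 a2y] := @rat_in_itvoo R (y - e2) (y); first by rewrite ltrBlDr ltrDl.
  have [|b2 b2y] := @rat_in_itvoo R (y) (y + e2); first by rewrite ltrDl.
  rewrite !in_itv/= in a1x b1x a2y b2y.
  have bU : box ((a1, b1), (a2, b2)) `<=` U.
    move=> [u v] [/=]; rewrite !in_itv/= => hu hv; apply: (U12 (u, v)); split => /=.
      by apply: H1; rewrite /= ltr_norml; apply/andP; split; lra.
    by apply: H2; rewrite /= ltr_norml; apply/andP; split; lra.
  exists (pickle ((a1, b1), (a2, b2))); first exact: I.
  rewrite /S pickleK asboolT; last exact: bU.
  move: a1x b1x a2y b2y => /andP[_ ?] /andP[? _] /andP[_ ?] /andP[? _].
  by split; rewrite /= in_itv/=; apply/andP; split.
apply: bigcupT_measurable => n; rewrite /S; case: unpickle => [q|]; last exact: measurable0.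
by case: asboolP => _; [exact: measurableX|exact: measurable0].
Qed.

Lemma continuous_measurable_prod (f : R^o * R^o -> R^o) : continuous f ->
  measurable_fun setT (f : measurableTypeR R * measurableTypeR R -> measurableTypeR R).
Proof.
move=> cf mT; apply: (measurability _ (measurable_realfun.RGenOInfty.measurableE R)) => //.
move=> _ [_ [x ->] <-]; rewrite setTI; apply: open_measurable_prod.
by apply: open_comp; [move=> p _; exact: cf|rewrite set_itvE; exact: open_gt].
Qed.

Lemma continuous_prodl (f : R^o -> R^o -> R^o) x : continuous (fun q : R^o * R^o => f q.1 q.2) ->
  continuous (f x).
Proof.
move=> cf t; have c : {for t, continuous (fun t : R^o => (x, t))}.
  by apply: continuous_pair; [exact: cvg_cst|move=> ?; exact: cvg_id].
exact: (@continuous_comp _ _ _ (fun t : R^o => (x, t)) (fun q : R^o * R^o => f q.1 q.2) t c (cf (x, t))).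
Qed.

Lemma continuous_swap (f : R^o -> R^o -> R^o) : continuous (fun q : R^o * R^o => f q.1 q.2) ->
  continuous (fun q : R^o * R^o => f q.2 q.1).
Proof.
move=> cf [x y]; have c : {for (x, y), continuous (fun q : R^o * R^o => (q.2, q.1))}.
  by apply: continuous_pair; [exact: cvg_snd|exact: cvg_fst].
exact: (@continuous_comp _ _ _ (fun q : R^o * R^o => (q.2, q.1)) (fun q : R^o * R^o => f q.1 q.2) (x, y) c (cf (y, x))).
Qed.

Lemma itg_integrable_prod (f : R^o * R^o -> R^o) (D : set (R * R)) (a b c d : R) :
  continuous f -> measurable (D : set (measurableTypeR R * measurableTypeR R)) ->
  D `<=` `[a, b] `*` `[c, d] -> (mu \x mu)%E.-integrable D (EFin \o f).
Proof.
move=> cf mD Dbox.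
have kB : compact ((`[a, b] `*` `[c, d]) : set (R^o * R^o)).
  by apply: compact_setX; exact: segment_compact.
have /compact_bounded[M [_ HM]] : compact (f @` (`[a, b] `*` `[c, d])).
  by apply: continuous_compact => //; exact: continuous_subspaceT.
apply: measurable_bounded_integrable => //.
- apply: (@le_lt_trans _ _ ((mu \x mu)%E (`[a, b] `*` `[c, d]))).
    by apply: le_measure; rewrite ?inE//; exact: measurableX.
  by rewrite product_measure1E//= !lebesgue_measure_itv/=; do 2 case: ifP => _;
    rewrite ?mul0e ?mule0 ?ltry// -EFinM ltry.
- by apply: measurable_funTS; exact: continuous_measurable_prod.
- exists M; split; first exact: num_real.
  by move=> x Mx p Dp; apply: (HM x Mx); exists p => //; exact: Dbox.
Qed.

Lemma itg_prod (f : R^o * R^o -> R^o) (D : set (R * R)) (a b c d : R) :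
  continuous f -> measurable (D : set (measurableTypeR R * measurableTypeR R)) ->
  D `<=` `[a, b] `*` `[c, d] ->
  \int[(mu \x mu)%E]_(p in D) f p =
    fine (\int[mu]_x \int[mu]_y ((f \_ D) (x, y))%:E)%E /\
  \int[(mu \x mu)%E]_(p in D) f p =
    fine (\int[mu]_y \int[mu]_x ((f \_ D) (x, y))%:E)%E.
Proof.
move=> cf mD Dbox.
have i1 := itg_integrable_prod cf mD Dbox.
have i2 : (mu \x mu)%E.-integrable setT (EFin \o (f \_ D)).
  by rewrite -restrict_EFin; apply/integrable_restrict => //=; rewrite setTI.
rewrite Rintegral_mkcond /Rintegral; split.
  by rewrite -(@integral12_prod_meas1 _ _ _ _ _ mu mu (EFin \o (f \_ D)) i2).
by rewrite -(@integral21_prod_meas1 _ _ _ _ _ mu mu (EFin \o (f \_ D)) i2).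
Qed.

Lemma itg_EFin (g : R^o -> R^o) (S : set R) (l u : R) : continuous g ->
  (forall y, S y <-> l <= y <= u) -> (\int[mu]_y ((g \_ S) y)%:E = (itg l u g)%:E)%E.
Proof.
move=> cg Slu; have -> : S = `[l, u]%classic.
  by apply/seteqP; split => y; rewrite /= in_itv/= => /Slu.
rewrite /itg /Rintegral fineK; last first.
  by apply: integrable_fin_num => //; exact: itg_integrable.
rewrite [RHS]integral_mkcond; apply: eq_integral => y _.
by rewrite restrict_EFin.
Qed.

Lemma itg_slices (f : R^o -> R^o -> R^o) (D : set (R * R)) (a b c d : R) (l u : R -> R) :
  continuous (fun q : R^o * R^o => f q.1 q.2) ->
  measurable (D : set (measurableTypeR R * measurableTypeR R)) ->
  D `<=` `[a, b] `*` `[c, d] ->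
  (forall x y, D (x, y) <-> a <= x <= b /\ l x <= y <= u x) ->
  \int[(mu \x mu)%E]_(p in D) f p.1 p.2 =
  \int[mu]_(x in `[a, b]) itg (l x) (u x) (f x).
Proof.
move=> cf mD Dbox Dlu.
rewrite (itg_prod cf mD Dbox).1 /Rintegral [in RHS]integral_mkcond; congr fine.
apply: eq_integral => x _; rewrite patchE; case: ifPn => [|xab].
  rewrite inE/= in_itv/= => xab; rewrite -(@itg_EFin (f x) [set y | D (x, y)]).
  - by apply: eq_integral => y _; rewrite !patchE.
  - exact: continuous_prodl.
  - by move=> y; rewrite /= Dlu xab; split => [[]|].
rewrite integral0_eq// => y _; rewrite patchE ifF//; apply/negbTE; apply: contra xab.
by rewrite !inE/= in_itv/= => /Dlu[].
Qed.

Lemma itg_swap (f : R^o -> R^o -> R^o) (a b c d : R) :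
  continuous (fun q : R^o * R^o => f q.1 q.2) ->
  itg a b (fun x => itg c d (f x)) = itg c d (fun y => itg a b (fun x => f x y)).
Proof.
move=> cf; pose D : set (R * R) := `[a, b] `*` `[c, d].
have mD : measurable (D : set (measurableTypeR R * measurableTypeR R)) by exact: measurableX.
have [_ e] := @itg_prod (fun q => f q.1 q.2) D a b c d cf mD (fun _ h => h).
have e1 : itg a b (fun x => itg c d (f x)) = \int[(mu \x mu)%E]_(p in D) f p.1 p.2.
  rewrite (@itg_slices f D a b c d (fun=> c) (fun=> d) cf mD)//.
rewrite e1 e /itg /Rintegral [in RHS]integral_mkcond; congr fine.
apply: eq_integral => y _; rewrite patchE; case: ifPn => [|yab].
  rewrite inE/= in_itv/= => ycd; rewrite -/(itg _ _ _) -(@itg_EFin (fun x => f x y) [set x | D (x, y)]).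
  - by apply: eq_integral => x _; rewrite !patchE.
  - exact: (@continuous_prodl (fun y x => f x y) y (continuous_swap cf)).
  - by move=> x; rewrite /D /= !in_itv/= ycd; split => [[]|].
rewrite integral0_eq// => x _; rewrite patchE ifF//; apply/negbTE; apply: contra yab.
by rewrite !inE/= => -[].
Qed.

Lemma itg_cont2 (f : R^o -> R^o -> R^o) (c d : R) : c <= d ->
  continuous (fun q : R^o * R^o => f q.1 q.2) -> continuous (fun x : R^o => itg c d (f x) : R^o).
Proof. exact: itg_continuous. Qed.

End integrals.

(** * The integral over the unit disk in coordinates adapted to vertical chords *)

Section disk_formula.
Context {R : realType}.
Notation mu := (@lebesgue_measure R).

Lemma smooth_is_derive (th : R^o -> R^o) (x : R) : Csmooth setT th ->
  is_derive x 1 (th : R -> R) (gateaux th x 1).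
Proof. by move=> sth; apply: dquot_is_derive; exact: smooth_dquot sth (I : setT x). Qed.

Lemma smooth_gateaux1 (th : R^o -> R^o) : Csmooth setT th ->
  Csmooth setT (fun x => gateaux th x 1).
Proof.
by move=> sth; apply: smooth_gateaux_at => //; exact: openT.
Qed.

Lemma smoothT_continuous (E F : tvsType R) (f : E -> F) : Csmooth setT f -> continuous f.
Proof. by move=> sf x; exact: (smooth_cont sf (I : setT x)). Qed.

Definition dstep (x : R^o) : R^o := gateaux (step : R^o -> R^o) x 1.

Lemma dstep_smooth : Csmooth setT dstep.
Proof. exact: (smooth_gateaux1 step_smooth). Qed.

Lemma is_derive_step (x : R) : is_derive x 1 (step : R -> R) (dstep x).
Proof. exact: (smooth_is_derive x step_smooth). Qed.

Lemma continuous_step : continuous (step : R^o -> R^o).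
Proof. exact: (smoothT_continuous step_smooth). Qed.

Lemma continuous_dstep : continuous dstep.
Proof. exact: (smoothT_continuous dstep_smooth). Qed.

Lemma step_01 (t : R) : 0 <= step t <= 1.
Proof. by rewrite step_ge0 step_le1. Qed.

Lemma itg_symm (g : R^o -> R^o) (w : R) : 0 <= w -> continuous g ->
  itg (- w) w g = itg 0 1 (fun t => g ((2 * step t - 1) * w) * (2 * dstep t * w)).
Proof.
move=> w0 cg; pose th (t : R^o) : R^o := (2 * step t - 1) * w.
have th0 : th 0 = - w by rewrite /th step0 ?mulr0 ?sub0r ?mulN1r//; lra.
have th1 : th 1 = w by rewrite /th step1; [rewrite mulr1 (_ : 2 - 1 = 1) ?mul1r//; lra|lra].
rewrite -{1}th0 -{1}th1; symmetry.
apply: (@itg_subst _ g th (fun t => 2 * dstep t * w) 0 1 (- w - 1) (w + 1)) => //.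
- by rewrite th0 th1; lra.
- move=> x; apply: cvgM; last exact: cvg_cst.
  by apply: cvgM; [exact: cvg_cst|exact: continuous_dstep].
- move=> x; have d := is_derive_step x.
  have d2 : is_derive x 1 (fun t : R => w * (2 * step t - 1)) (w * (2 * dstep x)).
    apply: is_derive_eq.
    by rewrite /GRing.scale/=; ring.
  by rewrite (_ : th = fun t : R => w * (2 * step t - 1)) ?[2 * _ * w]mulrC//; apply/funext => t; rewrite /th mulrC.
- move=> t _; have /andP[s0 s1] := step_01 t; rewrite /th; apply/andP; split; nra.
Qed.

Lemma measurable_unit_disk : measurable (unit_disk : set (measurableTypeR R * measurableTypeR R)).
Proof.
rewrite -[unit_disk]setCK; apply: measurableC; apply: open_measurable_prod.
have -> : ~` unit_disk = [set p : R^o * R^o | 1 < p.1 ^+ 2 + p.2 ^+ 2].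
  by apply/seteqP; split => p /=; rewrite ltNge => /negP.
apply: (@open_comp _ _ (fun p : R^o * R^o => p.1 ^+ 2 + p.2 ^+ 2) [set x | 1 < x]); last exact: open_gt.
move=> p _; apply: cvgD; apply: (@continuous_comp _ _ _ _ (fun x : R^o => x ^+ 2)).
- exact: cvg_fst.
- exact: exprn_continuous.
- exact: cvg_snd.
- exact: exprn_continuous.
Qed.

(** The half-length [w x] of the chord is not differentiable at [x = -1] and [x = 1]. The
    substitution [x = - cos (pi * s)] turns it into [sin (pi * s)], smooth throughout; [step] keeps
    the chord parameter inside the disk for every real [t]. *)
Lemma disk_integral_formula (f : R^o * R^o -> R^o) : continuous f ->
  \int[(mu \x mu)%E]_(p in unit_disk) f p =
  itg 0 1 (fun s => itg 0 1 (fun t =>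
    f (- cos (pi * s), (2 * step t - 1) * sin (pi * s)) * (2 * pi * sin (pi * s) ^+ 2 * dstep t))).
Proof.
move=> cf; pose w (x : R^o) : R^o := Num.sqrt (1 - x ^+ 2).
have cw : continuous w.
  move=> x; apply: (@continuous_comp _ _ _ (fun x : R^o => 1 - x ^+ 2) (fun x : R^o => Num.sqrt x)).
    by apply: cvgB; [exact: cvg_cst|exact: exprn_continuous].
  exact: sqrt_continuous.
have w0 x : 0 <= w x by exact: sqrtr_ge0.
have cf' : continuous (fun q : R^o * R^o => f (q.1, q.2)).
  by rewrite (_ : (fun q => _) = f)//; apply/funext => -[].
have -> : \int[(mu \x mu)%E]_(p in unit_disk) f p =
    \int[(mu \x mu)%E]_(p in unit_disk) f (p.1, p.2).
  by apply: eq_Rintegral => -[].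
rewrite (@itg_slices _ (fun x y => f (x, y)) unit_disk (-1) 1 (-1) 1 (fun x => - w x) w cf'); first last.
- move=> x y; rewrite /unit_disk/=; split.
    move=> xy; have x1 : x ^+ 2 <= 1 by have := sqr_ge0 y; lra.
    have y1 : y ^+ 2 <= 1 - x ^+ 2 by lra.
    rewrite -!ler_norml; split; first by rewrite -[leRHS]normr1 -ler_sqr ?nnegrE// !real_normK ?num_real// expr1n.
    by rewrite -sqrtr_sqr; apply: ler_wsqrtr.
  move=> [x1]; rewrite -ler_norml => yw.
  have x2 : x ^+ 2 <= 1 by rewrite -real_normK ?num_real// expr_le1// ler_norml.
  have : `|y| ^+ 2 <= w x ^+ 2 by rewrite lerXn2r ?nnegrE.
  rewrite real_normK ?num_real// sqr_sqrtr; lra.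
- move=> [x y]; rewrite /unit_disk /= !in_itv/= -!ler_norml => xy.
  by split; rewrite -[leRHS]normr1 -ler_sqr ?nnegrE// !real_normK ?num_real// expr1n;
     [have := sqr_ge0 y|have := sqr_ge0 x]; lra.
- exact: measurable_unit_disk.
pose g (x t : R^o) : R^o := f (x, (2 * step t - 1) * w x) * (2 * dstep t * w x).
have cg : continuous (fun q : R^o * R^o => g q.1 q.2).
  move=> q; have cw1 : {for q, continuous (fun q : R^o * R^o => w q.1)}.
    by apply: (@continuous_comp _ _ _ fst w); [exact: cvg_fst|exact: cw].
  have cs : {for q, continuous (fun q : R^o * R^o => step q.2 : R^o)}.
    by apply: (@continuous_comp _ _ _ snd (step : R^o -> R^o)); [exact: cvg_snd|exact: continuous_step].
  have cds : {for q, continuous (fun q : R^o * R^o => dstep q.2)}.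
    by apply: (@continuous_comp _ _ _ snd dstep); [exact: cvg_snd|exact: continuous_dstep].
  apply: cvgM; last by apply: cvgM => //; apply: cvgM => //; exact: cvg_cst.
  apply: (@continuous_comp _ _ _ (fun q : R^o * R^o => (q.1, (2 * step q.2 - 1) * w q.1) : R^o * R^o) f); last exact: cf.
  apply: continuous_pair; first exact: cvg_fst.
  by apply: cvgM => //; apply: cvgB; [apply: cvgM => //; exact: cvg_cst|exact: cvg_cst].
have E1 x : itg (- w x) (w x) (fun y => f (x, y)) = itg 0 1 (g x).
  by rewrite itg_symm//; exact: (@continuous_prodl _ (fun x y => f (x, y))).
have -> : \int[mu]_(x in `[(-1), 1]) itg (- w x) (w x) (fun y => f (x, y)) = itg (-1) 1 (fun x => itg 0 1 (g x)).
  by apply: eq_Rintegral => x _; exact: E1.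
pose th (s : R^o) : R^o := - cos (pi * s).
have th0 : th 0 = -1 by rewrite /th mulr0 cos0.
have th1 : th 1 = 1 by rewrite /th mulr1 cospi opprK.
have dth (x : R) : is_derive x 1 (th : R -> R) (pi * sin (pi * x)).
  by apply: is_derive_eq; rewrite /GRing.scale/=; ring.
rewrite -[X in itg X _ _]th0 -[X in itg _ X _]th1.
rewrite -(@itg_subst R (fun x => itg 0 1 (g x)) th (fun s => pi * sin (pi * s)) 0 1 (-2) 2 ler01 _ (itg_cont2 ler01 cg) _ dth) //.
- apply: itg_eq => s /andP[s0 s1].
  have sn0 : 0 <= sin (pi * s).
    by apply: sin_ge0_pi; rewrite mulr_ge0 ?pi_ge0//= -[leRHS]mulr1 ler_wpM2l ?pi_ge0.
  rewrite mulrC -itgZ; last exact: continuous_prodl cg.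
  apply: itg_eq => t _; rewrite /g.
  have -> : w (th s) = sin (pi * s).
    by rewrite /w /th sqrrN -sin2cos2 sqrtr_sqr ger0_norm.
  by rewrite /th; ring.
- by rewrite th0 th1; lra.
- move=> s; apply: cvgM; first exact: cvg_cst.
  apply: (@continuous_comp _ _ _ (fun s : R^o => pi * s : R^o) (sin : R^o -> R^o)); last exact: continuous_sin.
  by apply: cvgM; [exact: cvg_cst|exact: cvg_id].
- move=> t _; rewrite /th; have := cos_geN1 (pi * t); have := cos_le1 (pi * t); lra.
Qed.

End disk_formula.

(** * Chain rules for partial derivatives and pullbacks *)

Section partial_theory.
Context {R : realType} {E : tvsType R} {M : manifoldType E}.
Let hE : hausdorff_space E := @model_hausdorff R E M.
Implicit Types (A B : tvsType R).

Lemma partial_eq A (U : set A) (S S' : A -> M) a v : open U -> U a ->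
  (forall x, U x -> S x = S' x) -> partial S a v = partial S' a v.
Proof.
move=> oU Ua e; rewrite /partial e//.
by apply: (dir_eq v oU Ua) => x Ux /=; rewrite e.
Qed.

Lemma partial_cst A a v (x : M) : partial (fun _ : A => x) a v = 0.
Proof.
apply: (dir_unique hE); apply: (cvg_eqnear0 (@cvg_cst0 _ E 0)).
by near=> t; rewrite /dquot subrr scaler0.
Unshelve. all: by end_near. Qed.

Lemma partial_comp A B (hA : hausdorff_space A) (hB : hausdorff_space B) (W : set A) (U : set B)
    (phi : A -> B) (S : B -> M) a v :
  open W -> open U -> Csmooth W phi -> smooth_into U S -> W a -> U (phi a) ->
  partial (fun x => S (phi x)) a v = partial S (phi a) (gateaux phi a v).
Proof.
move=> oW oU sphi [cS sS] Wa Ua; rewrite /partial.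
set c : chart E M := chart_at _; have ac : atlas c := chart_at_atlas _.
have oV : open (U `&` S @^-1` chart_dom c) by apply: open_pre => //; exact: open_chart_dom.
apply: (@gateaux_comp R A B E hA hB hE W _ phi (c \o S) a v oW oV) => //; first exact: sS.
by split => //; exact: chart_at_dom.
Qed.

Lemma partialD A (hA : hausdorff_space A) (U : set A) (S : A -> M) a v w :
  open U -> smooth_into U S -> U a -> partial S a (v + w) = partial S a v + partial S a w.
Proof.
move=> oU [cS sS] Ua; rewrite /partial.
set c : chart E M := chart_at _; have ac : atlas c := chart_at_atlas _.
have oV : open (U `&` S @^-1` chart_dom c) by apply: open_pre => //; exact: open_chart_dom.
apply: (gateauxD hE v w oV (sS c ac)).
by split => //; exact: chart_at_dom.
Qed.

Lemma partialZ A (U : set A) (S : A -> M) a v (r : R) :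
  open U -> smooth_into U S -> U a -> partial S a (r *: v) = r *: partial S a v.
Proof.
move=> oU [cS sS] Ua; rewrite /partial.
set c : chart E M := chart_at _; have ac : atlas c := chart_at_atlas _.
apply: (gateauxZ hE v r (sS c ac)).
by split => //; exact: chart_at_dom.
Qed.

Context {Omega : M -> E -> E -> R^o} (tO : two_form Omega).

Lemma pullback_eq A (U : set A) (S S' : A -> M) v w a : open U -> U a ->
  (forall x, U x -> S x = S' x) -> pullback (Omega := Omega) S v w a = pullback (Omega := Omega) S' v w a.
Proof. by move=> oU Ua e; rewrite /pullback e// !(partial_eq _ oU Ua e). Qed.

Lemma pullback_comp A B (hA : hausdorff_space A) (hB : hausdorff_space B) (W : set A) (U : set B)
    (phi : A -> B) (S : B -> M) v w a :
  open W -> open U -> Csmooth W phi -> smooth_into U S -> W a -> U (phi a) ->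
  pullback (Omega := Omega) (fun x => S (phi x)) v w a =
  pullback (Omega := Omega) S (gateaux phi a v) (gateaux phi a w) (phi a).
Proof.
by move=> oW oU sphi sS Wa Ua; rewrite /pullback !(partial_comp hA hB _ oW oU sphi sS Wa Ua).
Qed.

Lemma two_formDr x v w w' : Omega x v (w + w') = Omega x v w + Omega x v w'.
Proof. by rewrite two_formC// two_formD// opprD -!two_formC. Qed.

Lemma two_formZr x v (a : R) w : Omega x v (a *: w) = a *: Omega x v w.
Proof. by rewrite two_formC// two_formZ// -scalerN -two_formC. Qed.

(** The Jacobian factor of all changes of variables in squares. *)
Lemma pullback_det (U : set (R^o * R^o)) (S : R^o * R^o -> M) (a1 a2 b1 b2 : R) p :
  open U -> smooth_into U S -> U p ->
  pullback (Omega := Omega) S (a1, a2) (b1, b2) p =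
  (a1 * b2 - a2 * b1) * pullback (Omega := Omega) S (1, 0) (0, 1) p.
Proof.
move=> oU sS Up; have hRR := prod_hausdorff (@scalar_hausdorff R) (@scalar_hausdorff R).
have d (x y : R) : partial S p ((x, y) : R^o * R^o) = x *: partial S p (1, 0) + y *: partial S p (0, 1).
  rewrite -!(partialZ _ _ oU sS Up) -(partialD hRR _ _ oU sS Up); congr partial.
  by congr (_, _); rewrite /= /GRing.scale/= ?mulr1 ?mulr0 ?addr0 ?add0r.
rewrite /pullback (d a1 a2) (d b1 b2) two_formD// !two_formDr !two_formZ// !two_formZr !two_form_alt//.
rewrite (two_formC tO (S p) (partial S p (0, 1)) (partial S p (1, 0))).
rewrite /GRing.scale/=; ring.
Qed.

(** Both partial derivatives are multiples of the same vector, the derivative of [g] at [phi a]. *)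
Lemma pullback_rank1 A (hA : hausdorff_space A) (W : set A) (U : set R^o)
    (phi : A -> R^o) (g : R^o -> M) v w a :
  open W -> open U -> Csmooth W phi -> smooth_into U g -> W a -> U (phi a) ->
  pullback (Omega := Omega) (fun x => g (phi x)) v w a = 0.
Proof.
move=> oW oU sphi sg Wa Ua.
rewrite (pullback_comp hA (@scalar_hausdorff R) v w oW oU sphi sg Wa Ua) /pullback.
set x := gateaux phi a v; set y := gateaux phi a w.
rewrite -[x]mulr1 -[y]mulr1 -[x * 1]/(x *: 1) -[y * 1]/(y *: 1).
rewrite !(partialZ _ _ oU sg Ua).
by rewrite two_formZ// two_formZr two_form_alt// !scaler0.
Qed.

End partial_theory.

Section smoothT.
Context {R : realType} {A : tvsType R} (hA : hausdorff_space A).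
Let oT := @openT A.

Lemma smT_cst (c : R^o) : Csmooth setT (fun _ : A => c).
Proof. exact: smooth_cst. Qed.

Lemma smT_add (f g : A -> R^o) : Csmooth setT f -> Csmooth setT g -> Csmooth setT (fun x => f x + g x : R^o).
Proof. by move=> sf sg; apply: smooth_add. Qed.

Lemma smT_opp (f : A -> R^o) : Csmooth setT f -> Csmooth setT (fun x => - f x : R^o).
Proof. by move=> sf; apply: smooth_opp. Qed.

Lemma smT_mul (f g : A -> R^o) : Csmooth setT f -> Csmooth setT g -> Csmooth setT (fun x => f x * g x : R^o).
Proof. by move=> sf sg; apply: smooth_mul. Qed.

Lemma smT_pair (E F : tvsType R) (hE : hausdorff_space E) (hF : hausdorff_space F) (f : A -> E) (g : A -> F) :
  Csmooth setT f -> Csmooth setT g -> Csmooth setT (fun x => (f x, g x)).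
Proof. by move=> sf sg; apply: smooth_pair. Qed.

Lemma smT_comp (E F : tvsType R) (hE : hausdorff_space E) (hF : hausdorff_space F) (g : E -> F) (f : A -> E) :
  Csmooth setT g -> Csmooth setT f -> Csmooth setT (fun x => g (f x)).
Proof. by move=> sg sf; apply: (@smooth_comp R A E F hA hE hF setT setT f g) => //; exact: openT. Qed.

Lemma smT_fst (E F : tvsType R) (hE : hausdorff_space E) (hF : hausdorff_space F) (f : A -> (E * F)%type) :
  Csmooth setT f -> Csmooth setT (fun x => (f x).1).
Proof. by apply: (@smT_comp _ _ (prod_hausdorff hE hF) hE fst); exact: smooth_fst. Qed.

Lemma smT_snd (E F : tvsType R) (hE : hausdorff_space E) (hF : hausdorff_space F) (f : A -> (E * F)%type) :
  Csmooth setT f -> Csmooth setT (fun x => (f x).2).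
Proof. by apply: (@smT_comp _ _ (prod_hausdorff hE hF) hF snd); exact: smooth_snd. Qed.

Lemma smT_step (f : A -> R^o) : Csmooth setT f -> Csmooth setT (fun x => step (f x) : R^o).
Proof. by apply: smT_comp => //; exact: step_smooth. Qed.

Lemma smT_dstep (f : A -> R^o) : Csmooth setT f -> Csmooth setT (fun x => dstep (f x)).
Proof. by apply: smT_comp => //; exact: dstep_smooth. Qed.

Lemma smT_cos (f : A -> R^o) : Csmooth setT f -> Csmooth setT (fun x => cos (f x) : R^o).
Proof. by apply: smT_comp => //; have [] := @cos_sin_smooth R setT. Qed.

Lemma smT_sin (f : A -> R^o) : Csmooth setT f -> Csmooth setT (fun x => sin (f x) : R^o).
Proof. by apply: smT_comp => //; have [] := @cos_sin_smooth R setT. Qed.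

Lemma smT_id : Csmooth setT (fun x : A => x).
Proof. exact: smooth_id. Qed.

End smoothT.

Ltac hausd := repeat first [exact: scalar_hausdorff | apply: prod_hausdorff].
Ltac smT := repeat first [ assumption
  | apply: smT_cst; hausd | apply: smT_id; hausd | apply: smT_pair; hausd | apply: smT_step; hausd
  | apply: smT_dstep; hausd | apply: smT_cos; hausd | apply: smT_sin; hausd
  | apply: smT_add; hausd | apply: smT_opp; hausd | apply: smT_mul; hausd
  | apply: smT_fst; hausd | apply: smT_snd; hausd ].

Lemma itg_subst01 (R : realType) (f th : R^o -> R^o) (a b : R) : a <= b -> continuous f ->
  Csmooth setT th -> (forall t, 0 <= th t <= 1) -> th a = 0 -> th b = 1 ->
  itg a b (fun t => f (th t) * gateaux th t 1) = itg 0 1 f.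
Proof.
move=> ab cf sth r01 tha thb.
have d (x : R) := smooth_is_derive x sth.
have cd : continuous (fun t : R^o => gateaux th t 1).
  by apply: smoothT_continuous; exact: smooth_gateaux1.
have thab : th a <= th b by rewrite tha thb ler01.
have r t : a <= t <= b -> -1 < th t < 2 by move=> _; have /andP[] := r01 t; lra.
have := @itg_subst R f th (fun t => gateaux th t 1) a b (-1) 2 ab thab cf cd d r.
by rewrite tha thb.
Qed.

(** * Areas of squares *)

Section area.
Context {R : realType} {E : tvsType R} {M : manifoldType E}.
Context {Omega : M -> E -> E -> R^o} (tO : two_form Omega).
Let hR := @scalar_hausdorff R.
Let hRR := prod_hausdorff hR hR.
Local Notation R2 := (R^o * R^o)%type.
Local Notation pb := (pullback (Omega := Omega)).
Local Notation dens S := (pb S ((1, 0) : R2) ((0, 1) : R2)).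

Definition area (S : R^o * R^o -> M) : R :=
  itg 0 1 (fun s => itg 0 1 (fun t => dens S (s, t))).

Lemma gateaux_fst (th : R^o -> R^o) (p : R2) (a b : R) : Csmooth setT th ->
  gateaux (fun q : R2 => th q.1) p (a, b) = a * gateaux th p.1 1.
Proof.
move=> sth; have oT := @openT R^o; have oT2 := @openT R2.
have -> : a * gateaux th p.1 1 = gateaux th p.1 (a *: (1 : R^o)).
  by rewrite (gateauxZ hR _ _ sth).
rewrite (@gateaux_comp R R2 R^o R^o hRR hR hR setT setT fst th p (a, b)) //.
  by rewrite (@gateaux_lin R R2 R^o hR fst p (a, b))//; congr (gateaux th _ _); exact: (esym (mulr1 _)).
exact: smooth_fst.
Qed.

Lemma gateaux_snd (th : R^o -> R^o) (p : R2) (a b : R) : Csmooth setT th ->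
  gateaux (fun q : R2 => th q.2) p (a, b) = b * gateaux th p.2 1.
Proof.
move=> sth; have oT := @openT R^o; have oT2 := @openT R2.
have -> : b * gateaux th p.2 1 = gateaux th p.2 (b *: (1 : R^o)).
  by rewrite (gateauxZ hR _ _ sth).
rewrite (@gateaux_comp R R2 R^o R^o hRR hR hR setT setT snd th p (a, b)) //.
  by rewrite (@gateaux_lin R R2 R^o hR snd p (a, b))//; congr (gateaux th _ _); exact: (esym (mulr1 _)).
exact: smooth_snd.
Qed.

Lemma dens_continuous (S : R2 -> M) : smooth_into setT S ->
  continuous (fun q : R2 => dens S (q.1, q.2)).
Proof.
move=> sS; rewrite (_ : (fun q : R2 => _) = dens S); last by apply/funext => -[].
by apply: smoothT_continuous; apply: pullback_smooth => //; exact: openT.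
Qed.

Lemma smooth_into_compT (A B : tvsType R) (hA : hausdorff_space A) (hB : hausdorff_space B)
    (S : B -> M) (U : set B) (phi : A -> B) : open U -> smooth_into U S -> Csmooth setT phi ->
  (forall a, U (phi a)) -> smooth_into setT (fun a => S (phi a)).
Proof.
move=> oU sS sphi Uphi.
apply: (@smooth_into_comp R A B E hA hB M U S setT phi) => //; exact: openT.
Qed.

(** The substitutions act on the two coordinates separately, and the outer interval [[a, b]] is
    arbitrary so that each half of a pasted square is covered. *)
Lemma area_sub (S : R2 -> M) (th1 th2 : R^o -> R^o) (a b : R) : a <= b ->
  smooth_into setT S -> Csmooth setT th1 -> Csmooth setT th2 ->
  (forall t, 0 <= th1 t <= 1) -> (forall t, 0 <= th2 t <= 1) ->
  th1 a = 0 -> th1 b = 1 -> th2 0 = 0 -> th2 1 = 1 ->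
  itg a b (fun s => itg 0 1 (fun t => dens (fun p : R2 => S (th1 p.1, th2 p.2)) (s, t))) = area S.
Proof.
move=> ab sS s1 s2 r1 r2 a1 b1 a2 b2.
have oT := @openT R^o; have oT2 := @openT R2.
have cd := dens_continuous sS.
pose F (x y : R^o) : R^o := dens S (x, y).
have cF : continuous (fun q : R2 => F q.1 q.2) by exact: cd.
have cdth (th : R^o -> R^o) : Csmooth setT th -> continuous (fun t : R^o => gateaux th t 1).
  by move=> sth; apply: smoothT_continuous; exact: smooth_gateaux1.
have E1 s t : dens (fun p : R2 => S (th1 p.1, th2 p.2)) (s, t) =
    gateaux th1 s 1 * (F (th1 s) (th2 t) * gateaux th2 t 1).
  have sphi : Csmooth setT (fun p : R2 => (th1 p.1, th2 p.2)).
    by apply: smooth_pair => //; apply: (@smT_comp _ _ hRR _ _ hR hR) => //; [exact: smooth_fst|exact: smooth_snd].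
  rewrite (pullback_comp hRR hRR _ _ oT2 oT2 sphi sS I I).
  have sf1 : Csmooth setT (fun p : R2 => th1 p.1).
    by apply: (@smT_comp _ _ hRR _ _ hR hR) => //; exact: smooth_fst.
  have sf2 : Csmooth setT (fun p : R2 => th2 p.2).
    by apply: (@smT_comp _ _ hRR _ _ hR hR) => //; exact: smooth_snd.
  rewrite !(gateaux_pair hR hR _ sf1 sf2 I) !(gateaux_fst _ _ _ s1) !(gateaux_snd _ _ _ s2) /=.
  rewrite (pullback_det tO _ _ _ _ oT2 sS I) /F; ring.
have E2 s : itg 0 1 (fun t => dens (fun p : R2 => S (th1 p.1, th2 p.2)) (s, t)) =
    itg 0 1 (F (th1 s)) * gateaux th1 s 1.
  rewrite (itg_eq (g := fun t => gateaux th1 s 1 * (F (th1 s) (th2 t) * gateaux th2 t 1))) //.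
  have cFth : continuous (F (th1 s)) by exact: continuous_prodl.
  rewrite itgZ; last first.
    move=> t; apply: cvgM; last exact: cdth.
    by apply: continuous_comp; [exact: smoothT_continuous|exact: cFth].
  rewrite mulrC; congr (_ * _).
  by rewrite (@itg_subst01 R (F (th1 s)) th2 0 1).
rewrite (itg_eq (g := fun s => itg 0 1 (F (th1 s)) * gateaux th1 s 1)) //.
by rewrite (@itg_subst01 R (fun x => itg 0 1 (F x)) th1 a b)//; exact: itg_cont2.
Qed.

Lemma step_0 : step (0 : R) = 0. Proof. by rewrite step0//; lra. Qed.
Lemma step_1 : step (1 : R) = 1. Proof. by rewrite step1//; lra. Qed.

Lemma area_step (S : R2 -> M) : smooth_into setT S ->
  area (fun p => S (step p.1, step p.2)) = area S.
Proof.
move=> sS; apply: area_sub => //; try exact: step_smooth; try exact: step_01; try exact: step_0; exact: step_1.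
Qed.

(** Inside [step], [2 * p.1] and [2 * p.1 - 1] make the map independent of [p.1] near the seam. The
    [step] on [p.2] brings the second coordinate into [[0, 1]], where alone the two sides are
    assumed to match. *)
Definition paste (S S' : R2 -> M) (p : R2) : M :=
  if p.1 <= 2^-1 then S (step (2 * p.1), step p.2) else S' (step (2 * p.1 - 1), step p.2).

(** The two formulas overlap: [2 * p.1] is at least 3/4 from [p.1 = 3/8] on, and [2 * p.1 - 1] is at
    most 1/4 up to [p.1 = 5/8]. In between both give the common side. *)
Lemma pasteE (S S' : R2 -> M) : (forall t : R, 0 <= t <= 1 -> S (1, t) = S' (0, t)) ->
  (forall p : R2, p.1 < 5 / 8 -> paste S S' p = S (step (2 * p.1), step p.2)) /\
  (forall p : R2, 3 / 8 < p.1 -> paste S S' p = S' (step (2 * p.1 - 1), step p.2)).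
Proof.
move=> SS'; split => -[s t] /= st; rewrite /paste /=; case: leP => // s2.
  rewrite (@step0 R (2 * s - 1)); last by lra.
  by rewrite (@step1 R (2 * s)) ?SS' ?step_01//; lra.
rewrite (@step0 R (2 * s - 1)); last by lra.
by rewrite (@step1 R (2 * s)) ?SS' ?step_01//; lra.
Qed.

Lemma open_lt1 (c : R) : open [set p : R2 | p.1 < c].
Proof.
apply: (@open_comp _ _ (@fst R^o R^o) [set x : R^o | x < c]); first by move=> p _; exact: cvg_fst.
exact: open_lt.
Qed.

Lemma open_gt1 (c : R) : open [set p : R2 | c < p.1].
Proof.
apply: (@open_comp _ _ (@fst R^o R^o) [set x : R^o | c < x]); first by move=> p _; exact: cvg_fst.
exact: open_gt.
Qed.

Lemma paste_smooth (S S' : R2 -> M) : smooth_into setT S -> smooth_into setT S' ->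
  (forall t : R, 0 <= t <= 1 -> S (1, t) = S' (0, t)) -> smooth_into setT (paste S S').
Proof.
move=> sS sS' /pasteE[g1 g2]; apply: smooth_into_local => -[s t] _.
have oT2 := @openT R2.
have [s2|s2] := ltP s (5 / 8).
  exists [set p : R2 | p.1 < 5 / 8]; split; [exact: open_lt1|exact: s2|].
  apply: (@smooth_into_eq _ _ _ _ _ (fun p : R2 => S (step (2 * p.1), step p.2))).
  - exact: open_lt1.
  - by move=> p /g1 ->.
  - apply: (@smooth_into_sub _ _ _ _ setT) => //; apply: (smooth_into_compT hRR hRR oT2 sS) => //.
    by smT.
exists [set p : R2 | 3 / 8 < p.1]; split; [exact: open_gt1|by rewrite /=; lra|].
apply: (@smooth_into_eq _ _ _ _ _ (fun p : R2 => S' (step (2 * p.1 - 1), step p.2))).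
- exact: open_gt1.
- by move=> p /g2 ->.
- apply: (@smooth_into_sub _ _ _ _ setT) => //; apply: (smooth_into_compT hRR hRR oT2 sS') => //.
  by smT.
Qed.

Lemma area_paste (S S' : R2 -> M) : smooth_into setT S -> smooth_into setT S' ->
  (forall t : R, 0 <= t <= 1 -> S (1, t) = S' (0, t)) -> area (paste S S') = area S + area S'.
Proof.
move=> sS sS' e; have [g1 g2] := pasteE e; have sg := paste_smooth sS sS' e.
have h0 : (0 : R) <= 2^-1 by lra.
have h1 : (2^-1 : R) <= 1 by lra.
have cg := @itg_cont2 R (fun x y => dens (paste S S') (x, y)) 0 1 ler01 (dens_continuous sg).
apply: (etrans (itg_split h0 h1 cg)).
have s1 : Csmooth setT (fun s : R^o => step (2 * s) : R^o) by smT.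
have s2 : Csmooth setT (fun s : R^o => step (2 * s - 1) : R^o) by smT.
have b1 : step (2 * 2^-1 : R) = 1 by rewrite divff// step_1.
have b2 : step (2 * 2^-1 - 1 : R) = 0 by rewrite divff// subrr step_0.
have b3 : step (2 * 0 : R) = 0 by rewrite mulr0 step_0.
have b4 : step (2 * 1 - 1 : R) = 1 by rewrite mulr1 step1//; lra.
have E1 := @area_sub S (fun s => step (2 * s)) step 0 2^-1 h0 sS s1 step_smooth
  (fun t => step_01 _) step_01 b3 b1 step_0 step_1.
have E2 := @area_sub S' (fun s => step (2 * s - 1)) step 2^-1 1 h1 sS' s2 step_smooth
  (fun t => step_01 _) step_01 b2 b4 step_0 step_1.
apply: f_equal2; [apply: etrans E1|apply: etrans E2].
  apply: itg_eq => s /andP[s0 s1']; apply: itg_eq => t _.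
  apply: (@pullback_eq _ _ _ _ _ [set p : R2 | p.1 < 5 / 8]); first exact: open_lt1.
    by rewrite /=; lra.
  exact: g1.
apply: itg_eq => s /andP[s0 s1']; apply: itg_eq => t _.
apply: (@pullback_eq _ _ _ _ _ [set p : R2 | 3 / 8 < p.1]); first exact: open_gt1.
  by rewrite /=; lra.
exact: g2.
Qed.

Lemma area_flip (S : R2 -> M) : smooth_into setT S ->
  area (fun p => S (p.2, p.1)) = - area S.
Proof.
move=> sS; have oT2 := @openT R2; have cd := dens_continuous sS.
have E1 s t : dens (fun p : R2 => S (p.2, p.1)) (s, t) = (-1) * dens S (t, s).
  have sphi : Csmooth setT (fun p : R2 => (p.2, p.1)) by smT.
  rewrite (pullback_comp hRR hRR _ _ oT2 oT2 sphi sS I I).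
  rewrite !gateaux_lin//.
  by rewrite (pullback_det tO _ _ _ _ oT2 sS I) /=; ring.
pose F (x y : R^o) : R^o := dens S (x, y).
have cF : continuous (fun q : R2 => F q.1 q.2) by exact: cd.
have cF' : continuous (fun q : R2 => F q.2 q.1) := continuous_swap cF.
have E2 : area (fun p => S (p.2, p.1)) = itg 0 1 (fun s => -1 * itg 0 1 (fun t => F t s)).
  apply: itg_eq => s _; rewrite -itgZ; last exact: (@continuous_prodl _ (fun y x => F x y) s cF').
  by apply: itg_eq => t _; exact: E1.
rewrite E2 itgZ; last exact: (@itg_cont2 R (fun y x => F x y) 0 1 ler01 cF').
by rewrite mulN1r -(@itg_swap R F 0 1 0 1 cF).
Qed.

Lemma area_rank1 (U : set R^o) (g : R^o -> M) (phi : R2 -> R^o) : open U -> smooth_into U g ->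
  Csmooth setT phi -> (forall p, U (phi p)) -> area (fun p => g (phi p)) = 0.
Proof.
move=> oU sg sphi Up; rewrite /area -[RHS](itg0 0 1); apply: itg_eq => s _.
rewrite -[RHS](itg0 0 1); apply: itg_eq => t _.
exact: (pullback_rank1 tO hRR _ _ (@openT R2) oU sphi sg I (Up _)).
Qed.

Lemma area_cst (x : M) : area (fun=> x) = 0.
Proof.
apply: (@area_rank1 setT (fun=> x) (fun=> 0)) => //; first exact: openT.
  exact: smooth_into_cst.
by smT.
Qed.

End area.

(** * Fillings and Stokes' theorem *)

Section stokes.
Context {R : realType} {E : tvsType R} {M : manifoldType E}.
Context {Omega : M -> E -> E -> R^o} (tO : two_form Omega) (cO : closed_form Omega).
Let hR := @scalar_hausdorff R.
Let hRR := prod_hausdorff hR hR.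
Let hRRR := prod_hausdorff hR hRR.
Local Notation R2 := (R^o * R^o)%type.
Local Notation R3 := (R^o * (R^o * R^o))%type.
Local Notation pb := (pullback (Omega := Omega)).
Local Notation er := ((1, (0, 0)) : R3).
Local Notation es := ((0, (1, 0)) : R3).
Local Notation et := ((0, (0, 1)) : R3).

Lemma gateaux_cst (A F : tvsType R) (hF : hausdorff_space F) (c : F) (u v : A) : gateaux (fun=> c) u v = 0.
Proof.
apply: (dir_unique hF); apply: (cvg_eqnear0 (@cvg_cst0 _ F 0)).
by near=> t; rewrite /dquot subrr scaler0.
Unshelve. all: by end_near. Qed.

Lemma gateaux_id (A : tvsType R) (hA : hausdorff_space A) (u v : A) : gateaux (fun x => x) u v = v.
Proof. exact: gateaux_lin. Qed.

Lemma line_derive (A : tvsType R) (hA : hausdorff_space A) (h : A -> R^o) (l : R^o -> A) (s : R) (v : A) :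
  Csmooth setT h -> Csmooth setT l -> gateaux l s 1 = v ->
  is_derive s 1 ((fun s => h (l s)) : R -> R) (gateaux h (l s) v).
Proof.
move=> sh sl lv; have oT := @openT R^o; have oTA := @openT A.
rewrite -lv -(@gateaux_comp R R^o A R^o hR hA hR setT setT l h s 1 oT oTA sl sh I I).
by apply: smooth_is_derive; apply: (@smT_comp _ _ hR _ _ hA hR).
Qed.

(** Closedness says that the [r]-derivative of [g] is the [s]-derivative of [h1] minus the
    [t]-derivative of [h2]. After exchanging integrals, the last two integrate to values of [h1] and
    [h2] on side faces. These contain the [r]-derivative of [T], which is zero there. *)
Lemma stokes_cube (T : R3 -> M) : smooth_into setT T ->
  (forall r s t : R, s = 0 \/ s = 1 \/ t = 0 \/ t = 1 -> partial T (r, (s, t)) er = 0) ->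
  area (Omega := Omega) (fun p => T (0, p)) = area (Omega := Omega) (fun p => T (1, p)).
Proof.
move=> sT bT; have oT3 := @openT R3; have oT2 := @openT R2.
pose g := pb T es et; pose h1 := pb T er et; pose h2 := pb T er es.
have sg : Csmooth setT g by exact: pullback_smooth.
have sh1 : Csmooth setT h1 by exact: pullback_smooth.
have sh2 : Csmooth setT h2 by exact: pullback_smooth.
pose dg (z : R3) : R^o := gateaux g z er.
pose d1 (z : R3) : R^o := gateaux h1 z es.
pose d2 (z : R3) : R^o := gateaux h2 z et.
have cdg : continuous dg by apply: smoothT_continuous; exact: smooth_gateaux_at.
have cd1 : continuous d1 by apply: smoothT_continuous; exact: smooth_gateaux_at.
have cd2 : continuous d2 by apply: smoothT_continuous; exact: smooth_gateaux_at.
have dgE z : dg z = d1 z - d2 z.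
  have H : dg z - d1 z + d2 z = 0 := pullback_closed tO hRRR er es et cO oT3 sT (I : setT z).
  by rewrite -[LHS]subr0 -H; ring.
have dens r s t : pb (fun p : R2 => T (r, p)) ((1, 0) : R2) ((0, 1) : R2) (s, t) = g (r, (s, t)).
  have sphi : Csmooth setT (fun p : R2 => (r, p) : R3) by apply: smT_pair => //; [exact: smT_cst|exact: smT_id].
  have gphi (v : R2) : gateaux (fun p : R2 => (r, p) : R3) (s, t) v = (0, v).
    rewrite (@gateaux_pair R R2 R^o R2 hR hRR setT (fun=> r) id) ?gateaux_cst ?gateaux_id//.
      exact: smooth_cst.
    exact: smooth_id.
  by rewrite (@pullback_comp R E M Omega R2 R3 hRR hRRR setT setT (fun p : R2 => (r, p)) T _ _ (s, t) oT2 oT3 sphi sT I I) !gphi.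
have cont (f : R3 -> R^o) (P : topologicalType) (l : P -> R3) : continuous f -> continuous l ->
  continuous (fun x => f (l x)) by move=> cf cl x; apply: continuous_comp; [exact: cl|exact: cf].
have cs (f : R3 -> R^o) : continuous f ->
    continuous (fun q : R2 => itg 0 1 (fun r => f (r, (q.1, q.2))) : R^o).
  move=> cf; apply: (@itg_continuous R R2 (fun q r => f (r, (q.1, q.2))) 0 1 ler01).
  apply: (cont f (R2 * R^o)%type (fun q => (q.2, (q.1.1, q.1.2))) cf).
  by apply: smoothT_continuous; smT.
have sl1 r t : Csmooth setT (fun s : R^o => (r, (s, t)) : R3) by smT.
have sl2 r s : Csmooth setT (fun t : R^o => (r, (s, t)) : R3) by smT.
have sl0 s t : Csmooth setT (fun r : R^o => (r, (s, t)) : R3) by smT.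
have gl1 r t s : gateaux (fun s : R^o => (r, (s, t)) : R3) s 1 = es.
  rewrite (@gateaux_pair R R^o R^o R2 hR hRR setT (fun=> r) (fun s => (s, t))) ?gateaux_cst//; [|exact: smooth_cst|by smT].
  by rewrite (@gateaux_pair R R^o R^o R^o hR hR setT id (fun=> t)) ?gateaux_cst ?gateaux_id//; smT.
have gl2 r s t : gateaux (fun t : R^o => (r, (s, t)) : R3) t 1 = et.
  rewrite (@gateaux_pair R R^o R^o R2 hR hRR setT (fun=> r) (fun t => (s, t))) ?gateaux_cst//; [|exact: smooth_cst|by smT].
  by rewrite (@gateaux_pair R R^o R^o R^o hR hR setT (fun=> s) id) ?gateaux_cst ?gateaux_id//; smT.
have gl0 s t r : gateaux (fun r : R^o => (r, (s, t)) : R3) r 1 = er.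
  by rewrite (@gateaux_pair R R^o R^o R2 hR hRR setT id (fun=> (s, t))) ?gateaux_cst ?gateaux_id//; smT.
have h1b r s t : s = 0 \/ s = 1 -> h1 (r, (s, t)) = 0.
  by move=> hs; rewrite /h1 /pullback bT ?two_form0//; case: hs; auto.
have h2b r s t : t = 0 \/ t = 1 -> h2 (r, (s, t)) = 0.
  by move=> ht; rewrite /h2 /pullback bT ?two_form0//; case: ht; auto.
have I1 r t : itg 0 1 (fun s => d1 (r, (s, t))) = 0.
  have := @itg_FTC2 R (fun s => d1 (r, (s, t))) (fun s => h1 (r, (s, t))) 0 1 ler01.
  rewrite !h1b; [|by auto|by auto]; rewrite subrr; apply.
    exact: (cont d1 _ _ cd1 (smoothT_continuous (sl1 r t))).
  by move=> s _; exact: (@line_derive R3 hRRR h1 (fun s => (r, (s, t))) s es sh1 (sl1 r t) (gl1 r t s)).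
have I2 r s : itg 0 1 (fun t => d2 (r, (s, t))) = 0.
  have := @itg_FTC2 R (fun t => d2 (r, (s, t))) (fun t => h2 (r, (s, t))) 0 1 ler01.
  rewrite !h2b; [|by auto|by auto]; rewrite subrr; apply.
    exact: (cont d2 _ _ cd2 (smoothT_continuous (sl2 r s))).
  by move=> t _; exact: (@line_derive R3 hRRR h2 (fun t => (r, (s, t))) t et sh2 (sl2 r s) (gl2 r s t)).
have I0 s t : itg 0 1 (fun r => dg (r, (s, t))) = g (1, (s, t)) - g (0, (s, t)).
  apply: (@itg_FTC2 R (fun r => dg (r, (s, t))) (fun r => g (r, (s, t))) 0 1 ler01).
    exact: (cont dg _ _ cdg (smoothT_continuous (sl0 s t))).
  by move=> r _; exact: (@line_derive R3 hRRR g (fun r => (r, (s, t))) r er sg (sl0 s t) (gl0 s t r)).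
have J1 : itg 0 1 (fun s => itg 0 1 (fun t => itg 0 1 (fun r => d1 (r, (s, t))))) = 0.
  rewrite (@itg_swap R (fun s t => itg 0 1 (fun r => d1 (r, (s, t)))) 0 1 0 1).
    rewrite -[RHS](itg0 0 1); apply: itg_eq => t _.
    rewrite (@itg_swap R (fun s r => d1 (r, (s, t))) 0 1 0 1).
      by rewrite -[RHS](itg0 0 1); apply: itg_eq => r _; exact: I1.
    apply: (cont d1 R2 (fun q => (q.2, (q.1, t))) cd1).
    by apply: smoothT_continuous; smT.
  exact: (cs d1 cd1).
have J2 : itg 0 1 (fun s => itg 0 1 (fun t => itg 0 1 (fun r => d2 (r, (s, t))))) = 0.
  rewrite -[RHS](itg0 0 1); apply: itg_eq => s _.
  rewrite (@itg_swap R (fun t r => d2 (r, (s, t))) 0 1 0 1).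
    by rewrite -[RHS](itg0 0 1); apply: itg_eq => r _; exact: I2.
  apply: (cont d2 R2 (fun q => (q.2, (s, q.1))) cd2).
  by apply: smoothT_continuous; smT.
have cg r : continuous (fun q : R2 => g (r, (q.1, q.2))).
  apply: (cont g R2 (fun q => (r, (q.1, q.2))) (smoothT_continuous sg)).
  by apply: smoothT_continuous; smT.
have cgs r s : continuous (fun t : R^o => g (r, (s, t)) : R^o).
  exact: (@continuous_prodl R (fun s t => g (r, (s, t))) s (cg r)).
have A r : area (Omega := Omega) (fun p => T (r, p)) = itg 0 1 (fun s => itg 0 1 (fun t => g (r, (s, t)))).
  by apply: itg_eq => s _; apply: itg_eq => t _; exact: dens.
apply/esym/eqP; rewrite -subr_eq0 !A; apply/eqP.
have cgi r : continuous (fun s : R^o => itg 0 1 (fun t => g (r, (s, t))) : R^o).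
  exact: (@itg_cont2 R (fun s t => g (r, (s, t))) 0 1 ler01 (cg r)).
rewrite -itgB//.
have cd q : continuous (fun t : R^o => itg 0 1 (fun r => d1 (r, (q, t))) : R^o).
  apply: (@continuous_prodl R (fun s t => itg 0 1 (fun r => d1 (r, (s, t)))) q).
  exact: (cs d1 cd1).
have cd' q : continuous (fun t : R^o => itg 0 1 (fun r => d2 (r, (q, t))) : R^o).
  apply: (@continuous_prodl R (fun s t => itg 0 1 (fun r => d2 (r, (s, t)))) q).
  exact: (cs d2 cd2).
transitivity (itg 0 1 (fun s => itg 0 1 (fun t => itg 0 1 (fun r => d1 (r, (s, t)))) -
   itg 0 1 (fun t => itg 0 1 (fun r => d2 (r, (s, t)))))).
  apply: itg_eq => s _.
  rewrite -(@itgB R (fun t => g (1, (s, t))) (fun t => g (0, (s, t))) 0 1 (cgs 1 s) (cgs 0 s)).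
  rewrite -(@itgB R _ _ 0 1 (cd s) (cd' s)); apply: itg_eq => t _; rewrite -I0.
  have c1 := cont d1 _ _ cd1 (smoothT_continuous (sl0 s t)).
  have c2 := cont d2 _ _ cd2 (smoothT_continuous (sl0 s t)).
  by rewrite -(@itgB R _ _ 0 1 c1 c2); apply: itg_eq => r _; rewrite dgE.
have cD1 := @itg_cont2 R (fun s t => itg 0 1 (fun r => d1 (r, (s, t)))) 0 1 ler01 (cs d1 cd1).
have cD2 := @itg_cont2 R (fun s t => itg 0 1 (fun r => d2 (r, (s, t)))) 0 1 ler01 (cs d2 cd2).
apply: (etrans (@itgB R _ _ 0 1 cD1 cD2)).
apply: (etrans (f_equal2 (fun x y => x - y) J1 J2)).
exact: subrr.
Qed.

End stokes.

(** * Null-homotopies and fillings of loops *)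

Section homotopy_filling.
Context {R : realType}.
Let hR := @scalar_hausdorff R.
Let hRR := prod_hausdorff hR hR.
Local Notation R2 := (R^o * R^o)%type.

Lemma continuous_row (T : topologicalType) (n : nat) (f : 'I_n -> T -> R) :
  (forall j, continuous (f j : T -> R^o)) ->
  continuous (fun x => \row_j f j x : 'rV[R]_n).
Proof.
move=> cf x A /= [P Px PA].
have H : \forall y \near x, forall j, P ord0 j (f j y).
  apply: filter_forall => j; have := Px ord0 j; rewrite mxE => nP.
  exact: cf j x _ nP.
change (nbhs x (fun y => A (\row_j f j y))).
by apply: filterS H => y Hy; apply: PA => i j; rewrite mxE ord1.
Qed.

Lemma open_ltf (T : topologicalType) (f : T -> R^o) (c : R) : continuous f -> open [set x | f x < c].
Proof.
by move=> cf; apply: (@open_comp _ _ f [set y : R^o | y < c]) => //; exact: open_lt.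
Qed.

Lemma open_gtf (T : topologicalType) (f : T -> R^o) (c : R) : continuous f -> open [set x | c < f x].
Proof.
by move=> cf; apply: (@open_comp _ _ f [set y : R^o | c < y]) => //; exact: open_gt.
Qed.

Definition unitv (T : Type) (f : T -> R) := forall x, 0 <= f x <= 1.

Lemma continuous_homotopy (T M : topologicalType) (n : nat) (H : R^o * 'rV[R]_n -> M)
    (a : T -> R^o) (b : 'I_n -> T -> R) :
  {within `[0, 1] `*` @cube R n, continuous H} ->
  continuous a -> (forall j, continuous (b j : T -> R^o)) ->
  unitv a -> (forall j, unitv (b j)) ->
  continuous (fun x => H (a x, \row_j b j x)).
Proof.
move=> cH ca cb ua ub.
have C : {within setT, continuous (H \o (fun x => (a x, \row_j b j x)))}.
  apply: within_comp cH => x _.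
    apply: continuous_pair; first exact: ca.
    exact: (@continuous_row T n b).
  split; first by rewrite /= in_itv/= ua.
  by move=> i; rewrite mxE ub.
by move=> x; have /subspace_continuousP/(_ x I) := C; rewrite withinET.
Qed.

Context {M : topologicalType}.

Lemma null_homotopy1 (l : R^o -> M) (x0 : M) : @trivial_pi R 1 M -> continuous l ->
  l 0 = x0 -> l 1 = x0 ->
  exists H : R^o -> R^o -> M, [/\ forall (T : topologicalType) (a b : T -> R^o), continuous a ->
    continuous b -> unitv a -> unitv b -> continuous (fun x => H (a x) (b x)),
    forall u, 0 <= u <= 1 -> H 0 u = l u /\ H 1 u = x0
    & forall r, 0 <= r <= 1 -> H r 0 = x0 /\ H r 1 = x0].
Proof.
move=> pi cl l0 l1.
have [||H [cH H01 Hb]] := pi x0 (fun p : 'rV[R]_1 => l (p ord0 ord0)).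
- apply: continuous_subspaceT => p; apply: (@continuous_comp _ _ _ (fun p : 'rV[R]_1 => p ord0 ord0 : R^o) l); last exact: cl.
  exact: coord_continuous.
- move=> p [_ [i pi01]]; have e : i = ord0 by rewrite ord1.
  by move: pi01; rewrite e => -[->|->].
exists (fun r u => H (r, \row_(j < 1) u)); split.
- move=> T a b ca cb ua ub.
  exact: (@continuous_homotopy T M 1 H a (fun=> b)).
- move=> u u01; have [|e0 e1] := H01 (\row_(j < 1) u); first by move=> i; rewrite mxE.
  by rewrite e0 e1 mxE.
- move=> r r01; split; apply: Hb => //; split=> [i|]; rewrite ?mxE ?lexx ?ler01//.
    by exists ord0; rewrite mxE; left.
  by exists ord0; rewrite mxE; right.
Qed.

Definition tuple2 {T : Type} (a b : T) (j : 'I_2) : T := if j == ord0 then a else b.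

Lemma null_homotopy2 (S : R2 -> M) (x0 : M) : @trivial_pi R 2 M -> continuous S ->
  (forall s t : R, 0 <= s <= 1 -> 0 <= t <= 1 -> s = 0 \/ s = 1 \/ t = 0 \/ t = 1 -> S (s, t) = x0) ->
  exists H : R^o -> R^o -> R^o -> M, [/\ forall (T : topologicalType) (a b c : T -> R^o), continuous a ->
    continuous b -> continuous c -> unitv a -> unitv b -> unitv c -> continuous (fun x => H (a x) (b x) (c x)),
    forall s t, 0 <= s <= 1 -> 0 <= t <= 1 -> H 0 s t = S (s, t) /\ H 1 s t = x0
    & forall r s t, 0 <= r <= 1 -> 0 <= s <= 1 -> 0 <= t <= 1 -> s = 0 \/ s = 1 \/ t = 0 \/ t = 1 -> H r s t = x0].
Proof.
move=> pi cS Sb.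
have [||H [cH H01 Hb]] := pi x0 (fun p : 'rV[R]_2 => S (p ord0 ord0, p ord0 ord_max)).
- apply: continuous_subspaceT => p.
  apply: (@continuous_comp _ _ _ (fun p : 'rV[R]_2 => (p ord0 ord0, p ord0 ord_max) : R2) S); last exact: cS.
  by apply: continuous_pair; exact: coord_continuous.
- move=> p [pc [i pi01]]; apply: Sb; [exact: pc|exact: pc|].
  have : i = ord0 \/ i = ord_max.
    by case: i pi01 => [[|[|//]] ?] _; [left|right]; apply/val_inj.
  by move=> [] e; rewrite e in pi01; case: pi01; auto.
have row01 s t : (\row_j tuple2 s t j : 'rV[R]_2) ord0 ord0 = s /\ (\row_j tuple2 s t j : 'rV[R]_2) ord0 ord_max = t.
  by rewrite !mxE.
exists (fun r s t => H (r, \row_j tuple2 s t j)); split.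
- move=> T a b c ca cb cc ua ub uc.
  have := @continuous_homotopy T M 2 H a (tuple2 b c) cH ca.
  rewrite (_ : (fun x => _) = (fun x => H (a x, \row_j tuple2 (b x) (c x) j))).
    by apply => // j; rewrite /tuple2; case: ifP.
  by apply/funext => x; congr (H (_, _)); apply/rowP => j; rewrite !mxE /tuple2; case: ifP.
- move=> s t s01 t01; have [r0 r1] := row01 s t.
  have [|-> ->] := H01 (\row_j tuple2 s t j); last by rewrite r0 r1.
  by move=> i; rewrite mxE /tuple2; case: ifP.
- move=> r s t r01 s01 t01 st; apply: Hb => //; split.
    by move=> i; rewrite mxE /tuple2; case: ifP.
  have [r0 r1] := row01 s t.
  by case: st => [e|[e|[e|e]]]; [exists ord0; left|exists ord0; right|exists ord_max; left|exists ord_max; right]; rewrite ?r0 ?r1.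
Qed.

End homotopy_filling.

Section fillings.
Context {R : realType} {E : tvsType R} {M : manifoldType E}.
Let hR := @scalar_hausdorff R.
Let hRR := prod_hausdorff hR hR.
Local Notation R2 := (R^o * R^o)%type.

Lemma smooth_into_cont (A : tvsType R) (S : A -> M) : smooth_into setT S -> continuous S.
Proof. by move=> [cS _] x; exact: cS. Qed.

Lemma smooth_on_open (A : tvsType R) (U : set A) (f g : A -> M) (z : A) :
  open U -> U z -> smooth_into setT g -> (forall x, U x -> f x = g x) ->
  exists W, [/\ open W, W z & smooth_into W f].
Proof.
move=> oU Uz sg e; exists U; split => //; apply: (@smooth_into_eq _ _ _ _ _ g) => //.
  by move=> x /e.
by apply: smooth_into_sub sg.
Qed.

(** The null-homotopy of [l] read from the constant loop to [l], made smooth. The margins on which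
    [l] is constant provide collars that the smoothing does not touch, which keeps the sides
    exact. *)
Lemma loop_square (l : R^o -> M) (x0 : M) : @trivial_pi R 1 M -> smooth_into setT l ->
  (forall u, u <= 1 / 12 \/ 11 / 12 <= u -> l u = x0) ->
  exists S : R2 -> M, [/\ smooth_into setT S,
    forall s u, s <= 1 / 8 \/ u <= 1 / 24 \/ 23 / 24 <= u -> S (s, u) = x0
    & forall s u, 7 / 8 <= s -> S (s, u) = l u].
Proof.
move=> pi sl lx.
(* The affine map sends [[0, 1]] onto [[1/12, 11/12]], outside which [l] is constant. The homotopy
   of this shorter loop then extends continuously by [x0]. *)
have sl1 : smooth_into setT (fun v : R^o => l (1 / 12 + v * (5 / 6))).
  by apply: (smooth_into_compT hR hR (@openT _) sl) => //; smT.
have [||H [cH H01 Hb]] := null_homotopy1 (x0 := x0) pi (smooth_into_cont sl1).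
- by rewrite lx//; left; lra.
- by rewrite lx//; right; lra.
(* A clamp and not [step]: it is the identity on [[0, 1]], so the right side is [l] itself and not a
   reparametrization. Its corners do no harm, since [S0] is smoothed for the middle values of [s]
   and is [x0] or [l u] for the others. *)
pose cl (x : R^o) : R^o := (`|x| - `|x - 1| + 1) / 2.
have ccl : continuous cl.
  move=> x; apply: cvgM; last exact: cvg_cst.
  apply: cvgD; last exact: cvg_cst.
  apply: cvgB; first exact: norm_continuous.
  apply: (@continuous_comp _ _ _ (fun x : R^o => x - 1) (fun x : R^o => `|x| : R^o)); last exact: norm_continuous.
  by apply: cvgB; [exact: cvg_id|exact: cvg_cst].
have cl0 x : x <= 0 -> cl x = 0.
  by move=> x0'; rewrite /cl !ler0_norm//; lra.
have cl1 x : 1 <= x -> cl x = 1.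
  by move=> x1; rewrite /cl !ger0_norm//; lra.
have clx x : 0 <= x <= 1 -> cl x = x.
  by move=> /andP[? ?]; rewrite /cl ger0_norm// ler0_norm; lra.
have clu x : 0 <= cl x <= 1.
  have [h|h] := leP x 0; first by rewrite cl0// lexx ler01.
  have [h'|h'] := leP 1 x; first by rewrite cl1// lexx ler01.
  by rewrite clx; lra.
pose a (u : R^o) : R^o := cl ((u - 1 / 12) * (6 / 5)).
pose S0 (p : R2) : M := H (1 - step p.1) (a p.2).
have cS0 : continuous S0.
  apply: cH.
  - by apply: smoothT_continuous; smT.
  - move=> p; apply: (@continuous_comp _ _ _ (fun p : R2 => (p.2 - 1 / 12) * (6 / 5) : R^o) cl); last exact: ccl.
    by move: p; apply: smoothT_continuous; smT.
  - by move=> p; have := step_ge0 p.1; have := step_le1 p.1; lra.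
  - by move=> p; exact: clu.
have S0s0 s u : s <= 1 / 4 -> S0 (s, u) = x0.
  by move=> s4; rewrite /S0 /= step0 ?subr0; [have [] := H01 _ (clu ((u - 1 / 12) * (6 / 5)))|lra].
have S0u s u : u <= 1 / 12 \/ 11 / 12 <= u -> S0 (s, u) = x0.
  have s01 : 0 <= 1 - step s <= 1 by have := step_ge0 s; have := step_le1 s; lra.
  have [h0 h1] := Hb _ s01.
  by rewrite /S0 /a /= => -[h|h]; [rewrite cl0//; lra|rewrite cl1//; lra].
have S0s1 s u : 3 / 4 <= s -> S0 (s, u) = l u.
  move=> s4; have [h|h] := leP u (1 / 12); first by rewrite S0u ?lx//; left.
  have [h'|h'] := leP (11 / 12) u; first by rewrite S0u ?lx//; right.
  rewrite /S0 /= step1 ?subrr//; have [-> _] := H01 _ (clu ((u - 1 / 12) * (6 / 5))).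
  by congr l; rewrite clx; lra.
have c1 : continuous (fun p : R2 => p.1 : R^o) by move=> p; exact: cvg_fst.
have c2 : continuous (fun p : R2 => p.2 : R^o) by move=> p; exact: cvg_snd.
pose W := [set p : R2 | p.1 < 1 / 4] `|` ([set p : R2 | 3 / 4 < p.1] `|`
  ([set p : R2 | p.2 < 1 / 12] `|` [set p : R2 | 11 / 12 < p.2])).
pose K := (`[(1 / 4), (3 / 4)] `*` `[(1 / 12), (11 / 12)])%classic : set R2.
pose N := ([set p : R2 | 1 / 8 < p.1] `&` [set p : R2 | p.1 < 7 / 8]) `&`
  ([set p : R2 | 1 / 24 < p.2] `&` [set p : R2 | p.2 < 23 / 24]).
have oW : open W by repeat apply: openU; (exact: open_ltf || exact: open_gtf).
have oN : open N by apply: openI; apply: openI; (exact: open_ltf || exact: open_gtf).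
have kK : compact K by apply: compact_setX; exact: segment_compact.
have bR := @bumpy_scalar R.
have [|||S sS eS] := @smoothing R R2 E hRR (bumpy_prod hR hR bR bR) M S0 W K N cS0 oW _ kK oN.
- apply: smooth_into_local => -[s u] [h|[h|h]].
  + apply: (@smooth_on_open R2 [set p : R2 | p.1 < 1 / 4] S0 (fun=> x0) (s, u)) => //.
    - exact: open_ltf.
    - exact: smooth_into_cst.
    - by move=> [a' b'] /= hh; rewrite S0s0// ltW.
  + apply: (@smooth_on_open R2 [set p : R2 | 3 / 4 < p.1] S0 (fun p => l p.2) (s, u)) => //.
    - exact: open_gtf.
    - by apply: (smooth_into_compT hRR hR (@openT _) sl) => //; smT.
    - by move=> [a' b'] /= hh; rewrite S0s1// ltW.
  + apply: (@smooth_on_open R2 ([set p : R2 | p.2 < 1 / 12] `|` [set p : R2 | 11 / 12 < p.2]) S0 (fun=> x0) (s, u)) => //.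
    - by apply: openU; [exact: open_ltf|exact: open_gtf].
    - exact: smooth_into_cst.
    - by move=> [a' b'] /= [] hh; rewrite S0u//; [left|right]; exact: ltW.
- by move=> [s u] [/=]; rewrite !in_itv/= => /andP[? ?] /andP[? ?]; split; split; rewrite /=; lra.
- apply/seteqP; split => // -[s u] _; rewrite /W /K /=.
  have [|h1] := ltP s (1 / 4); first by auto.
  have [|h2] := ltP (3 / 4) s; first by auto.
  have [|h3] := ltP u (1 / 12); first by auto 6.
  have [|h4] := ltP (11 / 12) u; first by auto 6.
  by right; rewrite !in_itv/= h1 h2 h3 h4.
exists S; split => //.
- move=> s u h; rewrite eS; last by move=> [[/= ? ?] [/= ? ?]]; lra.
  by case: h => [h|[h|h]]; [apply: S0s0|apply: S0u; left|apply: S0u; right]; lra.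
- move=> s u h; rewrite eS; last by move=> [[/= ? ?] [/= ? ?]]; lra.
  by apply: S0s1; lra.
Qed.

End fillings.

(** * Reflection and pasting of squares; squares with constant boundary *)

Section assembly.
Context {R : realType} {E : tvsType R} {M : manifoldType E}.
Context {Omega : M -> E -> E -> R^o} (tO : two_form Omega) (cO : closed_form Omega).
Let hR := @scalar_hausdorff R.
Let hRR := prod_hausdorff hR hR.
Let hRRR := prod_hausdorff hR hRR.
Local Notation R2 := (R^o * R^o)%type.
Local Notation R3 := (R^o * (R^o * R^o))%type.
Local Notation area := (area (Omega := Omega)).
Let oT2 := @openT R2.

Lemma smooth_into_compR2 (S : R2 -> M) (phi : R2 -> R2) : smooth_into setT S -> Csmooth setT phi ->
  smooth_into setT (fun a => S (phi a)).
Proof. by move=> sS sphi; apply: (smooth_into_compT hRR hRR oT2 sS). Qed.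

(** The reflection reverses the interval, while [itg_subst] wants [th a <= th b]; hence a separate
    computation with an antiderivative. *)
Lemma itg_onem (f : R^o -> R^o) : continuous f -> itg 0 1 (fun s => f (1 - s)) = itg 0 1 f.
Proof.
move=> cf; have [F dF] := antiderivative (-1) 2 cf.
have e1 : itg 0 1 f = F 1 - F 0.
  by apply: itg_FTC2 => // x /andP[x0 x1]; apply: dF; lra.
rewrite e1 (_ : F 1 - F 0 = - F (1 - 1) - - F (1 - 0)); last first.
  by rewrite subrr subr0 opprK addrC.
apply: (@itg_FTC2 R (fun s => f (1 - s)) (fun s => - F (1 - s)) 0 1 ler01).
  move=> s; apply: (@continuous_comp _ _ _ (fun s : R^o => 1 - s : R^o) f); last exact: cf.
  by apply: cvgB; [exact: cvg_cst|exact: cvg_id].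
move=> x /andP[x0 x1].
have d1 : is_derive (1 - x) 1 F (f (1 - x)) by apply: dF; lra.
have d2 : is_derive x 1 (fun s : R => 1 - s) (- 1).
  by apply: is_derive_eq; rewrite add0r mul1r.
have d3 : is_derive x 1 (fun s : R => F (1 - s)) (f (1 - x) * - 1) := @is_derive1_comp R F (fun s : R => 1 - s) x _ _ d1 d2.
have d4 : is_derive x 1 (fun s : R => - F (1 - s)) (- (f (1 - x) * -1)) := is_deriveN d3.
by apply: (is_derive_eq d4); rewrite mulrN1 opprK.
Qed.

Lemma area_rev (S : R2 -> M) : smooth_into setT S ->
  area (fun p => S (1 - p.1, p.2)) = - area S.
Proof.
move=> sS; have cd := dens_continuous tO sS.
pose F (x y : R^o) : R^o := pullback (Omega := Omega) S ((1, 0) : R2) ((0, 1) : R2) (x, y).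
have cF : continuous (fun q : R2 => F q.1 q.2) by exact: cd.
have E1 s t : pullback (Omega := Omega) (fun p : R2 => S (1 - p.1, p.2)) ((1, 0) : R2) ((0, 1) : R2) (s, t) = -1 * F (1 - s) t.
  have s1 : Csmooth setT (fun p : R2 => 1 - p.1 : R^o) by smT.
  have s2 : Csmooth setT (fun p : R2 => p.2 : R^o) by smT.
  have sphi : Csmooth setT (fun p : R2 => (1 - p.1, p.2)) by smT.
  rewrite (pullback_comp hRR hRR _ _ oT2 oT2 sphi sS I I).
  have gth u : gateaux (fun x : R^o => 1 - x : R^o) u 1 = -1.
    have d2 : is_derive u 1 (fun s : R => 1 - s) (- 1).
      by apply: is_derive_eq; rewrite add0r mul1r.
    exact: (dir_unique hR (is_derive_dquot d2)).
  have sth : Csmooth setT (fun x : R^o => 1 - x : R^o) by smT.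
  have sid : Csmooth setT (fun x : R^o => x) by smT.
  rewrite !(gateaux_pair hR hR _ s1 s2 I) !(gateaux_fst _ _ _ sth) !(gateaux_snd _ _ _ sid) /= !gth !gateaux_id//.
  by rewrite (pullback_det tO _ _ _ _ oT2 sS I) /F /=; ring.
have ci := @itg_cont2 R F 0 1 ler01 cF.
have E2 : area (fun p => S (1 - p.1, p.2)) = itg 0 1 (fun s => -1 * itg 0 1 (F (1 - s))).
  apply: itg_eq => s _; rewrite -itgZ; last exact: (continuous_prodl cF).
  by apply: itg_eq => t _; exact: E1.
have c1 : continuous (fun s : R^o => itg 0 1 (F (1 - s)) : R^o).
  move=> s; apply: (@continuous_comp _ _ _ (fun s : R^o => 1 - s : R^o) (fun s => itg 0 1 (F s) : R^o)); last exact: ci.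
  by apply: cvgB; [exact: cvg_cst|exact: cvg_id].
by rewrite E2 (@itgZ R _ 0 1 (-1) c1) mulN1r (itg_onem ci).
Qed.

Definition stp (S : R2 -> M) (p : R2) : M := S (step p.1, step p.2).

Definition paste3 (A B C : R2 -> M) : R2 -> M := paste (paste A B) (stp C).

Definition matching_sides (A B : R2 -> M) := forall t : R, 0 <= t <= 1 -> A (1, t) = B (0, t).

Lemma paste_bnd (A B : R2 -> M) : (forall t : R, 0 <= t <= 1 -> A (1, t) = B (0, t)) ->
  (forall t, paste A B (0, t) = A (0, step t)) /\ (forall t, paste A B (1, t) = B (1, step t)).
Proof.
move=> /pasteE[g1 g2]; split => t.
  by rewrite g1 /= ?mulr0 ?step_0//; lra.
by rewrite g2 /= ?mulr1 ?(step1 (x := 2 - 1))//; lra.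
Qed.

Lemma paste_adj (A B C : R2 -> M) : matching_sides A B -> matching_sides B C -> matching_sides (paste A B) (stp C).
Proof.
move=> AB BC t t01; have [_ ->] := paste_bnd AB.
by rewrite /stp /= step_0 BC ?step_01.
Qed.

Lemma stp_smooth (C : R2 -> M) : smooth_into setT C -> smooth_into setT (stp C).
Proof. by move=> sC; apply: smooth_into_compR2 => //; smT. Qed.

Lemma paste3_smooth (A B C : R2 -> M) : smooth_into setT A -> smooth_into setT B -> smooth_into setT C ->
  matching_sides A B -> matching_sides B C -> smooth_into setT (paste3 A B C).
Proof.
move=> sA sB sC AB BC; apply: paste_smooth; [exact: paste_smooth|exact: stp_smooth|exact: paste_adj].
Qed.

Lemma area_paste3 (A B C : R2 -> M) : smooth_into setT A -> smooth_into setT B -> smooth_into setT C ->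
  matching_sides A B -> matching_sides B C -> area (paste3 A B C) = area A + area B + area C.
Proof.
move=> sA sB sC AB BC; rewrite /paste3 (area_paste tO (paste_smooth sA sB AB) (stp_smooth sC) (paste_adj AB BC)).
by rewrite (area_paste tO sA sB AB) (area_step tO sC).
Qed.

Lemma paste3_left (A B C : R2 -> M) t : matching_sides A B -> matching_sides B C -> paste3 A B C (0, t) = A (0, step (step t)).
Proof.
move=> AB BC; have [h _] := paste_bnd (paste_adj AB BC); rewrite /paste3 h.
by have [-> _] := paste_bnd AB.
Qed.

Lemma paste3_right (A B C : R2 -> M) t : matching_sides A B -> matching_sides B C -> paste3 A B C (1, t) = C (1, step (step t)).
Proof. by move=> AB BC; have [_ h] := paste_bnd (paste_adj AB BC); rewrite /paste3 h /stp /= step_1. Qed.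

(** Meant for [a] and [b] in [{0, 1}], which [step] fixes: a horizontal side of the pasted square
    then involves only horizontal sides of the pieces. *)
Lemma paste3_side (a b : R) (A B C A' B' C' : R2 -> M) s : step a = a -> step b = b ->
  (forall s, 0 <= s <= 1 -> [/\ A (s, a) = A' (s, b), B (s, a) = B' (s, b) & C (s, a) = C' (s, b)]) ->
  paste3 A B C (s, a) = paste3 A' B' C' (s, b).
Proof.
move=> sa sb H; rewrite /paste3 /paste /stp /= !sa !sb.
have [h1 h2 _] := H (step (2 * step (2 * s))) (step_01 _).
have [_ h3 _] := H (step (2 * step (2 * s) - 1)) (step_01 _).
have [_ _ h4] := H (step (step (2 * s - 1))) (step_01 _).
by rewrite h1 h3 h4.
Qed.

Lemma area_null (S : R2 -> M) (x0 : M) : @trivial_pi R 2 M -> smooth_into setT S ->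
  (forall s t : R, 0 <= s <= 1 -> 0 <= t <= 1 -> s = 0 \/ s = 1 \/ t = 0 \/ t = 1 -> S (s, t) = x0) ->
  area S = 0.
Proof.
move=> pi sS Sb.
have [H [cH H01 Hb]] := null_homotopy2 pi (smooth_into_cont sS) Sb.
(* The three steps give every face a collar on which [T0] is [x0] or [S] reparametrized. Smoothing
   then affects only the interior, and the smoothed map is still constant near the side faces. *)
pose T0 (z : R3) : M := H (step z.1) (step z.2.1) (step z.2.2).
have cT0 : continuous T0.
  by apply: cH; try (apply: smoothT_continuous; smT); move=> z; exact: step_01.
have T0r0 r s t : r <= 1 / 4 -> T0 (r, (s, t)) = S (step s, step t).
  move=> r4; rewrite /T0 /= (@step0 _ r); last by lra.
  by have [] := H01 (step s) (step t) (step_01 _) (step_01 _).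
have T0r1 r s t : 3 / 4 <= r -> T0 (r, (s, t)) = x0.
  move=> r4; rewrite /T0 /= (@step1 _ r)//.
  by have [] := H01 (step s) (step t) (step_01 _) (step_01 _).
have T0b r s t : s <= 1 / 4 \/ 3 / 4 <= s \/ t <= 1 / 4 \/ 3 / 4 <= t -> T0 (r, (s, t)) = x0.
  move=> h; rewrite /T0 /=; apply: Hb; try exact: step_01.
  case: h => [h|[h|[h|h]]]; [left|right; left|right; right; left|right; right; right].
  - by rewrite step0//; lra.
  - by rewrite step1.
  - by rewrite step0//; lra.
  - by rewrite step1.
have c0 : continuous (fun z : R3 => z.1 : R^o) by apply: smoothT_continuous; smT.
have c1 : continuous (fun z : R3 => z.2.1 : R^o) by apply: smoothT_continuous; smT.
have c2 : continuous (fun z : R3 => z.2.2 : R^o) by apply: smoothT_continuous; smT.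
pose W0 := [set z : R3 | z.1 < 1 / 4].
pose W1 := [set z : R3 | 3 / 4 < z.1].
pose W2 := ([set z : R3 | z.2.1 < 1 / 4] `|` [set z : R3 | 3 / 4 < z.2.1]) `|`
  ([set z : R3 | z.2.2 < 1 / 4] `|` [set z : R3 | 3 / 4 < z.2.2]).
pose W := W0 `|` (W1 `|` W2).
pose K := (`[(1 / 4), (3 / 4)] `*` (`[(1 / 4), (3 / 4)] `*` `[(1 / 4), (3 / 4)]))%classic : set R3.
pose N := ([set z : R3 | 1 / 8 < z.1] `&` [set z : R3 | z.1 < 7 / 8]) `&`
  (([set z : R3 | 1 / 8 < z.2.1] `&` [set z : R3 | z.2.1 < 7 / 8]) `&`
  ([set z : R3 | 1 / 8 < z.2.2] `&` [set z : R3 | z.2.2 < 7 / 8])).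
have oW2 : open W2 by repeat apply: openU; (exact: open_ltf || exact: open_gtf).
have oW : open W by repeat apply: openU => //; (exact: open_ltf || exact: open_gtf).
have oN : open N by repeat apply: openI; (exact: open_ltf || exact: open_gtf).
have kK : compact K.
  by apply: compact_setX; [exact: segment_compact|apply: compact_setX; exact: segment_compact].
have bR := @bumpy_scalar R; have bRR := bumpy_prod hR hR bR bR.
have [|||T sT eT] := @smoothing R R3 E hRRR (bumpy_prod hR hRR bR bRR) M T0 W K N cT0 oW _ kK oN.
- apply: smooth_into_local => -[r [s t]] [h|[h|h]].
  + apply: (@smooth_on_open R E M R3 W0 T0 (fun z => S (step z.2.1, step z.2.2)) (r, (s, t))) => //.
    - exact: open_ltf.
    - by apply: (smooth_into_compT hRRR hRR oT2 sS) => //; smT.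
    - by move=> [a [b c]] /= hh; rewrite T0r0// ltW.
  + apply: (@smooth_on_open R E M R3 W1 T0 (fun=> x0) (r, (s, t))) => //.
    - exact: open_gtf.
    - exact: smooth_into_cst.
    - by move=> [a [b c]] /= hh; rewrite T0r1// ltW.
  + apply: (@smooth_on_open R E M R3 W2 T0 (fun=> x0) (r, (s, t))) => //.
    - exact: smooth_into_cst.
    - by move=> [a [b c]] /= [[|]|[|]] hh; apply: T0b; have := ltW hh; auto.
- move=> [r [s t]] [/=]; rewrite !in_itv/= => /andP[? ?] [/andP[? ?] /andP[? ?]].
  by split; [|split]; split; rewrite /=; lra.
- apply/seteqP; split => // -[r [s t]] _; rewrite /W /W0 /W1 /W2 /K /=.
  have [|h1] := ltP r (1 / 4); first by auto.
  have [|h2] := ltP (3 / 4) r; first by auto.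
  have [|h3] := ltP s (1 / 4); first by auto 6.
  have [|h4] := ltP (3 / 4) s; first by auto 6.
  have [|h5] := ltP t (1 / 4); first by auto 6.
  have [|h6] := ltP (3 / 4) t; first by auto 6.
  by right; rewrite !in_itv/= h1 h2 h3 h4 h5 h6.
have := @stokes_cube R E M Omega tO cO T sT.
have -> : (fun p => T (0, p)) = stp S.
  apply/funext => -[s t]; rewrite eT; last by move=> [[/= ? ?] _]; lra.
  by rewrite T0r0//; lra.
have -> : (fun p => T (1, p)) = (fun=> x0).
  apply/funext => -[s t]; rewrite eT; last by move=> [[/= ? ?] _]; lra.
  by rewrite T0r1//; lra.
rewrite (area_cst tO x0) (area_step tO sS); apply => r s t h.
pose V := ([set z : R3 | z.2.1 < 1 / 8] `|` [set z : R3 | 7 / 8 < z.2.1]) `|`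
  ([set z : R3 | z.2.2 < 1 / 8] `|` [set z : R3 | 7 / 8 < z.2.2]).
have oV : open V by repeat apply: openU; (exact: open_ltf || exact: open_gtf).
rewrite (@partial_eq R E M R3 V T (fun=> x0)); [exact: partial_cst|exact: oV| |].
  by rewrite /V /=; case: h => [->|[->|[->|->]]]; [left; left|left; right|right; left|right; right]; lra.
move=> [a [b c]] hV; rewrite eT; first by apply: T0b; move: hV; rewrite /V /=; lra.
by move=> [_ [[/= ? ?] [/= ? ?]]]; move: hV; rewrite /V /=; lra.
Qed.

End assembly.

(** * Primitives of the area on paths *)

Lemma onem01 (R : realType) (t : R) : 0 <= t <= 1 -> 0 <= 1 - t <= 1.
Proof. by lra. Qed.

Lemma square_area_arith (R : realType) (b l s r t : R) :
  - - b - (l + s - r) - - - t = 0 -> s = b + r - t - l.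
Proof. by lra. Qed.

Section path_functional.
Context {R : realType} {E : tvsType R} {M : manifoldType E}.
Let hR := @scalar_hausdorff R.
Let hRR := prod_hausdorff hR hR.
Local Notation R2 := (R^o * R^o)%type.
Let oT1 := @openT R^o.
Let oT2 := @openT R2.

Lemma smooth_path_comp (A : tvsType R) (hA : hausdorff_space A) (g : R^o -> M) (th : A -> R^o) :
  smooth_path g -> Csmooth setT th -> (forall x, 0 <= th x <= 1) ->
  smooth_into setT (fun x => g (th x)).
Proof.
move=> [U [oU IU sg]] sth th01; apply: (smooth_into_compT hA hR oU sg) => // x.
by apply: IU; rewrite /= in_itv/= th01.
Qed.

Lemma smoothT_path (g : R^o -> M) : smooth_into setT g -> smooth_path g.
Proof. by move=> sg; exists setT; split => //; exact: openT. Qed.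

Context {Omega : M -> E -> E -> R^o} (sO : symplectic Omega).
Let tO : two_form Omega. Proof. by case: sO. Qed.
Let cO : closed_form Omega. Proof. by case: sO. Qed.
Local Notation area := (area (Omega := Omega)).
Context (pi1M : @trivial_pi R 1 M) (pi2M : @trivial_pi R 2 M).
Context (x0 : M) (kp : M -> R^o -> M).
Context (kp_smooth : forall y, smooth_path (kp y)) (kp0 : forall y, kp y 0 = x0) (kp1 : forall y, kp y 1 = y).

(** A triangle with apex [x0], written as a square whose left side is collapsed. Its other sides are
    run through by [step], which slows down at the corners of the boundary loop. *)
Definition is_cone (g : R^o -> M) (C : R2 -> M) : Prop := smooth_into setT C /\
  forall t : R, 0 <= t <= 1 -> [/\ C (0, t) = x0, C (1, t) = g (step t),
    C (t, 0) = kp (g 0) (step t) & C (t, 1) = kp (g 1) (step t)].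

Lemma cone_exists (g : R^o -> M) : smooth_path g -> exists C, is_cone g C.
Proof.
move=> sg.
(* The boundary loop of the cone, each third of the parameter interval taking one side: out from
   [x0] to [g 0], along [g], and back from [g 1]. *)
pose l (u : R^o) : M := if u <= 1 / 3 then kp (g 0) (step (3 * u)) else
  if u <= 2 / 3 then g (step (3 * u - 1)) else kp (g 1) (step (3 - 3 * u)).
have l1 u : u < 5 / 12 -> l u = kp (g 0) (step (3 * u)).
  move=> h; rewrite /l; case: leP => // h1; rewrite ifT; last by lra.
  by rewrite (@step0 _ (3 * u - 1)) ?(@step1 _ (3 * u)) ?kp1//; lra.
have l2 u : 1 / 4 < u < 3 / 4 -> l u = g (step (3 * u - 1)).
  move=> h; rewrite /l; case: leP => h1.
    by rewrite (@step0 _ (3 * u - 1)) ?(@step1 _ (3 * u)) ?kp1//; lra.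
  case: leP => // h2.
  by rewrite (@step1 _ (3 * u - 1)) ?(@step1 _ (3 - 3 * u)) ?kp1//; lra.
have l3 u : 7 / 12 < u -> l u = kp (g 1) (step (3 - 3 * u)).
  move=> h; rewrite /l; case: leP => h1; first by exfalso; lra.
  case: leP => // h2.
  by rewrite (@step1 _ (3 * u - 1)) ?(@step1 _ (3 - 3 * u)) ?kp1//; lra.
have sl : smooth_into setT l.
  apply: smooth_into_local => u _.
  have [h|h] := ltP u (5 / 12).
    apply: (@smooth_on_open R E M R^o [set u | u < 5 / 12] l (fun u => kp (g 0) (step (3 * u))) u) => //.
    - by apply: smooth_path_comp => //; [smT|move=> x; exact: step_01].
  have [h'|h'] := ltP (7 / 12) u.
    apply: (@smooth_on_open R E M R^o [set u | 7 / 12 < u] l (fun u => kp (g 1) (step (3 - 3 * u))) u) => //.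
    - by apply: smooth_path_comp => //; [smT|move=> x; exact: step_01].
  apply: (@smooth_on_open R E M R^o ([set u | 1 / 4 < u] `&` [set u | u < 3 / 4]) l (fun u => g (step (3 * u - 1))) u) => //.
  - by apply: openI; [by apply: (@open_gtf R R^o idfun); move=> z; exact: cvg_id|by apply: (@open_ltf R R^o idfun); move=> z; exact: cvg_id].
  - by split; rewrite /=; lra.
  - by apply: smooth_path_comp => //; [smT|move=> x; exact: step_01].
  - by move=> x [/= ? ?]; apply: l2; apply/andP.
have lx u : u <= 1 / 12 \/ 11 / 12 <= u -> l u = x0.
  by move=> [h|h]; [rewrite l1 ?step0 ?kp0//|rewrite l3 ?step0 ?kp0//]; lra.
have [S [sS Sx Sl]] := loop_square pi1M sl lx.
(* The second argument is [p.1 / 3] on the side [p.2 = 0], [1 - p.1 / 3] on [p.2 = 1], and sweeps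
   the middle third on [p.1 = 1]. The factor 6 makes the first argument 1 from [p.1 = 1/8] on; below
   that, both horizontal sides lie in the margins of width 1/24 where [S] is [x0]. *)
exists (fun p => S (step (6 * p.1), p.2 * (1 - p.1 / 3) + (1 - p.2) * (p.1 / 3))); split.
  by apply: smooth_into_compR2 => //; smT.
move=> t t01; split => /=.
- by rewrite mulr0 step_0 Sx//; left; lra.
- rewrite mulr1 step1; last by lra.
  rewrite Sl; last by lra.
  by rewrite l2; [congr (g (step _)); field|lra].
- rewrite mul0r add0r subr0 mul1r; have [h|h] := leP t (1 / 8).
    by rewrite Sx ?(@step0 _ t) ?kp0//; [lra|right; left; lra].
  rewrite (@step1 _ (6 * t)); last by lra.
  rewrite Sl; last by lra.
  by rewrite l1; [congr (kp _ (step _)); field|lra].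
- rewrite mul1r subrr mul0r addr0; have [h|h] := leP t (1 / 8).
    by rewrite Sx ?(@step0 _ t) ?kp0//; [lra|right; right; lra].
  rewrite (@step1 _ (6 * t)); last by lra.
  rewrite Sl; last by lra.
  by rewrite l3; [congr (kp _ (step _)); field|lra].
Qed.

Definition cone (g : R^o -> M) : R2 -> M := xget (fun=> x0) [set C | is_cone g C].

Definition prim (g : R^o -> M) : R := area (cone g).

Lemma coneP (g : R^o -> M) : smooth_path g -> is_cone g (cone g).
Proof. by move=> /cone_exists[C gC]; apply: (@xgetPex _ (fun=> x0) [set C | is_cone g C]); exists C. Qed.

(** The cone is chosen from a set that depends only on the values of the path on [[0, 1]]. Equal
    sets give equal choices, so no comparison of two cones is involved. *)
Lemma prim_eq (g h : R^o -> M) : (forall t, 0 <= t <= 1 -> g t = h t) -> prim g = prim h.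
Proof.
move=> gh; rewrite /prim /cone; congr (area (xget _ _)).
have e : (fun t => g (step t)) = (fun t => h (step t)) by apply/funext => t; rewrite gh ?step_01.
have e' t : g (step t) = h (step t) by rewrite gh ?step_01.
have e0 : g 0 = h 0 by rewrite gh// lexx ler01.
have e1 : g 1 = h 1 by rewrite gh// lexx ler01.
by apply/seteqP; split => C [sC HC]; split => // t /HC[]; rewrite e' e0 e1.
Qed.

(* The square, the four cones over its sides and four degenerate corner cells
   form a 3 x 3 array whose boundary is constant, so that the total area is 0. *)
Theorem area_prim (S : R2 -> M) : smooth_into setT S ->
  area S = prim (fun s => S (s, 0)) + prim (fun t => S (1, t))
    - prim (fun s => S (s, 1)) - prim (fun t => S (0, t)).
Proof.
move=> sS.
have sb (phi : R^o -> R2) : Csmooth setT phi -> smooth_path (fun u => S (phi u)).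
  by move=> sphi; apply: smoothT_path; apply: (smooth_into_compT hR hRR oT2 sS).
have [sCb Cb] := coneP (sb (fun s => (s, 0)) ltac:(smT)).
have [sCr Cr] := coneP (sb (fun t => (1, t)) ltac:(smT)).
have [sCt Ct] := coneP (sb (fun s => (s, 1)) ltac:(smT)).
have [sCl Cl] := coneP (sb (fun t => (0, t)) ltac:(smT)).
rewrite /prim; set CB := cone _ in sCb Cb *; set CR := cone _ in sCr Cr *.
set CT := cone _ in sCt Ct *; set CL := cone _ in sCl Cl *.
pose k (y : M) (th : R2 -> R^o) (p : R2) : M := kp y (th p).
have sk y (th : R2 -> R^o) : Csmooth setT th -> (forall x, 0 <= th x <= 1) ->
    smooth_into setT (k y th) /\ area (k y th) = 0.
  move=> sth th01; split; first exact: smooth_path_comp.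
  have [U [oU IU sky]] := kp_smooth y.
  by apply: (area_rank1 tO oU sky sth) => p; apply: IU; rewrite /= in_itv/= th01.
(* The corner cells run along the path from [x0] to a corner of [S]: the products vanish on the two
   outer sides of the cell and reduce to one [step] on the inner ones. Each cell factors through a
   path, so its area is 0. *)
pose t00 (p : R2) : R^o := step p.1 * step p.2.
pose t10 (p : R2) : R^o := step (1 - p.1) * step p.2.
pose t01 (p : R2) : R^o := step p.1 * step (1 - p.2).
pose t11 (p : R2) : R^o := step (1 - p.1) * step (1 - p.2).
have m01 (a b : R) : 0 <= step a * step b <= 1.
  by rewrite mulr_ge0 ?step_ge0//= -[leRHS](mulr1 1) ler_pM ?step_ge0 ?step_le1.
have [s00 a00] := sk (S (0, 0)) t00 ltac:(by smT) (fun x => m01 _ _).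
have [s10 a10] := sk (S (1, 0)) t10 ltac:(by smT) (fun x => m01 _ _).
have [s01 a01] := sk (S (0, 1)) t01 ltac:(by smT) (fun x => m01 _ _).
have [s11 a11] := sk (S (1, 1)) t11 ltac:(by smT) (fun x => m01 _ _).
pose B1 (p : R2) : M := CB (p.2, p.1).
have sB1 : smooth_into setT B1 by apply: smooth_into_compR2 => //; smT.
pose B2 := stp S; have sB2 : smooth_into setT B2 by exact: stp_smooth.
pose B3 (p : R2) : M := CT (1 - p.2, p.1).
have sB3 : smooth_into setT B3 by apply: smooth_into_compR2 => //; smT.
pose C2 (p : R2) : M := CR (1 - p.1, p.2).
have sC2 : smooth_into setT C2 by apply: smooth_into_compR2 => //; smT.
have I0 : 0 <= (0 : R) <= 1 by rewrite lexx ler01.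
have I1 : 0 <= (1 : R) <= 1 by rewrite lexx ler01.
have Iom (t : R) : 0 <= t <= 1 -> 0 <= 1 - t <= 1 by exact: onem01.
have h1 : matching_sides (k (S (0, 0)) t00) B1.
  by move=> t /Cb[_ _ e _]; rewrite /k /t00 /B1 /= e step_1 mul1r.
have h2 : matching_sides B1 (k (S (1, 0)) t10).
  by move=> t /Cb[_ _ _ e]; rewrite /k /t10 /B1 /= e subr0 step_1 mul1r.
have h3 : matching_sides CL B2.
  by move=> t /Cl[_ e _ _]; rewrite /B2 /stp /= e step_0.
have h4 : matching_sides B2 C2.
  by move=> t /Cr[_ e _ _]; rewrite /B2 /stp /C2 /= subr0 e step_1.
have h5 : matching_sides (k (S (0, 1)) t01) B3.
  by move=> t /Iom/Ct[_ _ e _]; rewrite /k /t01 /B3 /= e step_1 mul1r.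
have h6 : matching_sides B3 (k (S (1, 1)) t11).
  by move=> t /Iom/Ct[_ _ _ e]; rewrite /k /t11 /B3 /= e subr0 step_1 mul1r.
(* The rows of the array. The middle one consists of the cone over the left side, the square, and
   the mirror image of the cone over the right side. *)
pose R1 := paste3 (k (S (0, 0)) t00) B1 (k (S (1, 0)) t10).
pose R2' := paste3 CL B2 C2.
pose R3 := paste3 (k (S (0, 1)) t01) B3 (k (S (1, 1)) t11).
have sR1 : smooth_into setT R1 by exact: paste3_smooth.
have sR2 : smooth_into setT R2' by exact: paste3_smooth.
have sR3 : smooth_into setT R3 by exact: paste3_smooth.
(* Pasting works along the first coordinate only, so the rows are transposed before being pasted
   together; each transposition changes the sign of an area. *)
pose fl (A : R2 -> M) (p : R2) : M := A (p.2, p.1).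
have sfl A : smooth_into setT A -> smooth_into setT (fl A).
  by move=> sA; apply: smooth_into_compR2 => //; smT.
have a12 : matching_sides (fl R1) (fl R2').
  move=> t _; rewrite /fl /= ?/R1 ?/R2' ?/R3; apply: (@paste3_side R E M 1 0 _ _ _ _ _ _ _ (@step_1 R) (@step_0 R)) => s /[dup] s01' /[dup] /Iom si Is.
  rewrite /k /t00 /t10 /B1 /B2 /C2 /stp /= !step_1 !step_0 !mulr1.
  have [_ _ -> _] := Cl s Is; have [_ -> _ _] := Cb s Is; have [_ _ -> _] := Cr _ si.
  by [].
have a23 : matching_sides (fl R2') (fl R3).
  move=> t _; rewrite /fl /= ?/R1 ?/R2' ?/R3; apply: (@paste3_side R E M 1 0 _ _ _ _ _ _ _ (@step_1 R) (@step_0 R)) => s /[dup] s01' /[dup] /Iom si Is.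
  rewrite /k /t01 /t11 /B3 /B2 /C2 /stp /= !subr0 !step_1 !mulr1.
  have [_ _ _ ->] := Cl s Is; have [_ -> _ _] := Ct s Is; have [_ _ _ ->] := Cr _ si.
  by [].
pose big := paste3 (fl R1) (fl R2') (fl R3).
have sbig : smooth_into setT big by exact: (paste3_smooth (sfl _ sR1) (sfl _ sR2) (sfl _ sR3) a12 a23).
have aflip A : smooth_into setT A -> area (fl A) = - area A by exact: area_flip.
have abig : area big = - area R1 - area R2' - area R3.
  apply: (etrans (area_paste3 tO (sfl _ sR1) (sfl _ sR2) (sfl _ sR3) a12 a23)).
  exact: (f_equal2 +%R (f_equal2 +%R (aflip _ sR1) (aflip _ sR2)) (aflip _ sR3)).
have aR1 : area R1 = - area CB.
  apply: (etrans (area_paste3 tO s00 sB1 s10 h1 h2)).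
  by rewrite a00 a10 add0r addr0; exact: (area_flip tO sCb).
have aR2 : area R2' = area CL + area S - area CR.
  apply: (etrans (area_paste3 tO sCl sB2 sC2 h3 h4)).
  exact: (f_equal2 +%R (f_equal2 +%R erefl (area_step tO sS)) (area_rev tO sCr)).
have aR3 : area R3 = - - area CT.
  apply: (etrans (area_paste3 tO s01 sB3 s11 h5 h6)).
  rewrite a01 a11 add0r addr0.
  have sCt' : smooth_into setT (fun p : R2 => CT (1 - p.1, p.2)) by apply: smooth_into_compR2 => //; smT.
  exact: (etrans (area_flip tO sCt') (f_equal -%R (area_rev tO sCt))).
have ss (t : R) : 0 <= step (step t) <= 1 by exact: step_01.
have big0 : area big = 0.
  apply: (@area_null R E M Omega tO cO big x0 pi2M sbig) => s t s01' t01' [->|[->|[->|->]]].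
  - rewrite /big (paste3_left _ a12 a23) /fl /=.
    (* Comparison with three pasted constant squares evaluates the side without opening the case
       distinctions of [paste3]. *)
    pose z (p : R2) := x0.
    have zz : matching_sides z z by [].
    transitivity (paste3 z z z (step (step t), 0)); last by rewrite /paste3 /paste /stp /z; repeat case: ifP.
    apply: (@paste3_side R E M 0 0 _ _ _ _ _ _ _ (@step_0 R) (@step_0 R)) => u u01; rewrite /k /t00 /t10 /B1 /= !step_0 !mulr0 !kp0.
    by have [-> _ _ _] := Cb u u01.
  - rewrite /big (paste3_right _ a12 a23) /fl /=.
    pose z (p : R2) := x0.
    have zz : matching_sides z z by [].
    transitivity (paste3 z z z (step (step t), 1)); last by rewrite /paste3 /paste /stp /z; repeat case: ifP.
    apply: (@paste3_side R E M 1 1 _ _ _ _ _ _ _ (@step_1 R) (@step_1 R)) => u u01; rewrite /k /t01 /t11 /B3 /= !subrr !step_0 !mulr0 !kp0.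
    by have [-> _ _ _] := Ct u u01.
  - pose z (p : R2) := x0.
    transitivity (paste3 z z z (s, 0)); last by rewrite /paste3 /paste /stp /z; repeat case: ifP.
    apply: (@paste3_side R E M 0 0 _ _ _ _ _ _ _ (@step_0 R) (@step_0 R)) => u u01; rewrite /fl /R1 /R2' /R3 /=.
    rewrite (paste3_left _ h1 h2) (paste3_left _ h3 h4) (paste3_left _ h5 h6).
    rewrite /k /t00 /t01 /= !step_0 !mul0r !kp0.
    by have [-> _ _ _] := Cl (step (step u)) (ss u).
  - pose z (p : R2) := x0.
    transitivity (paste3 z z z (s, 1)); last by rewrite /paste3 /paste /stp /z; repeat case: ifP.
    apply: (@paste3_side R E M 1 1 _ _ _ _ _ _ _ (@step_1 R) (@step_1 R)) => u u01; rewrite /fl /R1 /R2' /R3 /=.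
    rewrite (paste3_right _ h1 h2) (paste3_right _ h3 h4) (paste3_right _ h5 h6).
    rewrite /k /t10 /t11 /C2 /= !subrr !step_0 !mul0r !kp0.
    by have [-> _ _ _] := Cr (step (step u)) (ss u).
by move: big0; rewrite abig aR1 aR2 aR3; exact: square_area_arith.
Qed.

End path_functional.

Opaque prim area itg pullback.

Lemma halve (R : realType) (a b c d : R) : a + b = c + c -> b + a = d + d -> c = d.
Proof. by lra. Qed.

Lemma cancel0 (R : realType) (a b c d : R) : a + b = c + d -> a = 0 -> c = 0 -> d = b.
Proof. by move=> abcd a0 c0; move: abcd; rewrite a0 c0 !add0r. Qed.

(** * Reparametrization and subdivision of paths *)

Section reparametrization.
Context {R : realType} {E : tvsType R} {M : manifoldType E}.
Let hR := @scalar_hausdorff R.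
Let hRR := prod_hausdorff hR hR.
Local Notation R2 := (R^o * R^o)%type.
Let oT1 := @openT R^o.
Let oT2 := @openT R2.
Context {Omega : M -> E -> E -> R^o} (sO : symplectic Omega).
Let tO : two_form Omega. Proof. by case: sO. Qed.
Local Notation area := (area (Omega := Omega)).
Context (pi1M : @trivial_pi R 1 M) (pi2M : @trivial_pi R 2 M).
Context (x0 : M) (kp : M -> R^o -> M).
Context (kp_smooth : forall y, smooth_path (kp y)) (kp0 : forall y, kp y 0 = x0) (kp1 : forall y, kp y 1 = y).
Local Notation prim := (@prim R E M Omega x0 kp).
Let area_primE := area_prim sO pi1M pi2M kp_smooth kp0 kp1.

Lemma mix01 (a b s : R) : 0 <= a <= 1 -> 0 <= b <= 1 -> 0 <= s <= 1 -> 0 <= (1 - s) * a + s * b <= 1.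
Proof.
move=> /andP[a0 a1] /andP[b0 b1] /andP[s0 s1]; apply/andP; split.
  by apply: addr_ge0; apply: mulr_ge0 => //; lra.
by nra.
Qed.

(** The square [g] after [th] factors through a path, hence has area 0 and its sides balance.
    Back-tracking, change of parameter and subdivision of one path are all instances, for suitable
    [th]. *)
Lemma prim_rank1 (g : R^o -> M) (th : R2 -> R^o) (b r t l : R^o -> R^o) :
  smooth_path g -> Csmooth setT th -> (forall x, 0 <= th x <= 1) ->
  (forall u : R^o, 0 <= u <= 1 -> [/\ th (u, 0) = b u, th (1, u) = r u, th (u, 1) = t u & th (0, u) = l u]) ->
  prim (fun u => g (b u)) + prim (fun u => g (r u)) = prim (fun u => g (t u)) + prim (fun u => g (l u)).
Proof.
move=> sg sth th01 sides; have := area_primE (smooth_path_comp hRR sg sth th01).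
have [U [oU IU sU]] := sg.
have Uth p : U (th p) by apply: IU; rewrite /= in_itv/= th01.
rewrite (@area_rank1 R E M Omega tO U g th oU sU sth Uth).
have -> : prim (fun s => g (th (s, 0))) = prim (fun u => g (b u)) by apply: prim_eq => u /sides[->].
have -> : prim (fun s => g (th (1, s))) = prim (fun u => g (r u)) by apply: prim_eq => u /sides[_ ->].
have -> : prim (fun s => g (th (s, 1))) = prim (fun u => g (t u)) by apply: prim_eq => u /sides[_ _ ->].
have -> : prim (fun s => g (th (0, s))) = prim (fun u => g (l u)) by apply: prim_eq => u /sides[_ _ _ ->].
set a := prim _; set c := prim _; set d := prim _; set e := prim _; clearbody a c d e; lra.
Qed.

Lemma mul01 (a b : R) : 0 <= a <= 1 -> 0 <= b <= 1 -> 0 <= a * b <= 1.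
Proof. by move=> /andP[? ?] /andP[? ?]; rewrite mulr_ge0//= -[leRHS](mulr1 1) ler_pM. Qed.

(** Two squares inside one path equate the sum of [g] and its reverse with twice the value at [g 0]
    and with twice the value at [g 1]; so all constant paths have the value of [x0]. The cone over
    [x0] has equal opposite sides, hence its area, which is this value, is 0. *)
Lemma prim_cst (y : M) : prim (fun _ => y) = 0.
Proof.
have eq2 (g : R^o -> M) : smooth_path g -> prim (fun _ => g 0) = prim (fun _ => g 1).
  move=> sg; pose th (p : R2) : R^o := step p.1 * (1 - step p.2).
  have th01 p : 0 <= th p <= 1 by exact: (mul01 (step_01 _) (onem01 (step_01 _))).
  have h1 := @prim_rank1 g th (fun s => step s) (fun s => 1 - step s) (fun _ => 0) (fun _ => 0) sg
    ltac:(by smT) th01.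
  have h2 := @prim_rank1 g (fun p => 1 - th p) (fun s => 1 - step s) (fun s => step s) (fun _ => 1) (fun _ => 1) sg
    ltac:(by smT) (fun p => onem01 (th01 p)).
  have {}h1 := h1 ltac:(by move=> u _; split; rewrite /th /= ?step_0 ?step_1; ring).
  have {}h2 := h2 ltac:(by move=> u _; split; rewrite /th /= ?step_0 ?step_1; ring).
  exact: (halve h1 h2).
have hy z : prim (fun _ => x0) = prim (fun _ => z).
  have ea : prim (fun _ => x0) = prim (fun _ => kp z 0) by apply: prim_eq => t _; rewrite kp0.
  have eb : prim (fun _ => kp z 1) = prim (fun _ => z) by apply: prim_eq => t _; rewrite kp1.
  exact: (etrans ea (etrans (eq2 _ (kp_smooth z)) eb)).
have sy : smooth_path (fun _ : R^o => x0) by apply: smoothT_path; exact: smooth_into_cst.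
have [sC HC] := coneP pi1M kp_smooth kp0 kp1 sy.
have := area_primE sC; set C := cone _ _ _ in sC HC *.
have -> : prim (fun s => C (s, 0)) = prim (fun u => C (u, 1)).
  by apply: prim_eq => u /HC[_ _ -> ->].
have -> : prim (fun s => C (1, s)) = prim (fun _ => x0) by apply: prim_eq => u /HC[_ -> _ _].
have -> : prim (fun s => C (0, s)) = prim (fun _ => x0) by apply: prim_eq => u /HC[-> _ _ _].
rewrite -(hy y) -[area C]/(prim (fun=> x0)).
set a := prim _; set b := prim _; clearbody a b; lra.
Qed.

(** The linear interpolation between [k] and [k'] is a square inside [g] whose other two sides are
    constant. *)
Lemma prim_reparam (g : R^o -> M) (k k' : R^o -> R^o) : smooth_path g ->
  Csmooth setT k -> Csmooth setT k' -> (forall t, 0 <= k t <= 1) -> (forall t, 0 <= k' t <= 1) ->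
  k 0 = k' 0 -> k 1 = k' 1 -> prim (fun t => g (k t)) = prim (fun t => g (k' t)).
Proof.
move=> sg sk sk' k01 k'01 e0 e1.
pose th (p : R2) : R^o := (1 - step p.1) * k p.2 + step p.1 * k' p.2.
have sth : Csmooth setT th.
  have s1 : Csmooth setT (fun p : R2 => k p.2) by apply: (smT_comp hRR hR hR sk); smT.
  have s2 : Csmooth setT (fun p : R2 => k' p.2) by apply: (smT_comp hRR hR hR sk'); smT.
  by smT.
have sides (u : R^o) : 0 <= u <= 1 ->
    [/\ th (u, 0) = k 0, th (1, u) = k' u, th (u, 1) = k 1 & th (0, u) = k u].
  by rewrite /th /= -e0 -e1 step_1 step_0; split; ring.
have H := @prim_rank1 g th (fun _ => k 0) k' (fun _ => k 1) k sg sth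
  (fun p => mix01 (k01 _) (k'01 _) (step_01 _)) sides.
exact: (cancel0 H (prim_cst (g (k 0))) (prim_cst (g (k 1)))).
Qed.

Lemma smooth_path_step (g : R^o -> M) : smooth_path g -> smooth_path (fun t => g (step t)).
Proof.
by move=> sg; apply: smoothT_path; apply: (smooth_path_comp hR sg); [smT|move=> x; exact: step_01].
Qed.

(** [prim_reparam] does not apply, since the identity does not map the whole line into [[0, 1]].
    Instead the area identity is applied to the cone of [g], whose far side is [g] after [step]. *)
Lemma prim_step (g : R^o -> M) : smooth_path g -> prim (fun t => g (step t)) = prim g.
Proof.
pose P y := prim (fun t => kp y (step t)).
have key h : smooth_path h -> prim h = P (h 0) + prim (fun t => h (step t)) - P (h 1).
  move=> sh; have [sC HC] := coneP pi1M kp_smooth kp0 kp1 sh.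
  have := area_primE sC; set C := cone _ _ _ in sC HC *.
  have -> : prim (fun s => C (s, 0)) = P (h 0) by apply: prim_eq => u /HC[_ _ -> _].
  have -> : prim (fun s => C (s, 1)) = P (h 1) by apply: prim_eq => u /HC[_ _ _ ->].
  have -> : prim (fun s => C (1, s)) = prim (fun t => h (step t)) by apply: prim_eq => u /HC[_ -> _ _].
  have -> : prim (fun s => C (0, s)) = prim (fun _ => x0) by apply: prim_eq => u /HC[-> _ _ _].
  by rewrite prim_cst subr0.
(* [key] for the stepped path to [y] shows that the correction term is the same at all points, so
   the two corrections for [g] cancel. *)
have Pc y : P y = P x0.
  have := key _ (smooth_path_step (kp_smooth y)); rewrite step_0 step_1 kp0 kp1.
  have -> : prim (fun t => kp y (step (step t))) = P y.
    apply: (@prim_reparam _ (fun t => step (step t)) step) => //; try by smT.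
    - by move=> t; exact: step_01.
    - by move=> t; exact: step_01.
    - by rewrite !step_0.
    - by rewrite !step_1.
  rewrite -/(P y) addrK; set a := P y; set b := P x0; clearbody a b; lra.
move=> sg; rewrite [RHS]key// (Pc (g 0)) (Pc (g 1)); ring.
Qed.

(** The end [b] may precede [a]; the arc is then run backwards. *)
Definition prim_arc (g : R^o -> M) (a b : R) : R := prim (fun t => g (a + (b - a) * step t)).

Lemma arc01 (g : R^o -> M) : smooth_path g -> prim_arc g 0 1 = prim g.
Proof. by move=> sg; rewrite -(prim_step sg); apply: prim_eq => t _; rewrite subr0 mul1r add0r. Qed.

Lemma arc_step (a b t : R) : 0 <= a <= 1 -> 0 <= b <= 1 -> 0 <= a + (b - a) * step t <= 1.
Proof.
move=> ha hb; rewrite (_ : _ + _ = (1 - step t) * a + step t * b); last by ring.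
by apply: mix01 => //; exact: step_01.
Qed.

(** A degenerate triangle inside [g]: the left side of the square is collapsed at [g a] and the
    other three sides are the arcs. *)
Lemma arcD (g : R^o -> M) (a b c : R) : smooth_path g -> 0 <= a <= 1 -> 0 <= b <= 1 -> 0 <= c <= 1 ->
  prim_arc g a b + prim_arc g b c = prim_arc g a c.
Proof.
move=> sg ha hb hc.
pose th (p : R2) : R^o := a + step p.1 * ((b - a) + (c - b) * step p.2).
have sth : Csmooth setT th by smT.
have th01 p : 0 <= th p <= 1.
  rewrite /th (_ : _ + _ = (1 - step p.1) * a + step p.1 * ((1 - step p.2) * b + step p.2 * c)); last by ring.
  by apply: mix01 => //; [apply: mix01 => //; exact: step_01|exact: step_01].
have sides (u : R^o) : 0 <= u <= 1 -> [/\ th (u, 0) = a + (b - a) * step u,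
    th (1, u) = b + (c - b) * step u, th (u, 1) = a + (c - a) * step u & th (0, u) = a].
  by rewrite /th /= !step_1 !step_0; split; ring.
have H := @prim_rank1 g th (fun t => a + (b - a) * step t) (fun t => b + (c - b) * step t)
  (fun t => a + (c - a) * step t) (fun _ => a) sg sth th01 sides.
exact: (etrans H (etrans (f_equal2 +%R erefl (prim_cst (g a))) (addr0 _))).
Qed.

Lemma arc_comp (g : R^o -> M) (k : R^o -> R^o) : smooth_path g -> Csmooth setT k -> (forall t, 0 <= k t <= 1) ->
  prim (fun t => g (k t)) = prim_arc g (k 0) (k 1).
Proof.
move=> sg sk k01; apply: prim_reparam => //; first by smT.
- by move=> t; apply: arc_step.
- by rewrite step_0 mulr0 addr0.
- by rewrite step_1 mulr1; ring.
Qed.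

End reparametrization.

(** * Areas of disks *)

Section disks.
Context {R : realType} {E : tvsType R} {M : manifoldType E}.
Let hR := @scalar_hausdorff R.
Let hRR := prod_hausdorff hR hR.
Local Notation R2 := (R^o * R^o)%type.
Let oT1 := @openT R^o.
Let oT2 := @openT R2.

Lemma gateaux_slice2 (F : tvsType R) (f : R2 -> F) (s t : R^o) :
  gateaux f (s, t) (0, 1) = gateaux (fun y => f (s, y)) t 1.
Proof.
rewrite /gateaux; have -> // : dquot f (s, t) (0, 1) = dquot (fun y => f (s, y)) t 1.
apply/funext => h; rewrite /dquot; congr (_ *: (f _ - _)).
by congr pair; rewrite /= ?scaler0 ?addr0.
Qed.

(* Sweeps the disk by vertical chords, with no singularity at the boundary: the
   integral over the disk becomes the area of a smooth square whose vertical
   sides are constant. *)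
Definition disk_map (p : R2) : R2 := (- cos (pi * p.1), (2 * step p.2 - 1) * sin (pi * p.1)).

Lemma disk_map_smooth : Csmooth setT disk_map.
Proof. by rewrite /disk_map; smT. Qed.

Lemma disk_map_disk p : unit_disk (disk_map p).
Proof.
have /andP[s0 s1] := step_01 (p.2); have e := cos2Dsin2 (pi * p.1).
rewrite /unit_disk /= sqrrN exprMn -[leRHS]e lerD2l -[leRHS]mul1r; apply: ler_wpM2r; first exact: sqr_ge0.
have a0 : 0 <= step p.2 * (1 - step p.2) by rewrite mulr_ge0// subr_ge0.
move: a0; set a := step p.2; rewrite expr2; nra.
Qed.

(** Used to extend a density known near the disk to a continuous function on the plane. Outside the
    disk it is an inversion, as division by the squared norm avoids a square root. *)
Definition retract (p : R2) : R2 :=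
  let m := Num.max 1 (p.1 ^+ 2 + p.2 ^+ 2) in (p.1 / m, p.2 / m).

Lemma retract_id p : unit_disk p -> retract p = p.
Proof.
by case: p => x y; rewrite /unit_disk /retract /= => h; rewrite max_l// !divr1.
Qed.

Lemma retract_disk p : unit_disk (retract p).
Proof.
case: p => x y; rewrite /unit_disk /retract /=; set n := x ^+ 2 + y ^+ 2; set m := Num.max 1 n.
have m1 : 1 <= m by rewrite le_max lexx.
have nm : n <= m by rewrite le_max lexx orbT.
have m0 : 0 < m by exact: lt_le_trans m1.
rewrite !expr_div_n -mulrDl -/n ler_pdivrMr ?exprn_gt0// mul1r expr2.
by rewrite (le_trans nm)// ler_peMr// ltW.
Qed.

Lemma retract_continuous : continuous retract.
Proof.
move=> p; pose n (p : R2) : R^o := p.1 ^+ 2 + p.2 ^+ 2.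
have c1 : {for p, continuous (fun p : R2 => p.1)} by exact: cvg_fst.
have c2 : {for p, continuous (fun p : R2 => p.2)} by exact: cvg_snd.
have cn : {for p, continuous n} by apply: cvgD; apply: cvgM.
have cm : {for p, continuous (fun p => Num.max 1 (n p) : R^o)}.
  by apply: (@continuous_max R^o R2 (fun=> 1) n p) => //; exact: cvg_cst.
have m0 : Num.max 1 (n p) != 0 by rewrite gt_eqF// lt_max ltr01.
have cv : {for p, continuous (fun p => (Num.max 1 (n p))^-1 : R^o)} by exact: cvgV.
apply: (@continuous_pair R2 R^o R^o (fun p => p.1 / Num.max 1 (n p)) (fun p => p.2 / Num.max 1 (n p)) p).
  exact: (cvgM c1 cv).
exact: (cvgM c2 cv).
Qed.

Context {Omega : M -> E -> E -> R^o} (sO : symplectic Omega).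
Let tO : two_form Omega. Proof. by case: sO. Qed.
Local Notation area := (area (Omega := Omega)).
Local Notation pb := (pullback (Omega := Omega)).

(** The derivative of [disk_map] is triangular, and its determinant is exactly the factor in
    [disk_integral_formula]. *)
Lemma disk_integral_area (D : R2 -> M) : smooth_disk D ->
  disk_integral Omega D = area (fun p => D (disk_map p)).
Proof.
move=> [U [oU IU sD]]; pose f (p : R2) : R^o := pb D ((1, 0) : R2) ((0, 1) : R2) p.
have cf : continuous (fun p => f (retract p)).
  move=> p; apply: (@continuous_comp _ _ _ retract f); first exact: retract_continuous.
  apply: (smooth_cont (U := U)); last by apply: IU; exact: retract_disk.
  exact: pullback_smooth.
have -> : disk_integral Omega D = \int[(@lebesgue_measure R \x @lebesgue_measure R)%E]_(p in unit_disk) f (retract p).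
  by apply: eq_Rintegral => p /set_mem hp; rewrite retract_id.
rewrite (disk_integral_formula cf); apply: itg_eq => s _; apply: itg_eq => t _.
rewrite -/(disk_map (s, t)) retract_id; last exact: disk_map_disk.
rewrite (@pullback_comp R E M Omega R2 R2 hRR hRR setT U disk_map D _ _ (s, t) oT2 oU disk_map_smooth sD I); last first.
  by apply: IU; exact: disk_map_disk.
pose th (s : R^o) : R^o := - cos (pi * s).
have sth : Csmooth setT th by rewrite /th; smT.
have s1 : Csmooth setT (fun p : R2 => th p.1) by rewrite /th; smT.
have s2 : Csmooth setT (fun p : R2 => (2 * step p.2 - 1) * sin (pi * p.1) : R^o) by smT.
have e v : gateaux disk_map (s, t) v = (gateaux (fun p : R2 => th p.1) (s, t) v,
   gateaux (fun p : R2 => (2 * step p.2 - 1) * sin (pi * p.1) : R^o) (s, t) v).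
  exact: (gateaux_pair hR hR v s1 s2).
rewrite !e (@pullback_det R E M Omega tO U D _ _ _ _ _ oU sD); last by apply: IU; exact: disk_map_disk.
rewrite !gateaux_fst// mul0r mul1r mulr0 subr0 gateaux_slice2 /f mulrC; congr (_ * _).
have -> : gateaux th s 1 = pi * sin (pi * s).
  apply: dir_unique => //; apply: is_derive_dquot; apply: is_derive_eq; rewrite /GRing.scale/=; ring.
have -> : gateaux (fun y : R^o => (2 * step (s, y).2 - 1) * sin (pi * (s, y).1)) t 1 = 2 * dstep t * sin (pi * s).
  apply: dir_unique => //; apply: is_derive_dquot => /=.
  have d := is_derive_step t.
  have d2 : is_derive (t : R) 1 (fun t : R => sin (pi * s) * (2 * step t - 1)) (sin (pi * s) * (2 * dstep t)).
    by apply: is_derive_eq; rewrite /GRing.scale/=; ring.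
  have -> : (fun y : R => (2 * step y - 1) * sin (pi * s)) = (fun y : R => sin (pi * s) * (2 * step y - 1)).
    by apply/funext => x; rewrite mulrC.
  by rewrite [2 * dstep t * _]mulrC.
ring.
Qed.

End disks.

(** * Construction of disks with prescribed boundary *)

Section disk_theory.
Context {R : realType} {E : tvsType R} {M : manifoldType E}.
Let hR := @scalar_hausdorff R.
Let hRR := prod_hausdorff hR hR.
Local Notation R2 := (R^o * R^o)%type.
Let oT1 := @openT R^o.
Let oT2 := @openT R2.

Lemma circle_disk (t : R) : unit_disk (circle t).
Proof. by rewrite /unit_disk /circle /= cos2Dsin2. Qed.

Lemma circle_smooth : Csmooth setT (circle : R^o -> R2).
Proof. by rewrite /circle; smT. Qed.

Lemma smooth_disk_circle (D : R2 -> M) : smooth_disk D -> smooth_into setT (fun t : R^o => D (circle t)).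
Proof.
move=> [U [oU IU sD]]; apply: (smooth_into_compT hR hRR oU sD circle_smooth) => t.
by apply: IU; exact: circle_disk.
Qed.

(** [al] has arrived at 1 before [be] leaves 0, so the path rests at the junction for [c1 < u < c2]
    and its corner is smoothed out. *)
Lemma concat_smooth (g h : R^o -> M) (al be : R^o -> R^o) (c1 c2 : R) : c1 < c2 ->
  (forall u, c1 < u -> al u = 1) -> (forall u, u < c2 -> be u = 0) ->
  (forall u, 0 <= al u <= 1) -> (forall u, 0 <= be u <= 1) ->
  smooth_into setT (fun u => g (al u)) -> smooth_into setT (fun u => h (be u)) -> g 1 = h 0 ->
  smooth_into setT (fun u : R^o => path_concat g h (al u / 2 + be u / 2)).
Proof.
move=> c12 al1 be0 al01 be01 sg sh gh; apply: smooth_into_local => u _.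
have [uc|uc] := ltP u c2.
  apply: (@smooth_on_open R E M R^o [set u : R^o | u < c2] _ (fun u => g (al u)) u) => //.
  move=> x /= xc; rewrite be0// mul0r addr0 /path_concat.
  have -> : al x / 2 <= 2^-1 by have := al01 x; lra.
  by congr g; field.
apply: (@smooth_on_open R E M R^o [set u : R^o | c1 < u] _ (fun u => h (be u)) u) => //.
  by rewrite /=; lra.
move=> x /= xc; rewrite al1// /path_concat; case: ifPn => hx.
  have -> : be x = 0 by have := be01 x; lra.
  by rewrite -gh; congr g; field.
by congr h; field.
Qed.

(** Together with [plateau], which pauses at 0, 1/2, 3/4 and 1: the corners of
    [path_concat f (path_concat g h)]. One parametrization thus serves loops of two and of three
    pieces. *)
Definition plateau2 (u : R^o) : R^o := step (3 * u - 1) / 2 + step (3 * u - 2) / 2.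
Definition plateau (u : R^o) : R^o := step (3 * u) / 2 + plateau2 u / 2.

Lemma plateau2_01 u : 0 <= plateau2 u <= 1.
Proof.
by rewrite /plateau2; have := step_01 (3 * u - 1); have := step_01 (3 * u - 2); lra.
Qed.

Lemma plateau_01 u : 0 <= plateau u <= 1.
Proof. by rewrite /plateau; have := step_01 (3 * u); have := plateau2_01 u; lra. Qed.

Lemma plateau_smooth : Csmooth setT plateau.
Proof. by rewrite /plateau /plateau2; smT. Qed.

Lemma plateau_homo : {homo plateau : u v / u <= v}.
Proof.
move=> u v uv; rewrite /plateau /plateau2.
have h1 : step (3 * u) <= step (3 * v) by apply: step_homo; lra.
have h2 : step (3 * u - 1) <= step (3 * v - 1) by apply: step_homo; lra.
have h3 : step (3 * u - 2) <= step (3 * v - 2) by apply: step_homo; lra.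
lra.
Qed.

Lemma plateau0 u : u <= 1 / 12 -> plateau u = 0.
Proof. by move=> h; rewrite /plateau /plateau2 !step0 ?mul0r ?addr0 ?mul0r//; lra. Qed.

Lemma plateau1 u : 11 / 12 <= u -> plateau u = 1.
Proof. by move=> h; rewrite /plateau /plateau2 !step1; lra. Qed.

Lemma path_concat_plateau (g h : R^o -> M) : smooth_path g -> smooth_path h -> g 1 = h 0 ->
  smooth_into setT (fun u => path_concat g h (plateau u)).
Proof.
move=> sg sh gh; apply: (@concat_smooth g h (fun u => step (3 * u)) plateau2 (1 / 4) (5 / 12)) => //.
- lra.
- by move=> u hu; apply: step1; lra.
- by move=> u hu; rewrite /plateau2 !step0 ?mul0r ?addr0//; lra.
- by move=> u; exact: step_01.
- by move=> u; exact: plateau2_01.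
- by apply: (smooth_path_comp hR sg); [smT|move=> x; exact: step_01].
- by apply: (smooth_path_comp hR sh); [rewrite /plateau2; smT|move=> x; exact: plateau2_01].
Qed.

Lemma path_concat3_plateau (f g h : R^o -> M) : smooth_path f -> smooth_path g -> smooth_path h ->
  f 1 = g 0 -> g 1 = h 0 -> smooth_into setT (fun u => path_concat f (path_concat g h) (plateau u)).
Proof.
move=> sf sg sh fg gh.
apply: (@concat_smooth f (path_concat g h) (fun u => step (3 * u)) plateau2 (1 / 4) (5 / 12)) => //.
- lra.
- by move=> u hu; apply: step1; lra.
- by move=> u hu; rewrite /plateau2 !step0 ?mul0r ?addr0//; lra.
- by move=> u; exact: step_01.
- by move=> u; exact: plateau2_01.
- by apply: (smooth_path_comp hR sf); [smT|move=> x; exact: step_01].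
- apply: (@concat_smooth g h (fun u => step (3 * u - 1)) (fun u => step (3 * u - 2)) (7 / 12) (3 / 4)) => //.
  + lra.
  + by move=> u hu; apply: step1; lra.
  + by move=> u hu; apply: step0; lra.
  + by move=> u; exact: step_01.
  + by move=> u; exact: step_01.
  + by apply: (smooth_path_comp hR sg); [smT|move=> x; exact: step_01].
  + by apply: (smooth_path_comp hR sh); [smT|move=> x; exact: step_01].
- by rewrite /path_concat mulr0 ifT//; lra.
Qed.

(** On the upper half circle the boundary parameter is a function of the abscissa alone, and
    [theta0] rests at 1 on the lower half. This is the trace on the circle of a disk that separates
    the two coordinates, as in [disk_exists]. *)
Definition sig (t : R^o) : R^o := step (2^-1 - cos (2 * pi * t) / 2).
Definition theta0 (t : R^o) : R^o := if t <= 2^-1 then plateau (sig t) else 1.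

Lemma theta0_01 t : 0 <= theta0 t <= 1.
Proof. by rewrite /theta0; case: ifP => _; rewrite ?plateau_01// ler01 lexx. Qed.

Lemma sig_smooth : Csmooth setT sig.
Proof. by rewrite /sig; smT. Qed.

Lemma sig1 t : cos (2 * pi * t) < - 2^-1 -> sig t = 1.
Proof. by move=> h; rewrite /sig step1//; lra. Qed.

Lemma cos_half : cos (2 * pi * 2^-1) = -1 :> R.
Proof. by rewrite (_ : 2 * pi * 2^-1 = pi) ?cospi//; field. Qed.

Lemma theta0_smooth : Csmooth setT theta0.
Proof.
have ccos : continuous (fun t : R^o => cos (2 * pi * t) : R^o).
  by apply: smoothT_continuous; smT.
have oc : open [set t : R^o | cos (2 * pi * t) < - 2^-1] by have := @open_ltf R R^o _ (- 2^-1) ccos.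
apply: smooth_local => t _; have [t2|t2|t2] := ltgtP t 2^-1.
- exists [set t : R^o | t < 2^-1]; split => //.
  apply: (@smooth_eq R R^o R^o _ (fun t => plateau (sig t)) theta0); first by [].
    by move=> x /= /ltW hx; rewrite /theta0 hx.
  by apply: (smooth_sub (@subsetT _ _)); exact: (smT_comp hR hR hR plateau_smooth sig_smooth).
- exists [set t : R^o | 2^-1 < t]; split => //.
  apply: (@smooth_eq R R^o R^o _ (fun=> 1) theta0); first by [].
    by move=> x /=; rewrite ltNge => /negbTE hx; rewrite /theta0 hx.
  exact: smooth_cst.
- exists [set t : R^o | cos (2 * pi * t) < - 2^-1]; split => //; first by rewrite /= t2 cos_half; lra.
  apply: (@smooth_eq R R^o R^o _ (fun=> 1) theta0); first exact: oc.
    by move=> x /= hx; rewrite /theta0; case: ifP => // _; rewrite sig1// plateau1//; lra.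
  exact: smooth_cst.
Qed.

Lemma theta0_0 : theta0 0 = 0.
Proof.
have h : (0 : R) <= 2^-1 by lra.
by rewrite /theta0 h /sig mulr0 cos0 plateau0// step0//; lra.
Qed.

Lemma theta0_1 : theta0 1 = 1.
Proof.
have h : ((1 : R) <= 2^-1) = false by apply/negbTE; rewrite -ltNge; lra.
by rewrite /theta0 h.
Qed.

Lemma theta0_homo : {in `[0, 1] &, {homo theta0 : s t / s <= t}}.
Proof.
move=> s t; rewrite !in_itv/= => /andP[s0 s1] /andP[t0 t1] st; rewrite {2}/theta0; case: ifP => ht; last first.
  by have /andP[] := theta0_01 s.
have hs : s <= 2^-1 by exact: le_trans ht.
rewrite /theta0 hs; apply: plateau_homo; apply: step_homo.
suff : cos (2 * pi * t) <= cos (2 * pi * s) by lra.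
have p0 : 0 < pi :> R by exact: pi_gt0.
have m (x : R) : 0 <= x -> x <= 2^-1 -> 2 * pi * x \in `[0, pi].
  by move=> x0 x2; rewrite in_itv/=; apply/andP; split; nra.
have [->//|ts] := eqVneq t s.
apply: ltW; rewrite ltr_cos ?m//.
rewrite ltr_pM2l ?mulr_gt0//; rewrite lt_neqAle st eq_sym ts//.
Qed.

Lemma disk_exists (l : R^o -> M) : @trivial_pi R 1 M -> smooth_into setT (fun u => l (plateau u)) -> l 0 = l 1 ->
  exists D : R2 -> M, smooth_disk D /\ forall t : R, 0 <= t <= 1 -> D (circle t) = l (theta0 t).
Proof.
move=> pi1M sl l01.
have lx u : u <= 1 / 12 \/ 11 / 12 <= u -> l (plateau u) = l 0 by move=> [h|h]; [rewrite plateau0|rewrite plateau1].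
have [S [sS Sx Sl]] := loop_square pi1M sl lx.
(* On the circle, if the abscissa is less than 1/2 in absolute value then the ordinate exceeds 1/2
   in absolute value, and the first [step] is exactly 0 or 1. Otherwise the second [step] is exactly
   0 or 1, where [S] is the base point. *)
exists (fun p => S (step (2^-1 + p.2 / 2), step (2^-1 - p.1 / 2))); split.
  exists setT; split => //; apply: (smooth_into_compT hRR hRR oT2 sS) => //; smT.
move=> t /andP[t0 t1]; rewrite /circle /=.
set x := cos _; set y := sin _.
have e : x ^+ 2 + y ^+ 2 = 1 by exact: cos2Dsin2.
have p0 : 0 < pi :> R by exact: pi_gt0.
have [t2|t2] := leP t 2^-1.
  have y0 : 0 <= y by apply: sin_ge0_pi; apply/andP; split; nra.
  rewrite /theta0 t2 /sig -/x.
  have [xl|xl] := leP x (- 2^-1).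
    have -> : step (2^-1 - x / 2) = 1 :> R by apply: step1; lra.
    by rewrite Sx ?plateau1//; [lra|right; right; lra].
  have [xr|xr] := leP 2^-1 x.
    have -> : step (2^-1 - x / 2) = 0 :> R by apply: step0; lra.
    by rewrite Sx ?(@plateau0 0)//; right; left; lra.
  have -> : step (2^-1 + y / 2) = 1 :> R by apply: step1; nra.
  by rewrite Sl//; lra.
have y0 : y <= 0.
  rewrite /y (_ : 2 * pi * t = 2 * pi * t - pi + pi); last by rewrite subrK.
  rewrite sinDpi oppr_le0; apply: sin_ge0_pi; apply/andP; split; nra.
have -> : theta0 t = 1 by rewrite /theta0 leNgt t2.
rewrite -l01.
have [xl|xl] := leP x (- 2^-1).
  have -> : step (2^-1 - x / 2) = 1 :> R by apply: step1; lra.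
  by rewrite Sx//; right; right; lra.
have [xr|xr] := leP 2^-1 x.
  have -> : step (2^-1 - x / 2) = 0 :> R by apply: step0; lra.
  by rewrite Sx//; right; left; lra.
have -> : step (2^-1 + y / 2) = 0 :> R by apply: step0; nra.
by rewrite Sx//; left; lra.
Qed.

End disk_theory.

Opaque prim_arc.

(** * Disk integrals as values of [prim] on the boundary *)

Section disk_values.
Context {R : realType} {E : tvsType R} {M : manifoldType E}.
Let hR := @scalar_hausdorff R.
Let hRR := prod_hausdorff hR hR.
Local Notation R2 := (R^o * R^o)%type.
Let oT1 := @openT R^o.
Let oT2 := @openT R2.
Context {Omega : M -> E -> E -> R^o} (sO : symplectic Omega).
Context (pi1M : @trivial_pi R 1 M) (pi2M : @trivial_pi R 2 M).
Context (x0 : M) (kp : M -> R^o -> M).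
Context (kp_smooth : forall y, smooth_path (kp y)) (kp0 : forall y, kp y 0 = x0) (kp1 : forall y, kp y 1 = y).
Local Notation prim := (@prim R E M Omega x0 kp).
Local Notation prim_arc := (@prim_arc R E M Omega x0 kp).
Let area_primE := area_prim sO pi1M pi2M kp_smooth kp0 kp1.
Let prim_cstE := prim_cst sO pi1M pi2M kp_smooth kp0 kp1.
Let prim_stepE := prim_step sO pi1M pi2M kp_smooth kp0 kp1.
Let arcDE := arcD sO pi1M pi2M kp_smooth kp0 kp1.
Let arc01E := arc01 sO pi1M pi2M kp_smooth kp0 kp1.
Let arc_compE := arc_comp sO pi1M pi2M kp_smooth kp0 kp1.

Lemma arc_eq (g h : R^o -> M) (a b : R) : (forall t, 0 <= t <= 1 -> g (a + (b - a) * step t) = h (step t)) ->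
  smooth_path h -> prim_arc g a b = prim h.
Proof.
move=> gh sh; rewrite -(prim_stepE sh); exact: prim_eq.
Qed.

Lemma disk_arith (R' : realType) (dI b r t l lo hi c : R') : dI = b + r - t - l -> r = 0 -> l = 0 ->
  b = hi -> t = c - lo -> c = 0 -> dI = lo + hi.
Proof. by lra. Qed.

(** In the square swept by [disk_map], the bottom is the lower half circle, that is the arc from 1/2
    to 1. The top is the upper half circle run backwards, from 1/2 to 0, and the vertical sides are
    points. *)
Lemma disk_integral_prim (D : R2 -> M) : smooth_disk D ->
  disk_integral Omega D = prim (fun t => D (circle t)).
Proof.
move=> sD; have sg := smoothT_path (smooth_disk_circle sD).
set g := fun t : R^o => D (circle t) in sg *.
have sS : smooth_into setT (fun p : R2 => D (disk_map p)).
  have [U [oU IU sU]] := sD.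
  by apply: (smooth_into_compT hRR hRR oU sU disk_map_smooth) => p; apply: IU; exact: disk_map_disk.
have I0 : 0 <= (0 : R) <= 1 by rewrite lexx ler01.
have I1 : 0 <= (1 : R) <= 1 by rewrite lexx ler01.
have Ih : 0 <= (2^-1 : R) <= 1 by lra.
have sb (phi : R^o -> R2) : Csmooth setT phi -> smooth_path (fun u => D (disk_map (phi u))).
  by move=> sphi; apply: smoothT_path; apply: (smooth_into_compT hR hRR oT2 sS).
have eb : prim (fun s => D (disk_map (s, 0))) = prim_arc g 2^-1 1.
  symmetry; apply: arc_eq; last by apply: sb; smT.
  move=> t _; rewrite /g /circle /disk_map /= step_0 mulr0 sub0r mulN1r.
  have -> : 2 * pi * (2^-1 + (1 - 2^-1) * step t) = pi * step t + pi :> R by field.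
  by rewrite cosDpi sinDpi.
have et : prim (fun s => D (disk_map (s, 1))) = prim_arc g 2^-1 0.
  symmetry; apply: arc_eq; last by apply: sb; smT.
  move=> t _; rewrite /g /circle /disk_map /= step_1 mulr1.
  have -> : 2 * pi * (2^-1 + (0 - 2^-1) * step t) = - (pi * step t) + pi :> R by field.
  rewrite cosDpi sinDpi cosN sinN opprK; congr (D (_, _)); rewrite -[LHS]mul1r; congr (_ * _); lra.
have er : prim (fun t => D (disk_map (1, t))) = 0.
  apply: etrans (prim_cstE (D (1, 0))); apply: prim_eq => t _.
  by rewrite /disk_map /= mulr1 cospi sinpi mulr0 opprK.
have el : prim (fun t => D (disk_map (0, t))) = 0.
  apply: etrans (prim_cstE (D (-1, 0))); apply: prim_eq => t _.
  by rewrite /disk_map /= mulr0 cos0 sin0 mulr0.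
have ec : prim_arc g 2^-1 2^-1 = 0.
  apply: etrans (prim_cstE (g 2^-1)); apply: prim_eq => t _; congr g; ring.
have e1 : prim_arc g 2^-1 0 = prim_arc g 2^-1 2^-1 - prim_arc g 0 2^-1.
  exact: (canRL (addrK _) (arcDE sg Ih I0 Ih)).
apply: (etrans (disk_arith (etrans (disk_integral_area sO sD) (area_primE sS)) er el eb (etrans et e1) ec)).
exact: (etrans (arcDE sg I0 Ih I1) (arc01E sg)).
Qed.

(* The value of [prim] on smooth reparametrizations of l, for l only piecewise
   smooth. *)
Definition traverses (l : R -> M) (v : R) := forall (c : R^o -> M) (th : R^o -> R^o),
  smooth_into setT c -> Csmooth setT th -> {homo th : s t / s <= t} -> (forall t, 0 <= th t <= 1) ->
  th 0 = 0 -> th 1 = 1 -> (forall t, c t = l (th t)) -> prim c = v.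

Lemma traverses_path (g : R^o -> M) : smooth_path g -> traverses g (prim g).
Proof.
move=> sg c th sc sth _ th01 t0 t1 cl.
have -> : prim c = prim (fun t => g (th t)) by apply: prim_eq => t _.
by apply: (etrans (arc_compE sg sth th01)); rewrite t0 t1; exact: arc01E.
Qed.

Lemma ivt01 (th : R^o -> R^o) : Csmooth setT th -> th 0 = 0 -> th 1 = 1 ->
  exists2 t1 : R, 0 <= t1 <= 1 & th t1 = 2^-1.
Proof.
move=> sth t0 t1; have cth := smoothT_continuous sth.
have [||c] := @IVT R (th : R -> R) 0 1 2^-1 ler01; last by rewrite in_itv; exists c.
- by apply: continuous_subspaceT => x; exact: cth.
- by rewrite t0 t1 min_l ?max_r ?ler01//; lra.
Qed.

(** The path is cut at a time [a] where [th] equals 1/2. Monotonicity keeps each part of [th] in its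
    own half, so that after doubling it parametrizes [g] or [h] alone. *)
Lemma traverses_concat (g h : R^o -> M) v w : traverses g v -> traverses h w -> g 1 = h 0 ->
  traverses (path_concat g h) (v + w).
Proof.
move=> gv hw gh c th sc sth hth th01 t0 t1 cl.
have [a /andP[a0 a1] tha] := ivt01 sth t0 t1.
have sp := smoothT_path sc.
have I0 : 0 <= (0 : R) <= 1 by rewrite lexx ler01.
have I1 : 0 <= (1 : R) <= 1 by rewrite lexx ler01.
have Ia : 0 <= a <= 1 by rewrite a0.
have k01 (x y t : R) : x <= y -> x <= x + (y - x) * step t <= y.
  by move=> xy; have /andP[] := step_01 t; move: (step t : R) => s s0 s1; apply/andP; split; nra.
rewrite -(arc01E sp) -(arcDE sp I0 Ia I1).
have scomp (x y : R) : Csmooth setT (fun t : R^o => x + (y - x) * step t : R^o) by smT.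
have sck (x y : R) : smooth_into setT (fun t : R^o => c (x + (y - x) * step t)).
  exact: (smooth_into_compT hR hR oT1 sc (scomp x y)).
have sthk (x y : R) : Csmooth setT (fun t : R^o => th (x + (y - x) * step t) : R^o).
  exact: (smT_comp hR hR hR sth (scomp x y)).
have hk (x y : R) : x <= y -> {homo (fun t : R => x + (y - x) * step t) : s t / s <= t}.
  by move=> xy s t st; rewrite lerD2l ler_wpM2l ?subr_ge0//; exact: step_homo.
congr (_ + _).
- apply: (gv _ (fun t => 2 * th (0 + (a - 0) * step t)) (sck 0 a)).
  + apply: (@smT_mul R R^o hR (fun=> 2) (fun t => th (0 + (a - 0) * step t))); last exact: sthk.
    exact: smT_cst.
  + by move=> s t st; rewrite ler_pM2l//; apply: hth; exact: hk.
  + move=> t; have /andP[h0 h1] := k01 0 a t a0.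
    have := hth _ _ h1; rewrite tha; have /andP[] := th01 (0 + (a - 0) * step t); lra.
  + by rewrite step_0 mulr0 addr0 t0 mulr0.
  + by rewrite step_1 mulr1 add0r subr0 tha divff.
  + move=> t; rewrite cl /path_concat; have /andP[h0 h1] := k01 0 a t a0.
    by have := hth _ _ h1; rewrite tha => ->.
- apply: (hw _ (fun t => 2 * th (a + (1 - a) * step t) - 1) (sck a 1)).
  + apply: (@smT_add R R^o hR (fun t => 2 * th (a + (1 - a) * step t)) (fun=> -1)); last exact: smT_cst.
    apply: (@smT_mul R R^o hR (fun=> 2) (fun t => th (a + (1 - a) * step t))); last exact: sthk.
    exact: smT_cst.
  + by move=> s t st; rewrite lerD2r ler_pM2l//; apply: hth; exact: hk.
  + move=> t; have /andP[h0 h1] := k01 a 1 t a1.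
    have := hth _ _ h0; rewrite tha; have /andP[] := th01 (a + (1 - a) * step t); lra.
  + by rewrite step_0 mulr0 addr0 tha divff// subrr.
  + by rewrite step_1 mulr1 [a + _]addrC subrK t1; lra.
  + move=> t; rewrite cl /path_concat; have /andP[h0 h1] := k01 a 1 t a1.
    case: ifPn => // hh; have -> : th (a + (1 - a) * step t) = 2^-1.
      by apply/eqP; rewrite eq_le hh -tha; exact: hth.
    by rewrite divff// subrr.
Qed.

Lemma disk_integral_boundary (D : R2 -> M) (l : R -> M) v : smooth_disk D -> disk_boundary D l ->
  traverses l v -> disk_integral Omega D = v.
Proof.
move=> sD [th [[U [oU IU] sth] hth [t0 t1] Dl]] lv.
rewrite disk_integral_prim//; have sg := smooth_disk_circle sD.
(* The parameter [th] is controlled only on and near [[0, 1]]; composed with [step] it becomes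
   smooth and monotone on the line, as [traverses] requires. *)
rewrite -(prim_stepE (smoothT_path sg)).
have sI (t : R) : step t \in `[0, 1] by rewrite in_itv/= step_01.
apply: (lv _ (fun t => th (step t))).
- by apply: (smooth_into_compT hR hR oT1 sg) => //; smT.
- apply: (@smooth_comp R R^o R^o R^o hR hR hR U setT (step : R^o -> R^o) th oT1 oU _ step_smooth sth).
  by move=> t _; apply: IU; exact: sI.
- by move=> s t st; apply: hth => //; exact: step_homo.
- move=> t; have := hth 0 (step t); have := hth (step t) 1; rewrite t0 t1 !in_itv/= !lexx !ler01 !step_01 => h1 h2.
  by have /andP[s0 s1] := step_01 t; rewrite h1// h2.
- by rewrite step_0.
- by rewrite step_1.
- by move=> t; rewrite Dl ?step_01.
Qed.

End disk_values.

(** * Squares in the group *)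

Section chain_rules.
Context {R : realType} {E E' : tvsType R} {M : manifoldType E} {N : manifoldType E'}.
Let hE : hausdorff_space E := @model_hausdorff R E M.

Lemma partial_map (A : tvsType R) (hA : hausdorff_space A) (U : set A) (f : M -> N) (S : A -> M) a v :
  open U -> smooth_map f -> smooth_into U S -> U a ->
  partial (fun x => f (S x)) a v = tangent_map f (S a) (partial S a v).
Proof.
move=> oU sf [cS sS] Ua; rewrite /tangent_map {2}/partial.
set c : chart E M := chart_at (S a); have ac : atlas c := chart_at_atlas _.
have oW : open (U `&` S @^-1` chart_dom c) by apply: open_pre => //; exact: open_chart_dom.
have Wa : (U `&` S @^-1` chart_dom c) a by split => //; exact: chart_at_dom.
rewrite (@partial_eq R E' N A _ _ (fun x => (f \o chart_inv c) ((c \o S) x)) a v oW Wa); last first.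
  by move=> x [_ Sx] /=; rewrite chart_funK.
apply: (@partial_comp R E' N A E hA hE _ _ (c \o S) (f \o chart_inv c) a v oW (open_chart_img c) (sS c ac) (sf c ac) Wa).
by apply: chart_funS; exact: chart_at_dom.
Qed.

Lemma smooth_fun_comp (A : tvsType R) (hA : hausdorff_space A) (U : set A) (f : M -> R^o) (S : A -> M) :
  open U -> smooth_fun f -> smooth_into U S -> Csmooth U (fun x => f (S x)).
Proof.
move=> oU sf [cS sS]; apply: smooth_local => a Ua.
pose c : chart E M := chart_at (S a); have ac : atlas c := chart_at_atlas _.
have oW : open (U `&` S @^-1` chart_dom c) by apply: open_pre => //; exact: open_chart_dom.
exists (U `&` S @^-1` chart_dom c); split => //; first by split => //; exact: chart_at_dom.
apply: (@smooth_eq R A R^o _ (fun x => (f \o chart_inv c) ((c \o S) x))) => //.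
  by move=> x [_ Sx] /=; rewrite chart_funK.
apply: (@smooth_comp R A E R^o hA hE (@scalar_hausdorff R) (chart_img c) _ (c \o S) (f \o chart_inv c)) => //.
- exact: open_chart_img.
- by move=> x [_ Sx]; exact: chart_funS.
- exact: sS.
- exact: sf.
Qed.

Lemma gateaux_fun (A : tvsType R) (hA : hausdorff_space A) (U : set A) (f : M -> R^o) (S : A -> M) a v :
  open U -> smooth_fun f -> smooth_into U S -> U a ->
  gateaux (fun x => f (S x)) a v = dfun f (S a) (partial S a v).
Proof.
move=> oU sf [cS sS] Ua; rewrite /dfun /partial.
set c : chart E M := chart_at (S a); have ac : atlas c := chart_at_atlas _.
have oW : open (U `&` S @^-1` chart_dom c) by apply: open_pre => //; exact: open_chart_dom.
have Wa : (U `&` S @^-1` chart_dom c) a by split => //; exact: chart_at_dom.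
rewrite (@dir_eq R A R^o _ (fun x => f (S x)) (fun x => (f \o chart_inv c) ((c \o S) x)) a v oW Wa); last first.
  by move=> x [_ Sx] /=; rewrite chart_funK.
apply: (@gateaux_comp R A E R^o hA hE (@scalar_hausdorff R) _ _ (c \o S) (f \o chart_inv c) a v oW (open_chart_img c) (sS c ac) (sf c ac) Wa).
by apply: chart_funS; exact: chart_at_dom.
Qed.

End chain_rules.

(** * Mixed partial derivatives with moving frames *)

Section slices.
Context {R : realType} {E : tvsType R} {M : manifoldType E}.
Let hE : hausdorff_space E := @model_hausdorff R E M.
Let hR := @scalar_hausdorff R.
Let hRR := prod_hausdorff hR hR.
Let h4 := prod_hausdorff hRR hRR.
Local Notation R2 := (R^o * R^o)%type.
Local Notation R4 := (R2 * R2)%type.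
Let oT1 := @openT R^o.
Let oT2 := @openT R2.
Let oT4 := @openT R4.

Lemma dquot_slice1 (F : tvsType R) (f : R2 -> F) (s t : R^o) :
  dquot f (s, t) (1, 0) = dquot (fun x => f (x, t)) s 1.
Proof.
apply/funext => h; rewrite /dquot; congr (_ *: (f _ - _)).
by congr pair; rewrite /= ?scaler0 ?addr0.
Qed.

Lemma dquot_slice2 (F : tvsType R) (f : R2 -> F) (s t : R^o) :
  dquot f (s, t) (0, 1) = dquot (fun y => f (s, y)) t 1.
Proof.
apply/funext => h; rewrite /dquot; congr (_ *: (f _ - _)).
by congr pair; rewrite /= ?scaler0 ?addr0.
Qed.

Lemma gateaux_slice1 (F : tvsType R) (f : R2 -> F) (s t : R^o) :
  gateaux f (s, t) (1, 0) = gateaux (fun x => f (x, t)) s 1.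
Proof. by rewrite /gateaux dquot_slice1. Qed.

Lemma partial_slice1 (S : R2 -> M) (s t : R^o) :
  partial S (s, t) (1, 0) = partial (fun x => S (x, t)) s 1.
Proof. exact: gateaux_slice1. Qed.

Lemma partial_slice2 (S : R2 -> M) (s t : R^o) :
  partial S (s, t) (0, 1) = partial (fun y => S (s, y)) t 1.
Proof. exact: gateaux_slice2. Qed.

Lemma dquot_addc (F : tvsType R) (f : R^o -> F) (b : F) (s : R^o) : dquot (fun x => b + f x) s 1 = dquot f s 1.
Proof. by apply/funext => h; rewrite /dquot opprD addrACA subrr add0r. Qed.

(* F p = Phi ((p.2, p.1), p) is constant on the two axes through (s0, t0), so that
   its two first derivatives there differ from the two displayed ones by
   constants, and the symmetry of the second derivative of F applies. *)
Lemma mixed_swap (Phi : R4 -> M) (e : M) (s0 t0 : R^o) : smooth_into setT Phi ->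
  (forall u s s', Phi ((u, s), (s, t0)) = Phi ((u, s'), (s', t0))) ->
  (forall u t t', Phi ((t, u), (s0, t)) = Phi ((t', u), (s0, t'))) ->
  (forall s, Phi ((t0, s), (s, t0)) = e) -> (forall t, Phi ((t, s0), (s0, t)) = e) ->
  dquot (fun t => partial (fun p => Phi ((t, s0), p)) (s0, t) (1, 0)) t0 1 h @[h --> 0^'] -->
    gateaux (fun s => partial (fun p => Phi ((t0, s), p)) (s, t0) (0, 1)) s0 1.
Proof.
move=> sP P1 P2 Pe1 Pe2.
pose F (p : R2) : M := Phi ((p.2, p.1), p).
have sphi : Csmooth setT (fun p : R2 => ((p.2, p.1), p) : R4) by smT.
have sF : smooth_into setT F by exact: (smooth_into_compT hRR h4 oT4 sP sphi).
have smk (A : tvsType R) (hA : hausdorff_space A) (k : A -> R4) a v : Csmooth setT k ->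
    partial (fun x => Phi (k x)) a v = partial Phi (k a) (gateaux k a v).
  by move=> sk; exact: (@partial_comp R E M A R4 hA h4 setT setT k Phi a v (@openT _) oT4 sk sP I I).
have split4 (q a b : R4) : partial Phi q (a + b) = partial Phi q a + partial Phi q b.
  exact: (partialD h4 a b oT4 sP I).
have DF s t v : partial F (s, t) v = partial Phi ((t, s), (s, t)) ((v.2, v.1), v).
  rewrite (smk R2 hRR (fun p : R2 => ((p.2, p.1), p)) (s, t) v sphi); congr (partial Phi _ _).
  by rewrite (@gateaux_lin R R2 R4 h4 (fun p : R2 => ((p.2, p.1), p)) (s, t) v).
have D2 r s t v : partial Phi (r, (s, t)) (0, v) = partial (fun p => Phi (r, p)) (s, t) v.
  rewrite (smk R2 hRR (fun p : R2 => (r, p)) (s, t) v); last by apply: smT_pair => //; [exact: smooth_cst|exact: smT_id].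
  congr (partial Phi _ _); rewrite (@gateaux_pair R R2 R2 R2 hRR hRR setT (fun=> r) id (s, t) v) ?gateaux_cst ?gateaux_id//.
    exact: smooth_cst.
  exact: smooth_id.
have Ft s : partial F (s, t0) (0, 1) = partial (fun u => Phi ((u, s0), (s0, t0))) t0 1
    + partial (fun p => Phi ((t0, s), p)) (s, t0) (0, 1).
  rewrite DF /= (_ : ((1, 0), (0, 1)) = ((1, 0), (0, 0)) + ((0, 0), (0, 1)) :> R4); last first.
    by congr pair; congr pair; rewrite /= ?addr0 ?add0r.
  rewrite split4 (D2 (t0, s) s t0 (0, 1)); congr (_ + _).
  rewrite (_ : (fun u => _) = (fun u : R^o => Phi ((u, s), (s, t0)))); last by apply/funext => u; exact: P1.
  have sk : Csmooth setT (fun u : R^o => ((u, s), (s, t0)) : R4) by smT.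
  rewrite (smk R^o hR (fun u : R^o => ((u, s), (s, t0))) t0 1 sk); congr (partial Phi _ _).
  rewrite (@gateaux_pair R R^o R2 R2 hRR hRR setT (fun u : R^o => (u, s)) (fun=> (s, t0)) t0 1) ?gateaux_cst//; try by smT.
  by rewrite (@gateaux_pair R R^o R^o R^o hR hR setT id (fun=> s) t0 1) ?gateaux_cst ?gateaux_id//; smT.
have Fs t : partial F (s0, t) (1, 0) = partial (fun u => Phi ((t0, u), (s0, t0))) s0 1
    + partial (fun p => Phi ((t, s0), p)) (s0, t) (1, 0).
  rewrite DF /= (_ : ((0, 1), (1, 0)) = ((0, 1), (0, 0)) + ((0, 0), (1, 0)) :> R4); last first.
    by congr pair; congr pair; rewrite /= ?addr0 ?add0r.
  rewrite split4 (D2 (t, s0) s0 t (1, 0)); congr (_ + _).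
  rewrite (_ : (fun u => _) = (fun u : R^o => Phi ((t, u), (s0, t)))); last by apply/funext => u; exact: P2.
  have sk : Csmooth setT (fun u : R^o => ((t, u), (s0, t)) : R4) by smT.
  rewrite (smk R^o hR (fun u : R^o => ((t, u), (s0, t))) s0 1 sk); congr (partial Phi _ _).
  rewrite (@gateaux_pair R R^o R2 R2 hRR hRR setT (fun u : R^o => (t, u)) (fun=> (s0, t)) s0 1) ?gateaux_cst//; try by smT.
  by rewrite (@gateaux_pair R R^o R^o R^o hR hR setT (fun=> t) id s0 1) ?gateaux_cst ?gateaux_id//; smT.
(* Along the two axes [F] takes the value [e], so the preferred chart in which [partial] is read
   does not change there. *)
pose c : chart E M := chart_at e; have ac : atlas c := chart_at_atlas _.
have [cF sFc] := sF.
have oV : open (setT `&` F @^-1` chart_dom c) by apply: open_pre => //; exact: open_chart_dom.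
have sf := sFc c ac; set V := _ `&` _ in oV sf.
have Vst : V (s0, t0) by split => //; rewrite /= /F /= Pe1; exact: chart_at_dom.
have G1 : (fun s => partial F (s, t0) (0, 1)) = (fun s => gateaux (c \o F) (s, t0) (0, 1)).
  by apply/funext => s; rewrite /partial {1}/F /= Pe1.
have G2 : (fun t => partial F (s0, t) (1, 0)) = (fun t => gateaux (c \o F) (s0, t) (1, 0)).
  by apply/funext => t; rewrite /partial {1}/F /= Pe2.
have -> : gateaux (fun s => partial (fun p => Phi ((t0, s), p)) (s, t0) (0, 1)) s0 1 =
    gateaux (fun p => gateaux (c \o F) p (1, 0)) (s0, t0) (0, 1).
  rewrite -(@gateaux_sym R R2 E hE hRR V (c \o F) (s0, t0) (0, 1) (1, 0) oV sf Vst) gateaux_slice1 -G1.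
  by rewrite (funext Ft) /gateaux dquot_addc.
have := @smooth_dquot R R2 E V _ (s0, t0) (0, 1) (smooth_gateaux_at hRR hE (1, 0) oV sf) Vst.
by rewrite dquot_slice2 -G2 (funext Fs) dquot_addc.
Qed.

End slices.

Transparent area pullback.

Lemma orbit_area_arith (R : realType) (a b l s r t : R) :
  r - l = t - b + a -> a = b + r - t - l.
Proof. by lra. Qed.

Section group_squares.
Context {R : realType} {E F : tvsType R} {G : lieGroupType E} {X : manifoldType F}.
Let hE : hausdorff_space E := @model_hausdorff R E G.
Let hF : hausdorff_space F := @model_hausdorff R F X.
Let hR := @scalar_hausdorff R.
Let hRR := prod_hausdorff hR hR.
Let h4 := prod_hausdorff hRR hRR.
Local Notation R2 := (R^o * R^o)%type.
Local Notation R4 := (R2 * R2)%type.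
Let oT1 := @openT R^o.
Let oT2 := @openT R2.
Let oT4 := @openT R4.
Context {Omega : X -> F -> F -> R^o} (tO : two_form Omega).
Context {act : G -> X -> X} {mu : E -> X -> R^o}.
Context (sA : smooth_action act) (mm : moment_map act Omega mu).
Local Notation area := (area (Omega := Omega)).

Lemma smooth_into_mul (A : tvsType R) (hA : hausdorff_space A) (U : set A) (f g : A -> G) : open U ->
  smooth_into U f -> smooth_into U g -> smooth_into U (fun x => f x * g x)%g.
Proof.
by move=> oU sf sg; apply: (@smooth_into_map2 R A E E E hA G G G U (fun x y => x * y)%g f g oU) => //; exact: smooth_mulg.
Qed.

Lemma smooth_into_inv (A : tvsType R) (hA : hausdorff_space A) (U : set A) (f : A -> G) : open U ->
  smooth_into U f -> smooth_into U (fun x => (f x)^-1)%g.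
Proof.
by move=> oU sf; apply: (@smooth_into_map R A E E hA G G U (fun x => x^-1)%g f oU) => //; exact: smooth_invg.
Qed.

Lemma smooth_into_act (A : tvsType R) (hA : hausdorff_space A) (U : set A) (f : A -> G) (S : A -> X) : open U ->
  smooth_into U f -> smooth_into U S -> smooth_into U (fun x => act (f x) (S x)).
Proof.
case: sA => sa _ _ oU sf sS.
exact: (@smooth_into_map2 R A E F F hA G X X U act f S oU sa sf sS).
Qed.

Lemma smooth_map_act (g : G) : smooth_map (act g).
Proof.
move=> c ac; apply: (smooth_into_act hF (open_chart_img c)).
- exact: smooth_into_cst.
- exact: chart_inv_smooth.
Qed.

Lemma smooth_map_conj (g : G) : smooth_map (fun h : G => g * h * g^-1)%g.
Proof.
move=> c ac; have oc := open_chart_img c.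
apply: (smooth_into_mul hE oc); last exact: smooth_into_cst.
apply: (smooth_into_mul hE oc); first exact: smooth_into_cst.
exact: chart_inv_smooth.
Qed.

Lemma muD v w x : mu (v + w) x = mu v x + mu w x.
Proof. by case: mm => h _ _ _ _; rewrite -{1}[v]scale1r h scale1r. Qed.

Lemma mu0 x : mu 0 x = 0.
Proof. by apply: (addrI (mu 0 x)); rewrite -muD !addr0. Qed.

Lemma muZ a v x : mu (a *: v) x = a *: mu v x.
Proof. by case: mm => h _ _ _ _; rewrite -[a *: v]addr0 h mu0 addr0. Qed.

Lemma muB v w x : mu (v - w) x = mu v x - mu w x.
Proof. by rewrite muD -scaleN1r muZ scaleN1r. Qed.

Lemma mu_cvg (T : Type) (f : set_system T) (FF : Filter f) (Y : T -> E) (S : T -> X) (v : E) (x : X) :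
  Y @ f --> v -> S @ f --> x -> (fun t => mu (Y t) (S t)) @ f --> mu v x.
Proof.
move=> Yv Sx; case: mm => _ _ cm _ _.
have L : (fun t => (Y t, S t)) @ f --> (v, x) by exact: cvg_pair.
exact: (cvg_comp _ _ L (cm (v, x))).
Qed.

Lemma mu_continuous (T : topologicalType) (Y : T -> E) (S : T -> X) :
  continuous Y -> continuous S -> continuous (fun t => mu (Y t) (S t)).
Proof. by move=> cY cS t; apply: mu_cvg; [exact: cY|exact: cS]. Qed.

Lemma mu_dquot_l (Y : R^o -> E) (x : X) (t : R^o) l : dquot Y t 1 h @[h --> 0^'] --> l ->
  dquot (fun t => mu (Y t) x) t 1 h @[h --> 0^'] --> mu l x.
Proof.
move=> dY; have cx : (fun _ : R^o => x) h @[h --> (0 : R^o)^'] --> x by exact: cvg_cst.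
have L : (fun h => mu (dquot Y t 1 h) x) h @[h --> (0 : R^o)^'] --> mu l x by exact: (mu_cvg _ dY cx).
apply: (cvg_eqnear0 L); near=> h.
by rewrite /dquot muZ muB.
Unshelve. all: by end_near. Qed.

(** The increment is split into one of [Y] at the moved point and one of [S] for fixed [Y t]. Joint
    continuity of [mu] handles the first, smoothness of [mu (Y t)] the second. *)
Lemma mu_dquot (Y : R^o -> E) (S : R^o -> X) (t : R^o) : Csmooth setT Y -> smooth_into setT S ->
  dquot (fun t => mu (Y t) (S t)) t 1 h @[h --> 0^'] -->
    mu (gateaux Y t 1) (S t) + dfun (mu (Y t)) (S t) (partial S t 1).
Proof.
move=> sY sS; have [_ smu _ _ _] := mm.
have dY := @smooth_dquot R R^o E setT Y t 1 sY I.
have sf := smooth_fun_comp hR oT1 (smu (Y t)) sS.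
have dS := @smooth_dquot R R^o R^o setT _ t 1 sf I.
rewrite (gateaux_fun hR 1 oT1 (smu (Y t)) sS I) in dS.
have cS : S (t + h *: (1 : R^o)) @[h --> (0 : R^o)^'] --> S t.
  have c0 : (t + h *: (1 : R^o)) @[h --> (0 : R^o)] --> t + 0 *: (1 : R^o).
    by apply: cvg_addT; [exact: cvg_cst|apply: cvg_scaleT; [exact: cvg_id|exact: cvg_cst]].
  rewrite scale0r addr0 in c0.
  have c1 : S (t + h *: (1 : R^o)) @[h --> (0 : R^o)] --> S t.
    exact: (cvg_comp _ _ c0 (smooth_into_cont sS (x := t))).
  by move=> N nN; apply: nbhs_dnbhs; exact: c1 nN.
have L : (fun h => mu (dquot Y t 1 h) (S (t + h *: (1 : R^o))) + dquot (fun x => mu (Y t) (S x)) t 1 h) h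
    @[h --> (0 : R^o)^'] --> mu (gateaux Y t 1) (S t) + dfun (mu (Y t)) (S t) (partial S t 1).
  by apply: cvg_addT; [exact: (mu_cvg _ dY cS)|exact: dS].
apply: (cvg_eqnear0 L); near=> h.
rewrite {2}/dquot muZ muB -scalerDr /dquot; congr (_ *: _).
by rewrite addrA subrK.
Unshelve. all: by end_near. Qed.

(** The right logarithmic derivative of [H] in the direction [v], of which [log_velocity] is the
    one-parameter case. *)
Definition logv (A : tvsType R) (H : A -> G) (v p : A) : E := partial (fun q => H q * (H p)^-1)%g p v.

Lemma logv_smooth (A : tvsType R) (hA : hausdorff_space A) (U : set A) (H : A -> G) (v : A) : open U ->
  smooth_into U H -> Csmooth U (logv H v).
Proof.
move=> oU sH; have hAA := prod_hausdorff hA hA; pose Psi (z : (A * A)%type) : G := (H z.1 * (H z.2)^-1)%g.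
have oUU : open (U `*` U) by exact: open_setX.
have sPsi : smooth_into (U `*` U) Psi.
  apply: (smooth_into_mul hAA oUU).
    by apply: (smooth_into_comp hAA hA oU oUU _ _ sH) => [[a b] []//|]; exact: smooth_fst.
  apply: (smooth_into_inv hAA oUU).
  by apply: (smooth_into_comp hAA hA oU oUU _ _ sH) => [[a b] []//|]; exact: smooth_snd.
have [cP sP] := sPsi; pose c : chart E G := chart_at 1%g; have ac : atlas c := chart_at_atlas _.
have oV : open ((U `*` U) `&` Psi @^-1` chart_dom c) by apply: open_pre => //; exact: open_chart_dom.
have sf := sP c ac; set V := _ `&` _ in oV sf.
have Vd p : U p -> V (p, p).
  by move=> Up; split; [split|rewrite /Psi /= mulgV; exact: chart_at_dom].
have sd : Csmooth U (fun p : A => (p, p)) by apply: smooth_pair => //; exact: smooth_id.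
apply: (@smooth_eq R A E U (fun p => gateaux (c \o Psi) (p, p) (v, 0))) => // [p Up|].
  have sk : Csmooth U (fun q : A => (q, p)) by apply: smooth_pair => //; [exact: smooth_id|exact: smooth_cst].
  have Upp : (U `*` U) (p, p) by split.
  rewrite /logv (@partial_comp R E G A (A * A)%type hA hAA U (U `*` U) (fun q => (q, p)) Psi p v oU oUU sk sPsi Up Upp).
  rewrite (@gateaux_pair R A A A hA hA setT id (fun=> p) p v) ?gateaux_cst ?gateaux_id//; last exact: smooth_cst.
    by rewrite /partial {2}/Psi /= mulgV.
  exact: smooth_id.
apply: (@smooth_comp R A (A * A)%type E hA hAA hE V U (fun p => (p, p)) (fun z => gateaux (c \o Psi) z (v, 0)) oU oV Vd sd).
exact: (smooth_gateaux_at hAA hE (v, 0) oV sf).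
Qed.

Lemma log_velocity1 (H : R2 -> G) (s t : R^o) : log_velocity (fun s => H (s, t)) s = logv H (1, 0) (s, t).
Proof. by rewrite /logv partial_slice1. Qed.

Lemma log_velocity2 (H : R2 -> G) (s t : R^o) : log_velocity (fun t => H (s, t)) t = logv H (0, 1) (s, t).
Proof. by rewrite /logv partial_slice2. Qed.

Context (H : R2 -> G) (sH : smooth_into setT H) (x : X).
Local Notation S := (fun p : R2 => act (H p) x).

Lemma orbit_smooth : smooth_into setT S.
Proof. by apply: (smooth_into_act hRR oT2 sH); exact: smooth_into_cst. Qed.

(** The moment equation concerns paths that start at the identity. It is applied to
    [H (s, t + u) * (H (s, t))^-1], acting on the point [S (s, t)]. *)
Lemma moment_logv (s t : R^o) w : Omega (S (s, t)) (partial S (s, t) (0, 1)) w =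
  - dfun (mu (logv H (0, 1) (s, t))) (S (s, t)) w.
Proof.
have [_ _ _ mo _] := mm; have [_ act1 actM] := sA.
pose g (u : R^o) : G := (H (s, t + u) * (H (s, t))^-1)%g.
have sk : Csmooth setT (fun u : R^o => (s, t + u) : R2) by smT.
have gk : gateaux (fun u : R^o => (s, t + u) : R2) 0 1 = (0, 1).
  have s1 : Csmooth setT (fun u : R^o => t + u : R^o) by smT.
  rewrite (@gateaux_pair R R^o R^o R^o hR hR setT (fun=> s) (fun u => t + u) 0 1) ?gateaux_cst//; last exact: smooth_cst.
  congr pair; apply: dir_unique => //.
  have -> : dquot (fun u : R^o => t + u : R^o) 0 1 = dquot (fun u : R^o => u) 0 1 by exact: dquot_addc.
  rewrite -[X in _ --> X](@gateaux_id R R^o hR 0 1); apply: (smooth_dquot (U := setT)) => //; exact: smooth_id.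
have sg : smooth_into setT g.
  by apply: (smooth_into_mul hR oT1); [exact: (smooth_into_compT hR hRR oT2 sH sk)|exact: smooth_into_cst].
have sL : smooth_into setT (fun q => H q * (H (s, t))^-1)%g.
  by apply: (smooth_into_mul hRR oT2) => //; exact: smooth_into_cst.
have vg : velocity g 0 = logv H (0, 1) (s, t).
  rewrite /velocity /g (@partial_comp R E G R^o R2 hR hRR setT setT (fun u => (s, t + u)) (fun q => H q * (H (s, t))^-1)%g 0 1 oT1 oT2 sk sL I I).
  by rewrite gk addr0.
have g0 : g 0 = 1%g by rewrite /g addr0 mulgV.
rewrite -(mo _ g (smoothT_path sg) g0 vg); congr (Omega _ _ _).
have -> : (fun u => act (g u) (S (s, t))) = (fun u : R^o => S (s, t + u)).
  by apply/funext => u; rewrite /g -actM -mulgA mulVg mulg1.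
rewrite /velocity (@partial_comp R F X R^o R2 hR hRR setT setT (fun u => (s, t + u)) S 0 1 oT1 oT2 sk orbit_smooth I I).
by rewrite gk addr0.
Qed.

Local Notation alpha v := (fun p : R2 => mu (logv H v p) (S p)).
Local Notation D1 := (fun p : R2 => mu (gateaux (logv H (0, 1)) p (1, 0)) (S p)).
Local Notation dens := (pullback (Omega := Omega) S ((1, 0) : R2) ((0, 1) : R2)).

(** The product rule for [mu]. By the moment equation the differential of [mu] along the
    [s]-derivative of the orbit is the area density, after skew-symmetry has swapped the two
    vectors. *)
Lemma alpha_derive1 (s t : R) : is_derive s 1 (fun s : R => alpha (0, 1) (s, t)) (D1 (s, t) + dens (s, t)).
Proof.
apply: dquot_is_derive.
have sk : Csmooth setT (fun s : R^o => (s, t) : R2) by smT.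
have sY : Csmooth setT (fun s : R^o => logv H (0, 1) (s, t)).
  exact: (smT_comp hR hRR hE (logv_smooth hRR (0, 1) oT2 sH) sk).
have sS : smooth_into setT (fun s : R^o => S (s, t)) by exact: (smooth_into_compT hR hRR oT2 orbit_smooth sk).
have := @mu_dquot (fun s : R^o => logv H (0, 1) (s, t)) (fun s : R^o => S (s, t)) s sY sS.
rewrite -gateaux_slice1 -(partial_slice1 S) /pullback.
have [_ om _] := tO.
by rewrite om moment_logv opprK.
Qed.

(* Equivariance moves the base point to H (s0, t0), after which only the linear
   argument of mu varies. *)
Lemma alpha_derive2 (s0 t0 : R) : is_derive t0 1 (fun t : R => alpha (1, 0) (s0, t)) (D1 (s0, t0)).
Proof.
apply: dquot_is_derive; have [_ _ _ _ mAd] := mm; have [_ act1 actM] := sA.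
(* With first pair [(t0, s)] this is [H q * (H (s, t0))^-1]; with first pair [(t, s0)] it is the
   conjugate of [H q * (H (s0, t))^-1] by [H (s0, t0) * (H (s0, t))^-1]. [mixed_swap] exchanges the
   derivatives of these two families. *)
pose Phi (z : R4) : G := (H (s0, t0) * (H (s0, z.1.1))^-1 * H z.2 * (H (z.1.2, t0))^-1)%g.
have sPhi : smooth_into setT Phi.
  have c (k : R4 -> R2) : Csmooth setT k -> smooth_into setT (fun z => H (k z)).
    by move=> sk; exact: (smooth_into_compT h4 hRR oT2 sH sk).
  apply: (smooth_into_mul h4 oT4); [apply: (smooth_into_mul h4 oT4); [apply: (smooth_into_mul h4 oT4)|]|].
  - exact: smooth_into_cst.
  - by apply: (smooth_into_inv h4 oT4); apply: c; smT.
  - by apply: c; exact: smooth_snd.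
  - by apply: (smooth_into_inv h4 oT4); apply: c; smT.
have := @mixed_swap R E G Phi 1%g s0 t0 sPhi.
have P1 u s s' : Phi ((u, s), (s, t0)) = Phi ((u, s'), (s', t0)) by rewrite /Phi /= -!mulgA !mulgV.
have P2 u t t' : Phi ((t, u), (s0, t)) = Phi ((t', u), (s0, t')) by rewrite /Phi /= -!(mulgA (H (s0, t0))) !mulVg.
have e1 s : Phi ((t0, s), (s, t0)) = 1%g by rewrite /Phi /= mulgV mul1g mulgV.
have e2 t : Phi ((t, s0), (s0, t)) = 1%g by rewrite /Phi /= -(mulgA (H (s0, t0))) mulVg mulg1 mulgV.
move=> /(_ P1 P2 e1 e2).
have -> : (fun s => partial (fun p => Phi ((t0, s), p)) (s, t0) (0, 1)) = (fun s => logv H (0, 1) (s, t0)).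
  apply/funext => s.
  have -> : (fun p => Phi ((t0, s), p)) = (fun q => H q * (H (s, t0))^-1)%g.
    by apply/funext => p; rewrite /Phi /= mulgV mul1g.
  by [].
rewrite -gateaux_slice1 => L.
have := @mu_dquot_l (fun t => partial (fun p => Phi ((t, s0), p)) (s0, t) (1, 0)) (S (s0, t0)) t0 _ L.
suff -> : (fun t => mu (partial (fun p => Phi ((t, s0), p)) (s0, t) (1, 0)) (S (s0, t0))) = (fun t : R^o => alpha (1, 0) (s0, t)) by [].
apply/funext => t; pose u := (H (s0, t0) * (H (s0, t))^-1)%g.
have sq : smooth_into setT (fun q => H q * (H (s0, t))^-1)%g.
  by apply: (smooth_into_mul hRR oT2) => //; exact: smooth_into_cst.
rewrite /= -[RHS](mAd u); congr (mu _ _).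
- have ef : (fun p => Phi ((t, s0), p)) = (fun q => u * (H q * (H (s0, t))^-1) * u^-1)%g.
    by apply/funext => q; rewrite /Phi /u /= invgM invgK !mulgA mulgVK.
  have e3 : (H (s0, t) * (H (s0, t))^-1)%g = 1%g by rewrite mulgV.
  rewrite ef; apply: (etrans (@partial_map R E E G G R2 hRR setT (fun g : G => u * g * u^-1)%g (fun q => H q * (H (s0, t))^-1)%g (s0, t) (1, 0) oT2 (smooth_map_conj u) sq I)).
  exact: (congr1 (fun y => tangent_map (fun g : G => u * g * u^-1)%g y (logv H (1, 0) (s0, t))) e3).
- by rewrite -actM /u mulgVK.
Qed.

(** [D1] is the whole [t]-derivative of one component and, up to the area density, the
    [s]-derivative of the other. Each derivative is integrated in its own variable; by Fubini the
    contributions of [D1] cancel and only sides remain. *)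
Lemma area_orbit : area S = itg 0 1 (fun s => mu (log_velocity (fun s => H (s, 0)) s) (S (s, 0)))
  + itg 0 1 (fun t => mu (log_velocity (fun t => H (1, t)) t) (S (1, t)))
  - itg 0 1 (fun s => mu (log_velocity (fun s => H (s, 1)) s) (S (s, 1)))
  - itg 0 1 (fun t => mu (log_velocity (fun t => H (0, t)) t) (S (0, t))).
Proof.
have cS := smooth_into_cont orbit_smooth.
have cal v : continuous (alpha v).
  by apply: mu_continuous => //; exact: smoothT_continuous (logv_smooth hRR v oT2 sH).
have cD : continuous D1.
  apply: mu_continuous => //; apply: smoothT_continuous.
  exact: (smooth_gateaux_at hRR hE (1, 0) oT2 (logv_smooth hRR (0, 1) oT2 sH)).
have cd : continuous dens.
  by apply: smoothT_continuous; apply: pullback_smooth => //; exact: orbit_smooth.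
have line1 (f : R2 -> R^o) (t : R^o) : continuous f -> continuous (fun s : R^o => f (s, t)).
  move=> cf s; apply: (@continuous_comp _ _ _ (fun s : R^o => (s, t) : R2) f); last exact: cf.
  by apply: continuous_pair; [exact: cvg_id|exact: cvg_cst].
have line2 (f : R2 -> R^o) (s : R^o) : continuous f -> continuous (fun t : R^o => f (s, t)).
  move=> cf t; apply: (@continuous_comp _ _ _ (fun t : R^o => (s, t) : R2) f); last exact: cf.
  by apply: continuous_pair; [exact: cvg_cst|exact: cvg_id].
have uncurry (f : R2 -> R^o) : continuous f -> continuous (fun q : R2 => f (q.1, q.2)).
  by rewrite (_ : (fun q : R2 => f (q.1, q.2)) = f)//; apply/funext => -[].
have cDd : continuous (fun p => D1 p + dens p) by move=> p; apply: cvgD; [exact: cD|exact: cd].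
have iD : itg 0 1 (fun s => itg 0 1 (fun t => D1 (s, t))) =
    itg 0 1 (fun s => alpha (1, 0) (s, 1)) - itg 0 1 (fun s => alpha (1, 0) (s, 0)).
  rewrite -itgB; [|exact: (line1 (alpha (1, 0)) 1 (cal _))|exact: (line1 (alpha (1, 0)) 0 (cal _))].
  apply: itg_eq => s _; apply: (@itg_FTC2 R (fun t => D1 (s, t)) (fun t => alpha (1, 0) (s, t))) => //.
    exact: (line2 D1 s cD).
  by move=> t _; exact: alpha_derive2.
have iDd : itg 0 1 (fun s => itg 0 1 (fun t => D1 (s, t) + dens (s, t))) =
    itg 0 1 (fun t => alpha (0, 1) (1, t)) - itg 0 1 (fun t => alpha (0, 1) (0, t)).
  rewrite (@itg_swap R (fun s t => D1 (s, t) + dens (s, t)) 0 1 0 1 (uncurry _ cDd)).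
  rewrite -itgB; [|exact: (line2 (alpha (0, 1)) 1 (cal _))|exact: (line2 (alpha (0, 1)) 0 (cal _))].
  apply: itg_eq => t _; apply: (@itg_FTC2 R (fun s => D1 (s, t) + dens (s, t)) (fun s => alpha (0, 1) (s, t))) => //.
    exact: (line1 (fun p => D1 p + dens p) t cDd).
  by move=> s _; exact: alpha_derive1.
have iE : itg 0 1 (fun s => itg 0 1 (fun t => D1 (s, t) + dens (s, t))) =
    itg 0 1 (fun s => itg 0 1 (fun t => D1 (s, t))) + area S.
  rewrite -[area S]/(itg 0 1 (fun s => itg 0 1 (fun t => dens (s, t)))) -itgD.
  - by apply: itg_eq => s _; rewrite itgD//; [exact: (line2 D1 s cD)|exact: (line2 dens s cd)].
  - exact: (@itg_cont2 R (fun s t => D1 (s, t)) 0 1 ler01 (uncurry _ cD)).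
  - exact: (@itg_cont2 R (fun s t => dens (s, t)) 0 1 ler01 (uncurry _ cd)).
have -> : itg 0 1 (fun s => mu (log_velocity (fun s => H (s, 0)) s) (S (s, 0))) = itg 0 1 (fun s => alpha (1, 0) (s, 0)).
  by apply: itg_eq => s _; rewrite log_velocity1.
have -> : itg 0 1 (fun s => mu (log_velocity (fun s => H (s, 1)) s) (S (s, 1))) = itg 0 1 (fun s => alpha (1, 0) (s, 1)).
  by apply: itg_eq => s _; rewrite log_velocity1.
have -> : itg 0 1 (fun t => mu (log_velocity (fun t => H (1, t)) t) (S (1, t))) = itg 0 1 (fun t => alpha (0, 1) (1, t)).
  by apply: itg_eq => s _; rewrite log_velocity2.
have -> : itg 0 1 (fun t => mu (log_velocity (fun t => H (0, t)) t) (S (0, t))) = itg 0 1 (fun t => alpha (0, 1) (0, t)).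
  by apply: itg_eq => s _; rewrite log_velocity2.
move: iE; rewrite iD iDd.
move: (area _) (itg 0 1 (fun s => alpha (1, 0) (s, 0))) (itg 0 1 (fun s => alpha (1, 0) (s, 1)))
  (itg 0 1 (fun t => alpha (0, 1) (1, t))) (itg 0 1 (fun t => alpha (0, 1) (0, t))) => a b t r l e.
by apply: orbit_area_arith.
Qed.

End group_squares.

Transparent itg.

(** * The action of a path in the group *)

Lemma closed_arith (R : realType) (a p1 p2 p3 p4 m1 m2 m3 m4 : R) :
  a = p1 + p2 - p3 - p4 -> a = m1 + m2 - m3 - m4 -> (p1 - m1) + (p2 - m2) = (p3 - m3) + (p4 - m4).
Proof. by lra. Qed.

Section group_functional.
Context {R : realType} {E F : tvsType R} {G : lieGroupType E} {X : manifoldType F}.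
Let hR := @scalar_hausdorff R.
Let hRR := prod_hausdorff hR hR.
Local Notation R2 := (R^o * R^o)%type.
Let oT1 := @openT R^o.
Let oT2 := @openT R2.
Context {Omega : X -> F -> F -> R^o} (sO : symplectic Omega).
Let tO : two_form Omega. Proof. by case: sO. Qed.
Context (pi1M : @trivial_pi R 1 X) (pi2M : @trivial_pi R 2 X).
Context (x0 : X) (kp : X -> R^o -> X).
Context (kp_smooth : forall y, smooth_path (kp y)) (kp0 : forall y, kp y 0 = x0) (kp1 : forall y, kp y 1 = y).
Local Notation prim := (@prim R F X Omega x0 kp).
Context {act : G -> X -> X} {mu : E -> X -> R^o}.
Context (sA : smooth_action act) (mm : moment_map act Omega mu).
Context (iA : forall g x v w, Omega (act g x) (tangent_map (act g) x v) (tangent_map (act g) x w) = Omega x v w).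
Let area_primE := area_prim sO pi1M pi2M kp_smooth kp0 kp1.
Let prim_cstE := prim_cst sO pi1M pi2M kp_smooth kp0 kp1.
Let prim_stepE := prim_step sO pi1M pi2M kp_smooth kp0 kp1.

Definition moment_integral (g : R^o -> G) (x : X) : R :=
  itg 0 1 (fun t => mu (log_velocity g t) (act (g t) x)).

Definition path_action (x : X) (g : R^o -> G) : R := prim (fun t => act (g t) x) - moment_integral g x.
Local Notation W := path_action.

Lemma path_action_square (H : R2 -> G) (x : X) : smooth_into setT H ->
  W x (fun s => H (s, 0)) + W x (fun t => H (1, t)) = W x (fun s => H (s, 1)) + W x (fun t => H (0, t)).
Proof.
move=> sH; apply: closed_arith.
  exact: (area_primE (orbit_smooth sA sH x)).
exact: (area_orbit tO sA mm sH x).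
Qed.

Lemma path_action_cst (x : X) (g : G) : W x (fun _ => g) = 0.
Proof.
rewrite /path_action prim_cstE sub0r /moment_integral (_ : itg _ _ _ = 0) ?oppr0//.
rewrite -[RHS](itg0 0 1); apply: itg_eq => t _.
by rewrite /log_velocity /velocity partial_cst (mu0 mm).
Qed.

Lemma orbit_path (g : R^o -> G) (x : X) : smooth_path g -> smooth_path (fun t => act (g t) x).
Proof.
move=> [U [oU IU sg]]; exists U; split => //.
by apply: (smooth_into_act sA hR oU sg); exact: smooth_into_cst.
Qed.

Lemma act_path (g : G) (c : R^o -> X) : smooth_path c -> smooth_path (fun t => act g (c t)).
Proof.
move=> [U [oU IU sc]]; exists U; split => //.
by apply: (smooth_into_act sA hR oU _ sc); exact: smooth_into_cst.
Qed.

(** Extends to a continuous function on the line what is known only on [[0, 1]]; unlike [step] it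
    does not change the values there. *)
Definition clamp (u : R^o) : R^o := (`|u| - `|u - 1| + 1) / 2.

Lemma clamp_continuous : continuous clamp.
Proof.
have cn (x : R^o) : {for x, continuous (fun x : R^o => `|x| : R^o)} by exact: norm_continuous.
move=> x; apply: cvgM; last exact: cvg_cst.
apply: cvgD; last exact: cvg_cst.
apply: cvgB; first exact: cn.
apply: (@continuous_comp _ _ _ (fun x : R^o => x - 1) (fun x : R^o => `|x| : R^o)); last exact: cn.
by apply: cvgB; [exact: cvg_id|exact: cvg_cst].
Qed.

Lemma clamp_id u : 0 <= u <= 1 -> clamp u = u.
Proof. by move=> /andP[? ?]; rewrite /clamp ger0_norm// ler0_norm; lra. Qed.

Lemma clamp_01 u : 0 <= clamp u <= 1.
Proof.
rewrite /clamp; have [h|h] := leP 0 u; [rewrite (ger0_norm h)|rewrite (ltr0_norm h)];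
  (have [h'|h'] := leP 1 u; [rewrite ger0_norm|rewrite ler0_norm]); lra.
Qed.

Lemma moment_integral_step (g : R^o -> G) (x : X) : smooth_path g ->
  moment_integral (fun t => g (step t)) x = moment_integral g x.
Proof.
move=> sg; have [U [oU IU sU]] := sg.
have UI t : 0 <= t <= 1 -> U t by move=> h; apply: IU; rewrite /= in_itv.
(* The path is smooth only near [[0, 1]], whereas the substitution rule wants an integrand
   continuous on the line. *)
pose f (u : R^o) : R^o := mu (log_velocity g (clamp u)) (act (g (clamp u)) x).
have cf : continuous f.
  move=> u; have Uc := UI _ (clamp_01 u).
  apply: (mu_cvg mm).
    apply: (@continuous_comp _ _ _ clamp (log_velocity g) u); first exact: clamp_continuous.
    exact: (smooth_cont (logv_smooth hR (1 : R^o) oU sU) Uc).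
  apply: (@continuous_comp _ _ _ clamp (fun t => act (g t) x) u); first exact: clamp_continuous.
  have sx : smooth_into U (fun t => act (g t) x).
    by apply: (smooth_into_act sA hR oU sU); exact: smooth_into_cst.
  by case: sx => cx _; exact: (cx _ Uc).
have -> : moment_integral g x = itg 0 1 f.
  by apply: itg_eq => t t01; rewrite /f clamp_id.
rewrite -(@itg_subst01 R f step 0 1 ler01 cf step_smooth (fun t => step_01 t) (@step_0 R) (@step_1 R)).
apply: itg_eq => t _; rewrite /f (clamp_id (step_01 t)) mulrC.
apply: (etrans _ (muZ mm (gateaux (step : R^o -> R^o) t 1) _ _)); congr (mu _ _).
rewrite /log_velocity /velocity.
have Ut := UI _ (step_01 t).
have sq : smooth_into U (fun s => g s * (g (step t))^-1)%g.
  by apply: (smooth_into_mul hR oU sU); exact: smooth_into_cst.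
rewrite (@partial_comp R E G R^o R^o hR hR setT U (step : R^o -> R^o) (fun s => g s * (g (step t))^-1)%g t 1 oT1 oU step_smooth sq I Ut).
rewrite -(@partialZ R E G R^o U _ (step t) (1 : R^o) (gateaux (step : R^o -> R^o) t 1) oU sq Ut); congr (partial _ _ _).
by rewrite [RHS]mulr1.
Qed.

Lemma path_action_step (g : R^o -> G) (x : X) : smooth_path g -> W x (fun t => g (step t)) = W x g.
Proof.
move=> sg.
exact: (f_equal2 (fun a b : R => a - b) (prim_stepE (orbit_path x sg)) (moment_integral_step x sg)).
Qed.

(** Left translation by [h] conjugates the logarithmic velocity by [h] and moves the point by [h];
    equivariance of [mu] cancels the two effects. *)
Lemma moment_integral_mull (g : R^o -> G) (h : G) (x : X) : smooth_path g ->
  moment_integral (fun t => h * g t)%g x = moment_integral g x.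
Proof.
move=> [U [oU IU sU]]; have [_ _ _ _ mAd] := mm; have [_ _ actM] := sA.
apply: itg_eq => t t01; have Ut : U t by apply: IU; rewrite /= in_itv.
rewrite actM -[RHS](mAd h); congr (mu _ _).
have sq : smooth_into U (fun s => g s * (g t)^-1)%g.
  by apply: (smooth_into_mul hR oU sU); exact: smooth_into_cst.
rewrite /Ad /log_velocity /velocity.
have ef : (fun s => h * g s * (h * g t)^-1)%g = (fun s => h * (g s * (g t)^-1) * h^-1)%g.
  by apply/funext => s; rewrite invgM !mulgA.
have e3 : (g t * (g t)^-1)%g = 1%g by rewrite mulgV.
rewrite ef; apply: (etrans (@partial_map R E E G G R^o hR U (fun k : G => h * k * h^-1)%g (fun s => g s * (g t)^-1)%g t 1 oU (smooth_map_conj h) sq Ut)).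
exact: (congr1 (fun y => tangent_map (fun k : G => h * k * h^-1)%g y (partial (fun s => g s * (g t)^-1)%g t 1)) e3).
Qed.

(** Precomposed with [step] in both variables, the homotopy is already smooth on collars of the four
    sides. Smoothing the interior then leaves the ends and the two paths exact. *)
Lemma homotopy_smooth (p q : idpath G) : homotopic p q -> exists H : R2 -> G,
  [/\ smooth_into setT H, forall s, H (s, 0) = 1%g, forall s, H (s, 1) = p 1,
      forall t, H (0, t) = p (step t) & forall t, H (1, t) = q (step t)].
Proof.
move=> [H [cH H01 He]].
pose S0 (z : R2) : G := H (step z.1, step z.2).
have cS0 : continuous S0.
  have sphi : Csmooth setT (fun z : R2 => (step z.1, step z.2) : R2) by smT.
  have ph (z : R2) : setT z -> ((`[0, 1] : set R^o) `*` (`[0, 1] : set R^o)) (step z.1, step z.2).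
    by move=> _; split; rewrite /= in_itv/= step_01.
  have C := @within_comp _ _ _ setT _ (fun z : R2 => (step z.1, step z.2) : R2) H (fun z _ => smoothT_continuous sphi (x := z)) ph cH.
  by move=> z; have /subspace_continuousP/(_ z I) := C; rewrite withinET.
have S0s0 s u : s <= 1 / 4 -> S0 (s, u) = p (step u).
  by move=> h; rewrite /S0 /= step0; [have [] := H01 _ (step_01 u)|lra].
have S0s1 s u : 3 / 4 <= s -> S0 (s, u) = q (step u).
  by move=> h; rewrite /S0 /= (step1 h); have [] := H01 _ (step_01 u).
have S0u0 s u : u <= 1 / 4 -> S0 (s, u) = 1%g.
  by move=> h; rewrite /S0 /= (@step0 _ u); [have [-> _] := He _ (step_01 s); exact: idpath0|lra].
have S0u1 s u : 3 / 4 <= u -> S0 (s, u) = p 1.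
  by move=> h; rewrite /S0 /= (step1 h); have [_ ->] := He _ (step_01 s).
have c1 : continuous (fun p : R2 => p.1 : R^o) by move=> z; exact: cvg_fst.
have c2 : continuous (fun p : R2 => p.2 : R^o) by move=> z; exact: cvg_snd.
pose V := [set p : R2 | p.1 < 1 / 4] `|` ([set p : R2 | 3 / 4 < p.1] `|`
  ([set p : R2 | p.2 < 1 / 4] `|` [set p : R2 | 3 / 4 < p.2])).
pose K := (`[(1 / 4), (3 / 4)] `*` `[(1 / 4), (3 / 4)])%classic : set R2.
pose N := ([set p : R2 | 1 / 8 < p.1] `&` [set p : R2 | p.1 < 7 / 8]) `&`
  ([set p : R2 | 1 / 8 < p.2] `&` [set p : R2 | p.2 < 7 / 8]).
have oV : open V by repeat apply: openU; (exact: open_ltf || exact: open_gtf).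
have oN : open N by apply: openI; apply: openI; (exact: open_ltf || exact: open_gtf).
have kK : compact K by apply: compact_setX; exact: segment_compact.
have bR := @bumpy_scalar R.
have s2 : Csmooth setT (fun z : R2 => step z.2 : R^o) by smT.
have [|||S sS eS] := @smoothing R R2 E hRR (bumpy_prod hR hR bR bR) G S0 V K N cS0 oV _ kK oN.
- apply: smooth_into_local => -[s u] [h|[h|[h|h]]].
  + apply: (@smooth_on_open R E G R2 [set p : R2 | p.1 < 1 / 4] S0 (fun z => p (step z.2)) (s, u)) => //.
    - exact: open_ltf.
    - exact: (smooth_path_comp hRR (idpath_smooth p) s2 (fun z => step_01 z.2)).
    - by move=> [a' b'] /= hh; rewrite S0s0// ltW.
  + apply: (@smooth_on_open R E G R2 [set p : R2 | 3 / 4 < p.1] S0 (fun z => q (step z.2)) (s, u)) => //.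
    - exact: open_gtf.
    - exact: (smooth_path_comp hRR (idpath_smooth q) s2 (fun z => step_01 z.2)).
    - by move=> [a' b'] /= hh; rewrite S0s1// ltW.
  + apply: (@smooth_on_open R E G R2 [set p : R2 | p.2 < 1 / 4] S0 (fun=> 1%g) (s, u)) => //.
    - exact: open_ltf.
    - exact: smooth_into_cst.
    - by move=> [a' b'] /= hh; rewrite S0u0// ltW.
  + apply: (@smooth_on_open R E G R2 [set p : R2 | 3 / 4 < p.2] S0 (fun=> p 1) (s, u)) => //.
    - exact: open_gtf.
    - exact: smooth_into_cst.
    - by move=> [a' b'] /= hh; rewrite S0u1// ltW.
- by move=> [s u] [/=]; rewrite !in_itv/= => /andP[? ?] /andP[? ?]; split; split; rewrite /=; lra.
- apply/seteqP; split => // -[s u] _; rewrite /V /K /=.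
  have [|h1] := ltP s (1 / 4); first by auto.
  have [|h2] := ltP (3 / 4) s; first by auto.
  have [|h3] := ltP u (1 / 4); first by auto 6.
  have [|h4] := ltP (3 / 4) u; first by auto 6.
  by right; rewrite !in_itv/= h1 h2 h3 h4.
exists S; split => // [s|s|t|t]; rewrite eS; try by move=> [[/= ? ?] [/= ? ?]]; lra.
- by rewrite S0u0//; lra.
- by rewrite S0u1//; lra.
- by rewrite S0s0//; lra.
- by rewrite S0s1//; lra.
Qed.

Lemma path_action_homotopic (p q : idpath G) (x : X) : homotopic p q -> W x p = W x q.
Proof.
move=> /homotopy_smooth[H [sH Hb Ht Hl Hr]].
have := path_action_square x sH.
have -> : (fun s : R^o => H (s, 0)) = (fun _ => 1%g) by apply/funext => s; exact: Hb.
have -> : (fun s : R^o => H (s, 1)) = (fun _ => p 1) by apply/funext => s; exact: Ht.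
have -> : (fun s : R^o => H (0, s)) = (fun t => p (step t)) by apply/funext => s; exact: Hl.
have -> : (fun s : R^o => H (1, s)) = (fun t => q (step t)) by apply/funext => s; exact: Hr.
rewrite (path_action_step x (idpath_smooth p)) (path_action_step x (idpath_smooth q)) => h.
apply: esym; apply: (etrans _ (_ : W x (fun=> p 1) + W x p = W x p)).
  by rewrite -h path_action_cst add0r.
by rewrite path_action_cst add0r.
Qed.

(** The square sending [(s, t)] to [p s * q (s t)], up to steps, has the sides [p], [p * q],
    [p 1 * q] and a constant. *)
Lemma path_action_mul (p q : idpath G) (x : X) :
  W x (fun t => p t * q t)%g = W x p + W x (fun t => p 1%R * q t)%g.
Proof.
have sp := idpath_smooth p; have sq := idpath_smooth q.
pose Q (z : R2) : G := (p (step z.1) * q (step z.1 * step z.2)%R)%g.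
have sQ : smooth_into setT Q.
  apply: (smooth_into_mul hRR oT2).
    by apply: (smooth_path_comp hRR sp); [smT|move=> z; exact: step_01].
  by apply: (smooth_path_comp hRR sq); [smT|move=> z; apply: mul01; exact: step_01].
have := path_action_square x sQ.
have -> : (fun s : R^o => Q (s, 0)) = (fun t => p (step t)).
  by apply/funext => s; rewrite /Q /= step_0 mulr0 idpath0 mulg1.
have -> : (fun s : R^o => Q (s, 1)) = (fun t => p (step t) * q (step t))%g.
  by apply/funext => s; rewrite /Q /= step_1 mulr1.
have -> : (fun s : R^o => Q (1, s)) = (fun t => p 1%R * q (step t))%g.
  by apply/funext => s; rewrite /Q /= step_1 mul1r.
have -> : (fun s : R^o => Q (0, s)) = (fun _ => 1%g).
  by apply/funext => s; rewrite /Q /= step_0 mul0r !idpath0 mulg1.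
have spq := idpath_smooth (idpath_mul p q).
have s1 : smooth_path (fun t => p 1%R * q t)%g.
  have [U [oU IU sU]] := sq; exists U; split => //.
  by apply: (smooth_into_mul hR oU _ sU); exact: smooth_into_cst.
rewrite (path_action_step x sp) (path_action_step x s1) (path_action_step x spq) => ->.
by rewrite path_action_cst addr0.
Qed.

Lemma disk_integral_act (g : G) (D : R2 -> X) : smooth_disk D ->
  disk_integral Omega (fun z => act g (D z)) = disk_integral Omega D.
Proof.
move=> [U [oU IU sD]]; apply: eq_Rintegral => z /set_mem hz.
have Uz := IU _ hz; have pm v := partial_map hRR v oU (smooth_map_act sA g) sD Uz.
by rewrite !pm iA.
Qed.

Lemma smooth_disk_act (g : G) (D : R2 -> X) : smooth_disk D -> smooth_disk (fun z => act g (D z)).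
Proof.
move=> [U [oU IU sD]]; exists U; split => //.
by apply: (smooth_into_act sA hRR oU _ sD); exact: smooth_into_cst.
Qed.

Lemma theta0_boundary (D : R2 -> X) (l : R -> X) :
  (forall t, 0 <= t <= 1 -> D (circle t) = l (theta0 t)) -> disk_boundary D l.
Proof.
move=> Dl; exists theta0; split; [|exact: theta0_homo| |exact: Dl].
- by exists setT; [split; [exact: openT|exact: subsetT]|exact: theta0_smooth].
- by split; [exact: theta0_0|exact: theta0_1].
Qed.

Lemma path_concat0 (a b : R -> X) : path_concat a b 0 = a 0.
Proof.
have h : (0 : R) <= 2^-1 by rewrite invr_ge0.
by rewrite /path_concat h mulr0.
Qed.

Lemma path_concat1 (a b : R -> X) : path_concat a b 1 = b 1.
Proof.
have h : ((1 : R) <= 2^-1) = false by apply/negbTE; rewrite -ltNge; lra.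
have e : (2 * 1 - 1 : R) = 1 by lra.
by rewrite /path_concat h e.
Qed.

Lemma boundary_disk2 (a b : R^o -> X) : smooth_path a -> smooth_path b -> a 1 = b 0 -> b 1 = a 0 ->
  exists D : R2 -> X, smooth_disk D /\ disk_boundary D (path_concat a b).
Proof.
move=> sa sb ab ba.
have e : path_concat a b 0 = path_concat a b 1 by rewrite path_concat0 path_concat1.
have [D [sD Db]] := disk_exists pi1M (path_concat_plateau sa sb ab) e.
by exists D; split; [exact: sD|exact: theta0_boundary].
Qed.

Lemma boundary_disk3 (a b c : R^o -> X) : smooth_path a -> smooth_path b -> smooth_path c ->
  a 1 = b 0 -> b 1 = c 0 -> c 1 = a 0 ->
  exists D : R2 -> X, smooth_disk D /\ disk_boundary D (path_concat a (path_concat b c)).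
Proof.
move=> sa sb sc ab bc ca.
have e : path_concat a (path_concat b c) 0 = path_concat a (path_concat b c) 1.
  by rewrite path_concat0 !path_concat1.
have [D [sD Db]] := disk_exists pi1M (path_concat3_plateau sa sb sc ab bc) e.
by exists D; split; [exact: sD|exact: theta0_boundary].
Qed.

(** Acting by [g] moves the apex of the cones, so invariance of [prim] on a single path is not to be
    expected. Two paths that close up bound a disk, and the area of a disk is invariant. *)
Lemma prim_act_loop (g : G) (a b : R^o -> X) : smooth_path a -> smooth_path b -> a 1 = b 0 -> b 1 = a 0 ->
  prim (fun t => act g (a t)) + prim (fun t => act g (b t)) = prim a + prim b.
Proof.
move=> sa sb ab ba; have [D [sD Db]] := boundary_disk2 sa sb ab ba.
have tp := traverses_path sO pi1M pi2M kp_smooth kp0 kp1.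
have tc := traverses_concat sO pi1M pi2M kp_smooth kp0 kp1.
have db := disk_integral_boundary sO pi1M pi2M kp_smooth kp0 kp1.
have e1 := db _ _ _ sD Db (tc _ _ _ _ (tp _ sa) (tp _ sb) ab).
have abg : act g (a 1) = act g (b 0) by rewrite ab.
have Dg : disk_boundary (fun z => act g (D z)) (path_concat (fun t => act g (a t)) (fun t => act g (b t))).
  have [th [sth hth th01 Dth]] := Db; exists th; split; [exact: sth|exact: hth|exact: th01|].
  by move=> t t01; rewrite (Dth t t01) /path_concat; case: ifP.
have e2 := db _ _ _ (smooth_disk_act g sD) Dg (tc _ _ _ _ (tp _ (act_path g sa)) (tp _ (act_path g sb)) abg).
exact: (etrans (esym e2) (etrans (disk_integral_act g sD) e1)).
Qed.

End group_functional.

Lemma base_arith (R : realType) (a k l px py mx my : R) :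
  a = k + py - l - px -> a = my - mx -> (px - mx) - (py - my) = k - l.
Proof. by lra. Qed.

(** * Dependence on the base point *)

Section basepoint_change.
Context {R : realType} {E F : tvsType R} {G : lieGroupType E} {X : manifoldType F}.
Let hR := @scalar_hausdorff R.
Let hRR := prod_hausdorff hR hR.
Local Notation R2 := (R^o * R^o)%type.
Let oT1 := @openT R^o.
Let oT2 := @openT R2.
Context {Omega : X -> F -> F -> R^o} (sO : symplectic Omega).
Let tO : two_form Omega. Proof. by case: sO. Qed.
Context (pi1M : @trivial_pi R 1 X) (pi2M : @trivial_pi R 2 X).
Context (x0 : X) (kp : X -> R^o -> X).
Context (kp_smooth : forall y, smooth_path (kp y)) (kp0 : forall y, kp y 0 = x0) (kp1 : forall y, kp y 1 = y).
Local Notation prim := (@prim R F X Omega x0 kp).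
Context {act : G -> X -> X} {mu : E -> X -> R^o}.
Context (sA : smooth_action act) (mm : moment_map act Omega mu).
Context (iA : forall g x v w, Omega (act g x) (tangent_map (act g) x v) (tangent_map (act g) x w) = Omega x v w).
Let area_primE := area_prim sO pi1M pi2M kp_smooth kp0 kp1.
Let prim_stepE := prim_step sO pi1M pi2M kp_smooth kp0 kp1.
Local Notation W := (@path_action R E F G X Omega x0 kp act mu).
Local Notation moment_integral := (@moment_integral R E F G X act mu).

(** By the moment equation the density at [(s, t)] is the [s]-derivative of [mu (log_velocity p t)]
    along the transported curve. Integration in [s] leaves the two ends of [c]. *)
Lemma area_act (p : R^o -> G) (c : R^o -> X) : smooth_into setT p -> smooth_into setT c ->
  area (Omega := Omega) (fun z : R2 => act (p z.2) (c z.1)) = moment_integral p (c 1) - moment_integral p (c 0).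
Proof.
move=> sp sc; have [_ smu _ _ _] := mm; set S := fun z : R2 => act (p z.2) (c z.1).
have sH : smooth_into setT (fun z : R2 => p z.2) by apply: (smooth_into_compT hRR hR oT1 sp) => //; smT.
have sC : smooth_into setT (fun z : R2 => c z.1) by apply: (smooth_into_compT hRR hR oT1 sc) => //; smT.
have sS : smooth_into setT S by exact: (smooth_into_act sA hRR oT2 sH sC).
pose dens := pullback (Omega := Omega) S ((1, 0) : R2) ((0, 1) : R2).
have cdens : continuous (fun q : R2 => dens (q.1, q.2)) by exact: (dens_continuous tO sS).
have cd : continuous dens.
  by rewrite (_ : dens = (fun q : R2 => dens (q.1, q.2)))//; apply/funext => -[].
have lv : continuous (log_velocity p).
  exact: (smoothT_continuous (logv_smooth hR (1 : R^o) oT1 sp)).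
have d (s t : R) : is_derive s 1 (fun s : R => mu (log_velocity p t) (S (s, t))) (dens (s, t)).
  apply: dquot_is_derive; have [_ om _] := tO.
  have sk : Csmooth setT (fun s : R^o => (s, t) : R2) by smT.
  have sSt : smooth_into setT (fun s : R^o => S (s, t)) by exact: (smooth_into_compT hR hRR oT2 sS sk).
  have sf := smooth_fun_comp hR oT1 (smu (log_velocity p t)) sSt.
  have := @smooth_dquot R R^o R^o setT _ s 1 sf I.
  rewrite (gateaux_fun hR 1 oT1 (smu (log_velocity p t)) sSt I) -(partial_slice1 S).
  suff -> : dfun (mu (log_velocity p t)) (S (s, t)) (partial S (s, t) (1, 0)) = dens (s, t) by [].
  have := moment_logv sA mm sH (c s) s t (partial S (s, t) (1, 0)).
  rewrite -log_velocity2 partial_slice2 /= -/(S (s, t)).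
  rewrite -(partial_slice2 S) => e; rewrite /dens /pullback om.
  by apply: (canRL (@opprK _)); rewrite -[LHS]e.
rewrite -[area S]/(itg 0 1 (fun s => itg 0 1 (fun t => dens (s, t)))) (@itg_swap R (fun s t => dens (s, t)) 0 1 0 1 cdens).
have cmu (y : X) : continuous (fun t : R^o => mu (log_velocity p t) (act (p t) y) : R^o).
  apply: (mu_continuous mm lv).
  by apply: smooth_into_cont; apply: (smooth_into_act sA hR oT1 sp); exact: smooth_into_cst.
rewrite /moment_integral -itgB; [|exact: cmu|exact: cmu].
apply: itg_eq => t _; apply: (@itg_FTC2 R (fun s => dens (s, t)) (fun s => mu (log_velocity p t) (S (s, t))) 0 1 ler01).
  move=> s; apply: (@continuous_comp _ _ _ (fun s : R^o => (s, t) : R2) dens); last exact: cd.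
  by apply: continuous_pair; [exact: cvg_id|exact: cvg_cst].
Qed.

(** The area swept by [c] under [p] is computed twice, by [prim] on the four sides and by
    [area_act]. *)
Lemma path_action_base (p : idpath G) (c : R^o -> X) : smooth_path c ->
  W (c 0) p - W (c 1) p = prim c - prim (fun t => act (p 1) (c t)).
Proof.
move=> sc; have sp := idpath_smooth p.
have sps : smooth_into setT (fun t : R^o => p (step t)).
  by apply: (smooth_path_comp hR sp step_smooth) => t; exact: step_01.
have scs : smooth_into setT (fun t : R^o => c (step t)).
  by apply: (smooth_path_comp hR sc step_smooth) => t; exact: step_01.
have sH : smooth_into setT (fun z : R2 => p (step z.2)) by apply: (smooth_into_compT hRR hR oT1 sps) => //; smT.
have sC : smooth_into setT (fun z : R2 => c (step z.1)) by apply: (smooth_into_compT hRR hR oT1 scs) => //; smT.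
have sS : smooth_into setT (fun z : R2 => act (p (step z.2)) (c (step z.1))).
  exact: (smooth_into_act sA hRR oT2 sH sC).
have [_ act1 _] := sA.
have e1 : prim (fun s => act (p (step 0)) (c (step s))) = prim c.
  apply: etrans (prim_stepE sc); apply: prim_eq => t _.
  by rewrite step_0 idpath0 act1.
have e2 : prim (fun t => act (p (step t)) (c (step 1))) = prim (fun t => act (p t) (c 1)).
  apply: etrans (prim_stepE (orbit_path sA (c 1) sp)); apply: prim_eq => t _.
  by rewrite step_1.
have e3 : prim (fun s => act (p (step 1)) (c (step s))) = prim (fun t => act (p 1) (c t)).
  apply: etrans (prim_stepE (act_path sA (p 1) sc)); apply: prim_eq => t _.
  by rewrite step_1.
have e4 : prim (fun t => act (p (step t)) (c (step 0))) = prim (fun t => act (p t) (c 0)).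
  apply: etrans (prim_stepE (orbit_path sA (c 0) sp)); apply: prim_eq => t _.
  by rewrite step_0.
have a1 := area_primE sS; have a2 := area_act sps scs.
apply: base_arith.
  apply: (etrans a1).
  exact: (f_equal2 (fun a b : R => a - b) (f_equal2 (fun a b : R => a - b) (f_equal2 +%R e1 e2) e3) e4).
apply: (etrans a2).
have m1 : moment_integral (fun t => p (step t)) (c (step 1)) = moment_integral p (c 1).
  by rewrite step_1; exact: (moment_integral_step sA mm _ sp).
have m0 : moment_integral (fun t => p (step t)) (c (step 0)) = moment_integral p (c 0).
  by rewrite step_0; exact: (moment_integral_step sA mm _ sp).
exact: (f_equal2 (fun a b : R => a - b) m1 m0).
Qed.

End basepoint_change.

(** * Homogenization *)

(** Almost additivity gives [|f (m n) - m f n| <= (m + 1) D], hence the averages at [m n] and at [n]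
    differ by at most [2 D / n]. Comparing the averages at [m] and at [n] with the one at [m n]
    yields a Cauchy sequence. *)
Lemma homogenization_cvg (R : realType) (f : nat -> R) (D : R) :
  (forall m n, `|f (m + n)%N - f m - f n| <= D) -> cvgn (fun k => k%:R^-1 * f k).
Proof.
move=> fD; have D0 : 0 <= D by exact: le_trans (fD 0%N 0%N).
(* The extra 1 accounts for [m = 0], where only [|f 0| <= D] is known. *)
have fM m n : `|f (m * n)%N - m%:R * f n| <= (m%:R + 1) * D.
  elim: m => [|m IH].
    have := fD 0%N 0%N; rewrite mul0n mul0r addn0 subr0 add0r mul1r.
    by rewrite (_ : f 0%N - f 0%N - f 0%N = - f 0%N) ?normrN//; lra.
  rewrite mulSn; have h := fD n (m * n)%N.
  rewrite (_ : f (n + m * n)%N - m.+1%:R * f n = (f (n + m * n)%N - f n - f (m * n)%N) + (f (m * n)%N - m%:R * f n)); last first.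
    by rewrite -natr1; ring.
  by apply: (le_trans (ler_normD _ _)); rewrite -natr1; lra.
pose u k : R := k%:R^-1 * f k.
have uu m n : (0 < m)%N -> (0 < n)%N -> `|u (m * n)%N - u n| <= 2 * D * n%:R^-1.
  move=> m0 n0; have mr : (0 : R) < m%:R by rewrite ltr0n.
  have nr : (0 : R) < n%:R by rewrite ltr0n.
  have -> : u (m * n)%N - u n = (m%:R * n%:R)^-1 * (f (m * n)%N - m%:R * f n).
    by rewrite /u natrM; field; rewrite !gt_eqF.
  have p0 : 0 <= (m%:R * n%:R : R)^-1 by rewrite invr_ge0; apply: mulr_ge0; exact: ltW.
  rewrite normrM (ger0_norm p0).
  have h : (m%:R * n%:R)^-1 * `|f (m * n)%N - m%:R * f n| <= (m%:R * n%:R)^-1 * ((m%:R + 1) * D).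
    by apply: ler_wpM2l; [exact: p0|exact: fM].
  apply: (le_trans h); have m1 : (1 : R) <= m%:R by rewrite ler1n.
  rewrite invfM mulrAC; apply: ler_wpM2r; first by rewrite invr_ge0 ltW.
  by rewrite mulrC ler_pdivrMr//; nra.
have uc m n : (0 < m)%N -> (0 < n)%N -> `|u m - u n| <= 2 * D * m%:R^-1 + 2 * D * n%:R^-1.
  move=> m0 n0; rewrite -(subrKA (u (m * n)%N)); apply: (le_trans (ler_normD _ _)).
  by apply: lerD; [rewrite distrC mulnC; exact: uu|exact: uu].
apply/cauchy_cvgP; apply: cauchy_exP => e e0.
(* Beyond this index the two errors, each at most [2 D / N], add up to less than [e]. *)
have h0 : 0 <= 4 * D / e by rewrite divr_ge0 ?mulr_ge0// ltW.
have := archi_boundP h0; set N := Num.bound _ => hN.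
have N0 : (0 < N)%N by rewrite -(ltr0n R); exact: le_lt_trans hN.
have Nr : (0 : R) < N%:R by rewrite ltr0n.
exists (u N); exists N => // n /= Nn; rewrite -ball_normE /=.
have n0 : (0 < n)%N by exact: leq_trans Nn.
have nr : (0 : R) < n%:R by rewrite ltr0n.
apply: (le_lt_trans (uc _ _ N0 n0)).
have nN : n%:R^-1 <= N%:R^-1 :> R by rewrite lef_pV2 ?posrE// ler_nat.
have DN : 2 * D * n%:R^-1 <= 2 * D * N%:R^-1 by apply: ler_wpM2l => //; rewrite mulr_ge0.
apply: (le_lt_trans (lerD (lexx _) DN)).
rewrite -mulrDl ltr_pdivrMr//; move: hN; rewrite ltr_pdivrMr//; lra.
Qed.

Lemma classM (R : realType) (E : tvsType R) (G : lieGroupType E) (p q : idpath G) :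
  (ucover_class p * ucover_class q)%g = ucover_class (idpath_mul p q).
Proof. exact: ucover_classM. Qed.

Lemma homotopic_end (R : realType) (E : tvsType R) (G : lieGroupType E) (p q : idpath G) :
  homotopic p q -> p 1 = q 1.
Proof.
move=> [H [_ H01 He]]; have I1 : 0 <= (1 : R) <= 1 by rewrite lexx ler01.
by have [_ <-] := H01 1 I1; have [_ ->] := He 1 I1.
Qed.

Lemma homotopic_reparam (R : realType) (E : tvsType R) (G : lieGroupType E) (p q : idpath G) (th : R^o -> R^o) :
  Csmooth setT th -> (forall t, 0 <= th t <= 1) -> th 0 = 0 -> th 1 = 1 ->
  (forall t, q t = p (th t)) -> homotopic p q.
Proof.
move=> sth th01 th0 th1 qE.
have hR := @scalar_hausdorff R; have hRR := prod_hausdorff hR hR.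
pose phi (z : R^o * R^o) : R^o := (1 - z.1) * z.2 + z.1 * th z.2.
have sphi : Csmooth setT phi.
  have s2 : Csmooth setT (fun z : R^o * R^o => th z.2) by apply: (smT_comp hRR hR hR sth); smT.
  by rewrite /phi; smT.
exists (fun z => p (phi z)); split.
- have [U [oU IU [cU _]]] := idpath_smooth p.
  apply: (@within_comp _ _ _ _ (`[0, 1] : set R^o) phi p).
  + by move=> z _; exact: (smooth_cont sphi (I : setT z)).
  + move=> [s t] [/=]; rewrite !in_itv/= => s01 t01; apply: mix01 => //.
  + by apply/subspace_continuousP => x Ix; apply: cvg_within_filter; apply: cU; exact: IU.
- move=> t _; split; rewrite ?qE /phi /=; congr (idpath_fun p _); ring.
- by move=> s _; split; rewrite /phi /= ?th0 ?th1; congr (idpath_fun p _); ring.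
Qed.

Lemma cocycle_arith (R : realType) (pq wp gq aq mq b1 b2 b3 gk bk : R) :
  pq = wp + (gq - mq) -> gq + gk = aq + bk -> b3 = bk ->
  (pq + b1) - (wp + b2) - ((aq - mq) + b3) = b1 - b2 - gk.
Proof. by lra. Qed.

(** The three hypotheses are the triangles [(u, v, w)], [(u, w, w)] and [(w, w, w)]. The degenerate
    ones stand in for the symmetry of [K] and for constancy of [K w w], neither of which is
    given. *)
Lemma tri_bound (R : realType) (C uv vw wu uw ww : R) :
  `|uv + vw + wu| <= C -> `|uw + ww + wu| <= C -> `|ww + ww + ww| <= C -> `|uw - vw - uv| <= 3 * C.
Proof. by rewrite !ler_norml => /andP[? ?] /andP[? ?] /andP[? ?]; apply/andP; split; lra. Qed.

(** The quadrilateral on [x], [y] and their images is cut into two triangles along the side from [y]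
    to the image of [x], which cancels in the difference. *)
Lemma quad_bound (R : realType) (C wx wy xy gxy gx gy ygx : R) : wx - wy = xy - gxy ->
  `|gx + xy + ygx| <= C -> `|gxy + gy + ygx| <= C -> `|(wx + gx) - (wy + gy)| <= 2 * C.
Proof.
move=> e; rewrite !ler_norml => /andP[? ?] /andP[? ?].
by apply/andP; split; lra.
Qed.

Lemma etrans_le (R : realType) (a b c : R) : a = b -> `|b| <= c -> `|a| <= c.
Proof. by move=> ->. Qed.

Lemma cvg_bounded_over (R : realType) (f : nat -> R) (C : R) : (forall k, `|f k| <= C) ->
  (k%:R^-1 * f k) @[k --> \oo] --> (0 : R).
Proof.
move=> fC; apply/cvgrPdist_lt => e e0; have C0 : 0 <= C by exact: le_trans (fC 0%N).
have h0 : 0 <= C / e by rewrite divr_ge0// ltW.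
exists (Num.bound (C / e)) => // k /= Nk; rewrite sub0r normrN normrM.
have hk : C / e < k%:R by apply: (lt_le_trans (archi_boundP h0)); rewrite ler_nat.
have k0 : (0 : R) < k%:R by exact: le_lt_trans hk.
rewrite ger0_norm ?invr_ge0 ?ler0n// mulrC ltr_pdivrMr//.
by apply: (le_lt_trans (fC k)); move: hk; rewrite ltr_pdivrMr// mulrC.
Qed.

(** * The quasimorphism and its homogenization *)

Section domic_toledo_quasimorphism.
Context (R : realType) (E F : tvsType R) (G : lieGroupType E) (X : manifoldType F).
Context (Omega : X -> F -> F -> R^o) (K : X -> X -> R^o -> X) (act : G -> X -> X) (mu : E -> X -> R^o).
Context (GX : hamiltonian_hermitian act Omega K mu) (x0 : X).
Let hR := @scalar_hausdorff R.
Local Notation R2 := (R^o * R^o)%type.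
Let DT : domic_toledo Omega K. Proof. by case: GX. Qed.
Let sA : smooth_action act. Proof. by case: GX. Qed.
Let iA g x v w : Omega (act g x) (tangent_map (act g) x v) (tangent_map (act g) x w) = Omega x v w.
Proof. by case: GX. Qed.
Let mm : moment_map act Omega mu. Proof. by case: GX. Qed.
Let actK g x y t : 0 <= t <= 1 -> act g (K x y t) = K (act g x) (act g y) t. Proof. by case: GX => _ _ _ + _; exact. Qed.
Let sO : symplectic Omega. Proof. by case: DT. Qed.
Let pi1X : @trivial_pi R 1 X. Proof. by case: DT => _ []. Qed.
Let pi2X : @trivial_pi R 2 X. Proof. by case: DT => _ []. Qed.
Let sK x y : smooth_path (K x y). Proof. by case: DT => _ _ /(_ x y)[]. Qed.
Let K0 x y : K x y 0 = x. Proof. by case: DT => _ _ /(_ x y)[]. Qed.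
Let K1 x y : K x y 1 = y. Proof. by case: DT => _ _ /(_ x y)[]. Qed.
Local Notation prim := (@prim R F X Omega x0 (K x0)).
Local Notation W := (@path_action R E F G X Omega x0 (K x0) act mu).
Let tp := traverses_path sO pi1X pi2X (sK x0) (K0 x0) (K1 x0).
Let tc := traverses_concat sO pi1X pi2X (sK x0) (K0 x0) (K1 x0).
Let db := disk_integral_boundary sO pi1X pi2X (sK x0) (K0 x0) (K1 x0).

Definition side (x y : X) : R := prim (K x y).

(** The bound on triangles is conditional on a disk, which [boundary_disk3] provides; its area is
    then the sum over the three sides. *)
Lemma triangle_bound : exists C : R, forall x y z, `|side x y + side y z + side z x| <= C.
Proof.
have [_ _ _ [C HC]] := DT; exists C => x y z.
have e1 : K x y 1 = K y z 0 by rewrite K0 K1.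
have e2 : K y z 1 = K z x 0 by rewrite K0 K1.
have e3 : K z x 1 = K x y 0 by rewrite K0 K1.
have [D [sD bD]] := boundary_disk3 pi1X (sK x y) (sK y z) (sK z x) e1 e2 e3.
have e4 : K x y 1 = path_concat (K y z) (K z x) 0 by rewrite path_concat0 K0 K1.
have := db sD bD (tc (tp (sK x y)) (tc (tp (sK y z)) (tp (sK z x)) e2) e4).
by move=> e; have := HC x y z D sD bD; rewrite e addrA => /ltW.
Qed.

(** The formula at a chosen representative; [nu_class] removes the choice. The apex [x0] of the
    cones stays fixed while [x] varies, so that base points can be compared. *)
Definition nu_fun (x : X) (a : ucover G) : R :=
  W x (repr a) + side (act (repr a 1) x) x.

Lemma nu_class (x : X) (p : idpath G) : nu_fun x (ucover_class p) = W x p + side (act (p 1) x) x.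
Proof.
have h : homotopic (repr (ucover_class p)) p by apply/ucover_classP; rewrite ucover_repr.
by rewrite /nu_fun (homotopic_end h); congr (_ + _);
  exact: (path_action_homotopic sO pi1X pi2X (sK x0) (K0 x0) (K1 x0) sA mm x h).
Qed.

Lemma act_end (p : idpath G) (x : X) : act (p 0) x = x.
Proof. by case: sA => _ act1 _; rewrite idpath0 act1. Qed.

(** Every admissible disk has as area the sum of [prim] over the two boundary pieces, whence
    uniqueness of the value; [boundary_disk2] shows that there is one. *)
Lemma nu_values_eq (x : X) (p : idpath G) :
  nu_values act Omega K mu x p = [set nu_fun x (ucover_class p)].
Proof.
pose a t := act (p t) x; pose b := K (act (p 1) x) x.
have sa : smooth_path a by exact: (orbit_path sA x (idpath_smooth p)).
have sb : smooth_path b by exact: sK.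
have ab : a 1 = b 0 by rewrite /a /b K0.
have ba : b 1 = a 0 by rewrite /a /b K1 act_end.
have val (D : R2 -> X) : smooth_disk D -> disk_boundary D (path_concat a b) ->
    action_integral act Omega mu x p D = nu_fun x (ucover_class p).
  move=> sD bD; rewrite nu_class; have e := db sD bD (tc (tp sa) (tp sb) ab).
  rewrite /action_integral e addrAC; exact: erefl.
apply/seteqP; split => r /=.
  by move=> [D [sD bD ->]]; exact: val.
move=> ->; have [D [sD bD]] := boundary_disk2 pi1X sa sb ab ba.
by exists D; split => //; rewrite (val D sD bD).
Qed.

Lemma nu_quasimorphism (x : X) : quasimorphism (nu_fun x).
Proof.
have [C HC] := triangle_bound; exists (3 * C) => a b.
rewrite -(ucover_repr a) -(ucover_repr b) classM !nu_class.
set p := repr a; set q := repr b; have [_ _ actM] := sA.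
have e1 := path_action_mul sO pi1X pi2X (sK x0) (K0 x0) (K1 x0) sA mm p q x.
pose aq t := act (q t) x; pose bk := K (act (q 1) x) x.
have saq : smooth_path aq by exact: (orbit_path sA x (idpath_smooth q)).
have ab : aq 1 = bk 0 by rewrite /aq /bk K0.
have ba : bk 1 = aq 0 by rewrite /aq /bk K1 act_end.
have e2 := prim_act_loop sO pi1X pi2X (sK x0) (K0 x0) (K1 x0) sA iA (p 1) saq (sK _ _) ab ba.
have e3 : prim (fun t => act (p 1) (bk t)) = side (act (p 1) (act (q 1) x)) (act (p 1) x).
  by apply: prim_eq => t t01; exact: actK.
have e4 : W x (fun t => p 1%R * q t)%g = prim (fun t => act (p 1) (aq t)) - @moment_integral R E F G X act mu q x.
  have f1 : prim (fun t => act (p 1%R * q t)%g x) = prim (fun t => act (p 1) (aq t)).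
    by apply: prim_eq => t _; rewrite actM.
  exact: (f_equal2 (fun a b : R => a - b) f1 (moment_integral_mull sA mm (p 1) x (idpath_smooth q))).
have h := cocycle_arith (side (act (p 1%R * q 1%R)%g x) x) (side (act (p 1) x) x) (etrans e1 (f_equal2 +%R erefl e4)) e2
  (erefl (side (act (q 1) x) x)).
rewrite e3 -actM in h; apply: (etrans_le h).
exact: (tri_bound (HC _ _ _) (HC _ _ _) (HC _ _ _)).
Qed.

Lemma nu_basepoint : exists C : R, forall x y a, `|nu_fun x a - nu_fun y a| <= C.
Proof.
have [C HC] := triangle_bound; exists (2 * C) => x y a.
rewrite /nu_fun; set p := repr a.
have e := path_action_base sO pi1X pi2X (sK x0) (K0 x0) (K1 x0) sA mm p (sK x y).
have e1 : prim (fun t => act (p 1) (K x y t)) = side (act (p 1) x) (act (p 1) y).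
  by apply: prim_eq => t t01; exact: actK.
rewrite K0 K1 e1 in e.
exact: (quad_bound e (HC (act (p 1) x) x y) (HC (act (p 1) x) (act (p 1) y) y)).
Qed.

(** Taken at [x0]; [hom_nu_cvg] transfers the limit to any base point, as the difference is bounded
    uniformly over the group. *)
Definition hom_nu (a : ucover G) : R := lim ((fun k => k%:R^-1 * nu_fun x0 (a ^+ k)%g) @ \oo).

Lemma hom_nu_cvg (x : X) (a : ucover G) : (k%:R^-1 * nu_fun x (a ^+ k)%g) @[k --> \oo] --> hom_nu a.
Proof.
have [C HC] := nu_basepoint; have [D HD] := nu_quasimorphism x0.
have c0 : (k%:R^-1 * nu_fun x0 (a ^+ k)%g) @[k --> \oo] --> hom_nu a.
  by apply: (@homogenization_cvg R (fun k => nu_fun x0 (a ^+ k)%g) D) => m n; rewrite expgnDr; exact: HD.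
have d0 : (k%:R^-1 * (nu_fun x (a ^+ k)%g - nu_fun x0 (a ^+ k)%g)) @[k --> \oo] --> (0 : R).
  exact: (cvg_bounded_over (fun k => HC x x0 (a ^+ k)%g)).
have -> : (fun k : nat => k%:R^-1 * nu_fun x (a ^+ k)%g) =
    (fun k : nat => k%:R^-1 * nu_fun x0 (a ^+ k)%g + k%:R^-1 * (nu_fun x (a ^+ k)%g - nu_fun x0 (a ^+ k)%g)).
  by apply/funext => k; rewrite -mulrDr addrC subrK.
by rewrite -[hom_nu a]addr0; exact: cvgD.
Qed.

Lemma path_action_pow (x : X) (p : idpath G) (k : nat) : p 1 = 1%g -> exists q : idpath G,
  [/\ ucover_class q = (ucover_class p ^+ k)%g, q 1 = 1%g & W x q = k%:R * W x p].
Proof.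
move=> p1; elim: k => [|k [q [qk q1 Wq]]].
  exists idpath_one; split => //; rewrite mul0r.
  exact: (path_action_cst sO pi1X pi2X (sK x0) (K0 x0) (K1 x0) mm x 1%g).
exists (idpath_mul p q); split.
- by rewrite expgS -classM qk.
- by rewrite /= p1 q1 mulg1.
- apply: (etrans (path_action_mul sO pi1X pi2X (sK x0) (K0 x0) (K1 x0) sA mm p q x)).
  have -> : (fun t => p 1%R * q t)%g = q :> (R^o -> G) by apply/funext => t; rewrite p1 mul1g.
  by rewrite Wq -natr1 mulrDl mul1r addrC.
Qed.

Lemma hom_nu_pi1 (x : X) (p : idpath G) : p 1 = 1%g -> hom_nu (ucover_class p) = W x p.
Proof.
move=> p1; have := hom_nu_cvg x (a := ucover_class p).
have [_ act1 _] := sA.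
(* The term [side x x] may be nonzero, since [K x x] may be any loop, but it does not grow with
   [k]. *)
have e k : nu_fun x (ucover_class p ^+ k)%g = k%:R * W x p + side x x.
  by have [q [<- q1 <-]] := path_action_pow x k p1; rewrite nu_class q1 act1.
have d0 : (k%:R^-1 * side x x) @[k --> \oo] --> (0 : R).
  exact: (cvg_bounded_over (fun k => lexx `|side x x|)).
have L : (k%:R^-1 * nu_fun x (ucover_class p ^+ k)%g) @[k --> \oo] --> W x p.
  have L0 : (W x p + k%:R^-1 * side x x) @[k --> \oo] --> W x p + 0.
    by apply: cvgD d0; exact: cvg_cst.
  rewrite addr0 in L0; apply: (cvg_trans _ L0); apply: near_eq_cvg; near=> k.
  have k0 : (k%:R : R) != 0 by rewrite pnatr_eq0 -lt0n; near: k; exact: nbhs_infty_gt.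
  by rewrite /= e mulrDr mulrA mulVf// mul1r.
by move=> /cvg_lim <-//; apply: cvg_lim.
Unshelve. all: by end_near. Qed.

Lemma action_values_eq (x : X) (a : ucover G) : pi1 a -> action_values act Omega mu x a = [set hom_nu a].
Proof.
move=> [p pa p1]; have [_ act1 _] := sA.
have sa (q : idpath G) : smooth_path (fun t => act (q t) x) by exact: (orbit_path sA x (idpath_smooth q)).
have val (q : idpath G) (D : R2 -> X) : ucover_class q = a -> q 1 = 1%g -> smooth_disk D ->
    (forall t, 0 <= t <= 1 -> D (circle t) = act (q t) x) -> action_integral act Omega mu x q D = hom_nu a.
  move=> qa q1 sD Dq; rewrite -qa (hom_nu_pi1 x q1).
  have e1 := disk_integral_prim sO pi1X pi2X (sK x0) (K0 x0) (K1 x0) sD.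
  have e2 : prim (fun t => D (circle t)) = prim (fun t => act (q t) x) by exact: prim_eq.
  exact: (f_equal2 (fun a b : R => a - b) (etrans e1 e2) erefl).
apply/seteqP; split => r /=.
  by move=> [q [D [[qa q1] sD Dq ->]]]; exact: val.
move=> ->.
(* The disk must follow the loop itself, with no change of parameter, whereas [disk_exists] yields a
   boundary reparametrized by [theta0]. So [theta0] is absorbed into the representative, which stays
   in the same homotopy class. *)
have sq : smooth_path (fun t => p (theta0 t)).
  by apply: smoothT_path; exact: (smooth_path_comp hR (idpath_smooth p) (@theta0_smooth R) (@theta0_01 R)).
have q0 : p (theta0 0) = 1%g by rewrite theta0_0 idpath0.
pose q := IdPath sq q0.
have pq : homotopic p q.
  exact: (@homotopic_reparam R E G p q theta0 (@theta0_smooth R) (@theta0_01 R) (@theta0_0 R) (@theta0_1 R) (fun t => erefl)).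
have qa : ucover_class q = a by rewrite -pa; apply/esym/ucover_classP.
have q1 : q 1 = 1%g by rewrite -(homotopic_end pq).
have sl : smooth_into setT (fun u : R^o => act (p (plateau u)) x).
  by apply: (@smooth_path_comp R F X R^o hR (fun t => act (p t) x) plateau (sa p)); [exact: plateau_smooth|exact: plateau_01].
have l01 : act (p 0) x = act (p 1) x by rewrite p1 idpath0.
have [D [sD Dl]] := @disk_exists R F X (fun t => act (p t) x) pi1X sl l01.
by exists q, D; split => //; rewrite (val q D).
Qed.

End domic_toledo_quasimorphism.

Theorem theorem1 (R : realType) (E F : tvsType R)
    (G : lieGroupType E) (X : manifoldType F)
    (Omega : X -> F -> F -> R^o) (K : X -> X -> R^o -> X)
    (act : G -> X -> X) (mu : E -> X -> R^o)
    (GX : hamiltonian_hermitian act Omega K mu) :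
  exists nu_ : X -> ucover G -> R,
    [/\ forall (x : X) (p : idpath G),
          nu_values act Omega K mu x p = [set nu_ x (ucover_class p)],
        forall x : X, quasimorphism (nu_ x)
      & exists nu : ucover G -> R,
          (forall (x : X) (a : ucover G),
             (k%:R^-1 * nu_ x (a ^+ k)%g) @[k --> \oo] --> nu a) /\
          (forall a : ucover G, pi1 a -> forall x : X,
             action_values act Omega mu x a = [set nu a])].
Proof.
(* The cones need an apex; over an empty space all the assertions are vacuous. *)
have [[x0]|nX] := pselect (inhabited X); last first.
  have nx (x : X) : False by apply: nX; split.
  exists (fun _ _ => 0); split; [by move=> x; case: (nx x)|by move=> x; case: (nx x)|].
  by exists (fun=> 0); split => [x|a _ x]; case: (nx x).
exists (nu_fun Omega K act mu x0); split.
- exact: (nu_values_eq GX x0).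
- exact: (nu_quasimorphism GX x0).
- exists (hom_nu Omega K act mu x0); split; first by move=> x a; exact: (@hom_nu_cvg R E F G X Omega K act mu GX x0 x a).
  by move=> a pa x; exact: (action_values_eq GX x0 x pa).
Qed.
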